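(* For each integer $m\ge2$ let $F_m(x)$ be the monic degree $m$ polynomial with $$F_m(j(\tau))=\frac{E_4(\tau)E_6(\tau)}{11!}\cdot\Big(m^{11}\,\big(M_\Delta\,|\,T_{-10}(m)\big)(\tau)-\tau(m)\,M_\Delta(\tau)\Big)\quad(\tau\in\mathbb H).$$ Then: (1) For all $m\ge2$, $F_m(0)=F_m(1728)=0$. (2) For all $m\ge2$, the zeros of $F_m(x)$ are simple and lie in the interval $[0,1728]$. (3) As $m\to+\infty$, the zeros of $F_m(x)$ become equidistributed in $[0,1728]$.
   Context: Throughout, $\tau=u+iv\in\mathbb H$ and $q=e^{2\pi i\tau}$; $e(x):=e^{2\pi i x}$. $\sigma_\nu(n)=\sum_{d\mid n}d^\nu$. $E_4(\tau)=1+240\sum_{n\ge1}\sigma_3(n)q^n$, $E_6(\tau)=1-504\sum_{n\ge1}\sigma_5(n)q^n$, $\Delta(\tau)=\sum_{n\ge1}\tau(n)q^n=(E_4^3-E_6^2)/1728$ (so $\tau(m)$ is Ramanujan's tau function), and $j(\tau)=E_4(\tau)^3/\Delta(\tau)$. Kloosterman sum: $K(m,n,c)=\sum_{v \bmod c,\ \gcd(v,c)=1} e\big((m\bar v+nv)/c\big)$, $\bar v$ the inverse of $v$ mod $c$. $I_{11}$ is the modified Bessel function of the first kind and $B_{12}=-691/2730$. The mock modular form $M_\Delta$ is $$M_\Delta(\tau)=11!\,q^{-1}+\frac{24\cdot 11!}{B_{12}}+\sum_{n\ge1}a_\Delta(n)q^n,\qquad a_\Delta(n)=-2\pi\,\Gamma(12)\,n^{-11/2}\sum_{c=1}^\infty\frac{K(-1,n,c)}{c}\,I_{11}\!\Big(\frac{4\pi\sqrt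 n}{c}\Big).$$ For a function $f$ on $\mathbb H$, integer weight $k$ and $m\ge1$, $(f\,|\,T_k(m))(\tau)=m^{k-1}\sum_{ad=m,\ a,d>0}d^{-k}\sum_{b \bmod d} f\big((a\tau+b)/d\big)$. (The existence of a monic degree $m$ polynomial $F_m\in\mathbb Z[x]$ with the stated property is part of the setting.)
   Formalization: In (3), ''equidistributed'' is taken with respect to the image under j of the uniform distribution of Re(τ) on [-1/2,0] along the arc |τ|=1; equidistribution for the uniform measure on [0,1728] would be false, since zeros accumulate more densely near the endpoints. *)

(* Defs.v *)
From HB Require Import structures.
From mathcomp Require Import all_boot all_order all_algebra.
From mathcomp Require Export all_classical all_reals all_analysis.
From mathcomp Require Export complex.

Set Implicit Arguments.
Unset Strict Implicit.
Unset Printing Implicit Defensive.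

Import Order.TTheory GRing.Theory Num.Theory numFieldNormedType.Exports.

Local Open Scope ring_scope.
Local Open Scope complex_scope.
Local Open Scope classical_set_scope.

Section ComplexAnalysis.
Variable R : realType.
Local Notation C := R[i].

(* [C^o] is the alias of [C] that carries the topology of the norm. *)
Definition csum (a : nat -> C) : C := limn (series (a : nat -> C^o)).

Definition cexp (z : C) : C :=
  (expR (complex.Re z))%:C * (cos (complex.Im z) +i* sin (complex.Im z)).

Definition e2pi (z : C) : C := cexp ((0 +i* (2 * pi)) * z).

Definition upper_half_plane : set C := [set t | 0 < complex.Im t].

Definition besselI (nu : nat) (x : R) : R :=
  limn (series (fun k : nat =>
    (x / 2) ^+ (2 * k + nu) / (k`!%:R * (k + nu)`!%:R))).

End ComplexAnalysis.

Definition sigma (nu n : nat) : nat := (\sum_(d <- divisors n) d ^ nu)%N.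

(* The coefficient of q^n in (E4^3 - E6^2) / 1728 only involves the terms of
   E4 and E6 of degree at most n, hence the truncations. *)
Definition E4_trunc (n : nat) : {poly rat} :=
  1 + 240 *: \sum_(1 <= k < n.+1) (sigma 3 k)%:R *: 'X^k.

Definition E6_trunc (n : nat) : {poly rat} :=
  1 - 504 *: \sum_(1 <= k < n.+1) (sigma 5 k)%:R *: 'X^k.

Definition ramanujan_tau (n : nat) : rat :=
  (E4_trunc n ^+ 3 - E6_trunc n ^+ 2)`_n / 1728.

Section ModularForms.
Variable R : realType.
Local Notation C := R[i].
Implicit Types t : C.

Definition E4 t : C :=
  1 + 240 * csum (fun n : nat => (sigma 3 n.+1)%:R * e2pi t ^+ n.+1).

Definition E6 t : C :=
  1 - 504 * csum (fun n : nat => (sigma 5 n.+1)%:R * e2pi t ^+ n.+1).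

Definition Delta t : C := (E4 t ^+ 3 - E6 t ^+ 2) / 1728.

Definition jinv t : C := E4 t ^+ 3 / Delta t.

Definition invmod (c : nat) (v : 'I_c) : 'I_c :=
  odflt v [pick w : 'I_c | v * w == 1 %[mod c]].

Definition kloosterman (m n : int) (c : nat) : C :=
  \sum_(v < c | coprime v c)
    e2pi ((m%:~R * (invmod v)%:R + n%:~R * v%:R) / c%:R).

Definition B12 : C := - 691 / 2730.

Definition a_Delta (n : nat) : C :=
  - 2 * pi%:C * (11`!)%:R * (n%:R `^ (- (11 / 2)))%:C *
  csum (fun k : nat => let c := k.+1 in
    kloosterman (-1) n c / c%:R
    * (besselI 11 (4 * pi * Num.sqrt n%:R / c%:R))%:C).

Definition M_Delta t : C :=
  (11`!)%:R * (e2pi t)^-1 + 24 * (11`!)%:R / B12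
  + csum (fun n : nat => a_Delta n.+1 * e2pi t ^+ n.+1).

Definition hecke (k : int) (m : nat) (f : C -> C) t : C :=
  m%:R ^ (k - 1) *
  \sum_(d <- divisors m) d%:R ^ (- k) *
    \sum_(b < d) f (((m %/ d)%:R * t + b%:R) / d%:R).

Definition is_F (m : nat) (p : {poly int}) : Prop :=
  [/\ p \is monic, size p = m.+1 &
      forall t, upper_half_plane t ->
        (map_poly intr p).[jinv t] =
        E4 t * E6 t / (11`!)%:R *
        (m%:R ^+ 11 * hecke (- 10) m M_Delta t
         - ratr (ramanujan_tau m) * M_Delta t)].

Definition zeros (p : {poly int}) : seq C :=
  sval (closed_field_poly_normal (map_poly intr p : {poly C})).

Definition in_itv_cc (a b : R) (z : C) : bool :=
  (complex.Im z == 0) && (a <= complex.Re z <= b).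

Definition equidistributed (a b : R) (nu : set R -> \bar R)
    (Z : nat -> seq C) : Prop :=
  forall c d : R, a <= c -> c <= d -> d <= b ->
    ((count (in_itv_cc c d) (Z m))%:R / (size (Z m))%:R)%:E @[m --> \oo]
      --> nu `[c, d].

(* j maps the arc { |t| = 1, - 1/2 <= Re t <= 0 } of the boundary of the
   fundamental domain bijectively onto [0, 1728].  [arc_measure] is the image
   under j of the uniform distribution of Re t on [- 1/2, 0].  On this arc, away
   from its end point Re t = - 1/2 and up to terms exponentially small in m,
     t^-5 e^(- 2 pi m Im t) F_m(j(t)) / (E4(t) E6(t))
       = 2 cos (2 pi m Re t + 5 arg t),
   so the zeros become equally spaced in the coordinate Re t; they are
   equidistributed for neither the uniform distribution of j(t) on [0, 1728]
   nor that of arg t. *)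
Definition unit_arc (u : R) : C := u +i* Num.sqrt (1 - u ^+ 2).

Definition arc_measure (A : set R) : \bar R :=
  (2%:E * lebesgue_measure
    (`[- (1 / 2), 0] `&` [set u : R | A (complex.Re (jinv (unit_arc u)))])%R)%E.

End ModularForms.

(* Main.v *)
Require Import Defs.
From HB Require Import structures.
From mathcomp Require Import all_boot all_order all_algebra.
From mathcomp Require Import all_classical all_reals all_analysis.
From mathcomp Require Import complex ring lra zify ssrZ polyrcf.

Set Implicit Arguments.
Unset Strict Implicit.
Unset Printing Implicit Defensive.
Import Order.TTheory GRing.Theory Num.Theory numFieldNormedType.Exports.
Local Open Scope ring_scope.
Local Open Scope complex_scope.

(** Comparing the growth of both sides as [q -> 0] turns the defining relations for all
    [m] into identities between power series in [q].  Together they force Ramanujan's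
    derivative identity for [E4] and [E6], and [F_m = x (x - 1728) P_{m-2}] where [P_n(x)]
    is the coefficient of [q^n] in [(Delta/q)^2 / (E4^3 - x Delta)].  The two factors in
    front come from [j(rho) = 0] and [j(i) = 1728], that is, from the inversion formula
    of [E4] and [E6].

    For [x = j(t)] with [t = e^{i theta}] on the arc from [rho] to [i], the denominator has
    exactly the zeros [e(t)], its conjugate and [e(-1/(t+1))] in a disc of larger radius.
    In particular [j] is injective, hence monotone, on the arc.  The residues show
    that [P_n(j(t))] is a factor of constant sign times [2 cos(5 theta + 2 pi m cos theta)] up to a
    small error, so that it changes sign between consecutive points where the cosine is
    [1] or [-1].  For [n >= 12] this yields [n] zeros in [[0, 1728]], evenly spaced in
    [Re t] up to [O(1/m)], which gives both simplicity and equidistribution; for [n < 12]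
    the sign changes are read off integer values of [P_n] on a grid. *)

(** * Complex limits and the exponential *)

(** What each relation delivers is the polar part 11! (q^(-m) - tau(m) q^(-1)) up to a bounded term
    at the cusp. The tool that exploits it is a formal residue: j^k times q dj/dq has no constant
    term. Paired with the relation for m it isolates a single coefficient, and all m together give q
    dj/dq = - E4^2 E6 / Delta.

    The analytic obstacle is to locate the zeros of E4^3 - x Delta in q. The known zeros are divided
    out of the power series one at a time; a geometric bound on the coefficients survives each
    division, and the remaining factor stays within 0.56 of 1 on the disc of radius 3/2 |e(t)|. The
    zero e(-1/(t+1)) has to be removed too, because at rho its modulus equals |e(t)|. Its
    contribution, relative to the main term, decays like (|e(t)| / |e(-1/(t+1))|)^n, which is poor
    only near rho. Every sample point stays at distance at least 1/(3m) from rho in Re t, and this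
    together with n >= 12 keeps the relative error below the threshold 2. These last margins are
    narrow and explain the precision of the numerical constants. *)

Section ComplexNorm.
Variable R : realType.
Local Notation C := R[i].
Implicit Types (z w : C) (x y : R).

(** A real-valued modulus: the norm of [C] takes values in [C], whose order is only partial, while
    estimates want real numbers. *)
Definition nm z : R := ComplexField.Normc.normc z.

Lemma nmE z : nm z = Num.sqrt (complex.Re z ^+ 2 + complex.Im z ^+ 2).
Proof. by case: z. Qed.

Lemma nm_sqr z : nm z ^+ 2 = complex.Re z ^+ 2 + complex.Im z ^+ 2.
Proof. by rewrite nmE sqr_sqrtr // addr_ge0 ?sqr_ge0. Qed.

Lemma nm_ge0 z : 0 <= nm z. Proof. by rewrite nmE sqrtr_ge0. Qed.

Lemma nm_normE z : `|z| = (nm z)%:C. Proof. by rewrite normc_def nmE. Qed.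

Lemma nmM z w : nm (z * w) = nm z * nm w.
Proof. exact: ComplexField.Normc.normcM. Qed.

Lemma nmD z w : nm (z + w) <= nm z + nm w.
Proof. by rewrite -lecR rmorphD -!nm_normE ler_normD. Qed.

Lemma nmN z : nm (- z) = nm z.
Proof. by apply: (@complexI R); rewrite -!nm_normE normrN. Qed.

Lemma nmB z w : nm (z - w) <= nm z + nm w.
Proof. by rewrite -(nmN w) nmD. Qed.

Lemma nm_sub z w : nm (z - w) = nm (w - z).
Proof. by rewrite -nmN opprB. Qed.

Lemma nm_real x : nm (x%:C) = `|x|.
Proof. by rewrite nmE /= expr0n addr0 sqrtr_sqr. Qed.

Lemma nm0 : nm 0 = 0. Proof. by rewrite nm_real normr0. Qed.
Lemma nm1 : nm 1 = 1. Proof. by rewrite nm_real normr1. Qed.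

Lemma nm_eq0 z : (nm z == 0) = (z == 0).
Proof.
apply/eqP/eqP => [|->]; last exact: nm0.
exact: ComplexField.Normc.eq0_normc.
Qed.

Lemma nm_gt0 z : (0 < nm z) = (z != 0).
Proof. by rewrite lt_def nm_ge0 andbT nm_eq0. Qed.

Lemma nmV z : nm z^-1 = (nm z)^-1.
Proof. exact: ComplexField.Normc.normcV. Qed.

Lemma nmX z n : nm (z ^+ n) = nm z ^+ n.
Proof. by elim: n => [|n IH]; rewrite ?expr0 ?nm1 // !exprS nmM IH. Qed.

Lemma nm_nat n : nm (n%:R : C) = n%:R.
Proof. by rewrite -(rmorph_nat (real_complex R)) nm_real normr_nat. Qed.

Lemma nm_sum (I : Type) (r : seq I) (P : pred I) (F : I -> C) :
  nm (\sum_(i <- r | P i) F i) <= \sum_(i <- r | P i) nm (F i).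
Proof.
elim/big_ind2: _ => [|a b c d ab cd|//]; first by rewrite nm0.
by apply: le_trans (nmD _ _) _; apply: lerD.
Qed.

Lemma nm_ge_Re z : `|complex.Re z| <= nm z.
Proof. by rewrite nmE -sqrtr_sqr ler_wsqrtr // lerDl sqr_ge0. Qed.

Lemma nm_ge_Im z : `|complex.Im z| <= nm z.
Proof. by rewrite nmE -sqrtr_sqr ler_wsqrtr // lerDr sqr_ge0. Qed.

Lemma nm_le_ReIm z : nm z <= `|complex.Re z| + `|complex.Im z|.
Proof.
rewrite nmE -[leRHS]ger0_norm ?addr_ge0 // -sqrtr_sqr ler_wsqrtr //.
rewrite sqrrD !real_normK ?num_real // -subr_ge0.
set a := complex.Re z; set b := complex.Im z.
have : 0 <= `|a| * `|b| by rewrite mulr_ge0.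
by rewrite mulr2n; lra.
Qed.

Lemma nm_conj z : nm (z^*)%C = nm z.
Proof. by case: z => a b; rewrite !nmE /= sqrrN. Qed.

Lemma nm_ge_sub z w : nm z - nm w <= nm (z - w).
Proof. by rewrite lerBlDr -{1}(subrK w z) nmD. Qed.

Lemma sum_Re (I : Type) (r : seq I) (P : pred I) (F : I -> C) :
  complex.Re (\sum_(i <- r | P i) F i) = \sum_(i <- r | P i) complex.Re (F i).
Proof.
by apply: (big_morph _ _ _) => // -[a b] [c d].
Qed.

Lemma sum_Im (I : Type) (r : seq I) (P : pred I) (F : I -> C) :
  complex.Im (\sum_(i <- r | P i) F i) = \sum_(i <- r | P i) complex.Im (F i).
Proof.
by apply: (big_morph _ _ _) => // -[a b] [c d].
Qed.

End ComplexNorm.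
Arguments nm {R} z : simpl never.

Section Limits.
Variable R : realType.
Local Notation C := R[i].
Implicit Types (u v : nat -> C) (a b : nat -> R) (l k : C).

(** Limits are kept in elementary epsilon form; [small_cvg] and [cto_lim] are the bridges to the
    filter limits through which [csum] and the theorem are stated. *)
Definition small a := forall e : R, 0 < e -> exists N, forall n, (N <= n)%N -> `|a n| < e.

Definition cto u l := small (fun n => nm (u n - l)).

Lemma small_le a b n0 : small b ->
  (forall n, (n0 <= n)%N -> `|a n| <= `|b n|) -> small a.
Proof.
move=> sb ab e e0; have [N HN] := sb e e0; exists (maxn n0 N) => n.
by rewrite geq_max => /andP[n1 n2]; apply: le_lt_trans (ab n n1) (HN n n2).
Qed.

Lemma smallD a b : small a -> small b -> small (fun n => a n + b n).
Proof.
move=> sa sb e e0; have e20 : 0 < e / 2 by rewrite divr_gt0.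
have [N1 H1] := sa _ e20; have [N2 H2] := sb _ e20.
exists (maxn N1 N2) => n; rewrite geq_max => /andP[n1 n2].
apply: le_lt_trans (ler_normD _ _) _.
by have := H1 n n1; have := H2 n n2; lra.
Qed.

Lemma smallZ a (c : R) : small a -> small (fun n => c * a n).
Proof.
move=> sa e e0; have c0 : 0 < `|c| + 1 by apply: ltr_wpDl.
have [N H] := sa (e / (`|c| + 1)) (divr_gt0 e0 c0); exists N => n /H.
rewrite normrM ltr_pdivlMr // => h; apply: le_lt_trans h.
by rewrite mulrC ler_wpM2l // lerDl.
Qed.

Lemma small_sub a (f : nat -> nat) : (forall n, (n <= f n)%N) -> small a ->
  small (fun n => a (f n)).
Proof.
by move=> hf sa e /sa[N H]; exists N => n nN; apply/H/(leq_trans nN).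
Qed.

Lemma small_cvg a : (a @ \oo --> (0 : R))%classic <-> small a.
Proof.
split=> [/cvgr0Pnorm_lt H e e0|H].
  by have [N _ HN] := H e e0; exists N => n nN; apply: HN.
apply/cvgr0Pnorm_lt => e e0; have [N HN] := H e e0.
by exists N => // n /= nN; apply: HN.
Qed.

Lemma small_geom (x : R) : `|x| < 1 -> small (fun n => x ^+ n).
Proof. by move=> x1; apply/small_cvg; apply: cvg_expr. Qed.

Lemma small_inv : small (fun n => n.+1%:R^-1).
Proof. by apply/small_cvg; apply: cvg_harmonic. Qed.

Lemma cto_cst l : cto (fun=> l) l.
Proof. by move=> e e0; exists 0%N => n _; rewrite subrr nm0 normr0. Qed.

Lemma cto_le u l a n0 : small a ->
  (forall n, (n0 <= n)%N -> nm (u n - l) <= a n) -> cto u l.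
Proof.
move=> sa H; apply: (small_le (n0 := n0) sa) => n /H h.
by rewrite ger0_norm ?nm_ge0 //; apply: le_trans h (ler_norm _).
Qed.

Lemma cto_eq u v l n0 : cto v l -> (forall n, (n0 <= n)%N -> u n = v n) -> cto u l.
Proof. by move=> cv H; apply: (cto_le (n0 := n0) cv) => n /H ->. Qed.

Lemma cto_sub u l (f : nat -> nat) : (forall n, (n <= f n)%N) -> cto u l ->
  cto (fun n => u (f n)) l.
Proof. by move=> hf; apply: (@small_sub (fun n => nm (u n - l)) f). Qed.

Lemma ctoD u v l k : cto u l -> cto v k -> cto (fun n => u n + v n) (l + k).
Proof.
move=> cu cv; apply: (cto_le (n0 := 0) (smallD cu cv)) => n _ /=.
by rewrite opprD addrACA nmD.
Qed.

Lemma ctoN u l : cto u l -> cto (fun n => - u n) (- l).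
Proof. by move=> cu; apply: (cto_le (n0 := 0) cu) => n _; rewrite -opprD nmN. Qed.

Lemma ctoB u v l k : cto u l -> cto v k -> cto (fun n => u n - v n) (l - k).
Proof. by move=> cu cv; apply: ctoD => //; apply: ctoN. Qed.

Lemma cto_bnd u l : cto u l -> exists2 N, 0 < N & forall n, nm (u n) <= N.
Proof.
move=> cu; have [M HM] := cu 1 ltr01.
exists (nm l + 1 + \sum_(0 <= i < M) nm (u i)).
  rewrite ltr_pwDl ?sumr_ge0 // => [|i _]; rewrite ?nm_ge0 //.
  by rewrite ltr_wpDl ?nm_ge0.
move=> n; have [nM|Mn] := ltnP n M.
  rewrite (bigD1_seq n) ?iota_uniq ?mem_index_iota //= [leRHS]addrCA lerDl.
  by rewrite !addr_ge0 ?nm_ge0 ?ler01 // sumr_ge0 // => i _; rewrite nm_ge0.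
apply: (@le_trans _ _ (nm l + 1)).
  rewrite -lerBlDl; apply: le_trans (nm_ge_sub _ _) _.
  by have := HM n Mn; rewrite ger0_norm ?nm_ge0 // => /ltW.
by rewrite lerDl sumr_ge0 // => i _; rewrite nm_ge0.
Qed.

Lemma ctoM u v l k : cto u l -> cto v k -> cto (fun n => u n * v n) (l * k).
Proof.
move=> cu cv; have [M M0 HM] := cto_bnd cu.
have := smallD (smallZ M cv) (smallZ (nm k) cu).
move=> /(cto_le (n0 := 0)); apply => n _ /=.
have -> : u n * v n - l * k = u n * (v n - k) + k * (u n - l) by ring.
apply: le_trans (nmD _ _) _; rewrite !nmM lerD // ler_wpM2r ?nm_ge0 //.
Qed.

Lemma ctoZ (c : C) u l : cto u l -> cto (fun n => c * u n) (c * l).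
Proof. by move=> cu; apply: ctoM => //; apply: cto_cst. Qed.

Lemma ctoX u l p : cto u l -> cto (fun n => u n ^+ p) (l ^+ p).
Proof.
move=> cu; elim: p => [|p IH]; first exact: cto_cst.
apply: (cto_eq (n0 := 0) (v := fun n => u n * u n ^+ p)) => [|n _].
  by rewrite exprS; apply: ctoM.
by rewrite exprS.
Qed.

Lemma cto_sum (I : Type) (r : seq I) (F : nat -> I -> C) (L : I -> C) :
  (forall i, cto (fun n => F n i) (L i)) ->
  cto (fun n => \sum_(i <- r) F n i) (\sum_(i <- r) L i).
Proof.
move=> H; elim: r => [|x r IH].
  by apply: (cto_eq (n0 := 0) (v := fun=> 0)) => [|n _]; rewrite !big_nil //; apply: cto_cst.
rewrite big_cons; apply: (cto_eq (n0 := 0) (ctoD (H x) IH)) => n _.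
by rewrite big_cons.
Qed.

Lemma cto_uniq u l k : cto u l -> cto u k -> l = k.
Proof.
move=> cu cv; apply/eqP; rewrite -subr_eq0 -nm_eq0; apply/negPn/negP => h.
have e0 : 0 < nm (l - k) by rewrite lt_def h nm_ge0.
have sz := ctoB cu cv.
have [N HN] := sz _ e0; have := HN N (leqnn _).
by rewrite subrr sub0r nmN ger0_norm ?nm_ge0 // ltxx.
Qed.

Lemma cto_nm_le u l (M : R) : cto u l -> (forall n, nm (u n) <= M) -> nm l <= M.
Proof.
move=> cu H; apply/ler_addgt0Pl => e e0; have [N HN] := cu e e0.
have := HN N (leqnn _); rewrite ger0_norm ?nm_ge0 // => h.
have := nm_ge_sub l (u N); rewrite nm_sub; have := H N; lra.
Qed.

Lemma cto_lim u l : cto u l -> limn (u : nat -> C^o) = l.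
Proof.
move=> cu; apply: cvg_lim; first exact: norm_hausdorff.
apply/cvgrPdist_lt => e; rewrite ltcE /= => /andP[/eqP Ie Re0].
have [N HN] := cu _ Re0; exists N => // n /= nN.
have := HN n nN; rewrite ger0_norm ?nm_ge0 // nm_sub => h.
by rewrite (nm_normE (l - u n)) ltcE /= Ie eqxx.
Qed.

Lemma csum_cto (f : nat -> C) l :
  cto (fun n => \sum_(0 <= i < n) f i) l -> csum f = l.
Proof. exact: cto_lim. Qed.

Definition summable_seq a :=
  (forall n, 0 <= a n) /\ exists K : R, forall n, \sum_(0 <= i < n) a i <= K.

Lemma summable_tail a : summable_seq a -> forall e : R, 0 < e ->
  exists N, forall n, \sum_(N <= i < n) a i <= e.
Proof.
move=> [a0 [K HK]] e e0.
pose S := [set x | exists n, x = \sum_(0 <= i < n) a i]%classic.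
have supS : has_sup S.
  split; first by exists 0, 0%N; rewrite big_nil.
  by exists K => _ [n ->].
have [_ [N ->] HN] := sup_adherent e0 supS; exists N => n.
have [nN|Nn] := leqP n N; first by rewrite big_geq // ltW.
have : \sum_(0 <= i < n) a i <= sup S by apply: ub_le_sup; [case: supS|exists n].
rewrite (big_cat_nat (n := N)) //= ?(ltnW Nn) //. by move: HN; lra.
Qed.

Lemma summable_le a b : summable_seq b -> (forall n, 0 <= a n <= b n) ->
  summable_seq a.
Proof.
move=> [b0 [K HK]] H; split=> [n|]; first by case/andP: (H n).
by exists K => n; apply: le_trans (HK n); apply: ler_sum => i _; case/andP: (H i).
Qed.

Lemma summableZ a (c : R) : 0 <= c -> summable_seq a -> summable_seq (fun n => c * a n).
Proof.
move=> c0 [a0 [K HK]]; split=> [n|]; first by rewrite mulr_ge0.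
by exists (c * K) => n; rewrite -mulr_sumr ler_wpM2l.
Qed.


Lemma geom_sum_le (x : R) n : 0 <= x < 1 -> \sum_(0 <= i < n) x ^+ i <= (1 - x)^-1.
Proof.
move=> /andP[x0 x1]; have h : 0 < 1 - x by lra.
rewrite -[leRHS]mul1r ler_pdivlMr //.
have -> : (\sum_(0 <= i < n) x ^+ i) * (1 - x) = 1 - x ^+ n.
  elim: n => [|n IH]; first by rewrite big_nil mul0r expr0 subrr.
  by rewrite big_nat_recr //= mulrDl IH exprS; ring.
by rewrite lerBlDr lerDl exprn_ge0.
Qed.

Lemma summable_geom (x : R) : 0 <= x < 1 -> summable_seq (fun n => x ^+ n).
Proof.
move=> x01; split=> [n|]; first by rewrite exprn_ge0 //; case/andP: x01.
by exists (1 - x)^-1 => n; apply: geom_sum_le.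
Qed.


Lemma summable_invsq : summable_seq (fun n => (n.+1%:R ^+ 2)^-1).
Proof.
split=> [n|]; first by rewrite invr_ge0 exprn_ge0.
exists 2 => n; case: n => [|n]; first by rewrite big_nil.
suff: \sum_(0 <= i < n.+1) (i.+1%:R ^+ 2)^-1 <= 2 - n.+1%:R^-1 :> R.
  by move=> /le_trans; apply; rewrite gerBl invr_ge0.
elim: n => [|n IH]; first by rewrite big_nat1 expr1n invr1; lra.
rewrite big_nat_recr //=; apply: le_trans (lerD IH (lexx _)) _.
have n0 : 0 < n.+1%:R :> R by [].
have -> : n.+2%:R = n.+1%:R + 1 :> R by rewrite -natr1.
set x := n.+1%:R in n0 *.
have x1 : 0 < x + 1 by lra.
rewrite -lerBrDl.
have -> : 2 - (x + 1)^-1 - (2 - x^-1) = (x * (x + 1))^-1.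
  by field; rewrite !gt_eqF //=; lra.
rewrite lef_pV2 ?posrE ?mulr_gt0 ?exprn_gt0 // expr2 ler_wpM2r //; lra.
Qed.

Lemma summable_cto u : summable_seq (fun n => nm (u n)) ->
  exists l, cto (fun n => \sum_(0 <= i < n) u i) l.
Proof.
move=> su.
have aux (f : nat -> R) : (forall n, `|f n| <= nm (u n)) ->
    exists l : R, small (fun n => \sum_(0 <= i < n) f i - l).
  move=> hf.
  have H : cvgn (series f).
    apply: normed_cvg; apply: nondecreasing_is_cvgn.
      by apply/nondecreasing_series => n _ _ /=; apply: normr_ge0.
    case: su => _ [K HK]; exists K => _ [n _ <-].
    by apply: le_trans (HK n); apply: ler_sum => i _; apply: hf.
  exists (limn (series f)); apply/small_cvg.
  by apply/subr_cvg0.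
have [x Hx] := aux _ (fun n => nm_ge_Re (u n)).
have [y Hy] := aux _ (fun n => nm_ge_Im (u n)).
exists (x +i* y).
have sn (f : nat -> R) : small f -> small (fun n => `|f n|).
  by move=> sf; apply: (small_le (n0 := 0) sf) => n _; rewrite normr_id.
apply: (cto_le (n0 := 0) (smallD (sn _ Hx) (sn _ Hy))) => n _.
apply: le_trans (nm_le_ReIm _) _.
set S := \sum_(0 <= i < n) u i.
have -> : complex.Re (S - (x +i* y)) = complex.Re S - x by case: S.
have -> : complex.Im (S - (x +i* y)) = complex.Im S - y by case: S.
by rewrite /S sum_Re sum_Im.
Qed.

Lemma csum_bound u (M : R) : (forall n, \sum_(0 <= i < n) nm (u i) <= M) ->
  cto (fun n => \sum_(0 <= i < n) u i) (csum u) /\ nm (csum u) <= M.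
Proof.
move=> H; have [l Hl] : exists l, cto (fun n => \sum_(0 <= i < n) u i) l.
  by apply: summable_cto; split=> [n|]; [apply: nm_ge0|exists M].
rewrite (csum_cto Hl); split=> //; apply: cto_nm_le Hl _ => n.
exact: le_trans (nm_sum _ _ _) (H n).
Qed.

(** Tannery's theorem: beyond a cutoff the dominating series makes both tails small, and before it
    only finitely many limits are involved. The conclusion is a difference of two sums of the same
    growing length [b n], so that each use supplies the limit of the second sum by its own means. *)
Lemma tannery (u : nat -> nat -> C) (L : nat -> C) (M : nat -> R) (b : nat -> nat) n0 :
  summable_seq M -> (forall c, cto (fun n => u n c) (L c)) ->
  (forall n c, (n0 <= n)%N -> (c < b n)%N -> nm (u n c) <= M c) ->
  (forall n, (n <= b n)%N) ->
  cto (fun n => \sum_(0 <= c < b n) u n c - \sum_(0 <= c < b n) L c) 0.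
Proof.
move=> sM cu uM bn e e0.
(* Domination is assumed only for n0 <= n and c < b n; shifting the index by n0 + c + 1 secures
   both, so the bound passes to the limit. *)
have LM c : nm (L c) <= M c.
  have cu' := cto_sub (f := fun n => (n0 + c.+1 + n)%N) (fun n => leq_addl _ _) (cu c).
  apply: cto_nm_le cu' _ => n; apply: uM; first by lia.
  by apply: leq_trans (bn _); lia.
have e40 : 0 < e / 4 by rewrite divr_gt0.
have [N HN] := summable_tail sM e40.
have cf : cto (fun n => \sum_(0 <= c < N) (u n c - L c)) (\sum_(0 <= c < N) (L c - L c)).
  by apply: cto_sum => i; apply: ctoB => //; apply: cto_cst.
have [K HK] := cf _ e40; exists (maxn (maxn N K) n0) => n.
rewrite !geq_max => /andP[/andP[nN nK] nn0].
rewrite subr0 ger0_norm ?nm_ge0 // -sumrB (big_cat_nat (n := N)) //=; last first.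
  exact: leq_trans (bn n).
have := HK n nK; rewrite ger0_norm ?nm_ge0 // [\sum_(0 <= c < N) (L c - _)]big1 ?subr0.
  move=> h1; apply: le_lt_trans (nmD _ _) _.
  suff : nm (\sum_(N <= i < b n) (u n i - L i)) <= e / 4 + e / 4 by lra.
  apply: le_trans (nm_sum _ _ _) _.
  apply: (@le_trans _ _ (\sum_(N <= i < b n) (M i + M i))).
    rewrite big_nat_cond [leRHS]big_nat_cond; apply: ler_sum => i /andP[/andP[_ ib] _].
    by apply: le_trans (nmB _ _) _; apply: lerD => //; apply: uM.
  by rewrite big_split /=; apply: lerD.
by move=> c _; rewrite subrr.
Qed.

End Limits.

Section MoreLimits.
Variable R : realType.
Local Notation C := R[i].

Lemma cto_comp (u : nat -> C) l (f : nat -> nat) :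
  (forall M, exists N, forall n, (N <= n)%N -> (M <= f n)%N) -> cto u l ->
  cto (fun n => u (f n)) l.
Proof.
move=> hf cu e /cu[M HM]; have [N HN] := hf M.
by exists N => n /HN; apply: HM.
Qed.

Lemma ctoV (u : nat -> C) l : l != 0 -> cto u l -> cto (fun n => (u n)^-1) l^-1.
Proof.
move=> l0 cu; have nl : 0 < nm l by rewrite nm_gt0.
have [N HN] := cu _ (divr_gt0 nl (ltr0n _ 2)).
have := smallZ (2 / nm l ^+ 2) cu; move=> /(cto_le (n0 := N)); apply => n nN.
have := HN n nN; rewrite ger0_norm ?nm_ge0 // => h.
have hu : nm l / 2 < nm (u n).
  have := nm_ge_sub l (u n); rewrite nm_sub; move: h.
  by move: (nm l) (nm (u n)) (nm _) => a b c; lra.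
have u0 : u n != 0 by rewrite -nm_gt0; apply: lt_trans hu; rewrite divr_gt0.
have -> : (u n)^-1 - l^-1 = (l - u n) / (u n * l).
  by field; rewrite l0 u0.
rewrite nmM nmV nmM nm_sub mulrC ler_wpM2r ?nm_ge0 //.
have -> : 2 / nm l ^+ 2 = (nm l / 2 * nm l)^-1 by field; rewrite gt_eqF.
rewrite lef_pV2 ?posrE ?mulr_gt0 ?nm_gt0 // ler_wpM2r ?nm_ge0 //.
exact: ltW.
Qed.

Lemma cto_horner (p : {poly C}) (u : nat -> C) l :
  cto u l -> cto (fun n => p.[u n]) p.[l].
Proof.
move=> cu; rewrite horner_coef.
apply: (cto_eq (n0 := 0) (v := fun n => \sum_(i < size p) p`_i * u n ^+ i)).
  by apply: cto_sum => i; apply: ctoZ; apply: ctoX.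
by move=> n _; rewrite horner_coef.
Qed.

Lemma nm_horner (p : {poly C}) z : nm z <= 1 ->
  nm p.[z] <= \sum_(i < size p) nm p`_i.
Proof.
move=> z1; rewrite horner_coef; apply: le_trans (nm_sum _ _ _) _.
apply: ler_sum => i _; rewrite nmM nmX ler_piMr ?nm_ge0 //.
by rewrite exprn_ile1 ?nm_ge0.
Qed.

Lemma summable_ev (a b : nat -> R) N : summable_seq b -> (forall n, 0 <= a n) ->
  (forall n, (N <= n)%N -> a n <= b n) -> summable_seq a.
Proof.
move=> [b0 [K HK]] a0 H; split=> //.
have Ha : 0 <= \sum_(0 <= i < N) a i by apply: sumr_ge0.
exists (\sum_(0 <= i < N) a i + K) => n; have [nN|Nn] := leqP n N.
  apply: ler_wpDr; first by apply: le_trans (HK 0%N); rewrite big_nil.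
  by rewrite [leRHS](big_cat_nat (n := n)) //= lerDl sumr_ge0.
rewrite (big_cat_nat (n := N)) //= ?(ltnW Nn) // lerD2l.
apply: le_trans (HK n); rewrite [leRHS](big_cat_nat (n := N)) //= ?(ltnW Nn) //.
apply: ler_wpDl; first by apply: sumr_ge0.
rewrite big_nat_cond [leRHS]big_nat_cond; apply: ler_sum => i.
by rewrite andbT => /andP[iN _]; apply: H.
Qed.

Lemma summableD (a b : nat -> R) : summable_seq a -> summable_seq b ->
  summable_seq (fun n => a n + b n).
Proof.
move=> [a0 [K HK]] [b0 [L HL]]; split=> [n|]; first by rewrite addr_ge0.
by exists (K + L) => n; rewrite big_split lerD.
Qed.

(** With x = e^(-a), the Taylor term (n a)^(p+1) / (p+1)! of e^(n a) bounds n^p x^n by a multiple of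
    1/n. The value x = 0 has no logarithm and is treated apart. *)
Lemma small_natXgeom p (x : R) : 0 <= x < 1 -> small (fun n => n%:R ^+ p * x ^+ n).
Proof.
move=> /andP[]; rewrite le_eqVlt => /predU1P[<- _|x0 x1].
  move=> e e0; exists 1%N => -[//|n] _; by rewrite [0 ^+ _]exprS mul0r mulr0 normr0.
pose a := - ln x; have a0 : 0 < a by rewrite oppr_gt0 ln_lt0 // x0.
have xE : x = expR (- a) by rewrite opprK lnK.
have := smallZ (p.+1`!%:R * 2 / a ^+ p.+1) (@small_inv R).
move=> /(small_le (n0 := 1)); apply => -[//|n] _.
rewrite xE -expRM_natl mulrN expRN.
have n0 : 0 < n.+1%:R :> R by [].
have na : 0 <= n.+1%:R * a by rewrite mulr_ge0 // ltW.
have := expR_ge1Dxn p na.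
set F := p.+1`!%:R; have F0 : 0 < F by rewrite ltr0n fact_gt0.
move=> h; have {}h : (n.+1%:R * a) ^+ p.+1 / F <= expR (n.+1%:R * a).
  by apply: le_trans h; rewrite lerDr.
have q0 : 0 < (n.+1%:R * a) ^+ p.+1 / F by rewrite divr_gt0 // exprn_gt0 // mulr_gt0.
rewrite !ger0_norm; last 2 first.
- by rewrite !(mulr_ge0, invr_ge0, exprn_ge0) // ltW.
- by rewrite mulr_ge0 ?exprn_ge0 // invr_ge0 expR_ge0.
have h2 : (expR (n.+1%:R * a))^-1 <= ((n.+1%:R * a) ^+ p.+1 / F)^-1.
  by rewrite lef_pV2 // posrE expR_gt0.
apply: le_trans (ler_wpM2l _ h2) _; first by rewrite exprn_ge0.
have -> : n.+1%:R ^+ p * ((n.+1%:R * a) ^+ p.+1 / F)^-1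
   = F / a ^+ p.+1 * n.+1%:R^-1.
  rewrite exprMn [n.+1%:R ^+ p.+1]exprS.
  by field; rewrite !expf_neq0 ?gt_eqF.
have -> : F * 2 / a ^+ p.+1 * n.+2%:R^-1 = F / a ^+ p.+1 * (2 / n.+2%:R).
  by field; rewrite ?expf_neq0 ?gt_eqF //= ?ltr0n // pnatr_eq0.
rewrite ler_wpM2l //; first by rewrite divr_ge0 ?exprn_ge0 // ltW.
rewrite ler_pdivlMr ?ltr0n // mulrC ler_pdivrMr // -natrM ler_nat; lia.
Qed.

End MoreLimits.

(** * The exponential e(z) and its behaviour near 0 *)

Section Cexp.
Variable R : realType.
Local Notation C := R[i].
Implicit Types z w : C.

Lemma cexpD z w : cexp (z + w) = cexp z * cexp w.
Proof.
case: z w => [a b] [c d]; rewrite /cexp /= expRD cosD sinD.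
by apply/eqP; rewrite eq_complex /=; apply/andP; split; apply/eqP; ring.
Qed.

Lemma cexp0 : cexp (0 : C) = 1.
Proof.
by rewrite /cexp /= expR0 cos0 sin0; apply/eqP; rewrite eq_complex /= !mul0r !mul1r subr0 addr0 !eqxx.
Qed.

Lemma nm_cexp z : nm (cexp z) = expR (complex.Re z).
Proof.
rewrite /cexp nmM nm_real ger0_norm ?expR_ge0 // [X in _ * X]nmE /=.
by rewrite cos2Dsin2 sqrtr1 mulr1.
Qed.

Lemma e2piD z w : e2pi (z + w) = e2pi z * e2pi w.
Proof. by rewrite /e2pi mulrDr cexpD. Qed.

Lemma e2pi0 : e2pi (0 : C) = 1.
Proof. by rewrite /e2pi mulr0 cexp0. Qed.

Lemma nm_e2pi z : nm (e2pi z) = expR (- (2 * pi * complex.Im z)).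
Proof. by rewrite /e2pi nm_cexp; case: z => a b /=; rewrite mul0r add0r. Qed.

Lemma e2pi_neq0 z : e2pi z != 0.
Proof. by rewrite -nm_gt0 nm_e2pi expR_gt0. Qed.

Lemma e2piN z : e2pi (- z) = (e2pi z)^-1.
Proof.
apply: (mulfI (e2pi_neq0 z)); rewrite -e2piD subrr e2pi0 mulfV //.
exact: e2pi_neq0.
Qed.

Lemma e2pi1 : e2pi (1 : C) = 1.
Proof.
rewrite /e2pi mulr1 /cexp /= expR0 mulr_natl cos2pi sin2pi.
by apply/eqP; rewrite eq_complex /= !mul0r !mul1r subr0 addr0 !eqxx.
Qed.

Lemma e2pi_half : e2pi (2^-1 : C) = -1.
Proof.
have -> : (2^-1 : C) = (2^-1 : R)%:C by rewrite fmorphV rmorph_nat.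
rewrite /e2pi /cexp /= !mul0r !mulr0 subr0 add0r.
have -> : 2 * pi * 2^-1 = pi :> R by field.
rewrite expR0 cospi sinpi.
by apply/eqP; rewrite eq_complex /= !mul0r !mul1r subr0 addr0 oppr0 !eqxx.
Qed.

Lemma e2piX z n : e2pi z ^+ n = e2pi (n%:R * z).
Proof.
elim: n => [|n IH]; first by rewrite mul0r e2pi0.
by rewrite exprS IH -e2piD -natr1 mulrDl mul1r addrC.
Qed.

Lemma e2pi_nat n : e2pi (n%:R : C) = 1.
Proof. by rewrite -[n%:R]mulr1 -e2piX e2pi1 expr1n. Qed.

Lemma e2piDnat z n : e2pi (z + n%:R) = e2pi z.
Proof. by rewrite e2piD e2pi_nat mulr1. Qed.

Lemma e2piBnat z n : e2pi (z - n%:R) = e2pi z.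
Proof. by rewrite -[LHS](e2piDnat _ n) subrK. Qed.

Lemma e2pi_conj z : (e2pi z)^*%C = e2pi (- z^*%C).
Proof.
case: z => a b; rewrite /e2pi /cexp /=.
have -> : (0 * - a - 2 * pi * - - b) = 0 * a - 2 * pi * b by ring.
have -> : (0 * - - b + 2 * pi * - a) = - (0 * b + 2 * pi * a) by ring.
by rewrite cosN sinN; apply/eqP; rewrite eq_complex /= !mul0r ?mulrN ?oppr0 ?addr0 ?add0r ?subr0 !eqxx.
Qed.

Lemma sin_le_norm (x : R) : `|sin x| <= `|x|.
Proof.
wlog x0 : x / 0 <= x => [H|].
  have [/H//|x0] := leP 0 x.
  by have := H (- x); rewrite sinN !normrN oppr_ge0 => /(_ (ltW x0)).
have H1 y : y \in `]0, x[ -> is_derive y 1 sin (cos y) by move=> _; apply: is_derive_sin.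
have H2 : {within `[0, x], continuous (@sin R)}%classic.
  by apply/continuous_subspaceT => y; apply: continuous_sin.
have [c _] := MVT_segment x0 H1 H2.
by rewrite sin0 !subr0 => ->; rewrite normrM ler_piMl // cos_max.
Qed.

Lemma cos_ge_sqr (x : R) : 1 - cos x <= x ^+ 2 / 2.
Proof.
have -> : cos x = 1 - sin (x / 2) ^+ 2 *+ 2.
  have {1}-> : x = (x / 2) *+ 2 by rewrite -mulr_natr; field.
  by rewrite cos_mulr2n cos2sin2; ring.
have := sin_le_norm (x / 2); rewrite -(@ler_pXn2r _ 2) ?nnegrE //.
rewrite !real_normK ?num_real // -mulr_natl => h.
have -> : x ^+ 2 = 4 * (x / 2) ^+ 2 by field.
lra.
Qed.

Lemma sin_near_id (x : R) : `|x| <= 1 -> `|sin x - x| <= x ^+ 2.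
Proof.
wlog x0 : x / 0 <= x => [H|].
  case: (ger0P x) => // x0 h; first by apply: H => //; rewrite ger0_norm.
  have := H (- x); rewrite sinN -opprD !normrN sqrrN oppr_ge0 ltW // => -> //.
  by rewrite ltr0_norm.
rewrite ger0_norm // => x1.
have H1 y : y \in `]0, x[ -> is_derive y 1 sin (cos y) by move=> _; apply: is_derive_sin.
have H2 : {within `[0, x], continuous (@sin R)}%classic.
  by apply/continuous_subspaceT => y; apply: continuous_sin.
have [c] := MVT_segment x0 H1 H2.
rewrite in_itv /= => /andP[c0 cx]; rewrite sin0 !subr0 => ->.
have -> : cos c * x - x = - ((1 - cos c) * x) by ring.
have k := cos_ge_sqr c; have := cos_le1 c => k2.
rewrite normrN ger0_norm ?mulr_ge0 ?subr_ge0 //.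
rewrite expr2 ler_wpM2r //; apply: le_trans k _.
have : c ^+ 2 <= x by rewrite expr2; nra.
have : 0 <= c ^+ 2 by apply: sqr_ge0.
lra.
Qed.

Lemma expR_near1D (x : R) : `|x| <= 1 / 2 -> 0 <= expR x - 1 - x <= 2 * x ^+ 2.
Proof.
rewrite ler_norml => /andP[x1 x2]; have h1 := expR_ge1Dx x.
have h2 := expR_ge1Dx (- x); apply/andP; split; first by lra.
have E0 := expR_gt0 x.
have : expR x * (1 - x) <= 1.
  by rewrite -[leRHS](expRxMexpNx_1 x); apply: ler_wpM2l => //; apply: ltW.
move: (expR x) h1 E0 => y h1 E0 h3.
have : y <= 1 + x + 2 * x ^+ 2; last by lra.
rewrite -(@ler_pM2r _ (1 - x)); last by lra.
apply: le_trans h3 _; rewrite expr2.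
suff : 0 <= x * x * (1 - 2 * x) by lra.
by rewrite mulr_ge0 -?expr2 ?sqr_ge0 //; lra.
Qed.

Lemma cexp_near1D z : nm z <= 1 / 2 -> nm (cexp z - 1 - z) <= 12 * nm z ^+ 2.
Proof.
move=> h; have hR := le_trans (nm_ge_Re z) h; have hI := le_trans (nm_ge_Im z) h.
rewrite nm_sqr; case: z h hR hI => a b /= h ha hb.
have /andP[e1 e2] := expR_near1D ha.
have c1 := cos_ge_sqr b; have c2 := cos_le1 b.
have b1 : `|b| <= 1 by apply: le_trans hb _; lra.
have /ler_normlP[s1 s2] := sin_near_id b1.
have /ler_normlP[a1 a2] := ha; have /ler_normlP[b2 b3] := hb.
have a0 := sqr_ge0 a; have b0 := sqr_ge0 b.
have A : a ^+ 2 <= 1 / 4 by rewrite expr2; nra.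
have B : b ^+ 2 <= 1 / 4 by rewrite expr2; nra.
apply: le_trans (nm_le_ReIm _) _; rewrite /cexp /= !mul0r !subr0 !addr0.
set E := expR a in e1 e2 *; set c := cos b in c1 c2 *; set s := sin b in s1 s2 *.
have E2 : E <= 2 by lra.
have E0 : 0 <= E by rewrite /E expR_ge0.
have -> : E * c - 1 - a = (E - 1 - a) - E * (1 - c) by ring.
have -> : E * s - b = E * (s - b) + (E - 1) * b by ring.
have p1 : 0 <= E * (1 - c) <= b ^+ 2.
  by apply/andP; split; [apply: mulr_ge0; lra|nra].
have p2 : `|E * (s - b)| <= 2 * b ^+ 2.
  rewrite normrM ger0_norm //; apply: ler_pM => //.
  by apply/ler_normlP; split; lra.
have p3 : `|(E - 1) * b| <= 2 * a ^+ 2 + 2 * b ^+ 2.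
  have q1 : `|E - 1| <= 2 * `|a|.
    have -> : E - 1 = (E - 1 - a) + a by ring.
    apply: le_trans (ler_normD _ _) _; rewrite (ger0_norm e1).
    have : 2 * a ^+ 2 <= `|a|; last by lra.
    by rewrite -(real_normK (num_real a)) expr2; have := normr_ge0 a; nra.
  rewrite normrM; apply: (@le_trans _ _ (2 * `|a| * `|b|)).
    by rewrite ler_wpM2r.
  rewrite -(real_normK (num_real a)) -(real_normK (num_real b)).
  by have := sqr_ge0 (`|a| - `|b|); rewrite !expr2; nra.
have k1 := ler_normB (E - 1 - a) (E * (1 - c)).
have k2 := ler_normD (E * (s - b)) ((E - 1) * b).
case/andP: p1 => p1 p1'; rewrite (ger0_norm e1) (ger0_norm p1) in k1.
lra.
Qed.

Lemma pi_lt4 : pi < 4 :> R.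
Proof. by have := @pihalf_lt2 R; lra. Qed.

Lemma e2pi_near (u : C) : nm u <= 1 / 16 ->
  nm (e2pi u - 1 - (0 +i* (2 * pi)) * u) <= 12 * (2 * pi) ^+ 2 * nm u ^+ 2.
Proof.
move=> h; have E : nm ((0 +i* (2 * pi)) * u) = 2 * pi * nm u.
  by rewrite nmM [nm (0 +i* _)]nmE /= expr0n add0r sqrtr_sqr ger0_norm // mulr_ge0 // pi_ge0.
apply: le_trans (cexp_near1D _) _; rewrite E.
  have := pi_lt4; have := @pi_ge0 R; have := nm_ge0 u; nra.
by rewrite exprMn mulrA.
Qed.

(** The only zero of 1 - e(u) in this box is u = 0, and it is simple. Near 0 the linear term
    dominates; for Im u >= d the modulus of e(u) stays away from 1; otherwise its argument stays
    away from 0. The width 3/4 leaves room below the next zeros u = 1 and u = -1. *)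
Lemma e2pi_lower : exists2 c : R, 0 < c & forall u : C,
  `|complex.Re u| <= 3 / 4 -> 0 <= complex.Im u <= 1 -> c * nm u <= nm (1 - e2pi u).
Proof.
have p0 := @pi_gt0 R; have p4 := pi_lt4; have p2 := @pi_ge2 R.
(* This is d = 1/10000, for which the quadratic error 12 (2 pi)^2 |u|^2 is at most |u| when |u| <= 2
   d. *)
have [d d0 dE] : exists2 d : R, 0 < d & 100 * (100 * d) = 1.
  by exists (1 / (100 * 100)); lra.
pose c1 : R := 1 - expR (- (2 * pi * d)).
pose c2 : R := 1 - Num.max 0 (cos (2 * pi * d)).
have c10 : 0 < c1.
  by rewrite subr_gt0 expR_lt1 oppr_lt0 !mulr_gt0.
have c20 : 0 < c2.
  rewrite subr_gt0 gt_max ltr01 /= -[X in _ < X]cos0 ltr_cos ?in_itv /= ?lexx ?pi_ge0 //; last first.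
    by apply/andP; split; [rewrite !mulr_ge0 ?pi_ge0 ?(ltW d0)|nra].
  by rewrite !mulr_gt0.
exists (Num.min 1 (Num.min (c1 / 2) (c2 / 2))).
  by rewrite !lt_min ltr01 !divr_gt0.
move=> u; set m := Num.min _ _ => hx /andP[hy hy1].
have m0 : 0 <= m by rewrite /m !le_min ler01 !divr_ge0 // ltW.
have [hu|hu] := leP (nm u) (2 * d).
  have hu1 : nm u <= 1 / 16 by apply: le_trans hu _; lra.
  have h := e2pi_near hu1.
  apply: (@le_trans _ _ (nm u)).
    by rewrite ler_piMl ?nm_ge0 // /m ge_min lexx.
  have E : nm ((0 +i* (2 * pi)) * u) = 2 * pi * nm u.
    by rewrite nmM [nm (0 +i* _)]nmE /= expr0n add0r sqrtr_sqr ger0_norm // mulr_ge0 // pi_ge0.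
  have := nm_ge_sub ((0 +i* (2 * pi)) * u) (1 - e2pi u * 1).
  have := nm_ge_sub ((0 +i* (2 * pi)) * u) (e2pi u - 1).
  rewrite [nm (_ - (e2pi u - 1))]nm_sub E [nm (e2pi u - 1)]nm_sub => k _.
  suff : 12 * (2 * pi) ^+ 2 * nm u ^+ 2 <= nm u.
    have n0 := nm_ge0 u; have : 2 * 2 * nm u <= 2 * pi * nm u by rewrite ler_wpM2r //; lra.
    by move: h k; rewrite ?opprB; lra.
  have n0 := nm_ge0 u.
  have : (2 * pi) ^+ 2 <= 64 :> R by rewrite expr2; nra.
  have : 0 <= (2 * pi) ^+ 2 :> R by apply: sqr_ge0.
  move: ((2 * pi) ^+ 2 : R) => q q0 q1; rewrite [nm u ^+ 2]expr2 mulrA.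
  rewrite ler_piMl //; nra.
clear dE.
have nu2 : nm u <= 2.
  by apply: le_trans (nm_le_ReIm u) _; rewrite (ger0_norm hy); lra.
have hxy : 2 * d < `|complex.Re u| + complex.Im u.
  by apply: lt_le_trans hu _; have := nm_le_ReIm u; rewrite (ger0_norm hy).
have [hI|hI] := leP (d) (complex.Im u).
  apply: (@le_trans _ _ c1).
    have : m <= c1 / 2 by rewrite /m !ge_min lexx !orbT.
    by have := nm_ge0 u; nra.
  apply: le_trans (nm_ge_sub _ _); rewrite nm1 nm_e2pi lerD2l lerN2 ler_expR lerN2.
  by rewrite ler_wpM2l // mulr_ge0 // ltW.
apply: (@le_trans _ _ c2).
  have : m <= c2 / 2 by rewrite /m !ge_min lexx !orbT.
  by have := nm_ge0 u; nra.
apply: le_trans (nm_ge_Re _); apply: le_trans (ler_norm _).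
have -> : complex.Re (1 - e2pi u) =
    1 - expR (- (2 * pi * complex.Im u)) * cos (2 * pi * complex.Re u).
  by case: (u) => a b; rewrite /e2pi /cexp /= !mul0r !add0r ?subr0.
rewrite lerD2l lerN2.
set x := complex.Re u in hx hxy *.
have cx : cos (2 * pi * x) <= Num.max 0 (cos (2 * pi * d)).
  have -> : cos (2 * pi * x) = cos (2 * pi * `|x|).
    by rewrite -[LHS]cos_norm normrM (ger0_norm (x := 2 * pi)) // mulr_ge0 // ltW.
  have x1 : d < `|x| by lra.
  have [x2|x2] := leP `|x| (1 / 2).
    rewrite le_max; apply/orP; right; apply/ltW.
    have k1 : 2 * pi * d < 2 * pi * `|x| by rewrite ltr_pM2l ?mulr_gt0.
    have k2 : 2 * pi * `|x| <= 2 * pi * (1 / 2) by rewrite ler_pM2l ?mulr_gt0.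
    have k3 : 0 < 2 * pi * d by rewrite !mulr_gt0.
    by rewrite ltr_cos ?in_itv /= //; apply/andP; split; move: k1 k2 k3; clear; lra.
  rewrite le_max; apply/orP; left.
  have -> : 2 * pi * `|x| = (2 * pi * `|x| - pi) + pi by ring.
  have k1 : 2 * pi * (1 / 2) < 2 * pi * `|x| by rewrite ltr_pM2l ?mulr_gt0.
  have k2 : 2 * pi * `|x| <= 2 * pi * (3 / 4) by rewrite ler_pM2l ?mulr_gt0.
  by rewrite cosDpi oppr_le0 cos_ge0_pihalf //; apply/andP; split; lra.
have E1 : expR (- (2 * pi * complex.Im u)) <= 1.
  by rewrite expR_le1 oppr_le0 !mulr_ge0 // ltW.
have E0 := expR_gt0 (- (2 * pi * complex.Im u)).
have M0 : 0 <= Num.max 0 (cos (2 * pi * d)) :> R by rewrite le_max lexx.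
move: (expR _) (cos _) (Num.max _ _) cx E1 E0 M0 => E c M cx E1 E0 M0.
by nra.
Qed.

End Cexp.

(** * Lipschitz summation and the inversion of Eisenstein series *)

Lemma big_double (V : zmodType) (g : nat -> V) n :
  \sum_(0 <= d < 2 ^ n.+1) g d = \sum_(0 <= d < 2 ^ n) g d + \sum_(0 <= d < 2 ^ n) g (d + 2 ^ n)%N.
Proof.
rewrite expnS mul2n -addnn (big_cat_nat (n := 2 ^ n)) ?leq_addr //=; congr (_ + _).
by rewrite -{1}[(2 ^ n)%N]add0n big_addn addnK.
Qed.

Lemma big_half_rev (V : zmodType) (g : nat -> V) n :
  \sum_(0 <= d < 2 ^ n.+1) g d = \sum_(0 <= d < 2 ^ n) g d +
    \sum_(0 <= d < 2 ^ n) g (2 ^ n.+1 - d.+1)%N.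
Proof.
rewrite big_double; congr (_ + _); rewrite big_nat_rev /=.
apply: eq_big_nat => d /andP[_ dn]; congr g; rewrite expnS; lia.
Qed.

Section Lipschitz.
Variable R : realType.
Local Notation C := R[i].
Variables (k : nat) (A : {poly C}).
Hypothesis k4 : (4 <= k)%N.
Hypothesis A1 : A.[1] != 0.

(** For [A] equal to w times an Eulerian polynomial this is the rational function summing n^(k-1)
    w^n, and the hypothesis [lip_double] isolates its even terms. Iterating that hypothesis spreads
    lip(e(z)) over the points (z + d) / 2^n, where each term tends to a multiple of (z + d)^(-k). *)
Definition lip w : C := A.[w] / (1 - w) ^+ k.

Hypothesis lip_double : forall w, w ^+ 2 != 1 -> lip w + lip (- w) = 2 ^+ k * lip (w ^+ 2).

(** The constant in lip(e(u)) ~ [lipc] u^(-k) as u tends to 0, because 1 - e(u) ~ - 2 pi i u. *)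
Definition lipc : C := A.[1] / (- (0 +i* (2 * pi))) ^+ k.

Lemma tpi_neq0 : - (0 +i* (2 * pi)) != 0 :> C.
Proof.
rewrite oppr_eq0 eq_complex /= eqxx /= mulf_neq0 ?pnatr_eq0 //.
by rewrite gt_eqF // pi_gt0.
Qed.

Lemma lipc_neq0 : lipc != 0.
Proof. by rewrite mulf_neq0 // invr_eq0 expf_neq0 // tpi_neq0. Qed.

(** Division by zero assigns 0 to the pole, so at z = 0 the singular term d = 0 drops out of the
    sums; [lip_zeta] relies on this. *)
Lemma lip1 : lip 1 = 0.
Proof. by rewrite /lip subrr expr0n /= -[k]prednK ?invr0 ?mulr0 //; lia. Qed.

Lemma two_neq0 : 2 != 0 :> C. Proof. by rewrite pnatr_eq0. Qed.

Definition lipS n (z : C) := (2 ^+ (k * n))^-1 * \sum_(0 <= d < 2 ^ n) lip (e2pi ((z + d%:R) / 2 ^+ n)).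

Lemma lipS_split n (z : C) : \sum_(0 <= d < 2 ^ n.+1) lip (e2pi ((z + d%:R) / 2 ^+ n.+1)) =
  \sum_(0 <= d < 2 ^ n) (lip (e2pi ((z + d%:R) / 2 ^+ n.+1)) + lip (- e2pi ((z + d%:R) / 2 ^+ n.+1))).
Proof.
rewrite big_double -big_split; apply: eq_bigr => d _; congr (_ + lip _).
have -> : (z + (d + 2 ^ n)%:R) / 2 ^+ n.+1 = (z + d%:R) / 2 ^+ n.+1 + 2^-1.
  rewrite natrD natrX exprS; field.
  by rewrite expf_neq0 ?two_neq0.
by rewrite e2piD e2pi_half mulrN1.
Qed.

Lemma e2pi_sq (z : C) n : e2pi (z / 2 ^+ n.+1) ^+ 2 = e2pi (z / 2 ^+ n).
Proof.
rewrite e2piX; congr e2pi; rewrite exprS; field.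
by rewrite expf_neq0 ?two_neq0.
Qed.

Lemma lip_pair n (z : C) : e2pi (z / 2 ^+ n) != 1 ->
  lip (e2pi (z / 2 ^+ n.+1)) + lip (- e2pi (z / 2 ^+ n.+1)) = 2 ^+ k * lip (e2pi (z / 2 ^+ n)).
Proof. by rewrite -e2pi_sq; apply: lip_double. Qed.

Lemma lipS_pos n (z : C) : 0 < complex.Im z -> lipS n z = lip (e2pi z).
Proof.
move=> z0; elim: n => [|n IH].
  by rewrite /lipS muln0 !expr0 invr1 mul1r expn0 big_nat1 addr0 mulr1.
rewrite -IH /lipS lipS_split.
transitivity ((2 ^+ (k * n.+1))^-1 * \sum_(0 <= d < 2 ^ n) (2 ^+ k * lip (e2pi ((z + d%:R) / 2 ^+ n)))).
  congr (_ * _); apply: eq_bigr => d _; apply: lip_pair.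
  apply/eqP => /(congr1 nm); rewrite nm1 nm_e2pi => /eqP.
  rewrite lt_eqF // expR_lt1 oppr_lt0 !mulr_gt0 // ?pi_gt0 //.
  have -> : (2 : C) ^+ n = ((2 ^+ n : R))%:C by rewrite rmorphXn /= rmorph_nat.
  have -> : (d%:R : C) = (d%:R : R)%:C by rewrite rmorph_nat.
  case: z z0 {IH} => a b /= b0; rewrite expr0n /= !addr0 !mul0r oppr0 mulr0 add0r.
  by rewrite mulr_gt0 // divr_gt0 ?exprn_gt0 // exprn_gt0 // exprn_gt0.
rewrite -mulr_sumr mulrA mulnS exprD; congr (_ * _).
by rewrite invfM mulrC mulrA mulfV ?mul1r // expf_neq0 ?two_neq0.
Qed.

(** Doubling fails only for the pair 1, -1, which contributes [lip (-1)] at each level. Hence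
    [lipS n 0] is a geometric sum. *)
Lemma lipS_zero n : lipS n.+1 0 = lipS n 0 + (2 ^+ (k * n.+1))^-1 * lip (-1).
Proof.
rewrite /lipS lipS_split big_ltn ?expn_gt0 //= [in X in _ = _ * X + _]big_ltn ?expn_gt0 //.
rewrite addr0 !mul0r e2pi0 lip1 !add0r mulrDr addrC; congr (_ + _).
transitivity ((2 ^+ (k * n.+1))^-1 * \sum_(1 <= d < 2 ^ n) (2 ^+ k * lip (e2pi ((0 + d%:R) / 2 ^+ n)))).
  congr (_ * _); apply: eq_big_nat => d /andP[d0 dn]; apply: lip_pair.
  rewrite add0r; apply/eqP => /(congr1 (fun z => complex.Re z)).
  have -> : (d%:R / 2 ^+ n : C) = (d%:R / 2 ^+ n : R)%:C.
    by rewrite rmorphM rmorph_nat fmorphV rmorphXn /= rmorph_nat.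
  rewrite /e2pi /cexp /= !mul0r !mulr0 !subr0 expR0 add0r mul1r => h.
  have : sin (pi * (d%:R / 2 ^+ n)) = 0 :> R.
    move: h; have -> : 2 * pi * (d%:R / 2 ^+ n) = (pi * (d%:R / 2 ^+ n)) *+ 2 :> R.
      by ring.
    rewrite cos_mulr2n cos2sin2 mulrnBl => h.
    apply/eqP; rewrite -sqrf_eq0; apply/eqP.
    move: h; set q := sin _ ^+ 2; rewrite (_ : q *+ 2 = q + q) //; lra.
  have : 0 < sin (pi * (d%:R / 2 ^+ n)) :> R.
    have q0 : 0 < (2 : R) ^+ n by rewrite exprn_gt0.
    apply: sin_gt0_pi; apply/andP; split.
      by rewrite mulr_gt0 ?pi_gt0 // divr_gt0 // ltr0n.
    rewrite -[ltRHS]mulr1 ltr_pM2l ?pi_gt0 // ltr_pdivrMr // mul1r.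
    by rewrite -natrX ltr_nat.
  by move=> h1 h2; rewrite h2 ltxx in h1.
rewrite -mulr_sumr mulrA mulnS exprD; congr (_ * _).
by rewrite invfM mulrC mulrA mulfV ?mul1r // expf_neq0 ?two_neq0.
Qed.

(** The upper half of the period is moved down by 1, so that the real parts of the arguments stay
    near [-1/2, 1/2], inside the box where [lip_bound] holds. *)
Lemma lipS_sym n (z : C) : lipS n.+1 z = 
   (2 ^+ (k * n.+1))^-1 * \sum_(0 <= d < 2 ^ n) lip (e2pi ((z + d%:R) / 2 ^+ n.+1)) +
   (2 ^+ (k * n.+1))^-1 * \sum_(0 <= d < 2 ^ n) lip (e2pi ((z - 1 - d%:R) / 2 ^+ n.+1)).
Proof.
rewrite -mulrDr /lipS big_half_rev; congr (_ * (_ + _)).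
apply: eq_big_nat => d /andP[_ dn]; congr lip.
rewrite -[RHS](e2piDnat _ 1); congr e2pi.
have dn1 : (d.+1 <= 2 ^ n.+1)%N by rewrite expnS; lia.
rewrite (natrB _ dn1) natrX -natr1; field.
by rewrite expf_neq0 ?two_neq0.
Qed.

Lemma lip_bound : exists2 K : R, 0 < K & forall u : C,
  `|complex.Re u| <= 3 / 4 -> 0 <= complex.Im u <= 1 -> nm (lip (e2pi u)) <= K / nm u ^+ k.
Proof.
have [c c0 Hc] := e2pi_lower R.
exists ((1 + \sum_(i < size A) nm A`_i) / c ^+ k).
  by rewrite divr_gt0 ?exprn_gt0 // ltr_wpDr // sumr_ge0 // => i _; apply: nm_ge0.
move=> u h1 h2; have [->|u0] := eqVneq u 0.
  by rewrite e2pi0 lip1 nm0 divr_ge0 ?exprn_ge0 // divr_ge0 ?exprn_ge0 ?(ltW c0) // addr_ge0 // sumr_ge0 // => i _; apply: nm_ge0.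
have nu : 0 < nm u by rewrite nm_gt0.
rewrite /lip nmM nmV nmX -mulrA -invfM -exprMn; apply: ler_pM; rewrite ?nm_ge0 ?invr_ge0 ?exprn_ge0 ?nm_ge0 //.
  apply: le_trans (nm_horner _ _) _; last by rewrite lerDr.
  rewrite nm_e2pi expR_le1 oppr_le0 !mulr_ge0 ?pi_ge0 //; by case/andP: h2.
have cu : 0 < c * nm u by rewrite mulr_gt0.
have h := Hc u h1 h2.
rewrite lef_pV2 ?posrE ?exprn_gt0 //; last exact: lt_le_trans h.
by rewrite lerXn2r ?nnegrE // ?(ltW cu) // nm_ge0.
Qed.

Lemma lip_term_cto (z : C) : 
  cto (fun n => (2 ^+ (k * n.+1))^-1 * lip (e2pi (z / 2 ^+ n.+1))) (lipc * (z ^+ k)^-1).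
Proof.
have [->|z0] := eqVneq z 0.
  apply: (cto_eq (n0 := 0) (v := fun=> 0)) => [|n _].
    by rewrite expr0n -[k]prednK /= ?invr0 ?mulr0; [apply: cto_cst|lia].
  by rewrite mul0r e2pi0 lip1 mulr0.
pose u n : C := z / 2 ^+ n.+1.
have n2 n : (2 : C) ^+ n != 0 by rewrite expf_neq0 ?two_neq0.
have u0 n : u n != 0 by rewrite mulf_neq0 // invr_eq0 n2.
have nu n : nm (u n) = nm z * (2^-1) ^+ n.+1.
  by rewrite nmM nmV nmX nm_nat exprVn.
have su : small (fun n => nm (u n)).
  have h1 : `|2^-1 : R| < 1 by rewrite ger0_norm; lra.
  have := smallZ (nm z) (small_sub (f := S) (fun n => leqnSn n) (small_geom h1)).
  by move=> /(small_le (n0 := 0)); apply => n _; rewrite nu.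
have [N HN] := su (1 / 16) (ltac:(lra)).
have cq : cto (fun n => (1 - e2pi (u n)) / u n) (- (0 +i* (2 * pi))).
  have := smallZ (12 * (2 * pi) ^+ 2) su; move=> /(cto_le (n0 := N)); apply => n nN.
  have -> : (1 - e2pi (u n)) / u n - - (0 +i* (2 * pi)) =
      - ((e2pi (u n) - 1 - (0 +i* (2 * pi)) * u n) / u n).
    by field.
  have h : nm (u n) <= 1 / 16.
    by have := HN n nN; rewrite ger0_norm ?nm_ge0 // => /ltW.
  rewrite nmN nmM nmV ler_pdivrMr ?nm_gt0 ?u0 //.
  by apply: le_trans (e2pi_near h) _; rewrite [nm (u n) ^+ 2]expr2 mulrA.
have ce : cto (fun n => e2pi (u n)) 1.
  have cu : cto u 0 by apply: (cto_le (n0 := 0) su) => n _; rewrite subr0.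
  have := ctoM cq cu; rewrite mulr0 => h.
  have := ctoB (cto_cst 1) h; rewrite subr0 => /(cto_eq (n0 := 0)); apply => n _.
  by rewrite divfK // subKr.
have := ctoM (cto_horner A ce) (ctoV (expf_neq0 k tpi_neq0) (ctoX k cq)).
move=> /(ctoM (cto_cst (z ^+ k)^-1)); rewrite mulrC => /(cto_eq (n0 := 0)); apply => n _.
have w0 : (1 - e2pi (u n)) ^+ k * u n ^- k = ((1 - e2pi (u n)) / u n) ^+ k.
  by rewrite [RHS]expr_div_n.
rewrite /lip -/(u n) exprMn exprVn invfM invrK mulnC exprM /u exprMn exprVn.
have zk : z ^+ k != 0 by rewrite expf_neq0.
have tk : (2 ^+ n.+1) ^+ k != 0 :> C by rewrite expf_neq0.
rewrite -[LHS]mul1r -(mulVf zk); move: (z ^- k) (z ^+ k) => a b.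
set q := A.[_]; set r := (_ ^+ k)^-1; set w := (_ ^+ k)^-1; move: q r w => q r w.
by ring.
Qed.

Lemma summable_lip (z : C) : summable_seq (fun d => (nm (z + d%:R) ^+ k)^-1 : R).
Proof.
have [N HN] : exists N : nat, 2 * nm z + 2 <= N%:R.
  have h : 0 <= 2 * nm z + 2 by rewrite addr_ge0 // mulr_ge0 ?nm_ge0.
  by exists (Num.bound (2 * nm z + 2)); apply/ltW/archi_boundP.
apply: (@summable_ev R _ (fun n => 4 ^+ k * (n.+1%:R ^+ 2)^-1) N).
- by apply: summableZ; [rewrite exprn_ge0|apply: summable_invsq].
- by move=> n; rewrite invr_ge0 exprn_ge0 ?nm_ge0.
move=> n nN; have n1 : N%:R <= n%:R :> R by rewrite ler_nat.
have h : n.+1%:R / 4 <= nm (z + n%:R).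
  have h := nm_ge_sub (n%:R : C) (- z); rewrite opprK nm_nat nmN [n%:R + z]addrC in h.
  apply: le_trans h; rewrite -natr1; have := nm_ge0 z; lra.
have n10 : 1 <= n.+1%:R :> R by rewrite ler1n.
have h0 : 0 < n.+1%:R / 4 :> R by rewrite divr_gt0.
apply: (@le_trans _ _ ((n.+1%:R / 4) ^- k)).
  rewrite lef_pV2 ?posrE ?exprn_gt0 //; last exact: lt_le_trans h.
  by rewrite lerXn2r ?nnegrE ?nm_ge0 // ltW.
rewrite exprMn exprVn invfM invrK mulrC ler_wpM2l ?exprn_ge0 //.
rewrite lef_pV2 ?posrE ?exprn_gt0 // ler_weXn2l //; lia.
Qed.

Lemma lip_tannery (z s : C) (p : nat -> C) : nm s = 1 -> 0 <= complex.Im z ->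
  (forall d, p d = s * d%:R) ->
  (forall d : nat, `|complex.Re (s * d%:R)| = d%:R /\ complex.Im (s * d%:R) = 0) ->
  cto (fun n => \sum_(0 <= d < 2 ^ n) (2 ^+ (k * n.+1))^-1 * lip (e2pi ((z + p d) / 2 ^+ n.+1))
   - \sum_(0 <= d < 2 ^ n) lipc * ((z + p d) ^+ k)^-1) 0.
Proof.
move=> s1 Iz hp hs; have [K K0 HK] := lip_bound.
have s0 : s != 0 by rewrite -nm_gt0 s1.
have bnd (a b : R) : exists N : nat, forall n, (N <= n)%N -> a <= b * 2 ^+ n \/ b <= 0.
  have [b0|b0] := leP b 0; first by exists 0%N => n _; right.
  exists (Num.bound (`|a| / b)) => n nN; left.
  have h : `|a| / b < (Num.bound (`|a| / b))%:R by apply: archi_boundP; rewrite divr_ge0 // ltW.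
  rewrite mulrC -ler_pdivrMr //; apply: le_trans (ltW (le_lt_trans _ h)) _.
    by rewrite ler_wpM2r ?ler_norm // invr_ge0 ltW.
  by rewrite -natrX ler_nat; apply: leq_trans nN _; apply/ltnW/ltn_expl.
have [N1 H1] := bnd (`|complex.Re z|) (1 / 4).
have [N2 H2] := bnd (complex.Im z) 1.
apply: (@tannery R _ (fun d => lipc * ((z + p d) ^+ k)^-1)
   (fun d => K * (nm (z / s + d%:R) ^+ k)^-1) (fun n => 2 ^ n)%N (maxn N1 N2)).
- by apply: summableZ; [apply: ltW|apply: summable_lip].
- by move=> d; apply: lip_term_cto.
- move=> n d; rewrite geq_max => /andP[n1 n2] dn.
  have zs : nm (z / s + d%:R) = nm (z + s * d%:R).
    by rewrite -[RHS]mul1r -[1 in RHS]invr1 -s1 -nmV -nmM mulrDr mulKf // mulrC.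
  rewrite hp nmM nmV nmX nm_nat zs.
  have p0 : 0 < (2 : R) ^+ n by rewrite exprn_gt0.
  have [hs1 hs2] := hs d.
  have uE : (z + s * d%:R) / 2 ^+ n.+1 = (complex.Re (z + s * d%:R) / 2 ^+ n.+1) +i* (complex.Im (z + s * d%:R) / 2 ^+ n.+1).
    have -> : (2 : C) ^+ n.+1 = ((2 ^+ n.+1 : R))%:C by rewrite rmorphXn /= rmorph_nat.
    by rewrite -fmorphV; case: (z + s * d%:R) => a b; apply/eqP; rewrite eq_complex /= !mulr0 subr0 add0r !eqxx.
  have Re1 : `|complex.Re (z + s * d%:R)| <= `|complex.Re z| + d%:R.
    have -> : complex.Re (z + s * d%:R) = complex.Re z + complex.Re (s * d%:R).
      by case: (z) (s * _) => ? ? [].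
    by rewrite -hs1 ler_normD.
  have Im1 : complex.Im (z + s * d%:R) = complex.Im z.
    by move: hs2; case: (z) (s * _) => ? ? [? ?] /= ->; rewrite addr0.
  have dn' : d%:R <= 2 ^+ n :> R by rewrite -natrX ler_nat ltnW.
  apply: le_trans (ler_wpM2l _ (HK _ _ _)) _.
  + by rewrite invr_ge0 exprn_ge0.
  + rewrite uE /= normrM normfV (ger0_norm (x := 2 ^+ _)) ?exprn_ge0 // ler_pdivrMr ?exprn_gt0 //.
    rewrite exprS; case: (H1 n n1) => [h|]; last by lra.
    by apply: le_trans Re1 _; lra.
  + rewrite uE /= Im1 divr_ge0 ?exprn_ge0 //= ler_pdivrMr ?exprn_gt0 // mul1r exprS.
    by case: (H2 n n2) => h; lra.
  rewrite nmM nmV nmX nm_nat expr_div_n invf_div -exprM [(n.+1 * k)%N]mulnC mulrCA mulKf //.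
by move=> n; apply/ltnW/ltn_expl.
Qed.

Definition lipR n (z : C) := \sum_(0 <= d < n) ((z + d%:R) ^- k + (z - 1 - d%:R) ^- k).

Lemma lipR_cto (z : C) : exists l, cto (fun n => lipR n z) l.
Proof.
apply: summable_cto; apply: (summable_le (summableD (summable_lip z) (summable_lip (1 - z)))).
move=> n; rewrite nm_ge0 /=; apply: le_trans (nmD _ _) _; rewrite !nmV !nmX lerD2l.
by rewrite (_ : z - 1 - n%:R = - (1 - z + n%:R)) ?nmN //; ring.
Qed.

Lemma lip_lim (z L : C) : 0 <= complex.Im z -> cto (fun n => lipS n.+1 z) L ->
  cto (fun n => lipR n z) (L / lipc).
Proof.
move=> Iz cS; have [l Hl] := lipR_cto z.
suff -> : L / lipc = l by [].
apply/eqP; rewrite eq_sym -(can2_eq (mulfK lipc_neq0) (mulfVK lipc_neq0)); apply/eqP.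
have nd (d : nat) : (d%:R : C) = (d%:R : R)%:C by rewrite rmorph_nat.
have h1 (d : nat) : `|complex.Re (1 * d%:R : C)| = d%:R :> R /\ complex.Im (1 * d%:R : C) = 0.
  by rewrite mul1r nd /= normr_nat.
have h2 (d : nat) : `|complex.Re (-1 * d%:R : C)| = d%:R :> R /\ complex.Im (-1 * d%:R : C) = 0.
  by rewrite mulN1r nd /= normrN normr_nat oppr0.
have Iz1 : 0 <= complex.Im (z - 1) by case: (z) Iz => a b; rewrite /= subr0.
have nm11 : nm (-1 : C) = 1 by rewrite nmN nm1.
have t1 := @lip_tannery _ _ (fun d => d%:R) (nm1 R) Iz (fun d => esym (mul1r _)) h1.
have t2 := @lip_tannery _ _ (fun d => - d%:R) nm11 Iz1 (fun d => esym (mulN1r _)) h2.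
have t3 := ctoD t1 t2; rewrite addr0 in t3.
have ln n : (n <= 2 ^ n)%N by apply/ltnW/ltn_expl.
have t4 := ctoZ lipc (cto_sub ln Hl).
have := ctoB cS t4; rewrite mulrC => t5.
have t6 : cto (fun n => lipS n.+1 z - lipc * lipR (2 ^ n) z) 0.
  apply: (cto_eq (n0 := 0) t3) => n _.
  by rewrite lipS_sym /lipR big_split mulrDr !mulr_sumr opprD addrACA.
have := cto_uniq t5 t6.
by move/eqP; rewrite subr_eq0 eq_sym => /eqP.
Qed.

(** Lipschitz's summation formula: repeated doubling leaves the value lip(e(z)) unchanged, while its
    terms converge to those of the series of (z + j)^(-k) over the integers j. *)
Lemma lipschitz (z : C) : 0 < complex.Im z -> cto (fun n => lipR n z) (lip (e2pi z) / lipc).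
Proof.
move=> z0; apply: lip_lim; first exact: ltW.
by apply: (cto_eq (n0 := 0) (cto_cst _)) => n _; apply: lipS_pos.
Qed.

(** The sum of j^(-k) over the nonzero integers j. The geometric sum of [lipS_zero] converges to
    lip(-1) / (2^k - 1), and the inverse of 0 being 0 removes j = 0. *)
Lemma lip_zeta : cto (fun n => lipR n 0) (lip (-1) / (2 ^+ k - 1) / lipc).
Proof.
apply: lip_lim => //.
pose x : C := (2 ^+ k)^-1.
have k20 : (2 : C) ^+ k != 0 by rewrite expf_neq0 ?two_neq0.
have k21 : (2 : C) ^+ k - 1 != 0.
  rewrite subr_eq0 -natrX pnatr_eq1 gtn_eqF //; apply: leq_ltn_trans (ltn_expl k (ltnSn 1)); lia.
have E n : lipS n 0 = lip (-1) / (2 ^+ k - 1) * (1 - x ^+ n).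
  elim: n => [|n IH].
    rewrite /lipS muln0 !expr0 subrr mulr0 expn0 big_nat1 addr0 mul0r e2pi0 lip1.
    by rewrite mulr0.
  rewrite lipS_zero IH exprM -exprVn -/x exprS.
  have e : x * (2 ^+ k - 1) = 1 - x by rewrite mulrBr mulVf // mulr1.
  have -> : x * x ^+ n * lip (-1) = lip (-1) / (2 ^+ k - 1) * (x ^+ n * (x * (2 ^+ k - 1))).
    by move: (lip (-1)) => l; field.
  by rewrite e; move: (lip (-1) / _) => l; ring.
have nx : nm x < 1.
  rewrite nmV nmX nm_nat invf_lt1 ?exprn_gt0 //.
  by rewrite exprn_egt1 // ?ltr1n //; lia.
have sx : cto (fun n => x ^+ n.+1) 0.
  have h1 : `|nm x| < 1 by rewrite ger0_norm ?nm_ge0.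
  have := small_sub (f := S) (fun n => leqnSn n) (small_geom h1).
  by move=> /(cto_le (n0 := 0)); apply => n _; rewrite subr0 nmX.
have := ctoZ (lip (-1) / (2 ^+ k - 1)) (ctoB (cto_cst 1) sx).
by rewrite subr0 mulr1 => /(cto_eq (n0 := 0)); apply => n _.
Qed.

End Lipschitz.

Lemma big_nat_sym (V : zmodType) (C : comNzRingType) (g : C -> V) N :
  \sum_(0 <= j < N.*2.+1) g (j%:R - N%:R) =
  \sum_(0 <= d < N) (g d%:R + g (- 1 - d%:R)) + g N%:R.
Proof.
rewrite big_split /= -addrA addrC addrAC.
have -> : N.*2.+1 = (N + N.+1)%N by rewrite -addnn addnS.
rewrite (big_cat_nat (n := N)) ?leq_addr //=.
have -> : \sum_(0 <= i < N) g (i%:R - N%:R) = \sum_(0 <= i < N) g (-1 - i%:R).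
  rewrite big_nat_rev /=; apply: eq_big_nat => i /andP[_ iN]; congr g.
  by rewrite add0n natrB // -natr1; ring.
have -> : \sum_(N <= i < N + N.+1) g (i%:R - N%:R) = \sum_(0 <= i < N.+1) g i%:R.
  rewrite -{1}[N]add0n big_addn addKn; apply: eq_bigr => i _.
  by rewrite natrD addrK.
by rewrite -addrA -big_nat_recr.
Qed.

Lemma divisors_codiv M : (0 < M)%N ->
  perm_eq (divisors M) [seq (M %/ c.+1)%N | c <- iota 0 M & (c.+1 %| M)%N].
Proof.
move=> M0; apply: uniq_perm; first exact: divisors_uniq.
  rewrite map_inj_in_uniq ?filter_uniq ?iota_uniq // => a b.
  rewrite !mem_filter => /andP[/dvdnP[x xE] _] /andP[/dvdnP[y yE] _].
  rewrite {1}xE {1}yE !mulnK // => xy; rewrite xy in xE.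
  have : (y * a.+1 = y * b.+1)%N by rewrite -xE -yE.
  have y0 : (0 < y)%N by case: y yE M0 {xE xy} => // ->.
  by move/eqP; rewrite eqn_pmul2l // eqSS => /eqP.
move=> d; rewrite -dvdn_divisors //; apply/idP/mapP => [dM|[c]].
  exists (M %/ d).-1.
    have h : (0 < M %/ d)%N by rewrite divn_gt0 ?(dvdn_gt0 M0 dM) // dvdn_leq.
    rewrite mem_filter mem_iota prednK // dvdn_div //= add0n.
    by rewrite leq_div.
  have h : (0 < M %/ d)%N by rewrite divn_gt0 ?(dvdn_gt0 M0 dM) // dvdn_leq.
  by rewrite prednK // divnA // mulKn.
by rewrite mem_filter => /andP[cM _] ->; apply: dvdn_div.
Qed.

(** Both sides run over the pairs of positive integers (c, d) with c d <= N, each weighted by d^nu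
    q^(c d). *)
Lemma sigma_sum (K : comPzRingType) nu (q : K) N :
  \sum_(0 <= n < N) (sigma nu n.+1)%:R * q ^+ n.+1 =
  \sum_(0 <= c < N) \sum_(0 <= d < N %/ c.+1) d.+1%:R ^+ nu * q ^+ (c.+1 * d.+1).
Proof.
elim: N => [|N IH]; first by rewrite !big_nil.
rewrite big_nat_recr //= IH.
have -> : \sum_(0 <= c < N) \sum_(0 <= d < N %/ c.+1) d.+1%:R ^+ nu * q ^+ (c.+1 * d.+1) =
  \sum_(0 <= c < N.+1) \sum_(0 <= d < N %/ c.+1) d.+1%:R ^+ nu * q ^+ (c.+1 * d.+1).
  by rewrite [RHS]big_nat_recr //= divn_small // big_nil addr0.
have -> : (sigma nu N.+1)%:R * q ^+ N.+1 =
    \sum_(0 <= c < N.+1 | (c.+1 %| N.+1)%N) (N.+1 %/ c.+1)%:R ^+ nu * q ^+ N.+1.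
  rewrite -mulr_suml; congr (_ * _).
  rewrite /sigma (perm_big _ (divisors_codiv (ltn0Sn N))) big_map big_filter.
  by rewrite natr_sum /index_iota subn0; apply: eq_bigr => c _; rewrite natrX.
rewrite -big_mkcond /= || rewrite [X in _ + X]big_mkcond /=.
rewrite -big_split /=; apply: eq_bigr => c _.
rewrite divnS //; case: ifP => cN; last by rewrite add0n addr0.
rewrite add1n [RHS]big_nat_recr //=; congr (_ + _).
have e : (N.+1 %/ c.+1 = (N %/ c.+1).+1)%N by rewrite divnS // cN.
by rewrite -[((c.+1 %| N.+1) + _)%N]divnS // -e [(c.+1 * _)%N]mulnC divnK.
Qed.

Section Summability.
Variable R : realType.

Lemma summable_natXgeom p (x : R) : 0 <= x < 1 ->
  summable_seq (fun n => n.+1%:R ^+ p * x ^+ n.+1).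
Proof.
move=> /andP[x0 x1]; pose y := Num.sqrt x.
have yy : x = y * y by rewrite -expr2 sqr_sqrtr.
have y0 : 0 <= y by rewrite sqrtr_ge0.
have y1 : y < 1.
  by rewrite -(ltr_pXn2r (n := 2)) ?nnegrE // expr2 -yy expr1n.
have y01 : 0 <= y < 1 by rewrite y0.
have [N HN] := small_natXgeom p y01 (@ltr01 R).
apply: (@summable_ev R _ (fun n => y ^+ n) N); first exact: summable_geom.
  by move=> n; rewrite mulr_ge0 ?exprn_ge0.
move=> n nN; rewrite yy exprMn mulrA.
have := HN n.+1 (leq_trans nN (leqnSn n)).
rewrite ger0_norm ?mulr_ge0 ?exprn_ge0 // => h.
apply: (@le_trans _ _ (1 * y ^+ n.+1)).
  by rewrite ler_wpM2r ?exprn_ge0 // ltW.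
by rewrite mul1r exprS ler_piMl ?exprn_ge0 // ltW.
Qed.

(** The inner sums over d are cut at N / c; with the bound K |q|^c, [tannery] exchanges the two
    limits in the Lambert series. *)
Lemma lambert_sum (k : nat) (f : R[i] -> R[i]) (q : R[i]) : nm q < 1 ->
  (forall w, nm w < 1 -> cto (fun n => \sum_(0 <= i < n) i.+1%:R ^+ k * w ^+ i.+1) (f w)) ->
  exists S, cto (fun N => \sum_(0 <= n < N) (sigma k n.+1)%:R * q ^+ n.+1) S /\
    cto (fun N => \sum_(0 <= c < N) f (q ^+ c.+1)) S.
Proof.
move=> q1 hf; have q01 : 0 <= nm q < 1 by rewrite nm_ge0.
have [_ [K HK]] := summable_natXgeom k q01.
have K0 : 0 <= K by apply: le_trans (HK 0%N); rewrite big_nil.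
have qc c : nm (q ^+ c.+1) < 1.
  by rewrite nmX exprn_ilt1 ?nm_ge0.
have sM : summable_seq (fun c => K * nm q ^+ c).
  by apply: summableZ => //; apply: summable_geom.
have bd n c : nm (\sum_(0 <= d < n) d.+1%:R ^+ k * (q ^+ c.+1) ^+ d.+1) <= K * nm q ^+ c.
  apply: le_trans (nm_sum _ _ _) _.
  apply: (@le_trans _ _ (\sum_(0 <= d < n) (d.+1%:R ^+ k * nm q ^+ d.+1) * nm q ^+ c)).
    apply: ler_sum => d _; rewrite nmM !nmX nm_nat -mulrA ler_wpM2l ?exprn_ge0 //.
    rewrite -exprM -exprD ler_wiXn2l ?nm_ge0 //; first exact: ltW.
    by rewrite mulSn mulnS; lia.
  by rewrite -mulr_suml ler_wpM2r ?exprn_ge0 ?nm_ge0.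
have cf c : cto (fun n => \sum_(0 <= d < n %/ c.+1) d.+1%:R ^+ k * (q ^+ c.+1) ^+ d.+1) (f (q ^+ c.+1)).
  apply: (cto_comp (u := fun n => \sum_(0 <= d < n) d.+1%:R ^+ k * (q ^+ c.+1) ^+ d.+1) (f := fun n => (n %/ c.+1)%N)) => [M|]; last exact: hf.
  by exists (M * c.+1)%N => n; rewrite leq_divRL.
have fM c : nm (f (q ^+ c.+1)) <= K * nm q ^+ c.
  by apply: cto_nm_le (cf c) _ => n; apply: bd.
have [S HS] : exists S, cto (fun N => \sum_(0 <= c < N) f (q ^+ c.+1)) S.
  by apply: summable_cto; apply: (summable_le sM) => n; rewrite nm_ge0 fM.
exists S; split=> //.
have := tannery (n0 := 0) (b := id) sM cf (fun n c _ _ => bd _ c) (fun n => leqnn n).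
move=> /ctoD /(_ HS); rewrite add0r => /(cto_eq (n0 := 0)); apply => N _.
rewrite subrK sigma_sum; apply: eq_bigr => c _; apply: eq_bigr => d _.
by rewrite exprM.
Qed.

End Summability.

(** * Eisenstein series as limits of sums over squares *)

Section Eisenstein.
Variable R : realType.
Local Notation C := R[i].
Variables (k : nat) (A : {poly C}).
Hypothesis k4 : (4 <= k)%N.
Hypothesis kev : ~~ odd k.
Hypothesis A1 : A.[1] != 0.
Local Notation lip := (lip k A).
Local Notation lipc := (lipc k A).
Hypothesis lip_double : forall w, w ^+ 2 != 1 -> lip w + lip (- w) = 2 ^+ k * lip (w ^+ 2).
Hypothesis lip_series : forall w : C, nm w < 1 ->
  cto (fun n => \sum_(0 <= i < n) i.+1%:R ^+ k.-1 * w ^+ i.+1) (lip w).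

(** The square |i|, |j| <= N is symmetric in i and j, so t -> -1/t acts exactly at every finite
    level. The term i = j = 0 is 0 because the inverse of 0 is 0. *)
Definition eis_sq N (t : C) : C :=
  \sum_(0 <= i < N.*2.+1) \sum_(0 <= j < N.*2.+1) (((i%:R - N%:R) * t + (j%:R - N%:R)) ^+ k)^-1.

Lemma eis_sq_inv N (t : C) : t != 0 -> eis_sq N (- t^-1) = t ^+ k * eis_sq N t.
Proof.
move=> t0; rewrite /eis_sq exchange_big /= mulr_sumr; apply: eq_bigr => j _.
rewrite mulr_sumr big_nat_rev /=; apply: eq_big_nat => i /andP[_ iN].
rewrite add0n subSS natrB; last by lia.
have -> : (N.*2%:R - i%:R - N%:R) * - t^-1 + (j%:R - N%:R) =
   ((j%:R - N%:R) * t + (i%:R - N%:R)) / t.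
  by rewrite -addnn natrD; field.
by rewrite expr_div_n invf_div.
Qed.

Lemma even_expN (z : C) : (- z) ^+ k = z ^+ k.
Proof. by rewrite exprNn -signr_odd (negbTE kev) expr0 mul1r. Qed.

Definition lipN N (z : C) := lipR k N z + ((z + N%:R) ^+ k)^-1.

Lemma lipN_sum N z : lipN N z = \sum_(0 <= j < N.*2.+1) ((z + (j%:R - N%:R)) ^+ k)^-1.
Proof.
rewrite (big_nat_sym (fun x => ((z + x) ^+ k)^-1)); congr (_ + _).
by apply: eq_bigr => d _; rewrite addrA.
Qed.

Lemma lipN_even N z : lipN N (- z) = lipN N z.
Proof.
rewrite !lipN_sum big_nat_rev /=; apply: eq_big_nat => i /andP[_ iN].
rewrite add0n subSS natrB; last by lia.
rewrite -[in RHS]even_expN; congr ((_ ^+ k)^-1).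
by rewrite -addnn natrD; ring.
Qed.

Lemma eis_sqE N t : eis_sq N t = lipN N 0 + 2 * \sum_(0 <= c < N) lipN N (c.+1%:R * t).
Proof.
rewrite /eis_sq.
have -> : \sum_(0 <= i < N.*2.+1) \sum_(0 <= j < N.*2.+1) (((i%:R - N%:R) * t + (j%:R - N%:R)) ^+ k)^-1
   = \sum_(0 <= i < N.*2.+1) lipN N ((i%:R - N%:R) * t).
  by apply: eq_bigr => i _; rewrite lipN_sum.
rewrite (big_nat_sym (fun x => lipN N (x * t))) big_split /= addrAC.
have -> : \sum_(0 <= i < N) lipN N (i%:R * t) + lipN N (N%:R * t) =
   lipN N 0 + \sum_(0 <= c < N) lipN N (c.+1%:R * t).
  by rewrite -(big_nat_recr N) //= big_nat_recl //= mul0r.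
rewrite -addrA mulr_natl mulr2n; congr (_ + (_ + _)); apply: eq_bigr => i _.
by rewrite -lipN_even -natr1; congr lipN; ring.
Qed.

(** The quadratic form |c t + x|^2 is at least (c^2 + x^2) / B. Four of the k factors give the
    separate decay in c and in x that makes the double sum converge absolutely; the other k - 4 are
    bounded below by Im t. *)
Lemma lattice_lower (t : C) : 0 < complex.Im t -> exists2 K : R, 0 < K &
  forall (c : nat) (x : R), (nm (c.+1%:R * t + x%:C) ^+ k)^-1 <= K * ((c.+1%:R ^+ 2)^-1 * (1 + x ^+ 2)^-1).
Proof.
move=> v0; pose u := complex.Re t; pose v := complex.Im t.
pose B := 2 + (2 * u ^+ 2 + 1) / v ^+ 2.
have vv : 0 < v ^+ 2 by rewrite exprn_gt0.
have u2 : 0 <= u ^+ 2 by apply: sqr_ge0.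
have B0 : 0 < B by rewrite addr_gt0 // divr_gt0 //; lra.
exists (B ^+ 2 / v ^+ (k - 4)); first by rewrite divr_gt0 ?exprn_gt0.
move=> c x; pose a : R := c.+1%:R.
have a1 : 1 <= a by rewrite ler1n.
set z := c.+1%:R * t + x%:C.
have zE : nm z ^+ 2 = (a * u + x) ^+ 2 + (a * v) ^+ 2.
  rewrite nm_sqr /z.
  have -> : (c.+1%:R : C) = a%:C by rewrite rmorph_nat.
  by rewrite /u /v; case: (t) => p r /=; rewrite !mul0r subr0 !addr0.
have nv : v <= nm z.
  have h : (a * v) ^+ 2 <= nm z ^+ 2 by rewrite zE lerDr sqr_ge0.
  rewrite ler_pXn2r ?nnegrE ?nm_ge0 // in h; last by rewrite mulr_ge0 // ltW.
  by apply: le_trans h; rewrite ler_peMl // ltW.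
have nz : 0 < nm z by apply: lt_le_trans nv.
have h1 : a ^+ 2 + x ^+ 2 <= B * nm z ^+ 2.
  rewrite zE.
  have -> : B * ((a * u + x) ^+ 2 + (a * v) ^+ 2) =
    2 * (a * u + x) ^+ 2 + (2 * u ^+ 2 + 1) * a ^+ 2 +
    ((2 * u ^+ 2 + 1) / v ^+ 2 * (a * u + x) ^+ 2 + 2 * (a * v) ^+ 2).
    by rewrite /B; field; rewrite gt_eqF.
  have p1 : 0 <= (2 * u ^+ 2 + 1) / v ^+ 2 * (a * u + x) ^+ 2.
    by rewrite mulr_ge0 ?sqr_ge0 // divr_ge0 ?(ltW vv) //; lra.
  have p2 := sqr_ge0 (a * v).
  have p3 : 0 <= (x + 2 * (a * u)) ^+ 2 by apply: sqr_ge0.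
  have : 2 * (a * u + x) ^+ 2 + 2 * u ^+ 2 * a ^+ 2 - x ^+ 2 = (x + 2 * (a * u)) ^+ 2 by ring.
  lra.
have h2 : a ^+ 2 * (1 + x ^+ 2) <= B ^+ 2 * nm z ^+ 4.
  have x2 := sqr_ge0 x; have a2 : 1 <= a ^+ 2 by rewrite expr_ge1 // (le_trans ler01).
  have -> : B ^+ 2 * nm z ^+ 4 = (B * nm z ^+ 2) * (B * nm z ^+ 2) by ring.
  apply: ler_pM; rewrite ?sqr_ge0 //; lra.
have kE : k = (4 + (k - 4))%N by rewrite subnKC.
rewrite [X in nm z ^+ X]kE exprD -invfM -[leRHS]invrK lef_pV2 ?posrE; first last.
- rewrite invr_gt0 mulr_gt0 ?divr_gt0 ?exprn_gt0 // invr_gt0 mulr_gt0 ?exprn_gt0 //.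
  by have := sqr_ge0 x; lra.
- by rewrite mulr_gt0 ?exprn_gt0.
rewrite invf_div -/a ler_pdivrMr; last by rewrite divr_gt0 ?exprn_gt0.
have h3 : v ^+ (k - 4) <= nm z ^+ (k - 4) by rewrite lerXn2r ?nnegrE ?nm_ge0 // ltW.
apply: le_trans h2 _; move: h3; have q0 : 0 < v ^+ (k - 4) by rewrite exprn_gt0.
move: (v ^+ (k - 4)) (nm z ^+ (k - 4)) q0 => V W q0 h3.
rewrite [leRHS](_ : _ = B ^+ 2 * nm z ^+ 4 * (W / V)); last by ring.
rewrite ler_peMr ?mulr_ge0 ?exprn_ge0 ?nm_ge0 ?(ltW B0) //.
by rewrite ler_pdivlMr ?mul1r.
Qed.

Lemma lipN_bound (t : C) : 0 < complex.Im t -> exists2 K : R, 0 <= K &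
  forall N c, nm (lipN N (c.+1%:R * t)) <= K * (c.+1%:R ^+ 2)^-1.
Proof.
move=> t0; have [K K0 HK] := lattice_lower t0.
have [_ [K1 HK1]] := summable_invsq R.
have K10 : 0 <= K1 by apply: le_trans (HK1 0%N); rewrite big_nil.
exists (K * (3 * K1 + 1)); first by rewrite mulr_ge0 ?(ltW K0) // addr_ge0 // mulr_ge0.
move=> N c; set z := c.+1%:R * t.
have nd (d : nat) : (d%:R : C) = (d%:R : R)%:C by rewrite rmorph_nat.
apply: le_trans (nmD _ _) _.
have b1 : nm (((z + N%:R) ^+ k)^-1) <= K * (c.+1%:R ^+ 2)^-1.
  rewrite nmV nmX nd; apply: le_trans (HK c _) _; rewrite mulrA.
  rewrite ler_piMr ?mulr_ge0 ?(ltW K0) ?invr_ge0 ?exprn_ge0 // invf_le1; last by have := sqr_ge0 (N%:R : R); lra.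
  by rewrite lerDl sqr_ge0.
have b2 : nm (lipR k N z) <= K * (c.+1%:R ^+ 2)^-1 * (3 * K1).
  apply: le_trans (nm_sum _ _ _) _.
  apply: (@le_trans _ _ (\sum_(0 <= d < N) K * (c.+1%:R ^+ 2)^-1 * (3 * (d.+1%:R ^+ 2)^-1))).
    apply: ler_sum => d _; apply: le_trans (nmD _ _) _; rewrite !nmV !nmX.
    have -> : z - 1 - d%:R = z + (- d.+1%:R : R)%:C by rewrite rmorphN rmorph_nat -natr1; ring.
    rewrite nd; apply: le_trans (lerD (HK c _) (HK c _)) _.
    rewrite -mulrDr -mulrDr mulrA ler_wpM2l ?mulr_ge0 ?(ltW K0) ?invr_ge0 ?exprn_ge0 //.
    have d0 : 0 <= d%:R :> R by [].
    rewrite sqrrN.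
    have e1 : (1 + d%:R ^+ 2)^-1 <= 2 * (d.+1%:R ^+ 2)^-1 :> R.
      rewrite -[leLHS]mul1r ler_pdivrMr; last by have := sqr_ge0 (d%:R : R); lra.
      rewrite mulrAC ler_pdivlMr ?exprn_gt0 // mul1r -natr1; have := sqr_ge0 (d%:R - 1 : R); nra.
    have e2 : (1 + d.+1%:R ^+ 2)^-1 <= (d.+1%:R ^+ 2)^-1 :> R.
      rewrite lef_pV2 ?posrE ?exprn_gt0 //; first by rewrite lerDr.
    by move: e1 e2; move: (_^-1) (_^-1) (_^-1) => x1 x2 x3; lra.
  rewrite -mulr_sumr -mulr_sumr ler_wpM2l ?mulr_ge0 ?(ltW K0) ?invr_ge0 ?exprn_ge0 //.
  by rewrite ler_wpM2l.
apply: le_trans (lerD b2 b1) _; rewrite le_eqVlt; apply/orP; left; apply/eqP; ring.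
Qed.

Lemma lipN_cto (z L : C) : cto (fun N => lipR k N z) L -> cto (fun N => lipN N z) L.
Proof.
move=> h; rewrite -[L]addr0; apply: ctoD => //.
have sm : summable_seq (fun n => (nm (z + n%:R) ^+ k)^-1 : R).
  by apply: (@summable_lip R k A).
have : small (fun n => (nm (z + n%:R) ^+ k)^-1).
  move=> e e0; have e20 : 0 < e / 2 by rewrite divr_gt0.
  have [N HN] := summable_tail sm e20; exists N => n nN.
  have := HN n.+1; rewrite big_nat_recr //=.
  have s0 : 0 <= \sum_(N <= i < n) (nm (z + i%:R) ^+ k)^-1 by apply: sumr_ge0 => i _; apply: sm.1.
  rewrite ger0_norm ?(sm.1 n) //; move: s0 e0; lra.
by move=> /(cto_le (n0 := 0)); apply => n _; rewrite subr0 nmV nmX.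
Qed.

(** Each row c > 0 of the square is summed by [lipschitz], the row c = 0 by [lip_zeta], and
    [lipN_bound] dominates the rows so that [tannery] applies. *)
Lemma eis_cto (t : C) : 0 < complex.Im t -> exists S,
  cto (fun N => \sum_(0 <= n < N) (sigma k.-1 n.+1)%:R * e2pi t ^+ n.+1) S /\
  cto (fun N => eis_sq N t) ((lip (-1) / (2 ^+ k - 1) + 2 * S) / lipc).
Proof.
move=> t0; have q1 : nm (e2pi t) < 1.
  by rewrite nm_e2pi expR_lt1 oppr_lt0 !mulr_gt0 // pi_gt0.
have [S [HS1 HS2]] := lambert_sum q1 lip_series; exists S; split=> //.
have [K K0 HK] := lipN_bound t0.
have sM := summableZ K0 (summable_invsq R).
have ct c : 0 < complex.Im (c.+1%:R * t).
  have -> : (c.+1%:R : C) = (c.+1%:R : R)%:C by rewrite rmorph_nat.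
  by case: (t) t0 => a b /= b0; rewrite mul0r addr0 mulr_gt0.
have cl c : cto (fun N => lipN N (c.+1%:R * t)) (lip (e2pi t ^+ c.+1) / lipc).
  by apply: lipN_cto; rewrite e2piX; apply: lipschitz.
have := tannery (n0 := 0) (b := id) sM cl (fun n c _ _ => HK n c) (fun n => leqnn n).
have HS3 : cto (fun N => \sum_(0 <= c < N) lip (e2pi t ^+ c.+1) / lipc) (S / lipc).
  have := ctoZ lipc^-1 HS2; rewrite mulrC => /(cto_eq (n0 := 0)); apply => n _.
  by rewrite -mulr_suml mulrC.
move=> /ctoD /(_ HS3); rewrite add0r => /(ctoZ 2) h.
have hz := lipN_cto (lip_zeta k4 A1 lip_double).
have := ctoD hz h; rewrite mulrA -mulrDl => /(cto_eq (n0 := 0)); apply => N _.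
by rewrite subrK eis_sqE.
Qed.

Lemma eis_inv (t S S' : C) : 0 < complex.Im t ->
  cto (fun N => \sum_(0 <= n < N) (sigma k.-1 n.+1)%:R * e2pi t ^+ n.+1) S ->
  cto (fun N => \sum_(0 <= n < N) (sigma k.-1 n.+1)%:R * e2pi (- t^-1) ^+ n.+1) S' ->
  lip (-1) / (2 ^+ k - 1) + 2 * S' = t ^+ k * (lip (-1) / (2 ^+ k - 1) + 2 * S).
Proof.
move=> t0 HS HS'.
have tn0 : t != 0 by apply/eqP => t00; rewrite t00 /= ltxx in t0.
have ti : 0 < complex.Im (- t^-1).
  case: (t) tn0 t0 => a b; rewrite eq_complex /= => h b0.
  rewrite opprK divr_gt0 //; have := sqr_ge0 a; have : 0 < b ^+ 2 by rewrite exprn_gt0.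
  lra.
have [S1 [h1 h2]] := eis_cto t0; have [S2 [h3 h4]] := eis_cto ti.
rewrite (cto_uniq HS h1) (cto_uniq HS' h3).
have := ctoZ (t ^+ k) h2 => h5.
have h6 := cto_eq (n0 := 0) h5 (fun N _ => eis_sq_inv N tn0).
have := cto_uniq h4 h6; rewrite mulrA => /(mulIf _) -> //.
by rewrite invr_eq0 lipc_neq0.
Qed.

End Eisenstein.

Section Conjugation.
Variable R : realType.
Local Notation C := R[i].
Implicit Types z w : C.

Lemma cjD z w : (z + w)^*%C = z^*%C + w^*%C. Proof. exact: rmorphD. Qed.
Lemma cjN z : (- z)^*%C = - z^*%C. Proof. exact: rmorphN. Qed.
Lemma cjM z w : (z * w)^*%C = z^*%C * w^*%C. Proof. exact: rmorphM. Qed.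
Lemma cjX z n : (z ^+ n)^*%C = z^*%C ^+ n. Proof. exact: rmorphXn. Qed.
Lemma cjV z : (z^-1)^*%C = (z^*%C)^-1. Proof. exact: fmorphV. Qed.
Lemma cj_nat n : (n%:R : C)^*%C = n%:R. Proof. exact: rmorph_nat. Qed.
Lemma cj_sum (I : Type) (r : seq I) (P : pred I) (F : I -> C) :
  (\sum_(i <- r | P i) F i)^*%C = \sum_(i <- r | P i) (F i)^*%C.
Proof. exact: rmorph_sum. Qed.

End Conjugation.

(** * The series E4 and E6: inversion, translation, conjugation *)

Section EisensteinInstances.
Variable R : realType.
Local Notation C := R[i].
Implicit Types (t w q : C).

(** Numerators of the generating functions of n^3 and n^5: w times the Eulerian polynomials. *)
Definition eul4 : {poly C} := 'X * (1 + 4%:P * 'X + 'X^2).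
Definition eul6 : {poly C} := 'X * (1 + 26%:P * 'X + 66%:P * 'X^2 + 26%:P * 'X^3 + 'X^4).

Lemma eul4E w : eul4.[w] = w * (1 + 4 * w + w ^+ 2).
Proof. by rewrite /eul4 !hornerE. Qed.

Lemma eul6E w : eul6.[w] = w * (1 + 26 * w + 66 * w ^+ 2 + 26 * w ^+ 3 + w ^+ 4).
Proof. by rewrite /eul6 !hornerE. Qed.

Lemma lip4E w : lip 4 eul4 w = w * (1 + 4 * w + w ^+ 2) / (1 - w) ^+ 4.
Proof. by rewrite /lip eul4E. Qed.

Lemma lip6E w : lip 6 eul6 w =
  w * (1 + 26 * w + 66 * w ^+ 2 + 26 * w ^+ 3 + w ^+ 4) / (1 - w) ^+ 6.
Proof. by rewrite /lip eul6E. Qed.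

Lemma sq_neq1 w : w ^+ 2 != 1 -> (1 - w != 0) * (1 + w != 0) * (1 - w ^+ 2 != 0).
Proof.
move=> h; have h' : 1 - w ^+ 2 != 0 by rewrite subr_eq0 eq_sym.
have e : 1 - w ^+ 2 = (1 - w) * (1 + w) by ring.
have := h'; rewrite {1}e mulf_eq0 negb_or => /andP[a b].
by split; [split|].
Qed.

Lemma lip4_double w : w ^+ 2 != 1 ->
  lip 4 eul4 w + lip 4 eul4 (- w) = 2 ^+ 4 * lip 4 eul4 (w ^+ 2).
Proof.
move=> /sq_neq1 h; rewrite !lip4E opprK.
have -> : 1 - w ^+ 2 = (1 - w) * (1 + w) by ring.
by field; rewrite !h.
Qed.

Lemma lip6_double w : w ^+ 2 != 1 ->
  lip 6 eul6 w + lip 6 eul6 (- w) = 2 ^+ 6 * lip 6 eul6 (w ^+ 2).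
Proof.
move=> /sq_neq1 h; rewrite !lip6E opprK.
have -> : 1 - w ^+ 2 = (1 - w) * (1 + w) by ring.
by field; rewrite !h.
Qed.

Lemma cto_natXgeom p w : nm w < 1 -> cto (fun n => n.+1%:R ^+ p * w ^+ n.+1) 0.
Proof.
move=> w1; have w01 : 0 <= nm w < 1 by rewrite nm_ge0.
have := small_sub (f := S) (fun n => leqnSn n) (small_natXgeom p w01).
by move=> /(cto_le (n0 := 0)); apply => n _; rewrite subr0 nmM !nmX nm_nat.
Qed.

Lemma lip4_series w : nm w < 1 ->
  cto (fun n => \sum_(0 <= i < n) i.+1%:R ^+ 3 * w ^+ i.+1) (lip 4 eul4 w).
Proof.
move=> w1; have w0 : 1 - w != 0.
  by apply: contraTneq w1 => /eqP; rewrite subr_eq0 => /eqP <-; rewrite nm1 ltxx.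
(* An exact remainder: the partial sum equals (w (1 + 4 w + w^2) - [rem n]) / (1 - w)^4, and every
   term of [rem n] carries a power of n + 1 times w^(n+1). *)
pose rem n := (1 - w) ^+ 3 * (n.+1%:R ^+ 3 * w ^+ n.+1) + 3 * w * (1 - w) ^+ 2 * (n.+1%:R ^+ 2 * w ^+ n.+1)
  + 3 * w * (1 + w) * (1 - w) * (n.+1%:R ^+ 1 * w ^+ n.+1) + w * (1 + 4 * w + w ^+ 2) * (n.+1%:R ^+ 0 * w ^+ n.+1).
have E n : \sum_(0 <= i < n) i.+1%:R ^+ 3 * w ^+ i.+1 = (w * (1 + 4 * w + w ^+ 2) - rem n) / (1 - w) ^+ 4.
  apply: (canRL (mulfK _)); first by rewrite expf_neq0.
  elim: n => [|n IH]; first by rewrite big_nil /rem !expr1; ring.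
  rewrite big_nat_recr //= mulrDl IH /rem -[n.+2%:R]natr1 [w ^+ n.+2]exprS.
  by move: (w ^+ n.+1) (n.+1%:R) => x y; ring.
have z j c : cto (fun n => c * (n.+1%:R ^+ j * w ^+ n.+1)) 0.
  by have := ctoZ c (cto_natXgeom j w1); rewrite mulr0.
have cr : cto rem 0.
  have := ctoD (ctoD (ctoD (z 3%N ((1 - w) ^+ 3)) (z 2%N (3 * w * (1 - w) ^+ 2)))
    (z 1%N (3 * w * (1 + w) * (1 - w)))) (z 0%N (w * (1 + 4 * w + w ^+ 2))).
  by rewrite !addr0.
have := ctoM (ctoB (cto_cst (w * (1 + 4 * w + w ^+ 2))) cr) (cto_cst ((1 - w) ^+ 4)^-1).
by rewrite subr0 lip4E => /(cto_eq (n0 := 0)); apply => n _; rewrite E.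
Qed.

Lemma lip6_series w : nm w < 1 ->
  cto (fun n => \sum_(0 <= i < n) i.+1%:R ^+ 5 * w ^+ i.+1) (lip 6 eul6 w).
Proof.
move=> w1; have w0 : 1 - w != 0.
  by apply: contraTneq w1 => /eqP; rewrite subr_eq0 => /eqP <-; rewrite nm1 ltxx.
pose A := w * (1 + 26 * w + 66 * w ^+ 2 + 26 * w ^+ 3 + w ^+ 4).
pose rem n := (1 - w) ^+ 5 * (n.+1%:R ^+ 5 * w ^+ n.+1)
  + 5 * w * (1 - w) ^+ 4 * (n.+1%:R ^+ 4 * w ^+ n.+1)
  + 10 * w * (1 + w) * (1 - w) ^+ 3 * (n.+1%:R ^+ 3 * w ^+ n.+1)
  + 10 * w * (1 + 4 * w + w ^+ 2) * (1 - w) ^+ 2 * (n.+1%:R ^+ 2 * w ^+ n.+1)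
  + 5 * w * (1 + 11 * w + 11 * w ^+ 2 + w ^+ 3) * (1 - w) * (n.+1%:R ^+ 1 * w ^+ n.+1)
  + A * (n.+1%:R ^+ 0 * w ^+ n.+1).
have E n : \sum_(0 <= i < n) i.+1%:R ^+ 5 * w ^+ i.+1 = (A - rem n) / (1 - w) ^+ 6.
  apply: (canRL (mulfK _)); first by rewrite expf_neq0.
  elim: n => [|n IH]; first by rewrite big_nil /rem /A !expr1; ring.
  rewrite big_nat_recr //= mulrDl IH /rem -[n.+2%:R]natr1 [w ^+ n.+2]exprS /A.
  by move: (w ^+ n.+1) (n.+1%:R) => x y; ring.
have z j c : cto (fun n => c * (n.+1%:R ^+ j * w ^+ n.+1)) 0.
  by have := ctoZ c (cto_natXgeom j w1); rewrite mulr0.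
have cr : cto rem 0.
  have := ctoD (ctoD (ctoD (ctoD (ctoD (z 5%N ((1 - w) ^+ 5)) (z 4%N (5 * w * (1 - w) ^+ 4)))
    (z 3%N (10 * w * (1 + w) * (1 - w) ^+ 3))) (z 2%N (10 * w * (1 + 4 * w + w ^+ 2) * (1 - w) ^+ 2)))
    (z 1%N (5 * w * (1 + 11 * w + 11 * w ^+ 2 + w ^+ 3) * (1 - w)))) (z 0%N A).
  by rewrite !addr0.
have := ctoM (ctoB (cto_cst A) cr) (cto_cst ((1 - w) ^+ 6)^-1).
by rewrite subr0 lip6E => /(cto_eq (n0 := 0)); apply => n _; rewrite E.
Qed.

Lemma eul4_1 : eul4.[1] != 0.
Proof.
have -> : eul4.[1] = 6 by rewrite eul4E; ring.
by rewrite pnatr_eq0.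
Qed.

Lemma eul6_1 : eul6.[1] != 0.
Proof.
have -> : eul6.[1] = 120 by rewrite eul6E; ring.
by rewrite pnatr_eq0.
Qed.

Lemma nm_e2pi_lt1 t : 0 < complex.Im t -> nm (e2pi t) < 1.
Proof. by move=> t0; rewrite nm_e2pi expR_lt1 oppr_lt0 !mulr_gt0 // pi_gt0. Qed.

Lemma E4_cto t : 0 < complex.Im t ->
  cto (fun N => 1 + 240 * \sum_(0 <= n < N) (sigma 3 n.+1)%:R * e2pi t ^+ n.+1) (E4 t).
Proof.
move=> t0; have [S [HS _]] := lambert_sum (nm_e2pi_lt1 t0) lip4_series.
by rewrite /E4 (csum_cto HS); apply: ctoD; [apply: cto_cst|apply: ctoZ].
Qed.

Lemma E6_cto t : 0 < complex.Im t ->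
  cto (fun N => 1 - 504 * \sum_(0 <= n < N) (sigma 5 n.+1)%:R * e2pi t ^+ n.+1) (E6 t).
Proof.
move=> t0; have [S [HS _]] := lambert_sum (nm_e2pi_lt1 t0) lip6_series.
by rewrite /E6 (csum_cto HS); apply: ctoB; [apply: cto_cst|apply: ctoZ].
Qed.

Lemma Im_inv_gt0 t : 0 < complex.Im t -> 0 < complex.Im (- t^-1).
Proof.
case: t => a b /= b0; rewrite opprK divr_gt0 //.
have := sqr_ge0 a; have : 0 < b ^+ 2 by rewrite exprn_gt0.
lra.
Qed.

(** The constant term in [eis_inv] is zeta(-3) = 1/120, so the bracket becomes [E4] after
    multiplication by 120. In weight 6 the constant is zeta(-5) = - 1/252. *)
Lemma E4_inv t : 0 < complex.Im t -> E4 (- t^-1) = t ^+ 4 * E4 t.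
Proof.
move=> t0.
have [S [HS _]] := lambert_sum (nm_e2pi_lt1 t0) lip4_series.
have [S' [HS' _]] := lambert_sum (nm_e2pi_lt1 (Im_inv_gt0 t0)) lip4_series.
have := eis_inv (k := 4) (A := eul4) isT isT eul4_1 lip4_double lip4_series t0 HS HS'.
rewrite lip4E /E4 (csum_cto HS) (csum_cto HS').
have -> : -1 * (1 + 4 * -1 + (-1) ^+ 2) / (1 - -1) ^+ 4 / (2 ^+ 4 - 1) = 120^-1 :> C.
  have -> : -1 * (1 + 4 * -1 + (-1) ^+ 2) = 2 :> C by ring.
  have -> : (1 - -1) ^+ 4 = 2 * 8 :> C by ring.
  have -> : 2 ^+ 4 - 1 = 15 :> C by ring.
  by rewrite invfM mulVKf ?pnatr_eq0 // -invfM -natrM.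
move=> /(congr1 (fun z => 120 * z)); rewrite mulrCA !mulrDr mulfV ?pnatr_eq0 //.
move=> h; have -> : 1 + 240 * S' = 1 + 120 * (2 * S') by ring.
by rewrite h; ring.
Qed.

Lemma E6_inv t : 0 < complex.Im t -> E6 (- t^-1) = t ^+ 6 * E6 t.
Proof.
move=> t0.
have [S [HS _]] := lambert_sum (nm_e2pi_lt1 t0) lip6_series.
have [S' [HS' _]] := lambert_sum (nm_e2pi_lt1 (Im_inv_gt0 t0)) lip6_series.
have := eis_inv (k := 6) (A := eul6) isT isT eul6_1 lip6_double lip6_series t0 HS HS'.
rewrite lip6E /E6 (csum_cto HS) (csum_cto HS').
have -> : -1 * (1 + 26 * -1 + 66 * (-1) ^+ 2 + 26 * (-1) ^+ 3 + (-1) ^+ 4) / (1 - -1) ^+ 6 / (2 ^+ 6 - 1) = - 252^-1 :> C.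
  have -> : -1 * (1 + 26 * -1 + 66 * (-1) ^+ 2 + 26 * (-1) ^+ 3 + (-1) ^+ 4) = - 16 :> C by ring.
  have -> : (1 - -1) ^+ 6 = 16 * 4 :> C by ring.
  have -> : 2 ^+ 6 - 1 = 63 :> C by ring.
  by rewrite invfM !mulNr mulVKf ?pnatr_eq0 // -invfM -natrM.
move=> /(congr1 (fun z => - 252 * z)); rewrite mulrCA !mulrDr mulrNN mulfV ?pnatr_eq0 //.
move=> h; have -> : 1 - 504 * S' = 1 + -252 * (2 * S') by ring.
by rewrite h; ring.
Qed.

Lemma E4_shift t : E4 (t + 1) = E4 t.
Proof. by rewrite /E4 e2piD e2pi1 mulr1. Qed.

Lemma E6_shift t : E6 (t + 1) = E6 t.
Proof. by rewrite /E6 e2piD e2pi1 mulr1. Qed.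

Lemma cto_conj (u : nat -> C) l : cto u l -> cto (fun n => (u n)^*%C) (l^*%C).
Proof. by move=> /(cto_le (n0 := 0)); apply => n _; rewrite -rmorphB nm_conj. Qed.

Lemma E4_conj t : 0 < complex.Im t -> (E4 t)^*%C = E4 (- t^*%C).
Proof.
move=> t0; have t1 : 0 < complex.Im (- t^*%C) by case: t t0 => a b /=; rewrite opprK.
apply: cto_uniq (cto_conj (E4_cto t0)) _; apply: (cto_eq (n0 := 0) (E4_cto t1)) => N _.
rewrite cjD cjM (cj_nat _ 1) cj_nat cj_sum; congr (1 + _ * _).
by apply: eq_bigr => n _; rewrite cjM cjX cj_nat e2pi_conj.
Qed.

Lemma E6_conj t : 0 < complex.Im t -> (E6 t)^*%C = E6 (- t^*%C).
Proof.
move=> t0; have t1 : 0 < complex.Im (- t^*%C) by case: t t0 => a b /=; rewrite opprK.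
apply: cto_uniq (cto_conj (E6_cto t0)) _; apply: (cto_eq (n0 := 0) (E6_cto t1)) => N _.
rewrite cjD cjN cjM (cj_nat _ 1) cj_nat cj_sum; congr (1 - _ * _).
by apply: eq_bigr => n _; rewrite cjM cjX cj_nat e2pi_conj.
Qed.

End EisensteinInstances.

(** * Values on the unit arc, at rho and at i *)

Section Arc.
Variable R : realType.
Local Notation C := R[i].
Implicit Types (u : R).

Lemma arc_Im u : -1 < u < 1 -> 0 < complex.Im (unit_arc u).
Proof.
move=> /andP[u1 u2]; rewrite /= sqrtr_gt0 subr_gt0; nra.
Qed.

Lemma arc_nm u : -1 <= u <= 1 -> nm (unit_arc u) = 1.
Proof.
move=> /andP[u1 u2]; rewrite nmE /= sqr_sqrtr; last by nra.
by rewrite addrC subrK sqrtr1.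
Qed.

(** On the unit circle, inversion and reflection in the imaginary axis coincide. All reality
    statements on the arc come from this. *)
Lemma arc_inv u : -1 <= u <= 1 -> - (unit_arc u)^-1 = - (unit_arc u)^*%C.
Proof.
move=> h; have n1 := arc_nm h; congr (- _).
have t0 : unit_arc u != 0 by rewrite -nm_gt0 n1.
apply: (mulfI t0); rewrite mulfV //.
have : nm (unit_arc u) ^+ 2 = 1 by rewrite n1 expr1n.
rewrite nm_sqr; case: (unit_arc u) => a b /= e.
apply/esym/eqP; rewrite eq_complex /=; apply/andP; split; apply/eqP; last by ring.
by rewrite -e; ring.
Qed.

Lemma E4_arc_conj u : -1 < u < 1 -> (E4 (unit_arc u))^*%C = unit_arc u ^+ 4 * E4 (unit_arc u).
Proof.
move=> h; rewrite (E4_conj (arc_Im h)) -(E4_inv (arc_Im h)) arc_inv; first by [].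
by case/andP: h => ? ?; apply/andP; split; apply: ltW.
Qed.

Lemma E6_arc_conj u : -1 < u < 1 -> (E6 (unit_arc u))^*%C = unit_arc u ^+ 6 * E6 (unit_arc u).
Proof.
move=> h; rewrite (E6_conj (arc_Im h)) -(E6_inv (arc_Im h)) arc_inv; first by [].
by case/andP: h => ? ?; apply/andP; split; apply: ltW.
Qed.

Lemma Delta_arc_conj u : -1 < u < 1 ->
  (Delta (unit_arc u))^*%C = unit_arc u ^+ 12 * Delta (unit_arc u).
Proof.
move=> h; rewrite /Delta cjM cjD cjN !cjX (E4_arc_conj h) (E6_arc_conj h) cjV cj_nat.
set d := _^-1; move: (E4 (unit_arc u)) (E6 (unit_arc u)) (unit_arc u) d => a b c d; ring.
Qed.

Lemma jinv_arc_conj u : -1 < u < 1 -> (jinv (unit_arc u))^*%C = jinv (unit_arc u).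
Proof.
move=> h; rewrite /jinv cjM cjX cjV (E4_arc_conj h) (Delta_arc_conj h).
rewrite exprMn -exprM invfM mulrACA mulfV ?mul1r // expf_neq0 //.
by rewrite -nm_gt0 arc_nm ?ltr01 //; case/andP: h => ? ?; apply/andP; split; apply: ltW.
Qed.

Lemma conj_real (z : C) : (z^*)%C = z -> z = (complex.Re z)%:C.
Proof.
case: z => a b /eqP; rewrite eq_complex /= eqxx /= => /eqP h.
by apply/eqP; rewrite eq_complex /= eqxx /=; apply/eqP; lra.
Qed.

Lemma jinv_arc_real u : -1 < u < 1 -> jinv (unit_arc u) = (complex.Re (jinv (unit_arc u)))%:C.
Proof. by move=> /jinv_arc_conj/conj_real. Qed.

Definition rho : C := unit_arc (- (1 / 2)).

Lemma rho_eq : rho ^+ 2 + rho + 1 = 0.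
Proof.
rewrite /rho /unit_arc; set y := Num.sqrt _.
have yy : y ^+ 2 = 3 / 4 by rewrite sqr_sqrtr; [field|nra].
apply/eqP; rewrite eq_complex /=; apply/andP; split; apply/eqP; last by field.
have : y * y = 3 / 4 by rewrite -expr2.
lra.
Qed.

(** Since -1/rho = rho + 1, inversion and translation give E4(rho) = rho^4 E4(rho) = rho E4(rho). *)
Lemma E4_rho : E4 rho = 0.
Proof.
have h : -1 < - (1 / 2 : R) < 1 by apply/andP; split; lra.
have t0 := arc_Im h.
have r0 : rho != 0 by rewrite -nm_gt0 arc_nm ?ltr01 //; apply/andP; split; lra.
have e : - rho^-1 = rho + 1.
  apply: (mulfI r0); rewrite mulrN mulfV // mulrDr mulr1 -expr2.
  by apply/eqP; rewrite eq_sym -subr_eq0 opprK; apply/eqP; apply: rho_eq.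
have := E4_inv t0; rewrite -/rho e E4_shift => h1.
have r3 : rho ^+ 4 = rho.
  have -> : rho ^+ 4 = (rho ^+ 2 + rho + 1) * (rho ^+ 2 - rho) + rho by ring.
  by rewrite rho_eq mul0r add0r.
move/eqP: h1; rewrite r3 -subr_eq0 -{1}[E4 rho]mul1r -mulrBl mulf_eq0 => /orP[|/eqP//].
rewrite subr_eq0 eq_complex /= => /andP[/eqP h1 _].
by exfalso; clear e r3 r0 t0 h; move: h1; lra.
Qed.

Lemma unit_arc0 : unit_arc (0 : R) = 0 +i* 1.
Proof. by rewrite /unit_arc expr0n subr0 sqrtr1. Qed.

Lemma E6_i : E6 (unit_arc 0 : C) = 0.
Proof.
have h : -1 < (0 : R) < 1 by apply/andP; split; lra.
have := E6_inv (arc_Im h); rewrite arc_inv; last by apply/andP; split; lra.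
have -> : - (unit_arc 0)^*%C = unit_arc 0 :> C.
  by rewrite unit_arc0; apply/eqP; rewrite eq_complex /= oppr0 opprK !eqxx.
have -> : unit_arc 0 ^+ 6 = -1 :> C.
  have e : unit_arc 0 ^+ 2 = -1 :> C.
    by rewrite unit_arc0 expr2; apply/eqP; rewrite eq_complex /=; apply/andP; split; apply/eqP; ring.
  by rewrite (exprM _ 2 3) e !exprS expr0; ring.
move=> /eqP; rewrite mulN1r -subr_eq0 opprK -mulr2n mulrn_eq0 /= => /eqP//.
Qed.

Lemma jinv_rho : jinv rho = 0.
Proof. by rewrite /jinv E4_rho expr0n mul0r. Qed.

End Arc.

(** * Formal power series *)

(** A record around the coefficient function, so that its product is the Cauchy product and not the
    pointwise one. *)
Record fps (K : Type) := Fps { cf : nat -> K }.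

Section FpsType.
Variable K : fieldType.
Implicit Types f g h : fps K.

HB.instance Definition _ := gen_eqMixin (fps K).
HB.instance Definition _ := gen_choiceMixin (fps K).

Lemma fpsP f g : (forall n, cf f n = cf g n) -> f = g.
Proof. by case: f g => [a] [b] /= /funext ->. Qed.

Definition fps_add f g := Fps (fun n => cf f n + cf g n).
Definition fps_opp f := Fps (fun n => - cf f n).
Definition fps_zero : fps K := Fps (fun=> 0).

Fact fps_addA : associative fps_add.
Proof. by move=> f g h; apply: fpsP => n /=; rewrite addrA. Qed.
Fact fps_addC : commutative fps_add.
Proof. by move=> f g; apply: fpsP => n /=; rewrite addrC. Qed.
Fact fps_add0 : left_id fps_zero fps_add.
Proof. by move=> f; apply: fpsP => n /=; rewrite add0r. Qed.
Fact fps_addN : left_inverse fps_zero fps_opp fps_add.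
Proof. by move=> f; apply: fpsP => n /=; rewrite addNr. Qed.

HB.instance Definition _ := GRing.isZmodule.Build (fps K) fps_addA fps_addC fps_add0 fps_addN.

Definition fps_tr N f : {poly K} := \poly_(i < N) cf f i.
Definition fps_mul f g := Fps (fun n => \sum_(j < n.+1) cf f j * cf g (n - j)).
Definition fps_cst (c : K) : fps K := Fps (fun n => if n is 0 then c else 0).

(** A coefficient of a product sees only finitely many coefficients of the factors, so the ring laws
    are inherited from truncating polynomials. *)
Lemma fps_mul_coef f g (p q : {poly K}) n : (forall i, (i <= n)%N -> p`_i = cf f i) ->
  (forall i, (i <= n)%N -> q`_i = cf g i) -> cf (fps_mul f g) n = (p * q)`_n.
Proof.
move=> hp hq; rewrite coefM; apply: eq_bigr => j _ /=.
by rewrite hp ?hq ?leq_subr // -ltnS.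
Qed.

Lemma fps_trE N f i : (i < N)%N -> (fps_tr N f)`_i = cf f i.
Proof. by move=> iN; rewrite coef_poly iN. Qed.

Fact fps_mulC : commutative fps_mul.
Proof.
move=> f g; apply: fpsP => n.
rewrite (@fps_mul_coef f g (fps_tr n.+1 f) (fps_tr n.+1 g)); try by move=> i ?; rewrite fps_trE.
rewrite (@fps_mul_coef g f (fps_tr n.+1 g) (fps_tr n.+1 f)); try by move=> i ?; rewrite fps_trE.
by rewrite mulrC.
Qed.

Fact fps_mulA : associative fps_mul.
Proof.
move=> f g h; apply: fpsP => n.
have T k i : (i <= n)%N -> (fps_tr n.+1 k)`_i = cf k i by move=> ?; rewrite fps_trE.
have M k l i : (i <= n)%N -> (fps_tr n.+1 k * fps_tr n.+1 l)`_i = cf (fps_mul k l) i.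
  by move=> iN; rewrite (@fps_mul_coef k l (fps_tr n.+1 k) (fps_tr n.+1 l)) // => j ji; apply: T; apply: leq_trans iN.
rewrite (@fps_mul_coef f (fps_mul g h) (fps_tr n.+1 f) (fps_tr n.+1 g * fps_tr n.+1 h)); [|exact: T|exact: M].
rewrite (@fps_mul_coef (fps_mul f g) h (fps_tr n.+1 f * fps_tr n.+1 g) (fps_tr n.+1 h)); [|exact: M|exact: T].
by rewrite mulrA.
Qed.

Fact fps_mul1 : left_id (fps_cst 1) fps_mul.
Proof.
move=> f; apply: fpsP => n /=; rewrite big_ord_recl /= mul1r subn0 big1 ?addr0 // => i _.
by rewrite mul0r.
Qed.

Fact fps_mulDl : left_distributive fps_mul fps_add.
Proof.
move=> f g h; apply: fpsP => n /=; rewrite -big_split; apply: eq_bigr => j _ /=.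
by rewrite mulrDl.
Qed.

Fact fps_one_neq0 : fps_cst 1 != fps_zero.
Proof. by apply/eqP => /(congr1 (fun f => cf f 0)) /= /eqP; rewrite oner_eq0. Qed.

HB.instance Definition _ := GRing.Zmodule_isComNzRing.Build (fps K)
  fps_mulA fps_mulC fps_mul1 fps_mulDl fps_one_neq0.

End FpsType.

Section FpsTheory.
Variable K : numFieldType.
Implicit Types f g h u : fps K.
Local Notation cst := (@fps_cst K).

Lemma cfD f g n : cf (f + g) n = cf f n + cf g n. Proof. by []. Qed.
Lemma cfN f n : cf (- f) n = - cf f n. Proof. by []. Qed.
Lemma cfB f g n : cf (f - g) n = cf f n - cf g n. Proof. by []. Qed.
Lemma cf1 n : cf (1 : fps K) n = (n == 0%N)%:R. Proof. by case: n. Qed.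
Lemma cfM f g n : cf (f * g) n = \sum_(j < n.+1) cf f j * cf g (n - j).
Proof. by []. Qed.

Lemma cf_sum (I : Type) (r : seq I) (P : pred I) (F : I -> fps K) n :
  cf (\sum_(i <- r | P i) F i) n = \sum_(i <- r | P i) cf (F i) n.
Proof. exact: (big_morph (fun f => cf f n)). Qed.

Lemma cf_cstM c f n : cf (cst c * f) n = c * cf f n.
Proof.
rewrite cfM big_ord_recl /= subn0 big1 ?addr0 // => i _.
by rewrite mul0r.
Qed.

Lemma cstD a b : cst (a + b) = cst a + cst b.
Proof. by apply: fpsP => -[|n] /=; rewrite ?addr0. Qed.
Lemma cstN a : cst (- a) = - cst a.
Proof. by apply: fpsP => -[|n] /=; rewrite ?oppr0. Qed.
Lemma cst1 : cst 1 = 1. Proof. by []. Qed.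
Lemma cst0 : cst 0 = 0. Proof. by apply: fpsP => -[|n]. Qed.
Lemma cstM a b : cst (a * b) = cst a * cst b.
Proof. by apply: fpsP => -[|n]; rewrite cf_cstM //= mulr0. Qed.
Lemma cstX a n : cst (a ^+ n) = cst a ^+ n.
Proof. by elim: n => [//|n IH]; rewrite !exprS cstM IH. Qed.
Lemma cst_nat n : cst n%:R = n%:R.
Proof. by elim: n => [|n IH]; rewrite ?cst0 // -!natr1 cstD IH. Qed.

Lemma cfM0 f g : cf (f * g) 0 = cf f 0 * cf g 0.
Proof. by rewrite cfM big_ord1. Qed.

Lemma cfX0 f n : cf (f ^+ n) 0 = cf f 0 ^+ n.
Proof. by elim: n => [//|n IH]; rewrite !exprS cfM0 IH. Qed.

Lemma cfM_ext f f' g g' N : (forall i, (i < N)%N -> cf f i = cf f' i) ->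
  (forall i, (i < N)%N -> cf g i = cf g' i) ->
  forall i, (i < N)%N -> cf (f * g) i = cf (f' * g') i.
Proof.
move=> hf hg i iN; rewrite !cfM; apply: eq_bigr => j _.
by rewrite hf ?hg //; apply: leq_ltn_trans iN; rewrite ?leq_subr // -ltnS.
Qed.

Definition fX : fps K := Fps (fun n => (n == 1%N)%:R).

Lemma cf_XM f n : cf (fX * f) n = if n is n'.+1 then cf f n' else 0.
Proof.
case: n => [|n]; first by rewrite cfM0 /= mul0r.
rewrite cfM !big_ord_recl big1 => [|i _]; last by rewrite mul0r.
by rewrite mul0r add0r mul1r addr0; congr (cf f _); rewrite /= /bump; lia.
Qed.

Lemma cf_XnM p f n : cf (fX ^+ p * f) n = if (p <= n)%N then cf f (n - p) else 0.
Proof.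
elim: p n => [|p IH] n; first by rewrite expr0 mul1r subn0.
rewrite exprS -mulrA cf_XM; case: n => [//|n]; by rewrite IH.
Qed.

Lemma cf_powX u n k : cf u 0 = 0 -> (n < k)%N -> cf (u ^+ k) n = 0.
Proof.
move=> u0 nk; have uE : u = fX * Fps (fun n => cf u n.+1).
  by apply: fpsP => -[|m]; rewrite cf_XM.
by rewrite uE exprMn cf_XnM leqNgt nk.
Qed.

(** Geometric series in u = 1 - f: as u^k starts in degree k, coefficient n can be read off the
    partial sum with n + 1 terms. *)
Lemma fps_inv f : cf f 0 = 1 -> exists2 g, f * g = 1 & cf g 0 = 1.
Proof.
move=> f0; pose u := 1 - f.
have u0 : cf u 0 = 0 by rewrite cfB cf1 f0 subrr.
pose s N : fps K := \sum_(k < N) u ^+ k.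
have fs N : f * s N = 1 - u ^+ N.
  have -> : f = 1 - u by rewrite opprB addrC subrK.
  elim: N => [|N IH]; first by rewrite /s big_ord0 mulr0 expr0 subrr.
  by rewrite /s big_ord_recr /= mulrDr -/(s N) IH exprS; ring.
pose g := Fps (fun n => cf (s n.+1) n).
have gs n i : (i < n)%N -> cf g i = cf (s n) i.
  move=> iN; rewrite /= /s !cf_sum (big_ord_widen n (fun k => cf (u ^+ k) i)) //.
  rewrite big_mkcond /=; apply: eq_bigr => k _; case: ltnP => // ik.
  by rewrite cf_powX.
have fg : f * g = 1.
  apply: fpsP => n; rewrite (@cfM_ext f f g (s n.+1) n.+1) //; last by move=> i; apply: gs.
  by rewrite fs cfB cf_powX ?subr0.
exists g => //; have := congr1 (fun h => cf h 0) fg.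
by rewrite cfM0 f0 mul1r cf1.
Qed.

Lemma fps_unitI f g h : cf f 0 = 1 -> f * g = f * h -> g = h.
Proof.
move=> /fps_inv[k fk _] e; rewrite -[g]mul1r -[h]mul1r -fk mulrAC [in RHS]mulrAC.
by rewrite e.
Qed.

Lemma fps_unitI_mod f g h N : cf f 0 = 1 ->
  (forall i, (i < N)%N -> cf (f * g) i = cf (f * h) i) ->
  forall i, (i < N)%N -> cf g i = cf h i.
Proof.
move=> /fps_inv[k fk _] e i iN.
have -> : g = k * (f * g) by rewrite mulrA [k * f]mulrC fk mul1r.
have -> : h = k * (f * h) by rewrite mulrA [k * f]mulrC fk mul1r.
exact: (cfM_ext (N := N)).
Qed.

(** The operator q d/dq. *)
Definition fD f : fps K := Fps (fun n => n%:R * cf f n).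

Lemma cf_fD f n : cf (fD f) n = n%:R * cf f n. Proof. by []. Qed.

Lemma fDM f g : fD (f * g) = fD f * g + f * fD g.
Proof.
apply: fpsP => n; rewrite cfD cf_fD !cfM mulr_sumr -big_split; apply: eq_bigr => j _ /=.
have jn : (j <= n)%N by rewrite -ltnS.
by rewrite -{1}(subnKC jn) natrD; ring.
Qed.

Lemma fD_exp f n : fD (f ^+ n.+1) = n.+1%:R * (f ^+ n * fD f).
Proof.
elim: n => [|n IH]; first by rewrite expr1 expr0 !mul1r.
rewrite exprS fDM IH -[n.+2%:R]natr1 [f ^+ n.+1]exprS; ring.
Qed.

(** The formal residue: (n + 1) f^n (f - Df) = (n + 1) f^(n+1) - D(f^(n+1)), and D multiplies
    coefficient n + 1 by n + 1. For f = q j it says that j^n times q dj/dq has no constant term. *)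
Lemma cf_powD f n : cf (f ^+ n * (f - fD f)) n.+1 = 0.
Proof.
have n0 : n.+1%:R != 0 :> K by rewrite pnatr_eq0.
apply: (mulfI n0); rewrite mulr0 -cf_cstM cst_nat.
have -> : n.+1%:R * (f ^+ n * (f - fD f)) = n.+1%:R * f ^+ n.+1 - fD (f ^+ n.+1).
  by rewrite fD_exp exprS; ring.
by rewrite cfB -cst_nat cf_cstM /= subrr.
Qed.

End FpsTheory.

(** * Polynomials in j determined by their polar parts *)

Section Faber.
Variable K : numFieldType.
Local Notation cst := (@fps_cst K).
Variables (a b d : fps K).
Hypothesis a0 : cf a 0 = 1.
Hypothesis b0 : cf b 0 = 1.
Hypothesis d0 : cf d 0 = 1.
Hypothesis dE : 1728 * (fX K * d) = a ^+ 3 - b ^+ 2.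

(** Delta^n p(j) written as a polynomial in E4^3 and Delta, which clears the poles; a, b, d stand
    for E4, E6 and Delta/q. The hypothesis [HP] says P_n(j) E4^2 E6 / Delta^2 = q^(-n-2) - tau(n+2)
    q^(-1) + O(1). *)
Definition hom (p : {poly K}) n : fps K := \sum_(k < n.+1) cst p`_k * (a ^+ 3) ^+ k * (fX K * d) ^+ (n - k).

Variable P : nat -> {poly K}.
Hypothesis HP : forall n i, (i < n.+2)%N ->
  cf (hom (P n) n * (a ^+ 2 * b)) i = cf (d ^+ n.+2 * (1 - cst (cf d n.+1) * fX K ^+ n.+1)) i.

(** With U = q j the claim is E4^2 E6 = - Delta q dj/dq. Relation n is multiplied by (U - DU) /
    (E4^2 E6) and read in degree n + 1: the left side is a combination of formal residues, hence 0,
    and the right side gives V_(n+1) = d_(n+1) for V = d^2 (U - DU) / (E4^2 E6). As n varies, V =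
    d. *)
Lemma fps_ramanujan (di : fps K) : d * di = 1 ->
  a ^+ 2 * b = d * (a ^+ 3 * di - fD (a ^+ 3 * di)).
Proof.
move=> ddi; set U := a ^+ 3 * di; set W := U - fD U.
have di0 : cf di 0 = 1 by have := congr1 (fun h => cf h 0) ddi; rewrite cfM0 d0 mul1r cf1.
have U0 : cf U 0 = 1 by rewrite cfM0 cfX0 a0 expr1n mul1r.
have W0 : cf W 0 = 1 by rewrite cfB U0 /= mul0r subr0.
have ab0 : cf (a ^+ 2 * b) 0 = 1 by rewrite cfM0 cfX0 a0 b0 expr1n mul1r.
have [abi abE abi0] := fps_inv ab0.
pose V := d ^+ 2 * W * abi.
have V0 : cf V 0 = 1 by rewrite /V !cfM0 d0 W0 abi0 !mul1r.
have homE n : hom (P n) n = d ^+ n * \sum_(k < n.+1) cst (P n)`_k * (fX K ^+ (n - k) * U ^+ k).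
  rewrite mulr_sumr; apply: eq_bigr => k _; have kn : (k <= n)%N by rewrite -ltnS.
  have -> : a ^+ 3 = d * U by rewrite /U mulrCA ddi mulr1.
  have -> : d ^+ n = d ^+ k * d ^+ (n - k) by rewrite -exprD subnKC.
  by rewrite !exprMn; ring.
have key n : cf V n.+1 = cf d n.+1.
  (* [S] is q^n P_n(j), and [T] is q^(n+2) times the prescribed polar part. *)
  pose S := \sum_(k < n.+1) cst (P n)`_k * (fX K ^+ (n - k) * U ^+ k).
  pose T := 1 - cst (cf d n.+1) * fX K ^+ n.+1.
  have h1 i : (i < n.+2)%N -> cf (S * (a ^+ 2 * b)) i = cf (d ^+ 2 * T) i.
    move=> iN; apply: (@fps_unitI_mod _ (d ^+ n) _ _ n.+2) iN.
      by rewrite cfX0 d0 expr1n.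
    move=> j jN; rewrite (mulrA (d ^+ n) S) -homE (mulrA (d ^+ n) (d ^+ 2)) -exprD addn2; exact: HP.
  have h2 : cf (S * W) n.+1 = cf (V * T) n.+1.
    have -> : S * W = (S * (a ^+ 2 * b)) * (abi * W).
      by rewrite -[S * W]mulr1 -abE; ring.
    have -> : V * T = (d ^+ 2 * T) * (abi * W) by rewrite /V; ring.
    exact: (cfM_ext (N := n.+2)).
  have h3 : cf (S * W) n.+1 = 0.
    rewrite /S mulr_suml cf_sum big1 // => k _; have kn : (k <= n)%N by rewrite -ltnS.
    rewrite -!mulrA cf_cstM cf_XnM; case: leqP => [_|]; last by lia.
    have -> : (n.+1 - (n - k) = k.+1)%N by lia.
    by rewrite /W cf_powD mulr0.
  have -> : cf V n.+1 = cf (V * T) n.+1 + cf d n.+1.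
    have -> : V * T = V - cst (cf d n.+1) * (fX K ^+ n.+1 * V) by rewrite /T; ring.
    by rewrite cfB cf_cstM cf_XnM leqnn subnn V0 mulr1 subrK.
  by rewrite -h2 h3 add0r.
have Vd : V = d by apply: fpsP => -[|n]; rewrite ?V0 ?d0 ?key.
have e : d * W * abi = 1.
  by apply: (fps_unitI d0); rewrite mulr1 -[RHS]Vd /V; ring.
rewrite -[LHS]mulr1 -e; transitivity ((a ^+ 2 * b * abi) * (d * W)); first by ring.
by rewrite abE mul1r.
Qed.

(** Write Delta^n P_n(j) = Delta^n P_n(x) + B T, where B = E4^3 - x Delta and T is the homogenised
    difference quotient of P_n. After multiplication by E4^2 E6 / (d^n B) the term with T is a
    combination of formal residues and vanishes in degree n; the left side is known from [HP], and
    what is left is P_n(x) q^n to leading order. *)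
Lemma faber_eval n (x : K) (Bi : fps K) : (size (P n) <= n.+1)%N ->
  (a ^+ 3 - cst x * (fX K * d)) * Bi = 1 -> (P n).[x] = cf (d ^+ 2 * Bi) n.
Proof.
move=> sP BE; have [di ddi di0] := fps_inv d0.
have ram := fps_ramanujan ddi.
set U := a ^+ 3 * di in ram; set W := U - fD U in ram.
set B := _ - _ in BE.
have B0 : cf B 0 = 1 by rewrite cfB cf_cstM cf_XM cfX0 a0 expr1n mulr0 subr0.
have Bi0 : cf Bi 0 = 1 by have := congr1 (fun h => cf h 0) BE; rewrite cfM0 B0 mul1r cf1.
have ab0 : cf (a ^+ 2 * b) 0 = 1 by rewrite cfM0 cfX0 a0 b0 expr1n mul1r.
have aE : a ^+ 3 = d * U by rewrite /U mulrCA ddi mulr1.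
have ddin k : d ^+ k * di ^+ k = 1 by rewrite -exprMn ddi expr1n.
pose T := \sum_(k < n.+1) cst (P n)`_k * \sum_(i < k) cst x ^+ i * ((a ^+ 3) ^+ (k.-1 - i) * (fX K * d) ^+ (n - k + i)).
have hT : hom (P n) n = cst (P n).[x] * (fX K * d) ^+ n + B * T.
  have -> : (P n).[x] = \sum_(k < n.+1) (P n)`_k * x ^+ k by apply: horner_coef_wide.
  have -> : cst (\sum_(k < n.+1) (P n)`_k * x ^+ k) = \sum_(k < n.+1) cst (P n)`_k * cst x ^+ k.
    by rewrite (big_morph _ (@cstD K) (@cst0 K)); apply: eq_bigr => k _; rewrite cstM cstX.
  rewrite mulr_suml /T mulr_sumr -big_split; apply: eq_bigr => k _ /=.
  have kn : (k <= n)%N by rewrite -ltnS.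
  set D := fX K * d.
  have -> : \sum_(i < k) cst x ^+ i * ((a ^+ 3) ^+ (k.-1 - i) * D ^+ (n - k + i)) =
     D ^+ (n - k) * \sum_(i < k) (a ^+ 3) ^+ (k.-1 - i) * (cst x * D) ^+ i.
    by rewrite mulr_sumr; apply: eq_bigr => i _; rewrite [(cst x * D) ^+ i]exprMn [D ^+ (_ + _)]exprD; ring.
  have e := subrXX (a ^+ 3) (cst x * D) k.
  have -> : B * (cst (P n)`_k * (D ^+ (n - k) * \sum_(i < k) (a ^+ 3) ^+ (k.-1 - i) * (cst x * D) ^+ i)) =
     cst (P n)`_k * D ^+ (n - k) * ((a ^+ 3) ^+ k - (cst x * D) ^+ k).
    by rewrite e /B -/D; ring.
  have -> : D ^+ n = D ^+ (n - k) * D ^+ k by rewrite -exprD subnK.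
  by rewrite [(cst x * D) ^+ k]exprMn; ring.
have TE : cf (T * (a ^+ 2 * b) * di ^+ n) n = 0.
  rewrite /T !mulr_suml cf_sum big1 // => k _; have kn : (k <= n)%N by rewrite -ltnS.
  rewrite -!mulrA cf_cstM !mulr_suml cf_sum big1 ?mulr0 // => i _.
  have ik := ltn_ord i.
  have gen (U' W' : fps K) : a ^+ 3 = d * U' -> a ^+ 2 * b = d * W' ->
     cst x ^+ i * ((a ^+ 3) ^+ (k.-1 - i) * (fX K * d) ^+ (n - k + i)) * (a * (a * (b * di ^+ n))) =
     cst x ^+ i * (fX K ^+ (n - k + i) * (U' ^+ (k.-1 - i) * W')).
    move=> aE' ram'.
    transitivity (cst x ^+ i * (a ^+ 3) ^+ (k.-1 - i) * (fX K * d) ^+ (n - k + i) * (a ^+ 2 * b) * di ^+ n); first by ring.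
    rewrite ram' aE' !exprMn.
    have -> : di ^+ n = di ^+ (k.-1 - i) * di ^+ (n - k + i) * di.
      by rewrite -exprD -exprSr; congr (_ ^+ _); lia.
    transitivity (cst x ^+ i * (fX K ^+ (n - k + i) * (U' ^+ (k.-1 - i) * W')) *
      ((d ^+ (k.-1 - i) * di ^+ (k.-1 - i)) * (d ^+ (n - k + i) * di ^+ (n - k + i)) * (d * di))); first by ring.
    by rewrite !ddin ddi !mulr1.
  rewrite (gen U W aE ram).
  rewrite -cstX cf_cstM cf_XnM; case: leqP => [_|]; last by lia.
  have -> : (n - (n - k + i) = (k.-1 - i).+1)%N by lia.
  by rewrite /W cf_powD mulr0.
have hL : cf (hom (P n) n * (a ^+ 2 * b) * (di ^+ n * Bi)) n = cf (d ^+ 2 * Bi) n.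
  rewrite (@cfM_ext _ _ (d ^+ n.+2 * (1 - cst (cf d n.+1) * fX K ^+ n.+1)) _ (di ^+ n * Bi) n.+1) //; last first.
    by move=> i iN; apply: HP; apply: ltnW.
  have -> : d ^+ n.+2 * (1 - cst (cf d n.+1) * fX K ^+ n.+1) * (di ^+ n * Bi) =
     d ^+ 2 * Bi * (d ^+ n * di ^+ n) - cst (cf d n.+1) * (fX K ^+ n.+1 * (d ^+ n.+2 * (di ^+ n * Bi))).
    by rewrite -addn2 exprD; ring.
  by rewrite ddin mulr1 cfB cf_cstM cf_XnM ltnn mulr0 subr0.
rewrite -hL hT.
have -> : (cst (P n).[x] * (fX K * d) ^+ n + B * T) * (a ^+ 2 * b) * (di ^+ n * Bi) =
   cst (P n).[x] * (fX K ^+ n * (a ^+ 2 * b * Bi)) * (d ^+ n * di ^+ n) + (T * (a ^+ 2 * b) * di ^+ n) * (B * Bi).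
  by rewrite exprMn; ring.
rewrite ddin BE !mulr1 cfD TE addr0 cf_cstM cf_XnM leqnn subnn cfM0 ab0 Bi0.
by rewrite !mulr1.
Qed.

End Faber.

(** * Consequences of the defining relation *)

Section Rep.
Variable R : realType.
Local Notation C := R[i].
Local Notation cst := (@fps_cst C).
Implicit Types (phi psi : R -> C) (f g : fps C).

(** This is phi(q) = f(q) + O(q^N) as q tends to 0 through positive reals. By [rep_uniq] such an
    expansion determines the first N coefficients, so that identities of functions near the cusp
    become identities of formal series. *)
Definition rep N phi f := exists K e : R, 0 < e /\ forall q, 0 < q < e ->
  nm (phi q - (fps_tr N f).[q%:C]) <= K * q ^+ N.

Lemma nm_realX (q : R) i : 0 <= q -> nm (q%:C ^+ i) = q ^+ i.
Proof. by move=> q0; rewrite nmX nm_real ger0_norm. Qed.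

Lemma poly_bigO (p : {poly C}) N : (forall i, (i < N)%N -> p`_i = 0) ->
  exists2 K : R, 0 <= K & forall q, 0 < q < 1 -> nm p.[q%:C] <= K * q ^+ N.
Proof.
move=> p0; exists (\sum_(i < size p) nm p`_i); first by apply: sumr_ge0 => i _; apply: nm_ge0.
move=> q /andP[q0 q1]; rewrite horner_coef mulr_suml; apply: le_trans (nm_sum _ _ _) _.
apply: ler_sum => i _; rewrite nmM nm_realX ?(ltW q0) //.
have [iN|iN] := ltnP i N; first by rewrite p0 // nm0 !mul0r.
by rewrite ler_wpM2l ?nm_ge0 // ler_wiXn2l // ltW.
Qed.

Lemma poly_bound (p : {poly C}) : exists2 K : R, 0 <= K & forall q, 0 < q < 1 -> nm p.[q%:C] <= K.
Proof.
have [|K K0 HK] := @poly_bigO p 0; first by [].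
by exists K => // q /HK; rewrite expr0 mulr1.
Qed.

Lemma coef_tr N f i : (fps_tr N f)`_i = if (i < N)%N then cf f i else 0.
Proof. exact: coef_poly. Qed.

Lemma rep_poly N phi f (p : {poly C}) : (forall i, (i < N)%N -> p`_i = cf f i) ->
  (exists K e : R, 0 < e /\ forall q, 0 < q < e -> nm (phi q - p.[q%:C]) <= K * q ^+ N) ->
  rep N phi f.
Proof.
move=> hp [K [e [e0 HK]]].
have [|K1 K10 HK1] := @poly_bigO (p - fps_tr N f) N.
  by move=> i iN; rewrite coefB coef_tr iN hp // subrr.
exists (K + K1), (Num.min e 1); split; first by rewrite lt_min e0 ltr01.
move=> q; rewrite lt_min => /andP[q0 /andP[qe q1]].
have -> : phi q - (fps_tr N f).[q%:C] = (phi q - p.[q%:C]) + (p - fps_tr N f).[q%:C].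
  by rewrite hornerD hornerN addrA subrK.
apply: le_trans (nmD _ _) _; rewrite mulrDl lerD ?HK ?HK1 //; by apply/andP.
Qed.

Lemma repD N phi psi f g : rep N phi f -> rep N psi g ->
  rep N (fun q => phi q + psi q) (f + g).
Proof.
move=> [K [e [e0 HK]]] [L [e' [e'0 HL]]].
apply: (@rep_poly _ _ _ (fps_tr N f + fps_tr N g)).
  by move=> i iN; rewrite coefD !coef_tr iN.
exists (K + L), (Num.min e e'); split; first by rewrite lt_min e0.
move=> q; rewrite lt_min => /andP[q0 /andP[qe qe']]; rewrite hornerD.
rewrite opprD addrACA; apply: le_trans (nmD _ _) _.
by rewrite mulrDl lerD ?HK ?HL ?q0.
Qed.

Lemma repM N phi psi f g : rep N phi f -> rep N psi g ->
  rep N (fun q => phi q * psi q) (f * g).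
Proof.
move=> [K [e [e0 HK]]] [L [e' [e'0 HL]]].
apply: (@rep_poly _ _ _ (fps_tr N f * fps_tr N g)).
  move=> i iN; rewrite -(@fps_mul_coef _ f g) // => j ji; rewrite coef_tr (leq_ltn_trans ji) //.
have [A A0 HA] := poly_bound (fps_tr N f); have [B B0 HB] := poly_bound (fps_tr N g).
exists (`|K| * (B + `|L|) + A * `|L|), (Num.min (Num.min e e') 1); split.
  by rewrite !lt_min e0 e'0 ltr01.
move=> q; rewrite !lt_min => /andP[q0 /andP[/andP[qe qe'] q1]]; rewrite hornerM.
set F := (fps_tr N f).[_]; set G := (fps_tr N g).[_].
have qN : 0 <= q ^+ N by rewrite exprn_ge0 // ltW.
have hf : nm (phi q - F) <= `|K| * q ^+ N.
  by apply: le_trans (HK q _) _; rewrite ?q0 // ler_wpM2r // ler_norm.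
have hg : nm (psi q - G) <= `|L| * q ^+ N.
  by apply: le_trans (HL q _) _; rewrite ?q0 // ler_wpM2r // ler_norm.
have q01 : 0 < q < 1 by rewrite q0.
have hF : nm F <= A by apply: HA.
have hG : nm G <= B by apply: HB.
have hpsi : nm (psi q) <= B + `|L|.
  rewrite -[psi q](subrK G) addrC; apply: le_trans (nmD _ _) _; apply: lerD => //.
  by apply: le_trans hg _; rewrite ler_piMr // exprn_ile1 // ltW.
have -> : phi q * psi q - F * G = (phi q - F) * psi q + F * (psi q - G) by ring.
apply: le_trans (nmD _ _) _; rewrite !nmM mulrDl.
apply: lerD; last first.
  by rewrite -mulrA; apply: ler_pM; rewrite ?nm_ge0.
rewrite mulrAC; apply: ler_pM; rewrite ?nm_ge0 //.
Qed.

Lemma rep_cst N c : rep N (fun=> c) (cst c).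
Proof.
apply: (@rep_poly _ _ _ c%:P); first by move=> [|i] _; rewrite coefC.
by exists 0, 1; split=> // q _; rewrite hornerC subrr nm0 mul0r.
Qed.

Lemma rep_X N : rep N (fun q => q%:C) (fX C).
Proof.
apply: (@rep_poly _ _ _ 'X); first by move=> i _; rewrite coefX.
by exists 0, 1; split=> // q _; rewrite hornerX subrr nm0 mul0r.
Qed.

Lemma repX N phi f n : rep N phi f -> rep N (fun q => phi q ^+ n) (f ^+ n).
Proof.
move=> h; elim: n => [|n IH]; first exact: (rep_cst N 1).
rewrite exprS; have := repM h IH.
by case=> K [e [e0 HK]]; exists K, e; split=> // q qe; rewrite exprS; apply: HK.
Qed.

Lemma repN N phi f : rep N phi f -> rep N (fun q => - phi q) (- f).
Proof.
move=> h; have := repM (rep_cst N (-1)) h; rewrite cstN cst1 mulN1r.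
by case=> K [e [e0 HK]]; exists K, e; split=> // q qe; rewrite -mulN1r; apply: HK.
Qed.

Lemma rep_sum N (n : nat) (phi : 'I_n -> R -> C) (f : 'I_n -> fps C) :
  (forall i, rep N (phi i) (f i)) -> rep N (fun q => \sum_(i < n) phi i q) (\sum_(i < n) f i).
Proof.
elim: n phi f => [|n IH] phi f h.
  rewrite big_ord0; have := rep_cst N 0; rewrite cst0.
  by case=> K [e [e0 HK]]; exists K, e; split=> // q qe; rewrite big_ord0; apply: HK.
rewrite big_ord_recl; have := repD (h ord0) (IH _ _ (fun i => h (lift ord0 i))).
by case=> K [e [e0 HK]]; exists K, e; split=> // q qe; rewrite big_ord_recl; apply: HK.
Qed.

Lemma le_lin_eq0 (x K e : R) : 0 <= x -> 0 < e -> (forall q, 0 < q < e -> x <= K * q) -> x = 0.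
Proof.
move=> x0 e0 H; apply/eqP; rewrite eq_le x0 andbT; apply/ler_addgt0Pl => d d0.
rewrite addr0; pose q := Num.min (e / 2) (d / (`|K| + 1)).
have K1 : 0 < `|K| + 1 by rewrite ltr_wpDl.
have q0 : 0 < q by rewrite lt_min !divr_gt0.
have qe : q < e by rewrite gt_min; apply/orP; left; lra.
apply: le_trans (H q _) _; first by rewrite q0.
have : q <= d / (`|K| + 1) by rewrite ge_min lexx orbT.
rewrite ler_pdivlMr // => h; apply: le_trans h; rewrite mulrC ler_wpM2l ?(ltW q0) //.
by apply: le_trans (ler_norm K) _; rewrite lerDl.
Qed.

Lemma rep_uniq N phi psi f g : rep N phi f -> rep N psi g ->
  (exists K e : R, 0 < e /\ forall q, 0 < q < e -> nm (phi q - psi q) <= K * q ^+ N) ->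
  forall i, (i < N)%N -> cf f i = cf g i.
Proof.
move=> [K1 [e1 [e10 H1]]] [K2 [e2 [e20 H2]]] [K3 [e3 [e30 H3]]].
pose p := fps_tr N f - fps_tr N g.
pose e := Num.min (Num.min e1 e2) (Num.min e3 1).
have e0 : 0 < e by rewrite !lt_min e10 e20 e30 ltr01.
pose K := `|K1| + `|K2| + `|K3|.
have hp q : 0 < q < e -> nm p.[q%:C] <= K * q ^+ N.
  rewrite !lt_min => /andP[q0 /andP[/andP[q1 q2] /andP[q3 q4]]].
  have qN : 0 <= q ^+ N by rewrite exprn_ge0 // ltW.
  have h1 : nm (phi q - (fps_tr N f).[q%:C]) <= `|K1| * q ^+ N.
    by apply: le_trans (H1 q _) _; rewrite ?q0 // ler_wpM2r // ler_norm.
  have h2 : nm (psi q - (fps_tr N g).[q%:C]) <= `|K2| * q ^+ N.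
    by apply: le_trans (H2 q _) _; rewrite ?q0 // ler_wpM2r // ler_norm.
  have h3 : nm (phi q - psi q) <= `|K3| * q ^+ N.
    by apply: le_trans (H3 q _) _; rewrite ?q0 // ler_wpM2r // ler_norm.
  have -> : p.[q%:C] = (phi q - psi q) + (psi q - (fps_tr N g).[q%:C]) - (phi q - (fps_tr N f).[q%:C]).
    by rewrite /p hornerD hornerN; ring.
  apply: le_trans (nmB _ _) _; apply: le_trans (lerD (nmD _ _) (lexx _)) _.
  by rewrite /K !mulrDl; lra.
have K0 : 0 <= K by rewrite !addr_ge0.
have key i : (i < N)%N -> p`_i = 0.
  elim/ltn_ind: i => i IH iN; apply/eqP; rewrite -nm_eq0; apply/eqP.
  have [|L L0 HL] := @poly_bigO (p - (p`_i)%:P * 'X^i) i.+1.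
    move=> j; rewrite ltnS leq_eqVlt coefB coefCM coefXn => /predU1P[->|ji].
      by rewrite eqxx mulr1 subrr.
    by rewrite (ltn_eqF ji) mulr0 subr0 IH // (ltn_trans ji).
  apply: (@le_lin_eq0 _ (K + L) e) => //; first exact: nm_ge0.
  move=> q /[dup] qe; rewrite {1}/e !lt_min => /andP[q0 /andP[_ /andP[_ q1]]].
  have qi : 0 < q ^+ i by rewrite exprn_gt0.
  rewrite -(ler_pM2r qi).
  have -> : nm p`_i * q ^+ i = nm (p.[q%:C] - (p - (p`_i)%:P * 'X^i).[q%:C]).
    rewrite hornerD hornerN hornerM hornerC hornerXn opprB addrC subrK nmM nm_realX //.
    exact: ltW.
  apply: le_trans (nmB _ _) _; rewrite mulrDl mulrDl.
  have qN : q ^+ N <= q ^+ i.+1 by rewrite ler_wiXn2l // ltW.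
  apply: lerD.
    apply: le_trans (hp q qe) _; rewrite -mulrA -exprS; exact: ler_wpM2l.
  by rewrite -mulrA -exprS; apply: HL; rewrite q0.
move=> i iN; have := key i iN; rewrite coefB !coef_tr iN => /eqP.
by rewrite subr_eq0 => /eqP.
Qed.

Lemma rep_series N phi (a : nat -> C) (r : R) : 0 < r ->
  summable_seq (fun n => nm (a n) * r ^+ n) ->
  (forall q, 0 < q < r -> cto (fun M => \sum_(0 <= n < M) a n * q%:C ^+ n) (phi q)) ->
  rep N phi (Fps a).
Proof.
move=> r0 [_ [K HK]] H; exists (K / r ^+ N), r; split=> // q /[dup] qr /andP[q0 q1].
have tE : (fps_tr N (Fps a)).[q%:C] = \sum_(0 <= n < N) a n * q%:C ^+ n.
  rewrite /fps_tr horner_poly big_mkord; by [].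
have c1 := ctoB (cto_sub (f := fun M => (N + M)%N) (fun M => leq_addl N M) (H q qr)) (cto_cst (fps_tr N (Fps a)).[q%:C]).
apply: cto_nm_le c1 _ => M; rewrite tE (big_cat_nat (n := N)) ?leq_addr //= addrAC subrr add0r.
apply: le_trans (nm_sum _ _ _) _.
have rN : 0 < r ^+ N by rewrite exprn_gt0.
rewrite mulrAC ler_pdivlMr // mulr_suml.
apply: (@le_trans _ _ (\sum_(N <= n < N + M) (nm (a n) * r ^+ n) * q ^+ N)).
  rewrite big_nat_cond [leRHS]big_nat_cond; apply: ler_sum => n; rewrite andbT => /andP[nN _].
  rewrite nmM nm_realX ?(ltW q0) // -!mulrA ler_wpM2l ?nm_ge0 //.
  rewrite -{1}(subnK nN) exprD -{2}(subnK nN) exprD.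
  rewrite [leRHS]mulrAC -!mulrA ler_wpM2r ?mulr_ge0 ?exprn_ge0 ?(ltW q0) ?(ltW r0) //.
  by rewrite lerXn2r ?nnegrE ?(ltW q0) ?(ltW r0) // ltW.
rewrite -mulr_suml ler_wpM2r ?exprn_ge0 ?(ltW q0) //.
apply: le_trans (HK (N + M)%N); rewrite [leRHS](big_cat_nat (n := N)) ?leq_addr //=.
by rewrite lerDr sumr_ge0 // => n _; rewrite mulr_ge0 ?nm_ge0 ?exprn_ge0 // ltW.
Qed.

(** The point of the imaginary axis with e([tq q]) = q. *)
Definition tq (q : R) : C := 0 +i* (- ln q / (2 * pi)).

Lemma tq_Im q : 0 < q < 1 -> 0 < complex.Im (tq q).
Proof.
move=> q01; rewrite /= divr_gt0 ?mulr_gt0 ?pi_gt0 //.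
by rewrite oppr_gt0 ln_lt0.
Qed.

Lemma e2pi_tq q : 0 < q -> e2pi (tq q) = q%:C.
Proof.
move=> q0; rewrite /e2pi /tq /cexp /= !mul0r mulr0 addr0 sub0r.
have -> : - (2 * pi * (- ln q / (2 * pi))) = ln q :> R.
  by rewrite mulrCA mulfV ?mulr1 ?opprK // mulf_neq0 ?pnatr_eq0 // gt_eqF // pi_gt0.
by rewrite lnK // cos0 sin0; apply/eqP; rewrite eq_complex /= !mul0r !mulr0 mulr1 subr0 addr0 !eqxx.
Qed.

Lemma sigma_le nu n : (sigma nu n.+1 <= n.+1 ^ nu.+1)%N.
Proof.
rewrite /sigma expnS; apply: (@leq_trans (\sum_(d <- divisors n.+1) n.+1 ^ nu)).
  rewrite !big_seq; apply: leq_sum => d; rewrite -dvdn_divisors // => dn.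
  case: nu => [|nu]; first by rewrite !expn0.
  by rewrite leq_exp2r // dvdn_leq.
rewrite big_const_seq count_predT iter_addn_0 mulnC leq_mul //.
have : perm_eq (divisors n.+1) [seq d <- iota 1 n.+1 | (d %| n.+1)%N].
  apply: uniq_perm; rewrite ?divisors_uniq ?filter_uniq ?iota_uniq // => d.
  rewrite -dvdn_divisors // mem_filter mem_iota; case dn: (d %| n.+1)%N => //=.
  by rewrite (dvdn_gt0 (ltn0Sn n) dn) add1n ltnS (dvdn_leq _ dn).
by move=> /perm_size ->; apply: leq_trans (size_subseq (filter_subseq _ _)) _; rewrite size_iota.
Qed.

Definition e4c (n : nat) : C := if n is 0 then 1 else 240 * (sigma 3 n)%:R.
Definition e6c (n : nat) : C := if n is 0 then 1 else - (504 * (sigma 5 n)%:R).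

Lemma summable_shift (a : nat -> R) : (forall n, 0 <= a n) ->
  summable_seq (fun n => a n.+1) -> summable_seq a.
Proof.
move=> a0 [_ [K HK]]; split=> //; exists (a 0%N + K) => -[|n].
  by rewrite big_nil addr_ge0 //; apply: le_trans (HK 0%N); rewrite big_nil.
by rewrite big_nat_recl //= lerD2l.
Qed.

Lemma summable_e4c (r : R) : 0 <= r < 1 -> summable_seq (fun n => nm (e4c n) * r ^+ n).
Proof.
move=> r01; have r0 : 0 <= r by case/andP: r01.
apply: summable_shift => [n|]; first by rewrite mulr_ge0 ?nm_ge0 ?exprn_ge0.
apply: (summable_le (summableZ (ler0n R 240) (summable_natXgeom 4 r01))) => n.
apply/andP; split; first by rewrite mulr_ge0 ?nm_ge0 ?exprn_ge0.
rewrite /e4c nmM !nm_nat -mulrA; apply: ler_wpM2l; first exact: ler0n.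
by rewrite ler_wpM2r ?exprn_ge0 // -natrX ler_nat sigma_le.
Qed.

Lemma summable_e6c (r : R) : 0 <= r < 1 -> summable_seq (fun n => nm (e6c n) * r ^+ n).
Proof.
move=> r01; have r0 : 0 <= r by case/andP: r01.
apply: summable_shift => [n|]; first by rewrite mulr_ge0 ?nm_ge0 ?exprn_ge0.
apply: (summable_le (summableZ (ler0n R 504) (summable_natXgeom 6 r01))) => n.
apply/andP; split; first by rewrite mulr_ge0 ?nm_ge0 ?exprn_ge0.
rewrite /e6c nmN nmM !nm_nat -mulrA; apply: ler_wpM2l; first exact: ler0n.
by rewrite ler_wpM2r ?exprn_ge0 // -natrX ler_nat sigma_le.
Qed.

Lemma E4_e4c t : 0 < complex.Im t ->
  cto (fun M => \sum_(0 <= n < M) e4c n * e2pi t ^+ n) (E4 t).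
Proof.
move=> t0; have h := E4_cto t0.
apply: (cto_eq (n0 := 1) (cto_comp (f := predn) _ h)) => [M|[//|M] _].
  by exists M.+1 => n; case: n.
rewrite big_nat_recl //= mulr1; congr (_ + _); rewrite mulr_sumr.
by apply: eq_bigr => n _; rewrite mulrA.
Qed.

Lemma E6_e6c t : 0 < complex.Im t ->
  cto (fun M => \sum_(0 <= n < M) e6c n * e2pi t ^+ n) (E6 t).
Proof.
move=> t0; have h := E6_cto t0.
apply: (cto_eq (n0 := 1) (cto_comp (f := predn) _ h)) => [M|[//|M] _].
  by exists M.+1 => n; case: n.
rewrite big_nat_recl //= mulr1; congr (_ + _); rewrite mulr_sumr -sumrN.
by apply: eq_bigr => n _; rewrite mulrA mulNr.
Qed.

Definition E4f : fps C := Fps e4c.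
Definition E6f : fps C := Fps e6c.

Lemma rep_E4 N : rep N (fun q => E4 (tq q)) E4f.
Proof.
have h : 0 <= (2^-1 : R) < 1 by apply/andP; split; lra.
apply: (@rep_series _ _ _ (2^-1)); [by lra|exact: summable_e4c|].
move=> q /andP[q0 q1]; rewrite -e2pi_tq //; apply: E4_e4c; apply: tq_Im; apply/andP; split=> //; lra.
Qed.

Lemma rep_E6 N : rep N (fun q => E6 (tq q)) E6f.
Proof.
have h : 0 <= (2^-1 : R) < 1 by apply/andP; split; lra.
apply: (@rep_series _ _ _ (2^-1)); [by lra|exact: summable_e6c|].
move=> q /andP[q0 q1]; rewrite -e2pi_tq //; apply: E6_e6c; apply: tq_Im; apply/andP; split=> //; lra.
Qed.

End Rep.

(** * Polar parts of the mock modular form and of its Hecke images *)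

Section MockBound.
Variable R : realType.
Local Notation C := R[i].

(** Dropping (k + 11)! from the denominators leaves (x/2)^11 times the exponential series of
    (x/2)^2. *)
Lemma besselI_bound (x : R) : 0 <= x ->
  `|besselI 11 x| <= (x / 2) ^+ 11 * expR ((x / 2) ^+ 2).
Proof.
move=> x0; rewrite /besselI; set f := (fun k : nat => _).
pose y := x / 2; have y0 : 0 <= y by rewrite divr_ge0.
have f0 k : 0 <= f k.
  by rewrite /f divr_ge0 ?exprn_ge0 // mulr_ge0.
have fle k : f k <= y ^+ 11 * exp_coeff (y ^+ 2) k.
  have -> : f k = y ^+ 11 * (exp_coeff (y ^+ 2) k / (k + 11)`!%:R).
    by rewrite /f /exp_coeff /= exprD exprM -/y invfM; ring.
  apply: ler_wpM2l; first by rewrite exprn_ge0.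
  rewrite ler_piMr //; first by apply: exp_coeff_ge0; rewrite exprn_ge0.
  by rewrite invf_le1 ?ltr0n ?fact_gt0 // ler1n fact_gt0.
have sle n : series f n <= y ^+ 11 * expR (y ^+ 2).
  apply: (@le_trans _ _ (y ^+ 11 * series (exp_coeff (y ^+ 2)) n)).
    by rewrite /series /= mulr_sumr; apply: ler_sum => k _; apply: fle.
  rewrite ler_wpM2l ?exprn_ge0 //; apply: nondecreasing_cvgn_le; last exact: is_cvg_series_exp_coeff.
  by apply/nondecreasing_series => k _ _; apply: exp_coeff_ge0; rewrite exprn_ge0.
have cvf : cvgn (series f).
  apply: nondecreasing_is_cvgn; first by apply/nondecreasing_series => k _ _; apply: f0.
  by exists (y ^+ 11 * expR (y ^+ 2)) => _ [n _ <-]; apply: sle.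
rewrite ger0_norm; first by apply: limr_le => //; near=> n; apply: sle.
by apply: limr_ge => //; near=> n; rewrite /series /=; apply: sumr_ge0.
Unshelve. all: by end_near.
Qed.

Lemma e2pi_real_nm (x : R) : nm (e2pi (x%:C)) = 1.
Proof. by rewrite nm_e2pi /= mulr0 oppr0 expR0. Qed.

Lemma kloosterman_bound (m n : int) c : nm (kloosterman R m n c) <= c%:R.
Proof.
rewrite /kloosterman; apply: le_trans (nm_sum _ _ _) _.
apply: (@le_trans _ _ (\sum_(v < c) (1 : R))); last by rewrite sumr_const card_ord.
rewrite big_mkcond /=; apply: ler_sum => v _; case: ifP => // _.
set z := _ / _.
have -> : z = ((m%:~R * (invmod v)%:R + n%:~R * v%:R) / c%:R : R)%:C.
  by rewrite /z rmorphM fmorphV rmorphD !rmorphM !rmorph_nat !rmorph_int.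
by rewrite e2pi_real_nm.
Qed.

(** The trivial bound |K(-1, n, c)| <= c cancels 1/c, and the factor (x/2)^11 of the Bessel
    function, with x proportional to 1/c, makes the sum over c converge. Geometric growth in n gives
    convergence for large Im z. *)
Lemma a_Delta_bound : exists K L : R, [/\ 0 < K, 1 <= L &
  forall n, nm (a_Delta R n.+1) <= K * L ^+ n.+1].
Proof.
have [_ [K0 HK0]] := summable_invsq R.
have K00 : 0 <= K0 by apply: le_trans (HK0 0%N); rewrite big_nil.
pose E := expR (4 * pi ^+ 2 : R).
exists (2 * pi * (11`!)%:R * ((2 * pi) ^+ 11 * (K0 + 1))), (expR 1 ^+ 11 * E).
split.
- by rewrite !mulr_gt0 ?pi_gt0 ?ltr0n ?fact_gt0 ?exprn_gt0 ?mulr_gt0 ?pi_gt0 // ltr_wpDl.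
- have e1 : 1 <= expR (1 : R) by rewrite ltW // expR_gt1.
  apply: mulr_ege1; first exact: exprn_ege1.
  by rewrite /E -expR0 ler_expR mulr_ge0 // sqr_ge0.
move=> n; set N := n.+1.
have N1 : 1 <= N%:R :> R by rewrite ler1n.
have N0 : 0 < N%:R :> R by [].
pose s := Num.sqrt (N%:R : R).
have s0 : 0 <= s by rewrite sqrtr_ge0.
have ss : s ^+ 2 = N%:R by rewrite sqr_sqrtr ?ler0n.
have sN : s <= expR N%:R.
  apply: (@le_trans _ _ N%:R).
    by rewrite -ss expr2 ler_peMr // -sqrtr1 ler_wsqrtr.
  by apply: le_trans (expR_ge1Dx _); rewrite lerDr.
have Et : expR (4 * pi ^+ 2 * N%:R) = E ^+ N by rewrite /E -expRM_natr.
pose u (k : nat) : C := kloosterman R (-1) N k.+1 / k.+1%:R * (besselI 11 (4 * pi * Num.sqrt N%:R / k.+1%:R))%:C.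
have ub k : nm (u k) <= ((2 * pi) ^+ 11 * s ^+ 11 * E ^+ N) * (k.+1%:R ^+ 2)^-1.
  have k1 : 1 <= k.+1%:R :> R by rewrite ler1n.
  have k0 : 0 < k.+1%:R :> R by [].
  rewrite /u !nmM nmV nm_nat nm_real.
  apply: (@le_trans _ _ (1 * `|besselI 11 (4 * pi * s / k.+1%:R)|)).
    rewrite ler_wpM2r // ler_pdivrMr // mul1r; exact: kloosterman_bound.
  have p0 := @pi_gt0 R.
  rewrite mul1r; apply: le_trans (besselI_bound _) _.
    by rewrite divr_ge0 ?mulr_ge0 // ltW.
  have -> : 4 * pi * s / k.+1%:R / 2 = 2 * pi * s / k.+1%:R :> R by field; rewrite gt_eqF.
  rewrite [(2 * pi * s / _) ^+ 11]expr_div_n exprMn mulrAC; apply: ler_pM.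
  - by rewrite mulr_ge0 ?expR_ge0 // mulr_ge0 ?exprn_ge0 ?mulr_ge0 // ltW.
  - by rewrite invr_ge0 exprn_ge0.
  - rewrite ler_wpM2l //; first by rewrite mulr_ge0 ?exprn_ge0 ?mulr_ge0 // ltW.
    rewrite -Et ler_expR expr_div_n !exprMn ss.
    rewrite (_ : 2 ^+ 2 = 4 :> R); last by ring.
    rewrite ler_pdivrMr ?exprn_gt0 //; apply: ler_peMr; last exact: exprn_ege1.
    by rewrite !mulr_ge0 ?sqr_ge0 // ltW.
  - by rewrite lef_pV2 ?posrE ?exprn_gt0 // ler_weXn2l.
have Pw0 : 0 <= (2 * pi) ^+ 11 * s ^+ 11 * E ^+ N.
  by rewrite !mulr_ge0 ?exprn_ge0 ?mulr_ge0 ?pi_ge0 ?expR_ge0.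
have hb M : \sum_(0 <= i < M) nm (u i) <= (2 * pi) ^+ 11 * s ^+ 11 * E ^+ N * K0.
  apply: (@le_trans _ _ (\sum_(0 <= k < M) (2 * pi) ^+ 11 * s ^+ 11 * E ^+ N * (k.+1%:R ^+ 2)^-1)).
    by apply: ler_sum => k _; apply: ub.
  by rewrite -mulr_sumr; apply: ler_wpM2l.
have [_ hs] := csum_bound hb.
have pw : `|N%:R `^ (- (11 / 2))| <= 1 :> R.
  rewrite ger0_norm ?powR_ge0 // /powR gt_eqF // expR_le1 mulNr oppr_le0 mulr_ge0 ?ln_ge0 //.
rewrite /a_Delta -/N.
have -> : csum (fun k : nat => let c := k.+1 in kloosterman R (-1) N c / c%:R * (besselI 11 (4 * pi * Num.sqrt N%:R / c%:R))%:C) = csum u by [].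
move: (csum u) hs (11`!) => cu hs F11.
rewrite nmM nmM nmM nmM nmN nm_nat nm_nat !nm_real (ger0_norm (pi_ge0 R)).
apply: (@le_trans _ _ (2 * pi * F11%:R * 1 * ((2 * pi) ^+ 11 * s ^+ 11 * E ^+ N * K0))).
  apply: ler_pM => //; first by rewrite !mulr_ge0 ?pi_ge0.
    exact: nm_ge0.
  by rewrite ler_wpM2l // !mulr_ge0 ?pi_ge0.
rewrite mulr1 -[leRHS]mulrA; apply: ler_wpM2l; first by rewrite !mulr_ge0 ?pi_ge0.
have Q0 : 0 <= (2 * pi) ^+ 11 :> R by rewrite exprn_ge0 // mulr_ge0 // pi_ge0.
have h : s ^+ 11 <= (expR 1 ^+ 11) ^+ N.
  by rewrite exprAC -expRM_natl mulr1 lerXn2r ?nnegrE ?expR_ge0.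
have s11 : 0 <= s ^+ 11 by rewrite exprn_ge0.
have EN : 0 <= E ^+ N by rewrite exprn_ge0 // expR_ge0.
rewrite [(expR 1 ^+ 11 * E) ^+ N]exprMn; move: ((2 * pi) ^+ 11 : R) (s ^+ 11) (E ^+ N) ((expR 1 ^+ 11) ^+ N) Q0 h s11 EN => Q a b c Q0 h a0 b0.
have -> : Q * a * b * K0 = Q * (a * b * K0) by ring.
have -> : Q * (K0 + 1) * (c * b) = Q * (c * b * (K0 + 1)) by ring.
apply: ler_wpM2l => //; apply: ler_pM => //; [by rewrite mulr_ge0|by rewrite ler_wpM2r|by rewrite lerDl].
Qed.

Lemma M_Delta_bound : exists Y K : R, 0 < Y /\ forall z : C, Y <= complex.Im z ->
  nm (M_Delta z - (11`!)%:R * (e2pi z)^-1) <= K.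
Proof.
have [K [L [K0 L1 HL]]] := a_Delta_bound.
have L0 : 0 < L by apply: lt_le_trans L1.
(* For Im z >= 2 L one has |q| <= 1 / (2 L), so the series is dominated by K times a geometric
   series of ratio 1/2. *)
exists (2 * L), (nm (24 * (11`!)%:R / B12 R : C) + K * 2); split; first by rewrite mulr_gt0.
move=> z hz; set q := e2pi z.
have nq : nm q <= (2 * L)^-1.
  rewrite nm_e2pi expRN lef_pV2 ?posrE ?expR_gt0 ?mulr_gt0 //.
  have z0 : 0 < complex.Im z by apply: lt_le_trans hz; rewrite mulr_gt0.
  apply: le_trans hz _; apply: le_trans (expR_ge1Dx _).
  have := @pi_ge2 R; move: z0; move: (complex.Im z) => y y0 p2; nra.
have -> : M_Delta z - (11`!)%:R * q^-1 = 24 * (11`!)%:R / B12 R + csum (fun n : nat => a_Delta R n.+1 * q ^+ n.+1).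
  have aux (x y w : C) : x + y + w - x = y + w by ring.
  exact: aux.
apply: le_trans (nmD _ _) _; rewrite lerD2l.
suff gen (a : nat -> C) : (forall n, nm (a n) <= K * L ^+ n.+1) ->
    nm (csum (fun n : nat => a n * q ^+ n.+1)) <= K * 2 by exact: gen HL.
move=> {}HL.
suff hb M : \sum_(0 <= i < M) nm (a i * q ^+ i.+1) <= K * 2.
  by have [] := csum_bound hb.
apply: (@le_trans _ _ (\sum_(0 <= i < M) K * (2^-1) ^+ i)).
  apply: ler_sum => i _; rewrite nmM nmX.
  apply: (@le_trans _ _ ((K * L ^+ i.+1) * ((2 * L)^-1) ^+ i.+1)).
    apply: ler_pM; rewrite ?nm_ge0 ?exprn_ge0 ?nm_ge0 //.
    by rewrite lerXn2r ?nnegrE ?nm_ge0 // invr_ge0 mulr_ge0 // ltW.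
  rewrite -mulrA -exprMn invfM mulrCA mulfV ?mulr1; last by rewrite gt_eqF.
  by rewrite ler_wpM2l ?(ltW K0) // ler_wiXn2l //; lra.
rewrite -mulr_sumr ler_wpM2l ?(ltW K0) //.
have h : 0 <= (2^-1 : R) < 1 by apply/andP; split; lra.
apply: le_trans (geom_sum_le M h) _.
by rewrite (_ : 1 - 2^-1 = 2^-1 :> R) ?invrK //; field.
Qed.

Lemma sum_roots_unity (d : nat) : (1 < d)%N -> \sum_(b < d) e2pi (- (b%:R / d%:R) : C) = 0.
Proof.
move=> d1; pose w : C := e2pi (- (1 / d%:R)).
have d0 : (d%:R : C) != 0 by rewrite pnatr_eq0; lia.
have E : \sum_(b < d) e2pi (- (b%:R / d%:R)) = \sum_(b < d) w ^+ b.
  by apply: eq_bigr => b _; rewrite e2piX; congr e2pi; field.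
have wd : w ^+ d = 1.
  rewrite e2piX (_ : d%:R * - (1 / d%:R) = -1); last by field.
  by rewrite e2piN e2pi1 invr1.
have w1 : w != 1.
  have dr : (1 / d%:R : C) = (1 / d%:R : R)%:C by rewrite !mul1r fmorphV rmorph_nat.
  apply/eqP => /(congr1 (fun z => complex.Re z)).
  rewrite /w dr /e2pi /cexp /= !mul0r oppr0 !mulr0 !subr0 expR0 mul1r add0r.
  rewrite mulrN cosN mul1r addr0 => h.
  have dR : 1 < (d%:R : R) by rewrite ltr1n.
  have p0 := @pi_gt0 R.
  have h0 : 0 < 2 * pi / d%:R :> R by rewrite !mulr_gt0 // invr_gt0; lra.
  have h1 : 2 * pi / d%:R <= pi :> R.
    rewrite ler_pdivrMr; last by lra.
    by rewrite mulrC ler_pM2l // (ler_nat R 2).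
  have : cos (2 * pi / d%:R) < cos 0 :> R.
    by rewrite ltr_cos // in_itv /= ?lexx ?(ltW p0) ?(ltW h0) ?h1.
  by rewrite h cos0 ltxx.
rewrite E; have := subrX1 w d; rewrite wd subrr => /esym/eqP.
by rewrite mulf_eq0 subr_eq0 (negbTE w1) => /eqP.
Qed.

Lemma hecke10E m (f : C -> C) t : (0 < m)%N ->
  m%:R ^+ 11 * hecke (- 10) m f t =
  \sum_(d <- divisors m) d%:R ^+ 10 * \sum_(b < d) f (((m %/ d)%:R * t + b%:R) / d%:R).
Proof.
move=> m0; rewrite /hecke mulrA.
have -> : m%:R ^+ 11 * m%:R ^ (- 10 - 1) = 1 :> C.
  have -> : (- 10 - 1 : int) = - 11%:Z by [].
  by rewrite -exprnN mulfV // expf_neq0 // pnatr_eq0; lia.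
by rewrite mul1r; apply: eq_bigr => d _; rewrite opprK exprnP.
Qed.

(** For Im t > m Y every argument (a t + b) / d still has imaginary part at least Y. The polar parts
    with d > 1 cancel in the sum over b by [sum_roots_unity], which leaves q^(-m) from d = 1. *)
Lemma hecke_asym (M : C -> C) (fa : C) (Y K : R) m : 0 < Y -> (0 < m)%N ->
  (forall z, Y <= complex.Im z -> nm (M z - fa * (e2pi z)^-1) <= K) ->
  exists K e : R, 0 < e /\ forall q, 0 < q < e ->
  nm (m%:R ^+ 11 * hecke (- 10) m M (tq q) - fa * (q%:C ^+ m)^-1) <= K.
Proof.
move=> Y0 m0 HK.
have mR : 0 < m%:R :> R by rewrite ltr0n.
have p0 := @pi_gt0 R.
exists (\sum_(d <- divisors m) d%:R ^+ 10 * (d%:R * K)), (expR (- (2 * pi * (m%:R * Y)))).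
split; first exact: expR_gt0.
move=> q /andP[q0 qe]; rewrite (hecke10E _ _ m0).
pose t := tq q; pose y := complex.Im t.
have yY : m%:R * Y < y.
  rewrite /y /= ltr_pdivlMr ?mulr_gt0 // mulrC ltrNr -ltr_expR lnK //.
pose z d b : C := ((m %/ d)%:R * t + b%:R) / d%:R.
have zY d b : d \in divisors m -> Y <= complex.Im (z d b).
  rewrite -dvdn_divisors // => dm; have d0 : (0 < d)%N by apply: dvdn_gt0 dm.
  have -> : complex.Im (z d b) = (m %/ d)%:R * y / d%:R.
    rewrite /z /y; have nd (k : nat) : (k%:R : C) = (k%:R : R)%:C by rewrite rmorph_nat.
    rewrite !nd -fmorphV; case: (t) => a c /=.
    by rewrite !mul0r !mulr0 ?addr0 ?add0r.
  have dR : 0 < d%:R :> R by rewrite ltr0n.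
  rewrite ler_pdivlMr //.
  have h1 : 1 <= (m %/ d)%:R :> R by rewrite ler1n divn_gt0 // dvdn_leq.
  have h2 : d%:R <= m%:R :> R by rewrite ler_nat dvdn_leq.
  apply: (@le_trans _ _ y); last by rewrite ler_peMl // ltW // (lt_trans _ yY) // mulr_gt0.
  by apply: le_trans (ltW yY); rewrite mulrC ler_wpM2r // ltW.
have main : \sum_(d <- divisors m) d%:R ^+ 10 * \sum_(b < d) fa * (e2pi (z d b))^-1 = fa * (q%:C ^+ m)^-1.
  rewrite (bigD1_seq 1%N) ?divisors_uniq //=; last by rewrite -dvdn_divisors // dvd1n.
  have -> : \sum_(d <- divisors m | d != 1%N) d%:R ^+ 10 * \sum_(b < d) fa * (e2pi (z d b))^-1 = 0; last first.
    by rewrite addr0 expr1n mul1r big_ord1 /z divn1 addr0 divr1 -e2piX e2pi_tq.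
  rewrite big_seq_cond; apply: big1 => d /andP[].
  rewrite -dvdn_divisors // => dm d1; have d0 : (0 < d)%N by apply: dvdn_gt0 dm.
  have dC : (d%:R : C) != 0 by rewrite pnatr_eq0; lia.
  rewrite -mulr_sumr.
  have -> : \sum_(b < d) (e2pi (z d b))^-1 = e2pi (- ((m %/ d)%:R * t / d%:R)) * \sum_(b < d) e2pi (- (b%:R / d%:R)).
    rewrite mulr_sumr; apply: eq_bigr => b _; rewrite -e2piN -e2piD; congr e2pi.
    by rewrite /z; field.
  by rewrite sum_roots_unity ?mulr0 //; lia.
rewrite -main -sumrB; apply: le_trans (nm_sum _ _ _) _.
rewrite big_seq [leRHS]big_seq; apply: ler_sum => d dm.
rewrite -mulrBr -sumrB nmM nmX nm_nat ler_wpM2l ?exprn_ge0 //.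
apply: le_trans (nm_sum _ _ _) _; apply: (@le_trans _ _ (\sum_(b < d) K)).
  by apply: ler_sum => b _; apply: HK; apply: zY.
by rewrite sumr_const card_ord mulr_natl.
Qed.

End MockBound.

(** * From the defining relation to identities of q-expansions *)

Section FromHypothesis.
Variable R : realType.
Local Notation C := R[i].
Local Notation cst := (@fps_cst C).

(** [Df] is the q-expansion of Delta and [d1f] that of Delta/q; thus coefficient n of [d1f] is tau(n
    + 1). *)
Definition Df : fps C := Fps (fun n => cf (E4f R ^+ 3 - E6f R ^+ 2) n / 1728).
Definition d1f : fps C := Fps (fun n => cf Df n.+1).

Lemma n1728 : (1728 : C) != 0. Proof. by rewrite pnatr_eq0. Qed.

Lemma Df1728 : 1728 * Df = E4f R ^+ 3 - E6f R ^+ 2.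
Proof.
apply: fpsP => n; rewrite -cst_nat cf_cstM /Df.
set g := E4f R ^+ 3 - _; change (1728 * (cf g n / 1728) = cf g n).
by rewrite mulrC mulfVK ?n1728.
Qed.

Lemma cf_E4_0 : cf (E4f R) 0 = 1. Proof. by []. Qed.
Lemma cf_E6_0 : cf (E6f R) 0 = 1. Proof. by []. Qed.

Lemma Df_X : Df = fX C * d1f.
Proof.
apply: fpsP => -[|n]; rewrite cf_XM //.
change (cf (E4f R ^+ 3 - E6f R ^+ 2) 0 / 1728 = 0).
by rewrite cfB !cfX0 cf_E4_0 cf_E6_0 !expr1n subrr mul0r.
Qed.

Lemma sigma1 nu : sigma nu 1 = 1%N.
Proof. by rewrite /sigma /divisors /= big_seq1 exp1n. Qed.

Lemma cf_sq1 (f : fps C) : cf f 0 = 1 -> cf (f ^+ 2) 1 = 2 * cf f 1.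
Proof.
move=> f0; transitivity (cf f 0 * cf f 1 + (cf f 1 * cf f 0 + 0)); last by rewrite f0; ring.
by rewrite expr2 cfM !big_ord_recl big_ord0.
Qed.

Lemma d1f_0 : cf d1f 0 = 1.
Proof.
change (cf (E4f R ^+ 3 - E6f R ^+ 2) 1 / 1728 = 1).
rewrite cfB cf_sq1 ?cf_E6_0 // exprS cfM !big_ord_recl big_ord0.
have -> : (1 - lift ord0 ord0 = 0)%N by [].
rewrite subn0 cfX0 cf_E4_0 expr1n cf_sq1 ?cf_E4_0 //.
change ((1 * (2 * e4c R 1) + (e4c R 1 * 1 + 0) - 2 * e6c R 1) / 1728 = 1).
rewrite /e4c /e6c !sigma1.
by rewrite (_ : _ - _ = 1728) ?divff ?n1728 //; ring.
Qed.

Lemma coef_sumX (K : nzRingType) (a : nat -> K) n i :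
  (\sum_(1 <= k < n.+1) a k *: 'X^k)`_i = if (0 < i <= n)%N then a i else 0.
Proof.
rewrite coef_sum; under eq_bigr => k _ do rewrite coefZ coefXn.
case: ifP => [/andP[i0 iN]|h].
  rewrite (bigD1_seq i) ?iota_uniq //=; last by rewrite mem_index_iota i0 ltnS.
  rewrite eqxx mulr1 big1 ?addr0 // => k /negbTE ki.
  by rewrite eq_sym ki mulr0.
rewrite big_seq big1 // => k; rewrite mem_index_iota ltnS => kn.
case: eqP => [ik|_]; last by rewrite mulr0.
by rewrite -ik h in kn.
Qed.

Lemma map_E4_trunc n i : (i <= n)%N -> (map_poly (@ratr C) (E4_trunc n))`_i = e4c R i.
Proof.
move=> iN; rewrite coef_map /= /E4_trunc coefD coefZ coef_sumX coef1.
case: i iN => [|i] iN /=; first by rewrite mulr0 addr0 rmorph1.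
by rewrite iN add0r rmorphM !rmorph_nat.
Qed.

Lemma map_E6_trunc n i : (i <= n)%N -> (map_poly (@ratr C) (E6_trunc n))`_i = e6c R i.
Proof.
move=> iN; rewrite coef_map /= /E6_trunc coefB coefZ coef_sumX coef1.
case: i iN => [|i] iN /=; first by rewrite mulr0 subr0 rmorph1.
by rewrite iN sub0r rmorphN rmorphM !rmorph_nat.
Qed.

Lemma tau_cf n : ratr (ramanujan_tau n) = cf Df n.
Proof.
rewrite /ramanujan_tau fmorph_div rmorph_nat.
change (cf Df n) with (cf (E4f R ^+ 3 - E6f R ^+ 2) n / 1728); congr (_ / _).
transitivity ((map_poly ratr (E4_trunc n) ^+ 3 - map_poly ratr (E6_trunc n) ^+ 2 : {poly C})`_n).
  by rewrite -!rmorphXn -rmorphB coef_map.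
rewrite coefB cfB; congr (_ - _).
  rewrite !exprS !expr0 !mulr1; apply/esym/fps_mul_coef => i iN; first exact: map_E4_trunc.
  by apply/esym/fps_mul_coef => j ji; apply: map_E4_trunc; apply: leq_trans ji iN.
rewrite !expr2; apply/esym/fps_mul_coef => i iN; exact: map_E6_trunc.
Qed.

Definition ev (P : R -> Prop) := exists2 e : R, 0 < e & forall q, 0 < q < e -> P q.

Lemma evI P Q : ev P -> ev Q -> ev (fun q => P q /\ Q q).
Proof.
move=> [e e0 H] [d d0 G]; exists (Num.min e d); first by rewrite lt_min e0.
move=> q; rewrite lt_min => /andP[q0 /andP[qe qd]].
by split; [apply: H|apply: G]; rewrite q0.
Qed.

Lemma rep1_neq0 (phi : R -> C) (f : fps C) : rep 1 phi f -> cf f 0 = 1 -> ev (fun q => phi q != 0).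
Proof.
move=> [K [e [e0 HK]]] f0.
have K1 : 0 < `|K| + 1 by rewrite ltr_wpDl.
exists (Num.min e (`|K| + 1)^-1); first by rewrite lt_min e0 invr_gt0.
move=> q; rewrite lt_min => /andP[q0 /andP[qe qK]]; apply/eqP => p0.
have := HK q; rewrite q0 qe => /(_ isT).
have -> : (fps_tr 1 f).[q%:C] = 1 by rewrite /fps_tr horner_poly big_ord1 f0 mul1r expr0.
rewrite p0 sub0r nmN nm1 expr1 leNgt => /negP; apply.
apply: (@le_lt_trans _ _ ((`|K| + 1) * q)).
  by rewrite ler_wpM2r ?(ltW q0) //; apply: le_trans (ler_norm K) _; rewrite lerDl.
by rewrite mulrC -ltr_pdivlMr // mul1r.
Qed.

Lemma rep_Delta N : rep N (fun q => Delta (tq q)) Df.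
Proof.
have h := repD (repX 3 (rep_E4 R N)) (repN (repX 2 (rep_E6 R N))).
have := repM h (rep_cst N (1728^-1 : C)).
have -> : (E4f R ^+ 3 - E6f R ^+ 2) * cst 1728^-1 = Df.
  by apply: fpsP => n; rewrite mulrC cf_cstM mulrC.
by [].
Qed.

Lemma rep_divX N (phi : R -> C) (f : fps C) : rep N.+1 phi (fX C * f) -> rep N (fun q => phi q / q%:C) f.
Proof.
move=> [K [e [e0 HK]]]; exists K, e; split=> // q qe; have /andP[q0 _] := qe.
have qC : q%:C != 0 by rewrite (inj_eq (@complexI R)) gt_eqF.
have -> : phi q / q%:C - (fps_tr N f).[q%:C] = (phi q - (fps_tr N.+1 (fX C * f)).[q%:C]) / q%:C.
  rewrite mulrBl; congr (_ - _); apply: (canRL (mulfK qC)).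
  rewrite /fps_tr !horner_poly big_ord_recl cf_XM mul0r add0r mulr_suml.
  by apply: eq_bigr => i _; rewrite cf_XM exprSr mulrA.
rewrite nmM nmV nm_real ger0_norm ?(ltW q0) // ler_pdivrMr // -mulrA -exprSr.
exact: HK.
Qed.

Lemma rep_d1 N : rep N (fun q => Delta (tq q) / q%:C) d1f.
Proof. by apply: rep_divX; rewrite -Df_X; apply: rep_Delta. Qed.

(** At t = i the number q = e^(- 2 pi) is positive, so every partial sum has real part at least
    1. *)
Lemma E4_i_neq0 : E4 (unit_arc 0 : C) != 0.
Proof.
have h : -1 < (0 : R) < 1 by apply/andP; split; lra.
have c := E4_cto (arc_Im h); apply/eqP => e0; rewrite e0 in c.
have [N HN] := c 1 ltr01; have := HN N (leqnn N).
have qE : e2pi (unit_arc 0 : C) = (expR (- (2 * pi)))%:C.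
  rewrite unit_arc0 /e2pi /cexp /= !mul0r !mulr0 addr0 sub0r cos0 sin0 mulr1.
  by rewrite mulr1.
rewrite subr0 ger0_norm ?nm_ge0 // ltNge => /negP; apply.
apply: le_trans (nm_ge_Re _); apply: le_trans (ler_norm _).
have -> : 1 + 240 * (\sum_(0 <= n < N) (sigma 3 n.+1)%:R * e2pi (unit_arc 0) ^+ n.+1) =
  (1 + 240 * (\sum_(0 <= n < N) (sigma 3 n.+1)%:R * expR (- (2 * pi)) ^+ n.+1) : R)%:C.
  rewrite rmorphD rmorph1 rmorphM rmorph_nat rmorph_sum; congr (1 + _ * _).
  by apply: eq_bigr => n _; rewrite rmorphM rmorphXn rmorph_nat qE.
rewrite [complex.Re _]/= lerDl; apply: mulr_ge0; first exact: ler0n.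
by apply: sumr_ge0 => n _; rewrite mulr_ge0 ?exprn_ge0 ?expR_ge0.
Qed.

Lemma jinv_i : jinv (unit_arc 0 : C) = 1728.
Proof.
rewrite /jinv /Delta E6_i expr0n subr0 invf_div mulrCA mulfV ?mulr1 //.
by rewrite expf_neq0 // E4_i_neq0.
Qed.

(** The form in which the defining relation is used: F_m(j) = E4 E6 G with G = q^(-m) - tau(m)
    q^(-1) + O(1) at the cusp. *)
Definition good m (FC : {poly C}) (G : C -> C) :=
  (forall t, 0 < complex.Im t -> FC.[jinv t] = E4 t * E6 t * G t) /\
  exists K e : R, 0 < e /\ forall q, 0 < q < e ->
    nm (G (tq q) - ((q%:C ^+ m)^-1 - cf d1f m.-1 * (q%:C)^-1)) <= K.

Lemma good_alg (fa h M tau x y : C) : fa != 0 ->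
  fa^-1 * (h - tau * M) - (x - tau * y) = fa^-1 * ((h - fa * x) - tau * (M - fa * y)).
Proof. by move=> f0; field. Qed.

Lemma good_gen (fa tau : C) (H M : C -> C) m (K1 e1 K2 e2 : R) : fa != 0 -> 0 < e1 -> 0 < e2 ->
  (forall q, 0 < q < e1 -> nm (H (tq q) - fa * (q%:C ^+ m)^-1) <= K1) ->
  (forall q, 0 < q < e2 -> nm (M (tq q) - fa * (q%:C)^-1) <= K2) ->
  exists K e : R, 0 < e /\ forall q, 0 < q < e ->
    nm (fa^-1 * (H (tq q) - tau * M (tq q)) - ((q%:C ^+ m)^-1 - tau * (q%:C)^-1)) <= K.
Proof.
move=> f0 e10 e20 H1 H2; exists (nm fa^-1 * (K1 + nm tau * K2)), (Num.min e1 e2).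
split; first by rewrite lt_min e10.
move=> q; rewrite lt_min => /andP[q0 /andP[q1 q2]].
rewrite (good_alg _ _ _ _ _ f0) nmM ler_wpM2l ?nm_ge0 //.
apply: le_trans (nmB _ _) _; apply: lerD; first by apply: H1; rewrite q0.
by rewrite nmM ler_wpM2l ?nm_ge0 //; apply: H2; rewrite q0.
Qed.

Lemma is_F_good m (F : {poly int}) : (2 <= m)%N -> is_F R m F ->
  exists G, good m (map_poly intr F) G.
Proof.
move=> m2 [_ _ HF]; have [Y [K [Y0 HK]]] := M_Delta_bound R.
have fa0 : (11`!)%:R != 0 :> C by rewrite pnatr_eq0 -lt0n fact_gt0.
(* The factorial is generalised so that no later step unfolds it. *)
move: HF HK fa0; move: ((11`!)%:R) => fa HF HK fa0.
have m0 : (0 < m)%N by apply: leq_trans m2.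
have [K1 [e1 [e10 H1]]] := hecke_asym Y0 m0 HK.
exists (fun t => fa^-1 * (m%:R ^+ 11 * hecke (- 10) m (@M_Delta R) t - ratr (ramanujan_tau m) * M_Delta t)); split.
  move=> t t0; rewrite (HF t t0); move: (_ - _) (E4 t * E6 t) => x y; by rewrite mulrA.
have -> : cf d1f m.-1 = ratr (ramanujan_tau m) by rewrite tau_cf; case: m m2 {HF m0 H1}.
apply: (good_gen (H := fun t => m%:R ^+ 11 * hecke (- 10) m (@M_Delta R) t) (M := @M_Delta R) _ fa0 e10 (expR_gt0 (- (2 * pi * Y))) H1 (K2 := K)).
move=> q /andP[q0 qe]; rewrite -(e2pi_tq q0); apply: HK.
have p0 := @pi_gt0 R.
by rewrite ler_pdivlMr ?mulr_gt0 // mulrC lerNr -ler_expR lnK // ltW.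
Qed.

Section OneF.
Variables (m : nat) (F : {poly int}).
Hypothesis m2 : (2 <= m)%N.
Hypothesis HF : is_F R m F.
Local Notation FC := (map_poly intr F : {poly C}).

Lemma FC_0 : FC.[0] = 0.
Proof.
have [G [H _]] := is_F_good m2 HF; have h : -1 < - (1 / 2 : R) < 1 by apply/andP; split; lra.
by have := H (rho R) (arc_Im h); rewrite jinv_rho E4_rho mul0r mul0r.
Qed.

Lemma FC_1728 : FC.[1728] = 0.
Proof.
have [G [H _]] := is_F_good m2 HF; have h : -1 < (0 : R) < 1 by apply/andP; split; lra.
by have := H (unit_arc 0) (arc_Im h); rewrite jinv_i E6_i mulr0 mul0r.
Qed.

Lemma size_FC : size FC = m.+1.
Proof.
case: HF => [mo sz _]; rewrite size_map_poly_id0 ?sz //.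
by rewrite (monicP mo) rmorph1 oner_eq0.
Qed.

Lemma F_root : F.[0] = 0 /\ F.[1728] = 0.
Proof.
have inj : injective (intr : int -> C) by apply: intr_inj.
split; apply: inj; rewrite /= -horner_map /= rmorph0.
  exact: FC_0.
have -> : (1728%:~R : C) = 1728 by rewrite rmorph_nat.
exact: FC_1728.
Qed.

Lemma FC_factor : exists P : {poly C}, FC = P * 'X * ('X - 1728%:P) /\ (size P <= m.-1)%N.
Proof.
have /factor_theorem[Q QE] : root FC 0 by apply/rootP; exact: FC_0.
have QE' : FC = Q * 'X by rewrite QE subr0.
have /factor_theorem[P PE] : root Q 1728.
  apply/rootP; have := FC_1728; rewrite QE' hornerM hornerX => /eqP.
  by rewrite mulf_eq0 (negbTE n1728) orbF => /eqP.
exists P; rewrite QE' PE mulrAC; split=> //.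
have := size_FC; rewrite QE' PE.
have [->|P0] := eqVneq P 0; first by rewrite !mul0r size_poly0.
rewrite size_mulX ?mulf_neq0 ?polyXsubC_eq0 // size_Mmonic ?monicXsubC // size_XsubC.
by rewrite addn2 /= => -[] <-.
Qed.

End OneF.

Lemma hom_eval n (P : {poly C}) (E D : C) : (size P <= n.+1)%N -> D != 0 ->
  \sum_(k < n.+1) P`_k * E ^+ k * D ^+ (n - k) = D ^+ n * P.[E / D].
Proof.
move=> sP D0; rewrite (horner_coef_wide _ sP) mulr_sumr; apply: eq_bigr => k _.
have kn : (k <= n)%N by rewrite -ltnS.
have -> : D ^+ n = D ^+ (n - k) * D ^+ k by rewrite -exprD subnK.
have Dk : D ^+ k != 0 by rewrite expf_neq0.
rewrite expr_div_n; move: (P`_k) (E ^+ k) (D ^+ (n - k)) (D ^+ k) Dk => p x y z z0.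
by field.
Qed.

Lemma Delta_eq (t : C) : E4 t ^+ 3 - E6 t ^+ 2 = 1728 * Delta t.
Proof.
rewrite /Delta; move: (_ - _) (1728 : C) n1728 => x y y0.
by rewrite mulrC mulfVK.
Qed.

Lemma hom_alg (P : {poly C}) (E S D G : C) : E != 0 -> S != 0 -> D != 0 ->
  E ^+ 3 - S ^+ 2 = 1728 * D ->
  (P * 'X * ('X - 1728%:P)).[E ^+ 3 / D] = E * S * G ->
  P.[E ^+ 3 / D] * (E ^+ 2 * S) = D ^+ 2 * G.
Proof.
move=> E0 S0 D0 eq; rewrite !hornerM hornerXsubC hornerX; move: (P.[_]) => p h.
have h2 : E ^+ 3 / D - 1728 = S ^+ 2 / D.
  by apply: (mulIf D0); rewrite mulrBl !divfK // -eq opprB addrC subrK.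
rewrite h2 in h; apply: (mulfI (mulf_neq0 E0 S0)).
transitivity (p * (E ^+ 3 / D) * (S ^+ 2 / D) * D ^+ 2); first by field.
by rewrite h; ring.
Qed.

Lemma pole_alg (D g c q : C) n : q != 0 ->
  D ^+ n * (D ^+ 2 * g) - (D / q) ^+ n.+2 * (1 - c * q ^+ n.+1) =
  D ^+ n.+2 * (g - ((q ^+ n.+2)^-1 - c * q^-1)).
Proof.
move=> q0; have -> : D ^+ n * (D ^+ 2 * g) = D ^+ n.+2 * g.
  by rewrite mulrA -exprD addn2.
rewrite expr_div_n; have qn : q ^+ n.+1 != 0 by rewrite expf_neq0.
rewrite [q ^+ n.+2]exprS; move: (D ^+ n.+2) (q ^+ n.+1) qn => E w w0.
by field; rewrite q0.
Qed.

(** Since j (j - 1728) = E4^3 E6^2 / Delta^2, the relation divided by E4 E6 gives P(j) E4^2 E6 =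
    Delta^2 G. After multiplication by Delta^n the bounded part of G carries Delta^(n+2) =
    O(q^(n+2)), so both sides agree up to degree n + 1. *)
Lemma HP_of_good n (FC P : {poly C}) (G : C -> C) : good n.+2 FC G ->
  FC = P * 'X * ('X - 1728%:P) -> (size P <= n.+1)%N ->
  forall i, (i < n.+2)%N ->
  cf (hom (E4f R) d1f P n * (E4f R ^+ 2 * E6f R)) i =
  cf (d1f ^+ n.+2 * (1 - cst (cf d1f n.+1) * fX C ^+ n.+1)) i.
Proof.
move=> [HG [K [e1 [e10 HK]]]] FE sP.
pose phi q := (\sum_(k < n.+1) P`_k * (E4 (tq q) ^+ 3) ^+ k * (Delta (tq q)) ^+ (n - k)) * (E4 (tq q) ^+ 2 * E6 (tq q)).
pose psi (q : R) := (Delta (tq q) / q%:C) ^+ n.+2 * (1 - cf d1f n.+1 * q%:C ^+ n.+1).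
apply: (@rep_uniq R n.+2 phi psi).
- apply: repM; last by apply: repM; [apply: repX; apply: rep_E4|apply: rep_E6].
  apply: rep_sum => k; apply: repM; last by apply: repX; rewrite -Df_X; apply: rep_Delta.
  by apply: repM; [apply: rep_cst|apply: repX; apply: repX; apply: rep_E4].
- apply: repM; first by apply: repX; apply: rep_d1.
  apply: repD; first exact: (rep_cst n.+2 1).
  by apply: repN; apply: repM; [apply: rep_cst|apply: repX; apply: rep_X].
have evG : ev (fun q => nm (G (tq q) - ((q%:C ^+ n.+2)^-1 - cf d1f n.+1 * (q%:C)^-1)) <= K).
  by exists e1.
have ev1 : ev (fun q => q < 1) by exists 1 => // q /andP[].
have ev4 := rep1_neq0 (rep_E4 R 1) cf_E4_0.
have ev6 := rep1_neq0 (rep_E6 R 1) cf_E6_0.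
have evD := rep1_neq0 (rep_d1 1) d1f_0.
have [A [eA [eA0 HA]]] := rep_d1 0.
have evA : ev (fun q => nm (Delta (tq q) / q%:C) <= A).
  exists eA; first exact: eA0.
  by move=> q /HA; rewrite /fps_tr horner_poly big_ord0 subr0 expr0 mulr1.
have [e e0 He] := evI evG (evI ev1 (evI ev4 (evI ev6 (evI evD evA)))).
exists (A ^+ n.+2 * K), e; split=> // q qe; have /andP[q0 _] := qe.
have [hG [q1 [h4 [h6 [hD hA]]]]] := He q qe.
have qC : q%:C != 0 by rewrite (inj_eq (@complexI R)) gt_eqF.
have hD' : Delta (tq q) != 0 by apply: contraNneq hD => ->; rewrite mul0r.
have t0 : 0 < complex.Im (tq q) by apply: tq_Im; rewrite q0.
have := HG (tq q) t0; rewrite FE => /(hom_alg h4 h6 hD' (Delta_eq _)) hh.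
have hphi : phi q = Delta (tq q) ^+ n * (Delta (tq q) ^+ 2 * G (tq q)).
  rewrite /phi (hom_eval _ sP hD'); move: (Delta (tq q) ^+ n) => w.
  by rewrite -mulrA hh.
rewrite hphi /psi.
rewrite (pole_alg _ _ _ _ qC).
rewrite nmM nmX [leRHS]mulrAC -exprMn; apply: ler_pM; rewrite ?exprn_ge0 ?nm_ge0 //.
rewrite lerXn2r ?nnegrE ?nm_ge0 //.
  by rewrite mulr_ge0 ?(ltW q0) //; apply: le_trans hA; apply: nm_ge0.
by move: hA; rewrite nmM nmV nm_real (ger0_norm (ltW q0)) ler_pdivrMr.
Qed.

End FromHypothesis.

(** * Values and bounds of power series *)

Section FpsValues.
Variable R : realType.
Local Notation C := R[i].
Local Notation cst := (@fps_cst C).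
Implicit Types (f g h : fps C) (r l : C) (s K A Y : R).

(** A bound for the weighted norm, the sum of |f_k| s^k. The norm is submultiplicative by [absbM],
    so estimates on the disc of radius s are obtained by algebra. *)
Definition absb f s K := forall N, \sum_(0 <= k < N) nm (cf f k) * s ^+ k <= K.
Definition fval f r l := cto (fun N => \sum_(0 <= k < N) cf f k * r ^+ k) l.

Lemma absb_ge0 f s K : absb f s K -> 0 <= K.
Proof. by move/(_ 0%N); rewrite big_geq. Qed.

Lemma absb_term f s k : 0 <= s -> 0 <= nm (cf f k) * s ^+ k.
Proof. by move=> s0; rewrite mulr_ge0 ?nm_ge0 ?exprn_ge0. Qed.

Lemma absbW f s K L : absb f s K -> K <= L -> absb f s L.
Proof. by move=> h KL N; apply: le_trans (h N) KL. Qed.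

Lemma absb_coef f s K k : 0 <= s -> absb f s K -> nm (cf f k) * s ^+ k <= K.
Proof.
move=> s0 /(_ k.+1); apply: le_trans; rewrite big_nat_recr //= lerDr.
by apply: sumr_ge0 => i _; apply: absb_term.
Qed.

Lemma absb_tail f s s' K p N : 0 <= s' <= s -> 0 < s -> absb f s K ->
  \sum_(p <= k < N) nm (cf f k) * s' ^+ k <= (s' / s) ^+ p * K.
Proof.
move=> /andP[s'0 s's] s0 h; have q0 : 0 <= s' / s by rewrite divr_ge0 // ltW.
have q1 : s' / s <= 1 by rewrite ler_pdivrMr // mul1r.
apply: (@le_trans _ _ ((s' / s) ^+ p * \sum_(p <= k < N) nm (cf f k) * s ^+ k)).
  rewrite mulr_sumr; apply: ler_sum_nat => k /andP[pk _].
  rewrite mulrCA ler_wpM2l ?nm_ge0 //.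
  have -> : s' ^+ k = (s' / s) ^+ k * s ^+ k by rewrite -exprMn divfK ?gt_eqF.
  by rewrite ler_wpM2r ?exprn_ge0 ?(ltW s0) // ler_wiXn2l.
rewrite ler_wpM2l ?exprn_ge0 //; apply: le_trans (h (maxn p N)).
case: (leqP p N) => pN; last by rewrite big_geq ?sumr_ge0 ?(ltnW pN) // => i _; apply: absb_term; apply: ltW.
rewrite [leRHS](big_cat_nat (n := p)) //= lerDr.
by apply: sumr_ge0 => i _; apply: absb_term; apply: ltW.
Qed.

Lemma absb_le f s s' K : 0 <= s' <= s -> 0 < s -> absb f s K -> absb f s' K.
Proof. by move=> h s0 hf N; have := absb_tail 0 N h s0 hf; rewrite expr0 mul1r. Qed.

Lemma absbD f g s K L : 0 <= s -> absb f s K -> absb g s L -> absb (f + g) s (K + L).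
Proof.
move=> s0 hf hg N; apply: le_trans (lerD (hf N) (hg N)); rewrite -big_split /=.
by apply: ler_sum => k _; rewrite -mulrDl ler_wpM2r ?exprn_ge0 // nmD.
Qed.

Lemma absbN f s K : absb f s K -> absb (- f) s K.
Proof. by move=> h N; under eq_bigr do rewrite cfN nmN; apply: h. Qed.

Lemma absbB f g s K L : 0 <= s -> absb f s K -> absb g s L -> absb (f - g) s (K + L).
Proof. by move=> s0 hf hg; apply: absbD => //; apply: absbN. Qed.

Lemma absb_cst c s : absb (cst c) s (nm c).
Proof.
case=> [|N]; first by rewrite big_geq // nm_ge0.
rewrite big_nat_recl // expr0 mulr1 big1 ?addr0 // => i _.
by rewrite /= nm0 mul0r.
Qed.

Lemma absb_X s : 0 <= s -> absb (fX C) s s.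
Proof.
move=> s0; case=> [|[|N]]; first by rewrite big_geq.
  by rewrite big_nat1 /= nm0 mul0r.
rewrite big_nat_recl // big_nat_recl //= big1 ?addr0 => [|i _]; last by rewrite nm0 mul0r.
by rewrite nm0 nm1 mul0r add0r mul1r expr1.
Qed.

Lemma poly1_sum (p : {poly R}) N M : (forall k, 0 <= p`_k) -> (size p <= M)%N ->
  \sum_(0 <= k < N) p`_k <= p.[1].
Proof.
move=> p0 sM; rewrite (@horner_coef_wide _ (maxn N M)) ?(leq_trans sM) ?leq_maxr //.
under [leRHS]eq_bigr do rewrite expr1n mulr1.
rewrite -(big_mkord predT (fun k => p`_k)) [leRHS](big_cat_nat (n := N)) ?leq_maxl //= lerDl.
by apply: sumr_ge0.
Qed.

Lemma absbM f g s K L : 0 <= s -> absb f s K -> absb g s L -> absb (f * g) s (K * L).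
Proof.
move=> s0 hf hg N.
pose p := \poly_(k < N) (nm (cf f k) * s ^+ k); pose q := \poly_(k < N) (nm (cf g k) * s ^+ k).
have E (h : fps C) : (\poly_(k < N) (nm (cf h k) * s ^+ k)).[1] = \sum_(0 <= k < N) nm (cf h k) * s ^+ k.
  by rewrite horner_poly big_mkord; apply: eq_bigr => k _; rewrite expr1n mulr1.
have P (h : fps C) k : 0 <= (\poly_(k < N) (nm (cf h k) * s ^+ k))`_k.
  by rewrite coef_poly; case: ifP => // _; apply: absb_term.
apply: (@le_trans _ _ (\sum_(0 <= k < N) (p * q)`_k)).
  apply: ler_sum_nat => k /andP[_ kN]; rewrite cfM coefM.
  apply: le_trans (ler_wpM2r (exprn_ge0 _ s0) (nm_sum _ _ _)) _; rewrite mulr_suml.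
  apply: ler_sum => j _; have jk : (j <= k)%N by rewrite -ltnS.
  rewrite !coef_poly (leq_ltn_trans jk kN) (leq_ltn_trans (leq_subr _ _) kN) nmM mulrACA.
  by rewrite -exprD subnKC.
apply: le_trans (poly1_sum (M := size (p * q)) _ _ (leqnn _)) _ => [k|].
  by rewrite coefM; apply: sumr_ge0 => j _; apply: mulr_ge0; apply: P.
rewrite hornerM !E; apply: ler_pM; rewrite ?hf ?hg //.
  by apply: sumr_ge0 => k _; apply: absb_term.
by apply: sumr_ge0 => k _; apply: absb_term.
Qed.

Lemma absbX f s K n : 0 <= s -> absb f s K -> absb (f ^+ n) s (K ^+ n).
Proof.
move=> s0 h; elim: n => [|n IH]; first by rewrite !expr0 -(nm1 R); apply: absb_cst.
by rewrite !exprS; apply: absbM.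
Qed.

Lemma absb_geom f s A Y : 0 <= A -> 0 <= Y -> 0 <= s -> s * Y < 1 ->
  (forall k, nm (cf f k) <= A * Y ^+ k) -> absb f s (A / (1 - s * Y)).
Proof.
move=> A0 Y0 s0 sY h N.
apply: (@le_trans _ _ (\sum_(0 <= k < N) A * (s * Y) ^+ k)).
  apply: ler_sum => k _; rewrite exprMn [s ^+ k * _]mulrC mulrA.
  by rewrite ler_wpM2r ?exprn_ge0.
by rewrite -mulr_sumr ler_wpM2l // geom_sum_le // mulr_ge0.
Qed.

Lemma absb_ev f s A Y p : 0 <= A -> 0 <= Y -> 0 <= s -> s * Y < 1 ->
  (forall k, (p <= k)%N -> nm (cf f k) <= A * Y ^+ k) -> exists K, absb f s K.
Proof.
move=> A0 Y0 s0 sY h; pose K := \sum_(0 <= k < p) nm (cf f k) * s ^+ k.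
pose g : fps C := Fps (fun k => if (p <= k)%N then cf f k else 0).
have hg : absb g s (A / (1 - s * Y)).
  apply: absb_geom => // k /=; case: ifP => [/h //|_].
  by rewrite nm0 mulr_ge0 ?exprn_ge0.
exists (K + A / (1 - s * Y)) => N; apply: (@le_trans _ _ (K + \sum_(0 <= k < N) nm (cf g k) * s ^+ k)); last by rewrite lerD2l.
have K0 M : 0 <= \sum_(0 <= k < M) nm (cf g k) * s ^+ k by apply: sumr_ge0 => k _; apply: absb_term.
case: (leqP N p) => Np.
  rewrite /K (big_cat_nat (n := N) (p := p)) //= -addrA lerDl addr_ge0 //.
  by apply: sumr_ge0 => k _; apply: absb_term.
rewrite (big_cat_nat (n := p)) //= ?(ltnW Np) // lerD2l [leRHS](big_cat_nat (n := p)) //= ?(ltnW Np) //.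
rewrite ler_wpDl //; apply: ler_sum_nat => k /andP[pk _] /=; by rewrite pk.
Qed.

Lemma fval_uniq f r l l' : fval f r l -> fval f r l' -> l = l'.
Proof. exact: cto_uniq. Qed.

Lemma fval_ex f s r K : absb f s K -> nm r <= s -> exists l, fval f r l.
Proof.
move=> h rs; apply: summable_cto; split=> [n|]; first exact: nm_ge0.
exists K => n; apply: le_trans (h n); apply: ler_sum => k _.
by rewrite nmM nmX ler_wpM2l ?nm_ge0 // lerXn2r // nnegrE ?nm_ge0 // (le_trans (nm_ge0 r)).
Qed.

Lemma fvalD f g r l k : fval f r l -> fval g r k -> fval (f + g) r (l + k).
Proof.
move=> hf hg; apply: (cto_eq (n0 := 0) (ctoD hf hg)) => n _.
by rewrite -big_split; apply: eq_bigr => i _; rewrite cfD mulrDl.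
Qed.

Lemma fvalN f r l : fval f r l -> fval (- f) r (- l).
Proof.
move=> hf; apply: (cto_eq (n0 := 0) (ctoN hf)) => n _.
by rewrite -sumrN; apply: eq_bigr => i _; rewrite cfN mulNr.
Qed.

Lemma fval_cst c r : fval (cst c) r c.
Proof.
apply: (cto_eq (n0 := 1) (cto_cst c)) => -[//|n] _.
by rewrite big_nat_recl // expr0 mulr1 big1 ?addr0 // => i _; rewrite /= mul0r.
Qed.

Lemma fval_X r : fval (fX C) r r.
Proof.
apply: (cto_eq (n0 := 2) (cto_cst r)) => -[//|[//|n]] _.
rewrite big_nat_recl // big_nat_recl //= big1 ?addr0 => [|i _]; last by rewrite mul0r.
by rewrite mul0r add0r mul1r expr1.
Qed.

Lemma fval_near f r l s K p : absb f s K -> 0 < s -> nm r <= s -> fval f r l ->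
  nm (l - \sum_(0 <= k < p) cf f k * r ^+ k) <= (nm r / s) ^+ p * K.
Proof.
move=> h s0 rs hf; have hs : 0 <= nm r <= s by rewrite nm_ge0.
have [N0 | ] := leqP 0 p; last by [].
apply: (@cto_nm_le _ (fun N => \sum_(0 <= k < maxn p N) cf f k * r ^+ k - \sum_(0 <= k < p) cf f k * r ^+ k)).
  apply: ctoB; last exact: cto_cst.
  by apply: (cto_sub (f := maxn p)) hf => n; apply: leq_maxr.
move=> N; rewrite (big_cat_nat (n := p)) ?leq_maxl //= addrAC subrr add0r.
apply: le_trans (nm_sum _ _ _) _; apply: le_trans (absb_tail p (maxn p N) hs s0 h).
by apply: ler_sum => k _; rewrite nmM nmX.
Qed.

Lemma fval_bound f r l s K : absb f s K -> 0 < s -> nm r <= s -> fval f r l -> nm l <= K.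
Proof.
by move=> h s0 rs /(fval_near 0 h s0 rs); rewrite big_geq // subr0 expr0 mul1r.
Qed.

(** The truncated product and the product of the truncations differ only in degrees from N to 2N,
    whose weight at r is at most (|r|/s)^N K L. It tends to 0 because |r| < s is strict. *)
Lemma fvalM f g r l k s K L : absb f s K -> absb g s L -> nm r < s ->
  fval f r l -> fval g r k -> fval (f * g) r (l * k).
Proof.
move=> af ag rs hf hg; have s0 : 0 < s by apply: le_lt_trans rs; apply: nm_ge0.
have x0 : 0 <= nm r / s < 1 by rewrite divr_ge0 ?nm_ge0 ?(ltW s0) //= ltr_pdivrMr // mul1r.
have K0 := absb_ge0 af; have L0 := absb_ge0 ag.
pose u N := \sum_(0 <= i < N) cf f i * r ^+ i; pose v N := \sum_(0 <= i < N) cf g i * r ^+ i.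
suff D N : nm (\sum_(0 <= i < N) cf (f * g) i * r ^+ i - u N * v N) <= (nm r / s) ^+ N * (K * L).
  have sm : small (fun N => (nm r / s) ^+ N * (K * L) + nm (u N * v N - l * k)).
    apply: smallD; last exact: ctoM hf hg.
    have := smallZ (K * L) (small_geom (x := nm r / s) _).
    move=> H; have /H h1 : `|nm r / s| < 1 by rewrite ger0_norm; case/andP: x0.
    by apply: (small_le (n0 := 0)) h1 _ => n _; rewrite mulrC.
  apply: (cto_le (n0 := 0) sm) => N _; apply: le_trans (lerD (D N) (lexx _)).
  by rewrite -[X in nm X](subrKA (u N * v N)) nmD.
pose f' : fps C := Fps (fun i => if (i < N)%N then cf f i else 0).
pose g' : fps C := Fps (fun i => if (i < N)%N then cf g i else 0).
have tr (h : fps C) M : absb h s M -> absb (Fps (fun i => if (i < N)%N then cf h i else 0)) s M.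
  move=> hh n; apply: le_trans (hh n); apply: ler_sum => i _; rewrite ler_wpM2r ?exprn_ge0 ?(ltW s0) //=.
  by case: ifP; rewrite ?nm0 ?nm_ge0.
have a' := absbM (ltW s0) (tr _ _ af) (tr _ _ ag).
have pE (h : fps C) i : (fps_tr N h)`_i = cf (Fps (fun i => if (i < N)%N then cf h i else 0)) i.
  by rewrite /fps_tr coef_poly.
have uv : u N * v N = \sum_(0 <= i < N + N) cf (f' * g') i * r ^+ i.
  have uE (h : fps C) : \sum_(0 <= i < N) cf h i * r ^+ i = (fps_tr N h).[r].
    by rewrite /fps_tr horner_poly big_mkord.
  rewrite /u /v !uE -hornerM (@horner_coef_wide _ (N + N)); last first.
    apply: leq_trans (size_polyMleq _ _) _; apply: leq_trans (leq_pred _) _.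
    by apply: leq_add; apply: size_poly.
  rewrite big_mkord; apply: eq_bigr => i _; congr (_ * _); apply/esym.
  by apply: (@fps_mul_coef _ f' g') => j _; rewrite pE.
rewrite uv (big_cat_nat (n := N) (m := 0) (p := N + N)) ?leq_addr //=.
have -> : \sum_(0 <= i < N) cf (f * g) i * r ^+ i = \sum_(0 <= i < N) cf (f' * g') i * r ^+ i.
  apply: eq_big_nat => i /andP[_ iN]; congr (_ * _).
  by apply: (@cfM_ext _ f f' g g' N) => // j jN /=; rewrite jN.
rewrite opprD addrA subrr add0r nmN; apply: le_trans (nm_sum _ _ _) _.
have hs : 0 <= nm r <= s by rewrite nm_ge0 ltW.
apply: le_trans (absb_tail N (N + N) hs s0 a').
by apply: ler_sum => i _; rewrite nmM nmX.
Qed.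

Lemma fdiv_coef f (G : fps C) r k : r != 0 -> (1 - cst r^-1 * fX C) * G = f ->
  cf G k * r ^+ k = \sum_(0 <= j < k.+1) cf f j * r ^+ j.
Proof.
move=> r0 <-; have E n : cf ((1 - cst r^-1 * fX C) * G) n = cf G n - r^-1 * (if n is n'.+1 then cf G n' else 0).
  by rewrite mulrBl mul1r -mulrA cfB cf_cstM cf_XM.
elim: k => [|k IH]; first by rewrite big_nat1 E mulr0 subr0.
rewrite big_nat_recr // -IH; rewrite [in X in _ = _ + X]E exprS.
move: (r ^+ k) (cf G k) (cf G k.+1) => z a b.
by field.
Qed.

(** By [fdiv_coef], G_k r^k is a partial sum of f(r). As f(r) = 0 it is minus the tail, which
    involves f_j only for j > k. The bound keeps its ratio Y, gains the factor |r| Y / (1 - |r| Y),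
    and now holds from one degree earlier. *)
Lemma fdiv_bound f (G : fps C) r A Y p : r != 0 -> (1 - cst r^-1 * fX C) * G = f -> fval f r 0 ->
  0 <= A -> 0 <= Y -> nm r * Y < 1 ->
  (forall j, (p < j)%N -> nm (cf f j) <= A * Y ^+ j) ->
  forall k, (p <= k)%N -> nm (cf G k) <= A * (nm r * Y) / (1 - nm r * Y) * Y ^+ k.
Proof.
move=> r0 fG f0 A0 Y0 rY fb k pk; set z := nm r * Y.
have rn : 0 < nm r by rewrite nm_gt0.
have z0 : 0 <= z by rewrite mulr_ge0 ?nm_ge0.
rewrite -(ler_pM2r (exprn_gt0 k rn)) -nmX -nmM (fdiv_coef k r0 fG).
set S := \sum_(0 <= j < k.+1) _.
apply: (@cto_nm_le _ (fun N => S - \sum_(0 <= j < maxn k.+1 N) cf f j * r ^+ j)).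
  rewrite -[X in cto _ X]subr0; apply: ctoB; first exact: cto_cst.
  by apply: (cto_sub (f := maxn k.+1)) f0 => n; apply: leq_maxr.
move=> N; rewrite (big_cat_nat (n := k.+1)) ?leq_maxl //= opprD addrA subrr add0r nmN.
apply: le_trans (nm_sum _ _ _) _.
apply: (@le_trans _ _ (\sum_(k.+1 <= j < maxn k.+1 N) A * z ^+ j)).
  apply: ler_sum_nat => j /andP[kj _]; rewrite nmM nmX /z exprMn mulrCA mulrC.
  by rewrite ler_wpM2l ?exprn_ge0 ?nm_ge0 // fb // (leq_ltn_trans pk).
rewrite -mulr_sumr -[X in A * X](_ : z ^+ k.+1 * \sum_(0 <= j < maxn k.+1 N - k.+1) z ^+ j = _); last first.
  apply/esym; have -> M : \sum_(k.+1 <= i < M) z ^+ i = \sum_(0 <= i < M - k.+1) z ^+ (i + k.+1).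
    by rewrite -{1}(add0n k.+1) big_addn.
  rewrite mulr_sumr; apply: eq_bigr => j _.
  by rewrite -exprD addnC.
have hz : 0 <= z < 1 by rewrite z0.
have g := geom_sum_le (maxn k.+1 N - k.+1) hz.
apply: le_trans (ler_wpM2l A0 (ler_wpM2l (exprn_ge0 k.+1 z0) g)) _.
by rewrite nmX exprS /z exprMn le_eqVlt; apply/orP; left; apply/eqP; ring.
Qed.

Lemma fdiv_ex f r : exists G : fps C, (1 - cst r^-1 * fX C) * G = f.
Proof.
have [|g gE _] := @fps_inv _ (1 - cst r^-1 * fX C).
  by rewrite cfB cf1 cf_cstM /= mulr0 subr0.
by exists (g * f); rewrite mulrA gE mul1r.
Qed.

Lemma fval_lin r r' : fval (1 - cst r^-1 * fX C) r' (1 - r' / r).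
Proof.
apply: fvalD; first exact: fval_cst.
apply: fvalN; have s0 : 0 <= nm r' + 1 by rewrite addr_ge0 ?nm_ge0.
have rs : nm r' < nm r' + 1 by rewrite ltrDl.
by have := fvalM (absb_cst r^-1 _) (absb_X s0) rs (fval_cst r^-1 r') (fval_X r'); rewrite [r^-1 * r']mulrC.
Qed.

Lemma absb_lin r s : 0 <= s -> absb (1 - cst r^-1 * fX C) s (nm 1 + nm r^-1 * s).
Proof.
move=> s0; apply: absbB => //; first exact: absb_cst.
by apply: absbM => //; [apply: absb_cst|apply: absb_X].
Qed.

Lemma fdiv_val0 f (G : fps C) r r' s K : (1 - cst r^-1 * fX C) * G = f -> absb G s K -> nm r' < s ->
  r != 0 -> r' != r -> fval f r' 0 -> fval G r' 0.
Proof.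
move=> fG aG rs r0 rr f0; have s0 : 0 <= s by apply: le_trans (ltW rs); apply: nm_ge0.
have [l Gl] := fval_ex aG (ltW rs).
have := fvalM (absb_lin r s0) aG rs (fval_lin r r') Gl.
rewrite fG => h; have /esym/eqP := fval_uniq h f0.
have h1 : 1 - r' / r != 0.
  by rewrite subr_eq0; apply: contra rr => /eqP h1; rewrite -[r]mul1r h1 divfK.
by rewrite eq_sym mulf_eq0 (negbTE h1) /= => /eqP l0; rewrite -l0.
Qed.

(** Each division by 1 - X/r lowers by one the degree from which the geometric bound holds. Three of
    them turn a bound on B_j for j > 3 into one on all G_k with k > 0, whose constant contains the
    product of the three moduli. This quantitative factorization does the work of the argument
    principle. *)
Lemma cube_roots_div (B : fps C) r1 r2 r3 A Y : cf B 0 = 1 ->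
  [/\ r1 != 0, r2 != 0 & r3 != 0] -> [/\ r2 != r1, r3 != r1 & r3 != r2] ->
  [/\ fval B r1 0, fval B r2 0 & fval B r3 0] ->
  0 <= A -> 0 <= Y -> [/\ nm r1 * Y < 1, nm r2 * Y < 1 & nm r3 * Y < 1] ->
  (forall j, (3 < j)%N -> nm (cf B j) <= A * Y ^+ j) ->
  exists G : fps C, [/\ (1 - cst r1^-1 * fX C) * ((1 - cst r2^-1 * fX C) * ((1 - cst r3^-1 * fX C) * G)) = B,
    cf G 0 = 1 & forall k, (0 < k)%N -> nm (cf G k) <=
    A * (nm r1 * Y) / (1 - nm r1 * Y) * (nm r2 * Y) / (1 - nm r2 * Y)
      * (nm r3 * Y) / (1 - nm r3 * Y) * Y ^+ k].
Proof.
move=> B0 [r10 r20 r30] [r21 r31 r32] [v1 v2 v3] A0 Y0 [y1 y2 y3] bB.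
have nn (r : C) : nm r * Y < 1 -> 0 <= (nm r * Y) / (1 - nm r * Y).
  by move=> h; rewrite divr_ge0 ?mulr_ge0 ?nm_ge0 // subr_ge0 ltW.
have [G1 G1E] := fdiv_ex B r1; have [G2 G2E] := fdiv_ex G1 r2; have [G3 G3E] := fdiv_ex G2 r3.
have b1 := fdiv_bound r10 G1E v1 A0 Y0 y1 bB.
have A10 : 0 <= A * (nm r1 * Y) / (1 - nm r1 * Y) by rewrite -mulrA mulr_ge0 ?nn.
(* A radius beyond the three zeros at which the quotients still converge absolutely, so that the
   remaining zeros of a dividend are zeros of the quotient. *)
have [s [s0 [s1 [s2 [s3 sY]]]]] : exists s, 0 < s /\ nm r1 < s /\ nm r2 < s /\ nm r3 < s /\ s * Y < 1.
  have [->|Yn] := eqVneq Y 0.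
    exists (nm r1 + nm r2 + nm r3 + 1); rewrite mulr0.
    by have := nm_ge0 r1; have := nm_ge0 r2; have := nm_ge0 r3; do !split; lra.
  have Yp : 0 < Y by rewrite lt_def Yn.
  pose M := Num.max (nm r1) (Num.max (nm r2) (nm r3)).
  have hM : M < Y^-1 by rewrite !gt_max -![_ < Y^-1](ltr_pM2r Yp) mulVf // y1 y2 y3.
  have M1 : nm r1 <= M by rewrite le_max lexx.
  have M2 : nm r2 <= M by rewrite !le_max lexx orbT.
  have M3 : nm r3 <= M by rewrite !le_max lexx !orbT.
  have := nm_ge0 r1 => n1.
  exists ((M + Y^-1) / 2); do 4 (split; first lra).
  by rewrite -ltr_pdivlMr // div1r; lra.
have [K1 a1] := absb_ev A10 Y0 (ltW s0) sY b1.
have w2 := fdiv_val0 G1E a1 s2 r10 r21 v2; have w3 := fdiv_val0 G1E a1 s3 r10 r31 v3.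
have b2 := fdiv_bound r20 G2E w2 A10 Y0 y2 b1.
have A20 : 0 <= A * (nm r1 * Y) / (1 - nm r1 * Y) * (nm r2 * Y) / (1 - nm r2 * Y) by rewrite -mulrA mulr_ge0 ?nn.
have [K2 a2] := absb_ev A20 Y0 (ltW s0) sY b2.
have x3 := fdiv_val0 G2E a2 s3 r20 r32 w3.
have b3 := fdiv_bound r30 G3E x3 A20 Y0 y3 b2.
exists G3; rewrite G3E G2E G1E; split=> //.
have := B0; rewrite -G1E -G2E -G3E !cfM0.
have E r : cf (1 - cst r^-1 * fX C) 0 = 1 by rewrite cfB cf1 cf_cstM /= mulr0 subr0.
by rewrite !E !mul1r.
Qed.

End FpsValues.

(** * Exact computation of the first coefficients *)

Section IntegerCoefficients.
Variable R : realType.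
Local Notation C := R[i].
Local Notation cst := (@fps_cst C).
Notation Zi := BinNums.Z.

(** Coefficients are computed in the binary integers, where [vm_compute] is fast, and transported
    along this morphism. *)
Definition iz (K : nzRingType) : Zi -> K := intr \o int_of_Z.
HB.instance Definition _ (K : nzRingType) := GRing.RMorphism.on (iz K).

Lemma iz_real z : iz C z = (iz R z)%:C.
Proof. by rewrite /iz /= rmorph_int. Qed.

Lemma ler_iz (a b : Zi) : (iz R a <= iz R b) = (a <= b).
Proof. by rewrite /iz /= ler_int -{2}[a]int_of_ZK -{2}[b]int_of_ZK; move: (int_of_Z a) (int_of_Z b) => x y; lia. Qed.

Lemma ltr_iz (a b : Zi) : (iz R a < iz R b) = (a < b).
Proof. by rewrite !ltNge ler_iz. Qed.

Lemma nm_iz z : nm (iz C z) = iz R `|z|.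
Proof.
rewrite iz_real nm_real; case: (lerP 0 z) => z0.
  have h : 0 <= iz R z by rewrite -(rmorph0 (iz R)) ler_iz.
  by rewrite !ger0_norm.
have h : iz R z < 0 by rewrite -(rmorph0 (iz R)) ltr_iz.
by rewrite !ltr0_norm // (rmorphN (iz R)).
Qed.

Definition zdot (a b : seq Zi) k : Zi :=
  foldr (fun i acc => nth 0 a i * nth 0 b (k - i) + acc) 0 (iota 0 k.+1).
Definition zmul N a b : seq Zi := mkseq (zdot a b) N.
Definition zsub N (a b : seq Zi) : seq Zi := mkseq (fun k => nth 0 a k - nth 0 b k) N.
Definition zscale N (x : Zi) (a : seq Zi) : seq Zi := mkseq (fun k => x * nth 0 a k) N.
Definition sigZ nu n : Zi := foldr (fun d acc => d%:R ^+ nu + acc) 0 (divisors n).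
Definition e4L N : seq Zi := mkseq (fun n => if n is 0 then 1 else 240 * sigZ 3 n) N.
Definition e6L N : seq Zi := mkseq (fun n => if n is 0 then 1 else - (504 * sigZ 5 n)) N.
Definition E3L N := zmul N (e4L N) (zmul N (e4L N) (e4L N)).
Definition D1728L N := zsub N (E3L N) (zmul N (e6L N) (e6L N)).
Definition DL N : seq Zi := map (fun z => BinInt.Z.div z 1728%:R) (D1728L N).

Lemma foldr_sum (I : Type) (F : I -> Zi) s : foldr (fun i acc => F i + acc) 0 s = \sum_(i <- s) F i.
Proof. by elim: s => [|a s IH] /=; rewrite ?big_nil ?big_cons ?IH. Qed.

Lemma zdotE a b k : zdot a b k = \sum_(i < k.+1) nth 0 a i * nth 0 b (k - i).
Proof. by rewrite /zdot (foldr_sum (fun i => nth 0 a i * nth 0 b (k - i))) -(big_mkord predT (fun i => nth 0 a i * nth 0 b (k - i))) /index_iota subn0. Qed.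

Definition repl N (f : fps C) (a : seq Zi) := forall k, (k < N)%N -> cf f k = iz C (nth 0 a k).

Lemma repl_mul N f g a b : repl N f a -> repl N g b -> repl N (f * g) (zmul N a b).
Proof.
move=> hf hg k kN; rewrite nth_mkseq // zdotE rmorph_sum cfM; apply: eq_bigr => i _.
rewrite rmorphM hf ?hg //; first exact: leq_ltn_trans (leq_subr _ _) kN.
by apply: leq_ltn_trans kN; rewrite -ltnS.
Qed.

Lemma repl_sub N f g a b : repl N f a -> repl N g b -> repl N (f - g) (zsub N a b).
Proof. by move=> hf hg k kN; rewrite nth_mkseq // rmorphB cfB hf // hg. Qed.

Lemma repl_scale N f a x : repl N f a -> repl N (cst (iz C x) * f) (zscale N x a).
Proof. by move=> hf k kN; rewrite nth_mkseq // rmorphM cf_cstM hf. Qed.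

Lemma sigZE nu n : iz C (sigZ nu n) = (sigma nu n)%:R.
Proof.
rewrite /sigZ (foldr_sum (fun d => d%:R ^+ nu)) rmorph_sum /sigma natr_sum.
by apply: eq_bigr => d _; rewrite rmorphXn rmorph_nat natrX.
Qed.

Lemma repl_E4 N : repl N (E4f R) (e4L N).
Proof.
move=> k kN; rewrite nth_mkseq //; case: k kN => [|k] _; first by rewrite rmorph1.
transitivity (iz C 240%:R * iz C (sigZ 3 k.+1)); last by rewrite (rmorphM (iz C)).
by rewrite sigZE (rmorph_nat (iz C)).
Qed.

Lemma repl_E6 N : repl N (E6f R) (e6L N).
Proof.
move=> k kN; rewrite nth_mkseq //; case: k kN => [|k] _; first by rewrite rmorph1.
transitivity (- (iz C 504%:R * iz C (sigZ 5 k.+1))); last by rewrite (rmorphN (iz C)) (rmorphM (iz C)).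
by rewrite sigZE (rmorph_nat (iz C)).
Qed.

Lemma repl_E3 N : repl N (E4f R ^+ 3) (E3L N).
Proof. by rewrite exprS expr2; do 2?apply: repl_mul; apply: repl_E4. Qed.

Lemma repl_D N : all (fun z => 1728%:R * BinInt.Z.div z 1728%:R == z) (D1728L N) -> repl N (Df R) (DL N).
Proof.
move=> /allP ok k kN.
have sz : size (D1728L N) = N by rewrite size_mkseq.
have h : repl N (E4f R ^+ 3 - E6f R ^+ 2) (D1728L N).
  by apply: repl_sub; [apply: repl_E3|rewrite expr2; apply: repl_mul; apply: repl_E6].
have h1 : cf (1728 * Df R) k = iz C (nth 0 (D1728L N) k) by rewrite Df1728 h.
have h2 : 1728 * cf (Df R) k = iz C (nth 0 (D1728L N) k) by rewrite -h1 -cst_nat cf_cstM.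
have kk : (k < size (D1728L N))%N by rewrite sz.
have /eqP e := ok _ (mem_nth 0 kk).
have -> : nth 0 (DL N) k = BinInt.Z.div (nth 0 (D1728L N) k) 1728%:R by rewrite (nth_map 0).
apply: (mulfI (n1728 R)); rewrite h2; move: (nth 0 _ _) e => z e.
by rewrite -{1}e (rmorphM (iz C)) (rmorph_nat (iz C)).
Qed.

Lemma repl_d1 N : all (fun z => 1728%:R * BinInt.Z.div z 1728%:R == z) (D1728L N.+1) ->
  repl N (d1f R) (behead (DL N.+1)).
Proof. by move=> ok k kN; rewrite nth_behead -(repl_D ok). Qed.

Lemma DL20_ok : all (fun z => 1728%:R * BinInt.Z.div z 1728%:R == z) (D1728L 20).
Proof. by vm_compute. Qed.

Lemma DL12_ok : all (fun z => 1728%:R * BinInt.Z.div z 1728%:R == z) (D1728L 12).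
Proof. by vm_compute. Qed.

Lemma DL13_ok : all (fun z => 1728%:R * BinInt.Z.div z 1728%:R == z) (D1728L 13).
Proof. by vm_compute. Qed.

(* The first coefficients of the inverse of a power series with constant term 1. *)
Fixpoint zinv_rec N (a acc : seq Zi) : seq Zi := if N is N'.+1 then
  zinv_rec N' a (rcons acc (- foldr (fun i s => nth 0 a (size acc - i) * nth 0 acc i + s) 0 (iota 0 (size acc))))
  else acc.
Definition zinv N a := zinv_rec N.-1 a [:: 1].

Definition BL N x := zsub N (E3L N) (zscale N x (DL N)).
Definition faberL N x := zmul N (zmul N (behead (DL N.+1)) (behead (DL N.+1))) (zinv N (BL N x)).
Definition oneL N : seq Zi := mkseq (fun k => if k is 0 then 1 else 0) N.

(** Exactness of the divisions by 1728 and correctness of [zinv] are checked on the computed lists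
    by multiplying back; uniqueness of the inverse modulo q^N then identifies the result. *)
Lemma faberL_ok N x (Bi : fps C) :
  all (fun z => 1728%:R * BinInt.Z.div z 1728%:R == z) (D1728L N.+1) ->
  all (fun z => 1728%:R * BinInt.Z.div z 1728%:R == z) (D1728L N) ->
  zmul N (BL N x) (zinv N (BL N x)) == oneL N ->
  (E4f R ^+ 3 - cst (iz C x) * (fX C * d1f R)) * Bi = 1 ->
  repl N (d1f R ^+ 2 * Bi) (faberL N x).
Proof.
move=> ok1 ok0 /eqP inv BB; have hd := repl_d1 ok1.
have hB : repl N (E4f R ^+ 3 - cst (iz C x) * (fX C * d1f R)) (BL N x).
  by rewrite -Df_X; apply: repl_sub; [apply: repl_E3|apply: repl_scale; apply: repl_D].
rewrite /faberL expr2; apply: repl_mul; first exact: repl_mul.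
pose Z : fps C := Fps (fun k => iz C (nth 0 (zinv N (BL N x)) k)).
have hZ : repl N Z (zinv N (BL N x)) by [].
set B := E4f R ^+ 3 - _ in hB BB.
have B0 : cf B 0 = 1.
  by rewrite cfB cf_cstM cf_XM mulr0 subr0 cfX0 cf_E4_0 expr1n.
apply: (@fps_unitI_mod _ B Bi Z N B0) => k kN.
rewrite BB (repl_mul hB hZ kN) inv nth_mkseq //; case: k kN => [|k] _.
  by rewrite rmorph1.
by rewrite rmorph0.
Qed.

Fixpoint altZ (b : bool) (s : seq Zi) : bool :=
  if s is z :: s' then (if b then 0 < z else z < 0) && altZ (~~ b) s' else true.

(** Row n holds n + 1 integers in (0, 1728) at which P_n alternates in sign. They are mere
    witnesses, validated by [grid_ok]. *)
Definition grid : seq (seq nat) := [:: [:: 1]; [:: 384; 1248]; [:: 156; 756; 1463];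
 [:: 76; 426; 1052; 1565]; [:: 42; 254; 703; 1246; 1619];
 [:: 26; 161; 475; 924; 1371; 1650]; [:: 17; 108; 331; 681; 1090; 1455; 1669];
 [:: 11; 75; 238; 507; 853; 1214; 1513; 1682];
 [:: 8; 55; 176; 385; 669; 993; 1306; 1554; 1691];
 [:: 6; 41; 134; 297; 529; 809; 1105; 1377; 1586; 1698];
 [:: 5; 32; 104; 234; 423; 662; 928; 1195; 1432; 1609; 1703];
 [:: 4; 25; 82; 187; 343; 545; 780; 1029; 1269; 1475; 1627; 1707]]%N.

Definition zx (x : nat) : Zi := BinInt.Z.of_nat x.

Definition grid_ok n (g : seq nat) : bool :=
  [&& size g == n.+1, path ltn 0%N g, all (ltn^~ 1728%N) g,
      all (fun x => zmul 12 (BL 12 (zx x)) (zinv 12 (BL 12 (zx x))) == oneL 12) g &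
      altZ (~~ odd n) (map (fun x => nth 0 (faberL 12 (zx x)) n) g)].

Lemma grid_all_ok : all (fun n => grid_ok n (nth [::] grid n)) (iota 0 12).
Proof. by vm_compute. Qed.

Lemma altZP b s i : altZ b s -> (i < size s)%N -> 0 < (-1) ^+ (~~ b (+) odd i) * nth 0 s i.
Proof.
elim: s b i => //= z s IH b [|i] /andP[hz hs] hi /=.
  by rewrite addbF; case: b hz {hs IH} => /= h; rewrite ?mul1r // expr1 mulN1r oppr_gt0.
by have := IH (~~ b) i hs hi; case: (b); case: (odd i).
Qed.

Lemma small_alternation n : (n < 12)%N -> exists g : seq nat,
  [/\ size g = n.+1, path ltn 0%N g, all (ltn^~ 1728%N) g &
   forall i, (i <= n)%N -> forall Bi : fps C,
     (E4f R ^+ 3 - cst (nth 0%N g i)%:R * (fX C * d1f R)) * Bi = 1 ->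
     exists2 z : R, cf (d1f R ^+ 2 * Bi) n = z%:C & 0 < (-1) ^+ (odd n (+) odd i) * z].
Proof.
move=> n12; have := allP grid_all_ok n; rewrite mem_iota n12 => /(_ isT).
set g := nth _ _ _ => /and5P[/eqP sg pg lg /allP iv al]; exists g; split=> // i iN Bi BB.
have ig : (i < size g)%N by rewrite sg.
have E : iz C (zx (nth 0%N g i)) = (nth 0%N g i)%:R.
  by rewrite /zx -{1}[nth _ _ _]natn (rmorph_nat BinInt.Z.of_nat) rmorph_nat.
rewrite -E in BB.
have h := faberL_ok DL13_ok DL12_ok (iv _ (mem_nth 0%N ig)) BB.
exists (iz R (nth 0 (faberL 12 (zx (nth 0%N g i))) n)); first by rewrite (h n n12) iz_real.
have ig' : (i < size [seq nth (0%R : Zi) (faberL 12 (zx x)) n | x <- g])%N by rewrite size_map.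
have := altZP al ig'; rewrite (nth_map 0%N) // negbK => h1.
have -> : (-1) ^+ (odd n (+) odd i) = iz R ((-1) ^+ (odd n (+) odd i)) by rewrite rmorphXn rmorphN1.
by rewrite -rmorphM -(rmorph0 (iz R)) ltr_iz.
Qed.

(** The bound of [Bx_coef] in degrees 4 to 19. Degree 4, where E4^3 has coefficient 396974160,
    nearly attains it and fixes the constant 19700. *)
Lemma coef_check : all (fun j => `|nth 0 (E3L 20) j| + (75 * 100)%:R * `|nth 0 (DL 20) j| <= (197 * 100)%:R * 12%:R ^+ j) (iota 4 16).
Proof. by vm_compute. Qed.

Lemma B_coef_small (x : C) j : nm x <= 7500 -> (3 < j < 20)%N ->
  nm (cf (E4f R ^+ 3 - cst x * (fX C * d1f R)) j) <= 19700 * 12 ^+ j.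
Proof.
move=> x5 /andP[j3 j20]; have := allP coef_check j; rewrite mem_iota j3 j20 => /(_ isT) h.
rewrite -Df_X cfB cf_cstM (repl_E3 j20) (repl_D DL20_ok j20).
apply: le_trans (nmB _ _) _; rewrite nmM !nm_iz.
have E : 19700 * 12 ^+ j = iz R ((197 * 100)%:R * 12%:R ^+ j) :> R.
  by rewrite rmorphM rmorphXn !rmorph_nat natrM; congr (_ * _); ring.
rewrite E; apply: (@le_trans _ _ (iz R (`|nth 0 (E3L 20) j| + (75 * 100)%:R * `|nth 0 (DL 20) j|))); last by rewrite ler_iz.
rewrite (rmorphD (iz R)) (rmorphM (iz R)) (rmorph_nat (iz R)) lerD2l ler_wpM2r //.
by rewrite -(rmorph0 (iz R)) ler_iz.
Qed.

(** The absolute values of tau(1), ..., tau(8). *)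
Definition tau8 : seq nat := [:: 1; 24; 252; 1472; 4830; 6048; 16744; 84480]%N.

Lemma d1_check : all (fun k => `|nth 0 (behead (DL 20)) k| == zx (nth 0%N tau8 k)) (iota 0 8).
Proof. by vm_compute. Qed.

Lemma nm_d1_small k : (k < 8)%N -> nm (cf (d1f R) k) = (nth 0%N tau8 k)%:R.
Proof.
move=> k8; have := allP d1_check k; rewrite mem_iota k8 => /(_ isT) /eqP h.
rewrite (repl_d1 DL20_ok) ?(leq_trans k8) // nm_iz h.
by rewrite /zx -{1}[nth _ _ _]natn (rmorph_nat BinInt.Z.of_nat) rmorph_nat.
Qed.

End IntegerCoefficients.

(** * Numerical bounds for pi and for exponentials *)

Section NumericalBounds.
Variable R : realType.
Implicit Types x y l : R.

Lemma cos_half_sq x : cos (x / 2) ^+ 2 = (1 + cos x) / 2.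
Proof.
have -> : cos x = cos (x / 2 + x / 2) by congr cos; field.
rewrite cosD -!expr2; have := cos2Dsin2 (x / 2).
move: (cos _ ^+ 2) (sin _ ^+ 2) => a b ab; lra.
Qed.

Notation Zi := BinNums.Z.

Definition scaleZ : Zi := 10%:R ^+ 12.
(** One step of cos(x/2)^2 = (1 + cos x) / 2 on an integer enclosure of 10^12 cos x. The square root
    is rounded down in the lower bound and up in the upper one. *)
Definition halfZ (ab : Zi * Zi) : Zi * Zi :=
  (BinInt.Z.sqrt (BinInt.Z.div (scaleZ * (scaleZ + ab.1)) 2%:R),
   BinInt.Z.sqrt (BinInt.Z.div (scaleZ * (scaleZ + ab.2)) 2%:R + 1) + 1).

Lemma sqrtZ_le (n : Zi) : 0 <= n -> BinInt.Z.sqrt n ^+ 2 <= n.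
Proof.
move=> n0; have := BinInt.Z.sqrt_spec n; rewrite expr2; move: (BinInt.Z.sqrt n) => w; lia.
Qed.

Lemma sqrtZ_ge (n : Zi) : 0 <= n -> n <= (BinInt.Z.sqrt n + 1) ^+ 2.
Proof.
move=> n0; have := BinInt.Z.sqrt_spec n; rewrite expr2; move: (BinInt.Z.sqrt n) => w; lia.
Qed.

Lemma div2Z (n : Zi) : 2 * BinInt.Z.div n 2%:R <= n <= 2 * (BinInt.Z.div n 2%:R + 1).
Proof. have := BinInt.Z.mul_div_le n 2%:R; have := BinInt.Z.mul_succ_div_gt n 2%:R; move: (BinInt.Z.div _ _) => w; lia. Qed.

Lemma sqrtZ_ge0 (n : Zi) : 0 <= BinInt.Z.sqrt n.
Proof. have := BinInt.Z.sqrt_nonneg n; move: (BinInt.Z.sqrt n) => w; lia. Qed.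

Definition cosb x (ab : Zi * Zi) := [/\ 0 <= x <= pi, 0 <= ab.1, 0 <= ab.2 &
  iz R ab.1 <= iz R scaleZ * cos x <= iz R ab.2].

Lemma scaleZ_gt0 : 0 < scaleZ. Proof. by vm_compute. Qed.

Lemma iz_ge0 (z : Zi) : (0 <= iz R z) = (0 <= z).
Proof. by rewrite -(rmorph0 (iz R)) ler_iz. Qed.

Lemma halfZ_cosb x ab : cosb x ab -> cosb (x / 2) (halfZ ab).
Proof.
case: ab => a b [/andP[x0 xp] /= a0 b0 /andP[ax xb]]; have p0 := @pi_gt0 R.
have d0 := scaleZ_gt0; have c0 : 0 <= cos (x / 2) by apply: cos_ge0_pihalf; apply/andP; split; lra.
have D0 : 0 < iz R scaleZ by rewrite -(rmorph0 (iz R)) ltr_iz.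
have h := cos_half_sq x; rewrite /cosb /halfZ /=; move: scaleZ d0 D0 ax xb => D d0 D0 ax xb.
set na := BinInt.Z.div (D * (D + a)) 2%:R; set nb := BinInt.Z.div (D * (D + b)) 2%:R.
have /andP[na1 na2] := div2Z (D * (D + a)); have /andP[nb1 nb2] := div2Z (D * (D + b)).
rewrite -/na in na1 na2; rewrite -/nb in nb1 nb2.
have Da0 : 0 <= D * (D + a) by rewrite mulr_ge0 ?addr_ge0 // ltW.
have Db0 : 0 <= D * (D + b) by rewrite mulr_ge0 ?addr_ge0 // ltW.
have na0 : 0 <= na by lia.
have nb0 : 0 <= nb by lia.
have nb10 : 0 <= nb + 1 by lia.
have s1 := sqrtZ_le na0; have s2 := sqrtZ_ge nb10.
have p1 := sqrtZ_ge0 na; have p2 := sqrtZ_ge0 (nb + 1).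
move: (BinInt.Z.sqrt na) (BinInt.Z.sqrt (nb + 1)) s1 s2 p1 p2 => A B s1 s2 p1 p2.
split; rewrite /= ?addr_ge0 //; first by apply/andP; split; lra.
have A0 : 0 <= iz R A by rewrite iz_ge0.
have B0 : 0 <= iz R (B + 1) by rewrite iz_ge0 addr_ge0.
have Dc0 : 0 <= iz R D * cos (x / 2) by rewrite mulr_ge0 // ltW.
rewrite -(ler_sqr A0 Dc0) -(ler_sqr Dc0 B0) exprMn h.
have k1 : 2 * iz R A ^+ 2 <= iz R D * (iz R D + iz R a).
  rewrite -(rmorphD (iz R)) -(rmorphM (iz R)) -(rmorphXn (iz R)) -(rmorph_nat (iz R) 2) -(rmorphM (iz R)) ler_iz; lia.
have k2 : iz R D * (iz R D + iz R b) <= 2 * iz R (B + 1) ^+ 2.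
  rewrite -(rmorphD (iz R)) -(rmorphM (iz R)) -(rmorphXn (iz R)) -(rmorph_nat (iz R) 2) -(rmorphM (iz R)) ler_iz; lia.
move: (iz R A) (iz R (B + 1)) (iz R D) (iz R a) (iz R b) (cos x) D0 k1 k2 ax xb => a1 b1 d a2 b2 c D0 k1 k2 ax xb.
have m1 : d * a2 <= d * (d * c) by rewrite ler_wpM2l // ltW.
have m2 : d * (d * c) <= d * b2 by rewrite ler_wpM2l // ltW.
have e : d ^+ 2 * ((1 + c) / 2) = (d * d + d * (d * c)) / 2 by field.
rewrite e; apply/andP; split; lra.
Qed.

Lemma izk1 (p q1 q2 : nat) (b d : Zi) : p%:R ^+ 2 * d <= 2%:R * (d - b) * (q1%:R * q2%:R) ^+ 2 ->
  p%:R ^+ 2 * iz R d <= 2 * (iz R d - iz R b) * (q1%:R * q2%:R) ^+ 2.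
Proof.
rewrite -(ler_iz R) !expr2 !(rmorphM (iz R)) (rmorphB (iz R)).
by rewrite !(rmorph_nat (iz R)).
Qed.

Lemma izk2 (p1 p2 q1 q2 q3 : nat) (a d : Zi) :
  (d ^+ 2 - a ^+ 2) * (q1%:R * q2%:R * q3%:R) ^+ 2 < (d * p1%:R * p2%:R) ^+ 2 ->
  (iz R d ^+ 2 - iz R a ^+ 2) * (q1%:R * q2%:R * q3%:R) ^+ 2 < (iz R d * p1%:R * p2%:R) ^+ 2.
Proof.
rewrite -(ltr_iz R) !expr2 !(rmorphM (iz R)) (rmorphB (iz R)) !(rmorphM (iz R)).
by rewrite !(rmorph_nat (iz R)).
Qed.

Lemma lo_gen (D B x c p q : R) : 0 < D -> 0 <= x -> 0 <= p -> 0 <= q -> D * c <= B ->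
  1 - c <= x ^+ 2 / 2 -> p ^+ 2 * D <= 2 * (D - B) * q ^+ 2 -> p <= x * q.
Proof.
move=> D0 x0 p0 q0 cu hc k1; rewrite -ler_sqr ?nnegrE ?mulr_ge0 // -(ler_pM2r D0).
apply: le_trans k1 _; have -> : (x * q) ^+ 2 * D = x ^+ 2 * D * q ^+ 2 by ring.
apply: ler_wpM2r; first by rewrite exprn_ge0.
have : D * (1 - c) <= D * (x ^+ 2 / 2) by rewrite ler_wpM2l // ltW.
by move: (x ^+ 2) => w; lra.
Qed.

Lemma hi_gen (D A x c s p1 p2 q q3 : R) : 0 < D -> 0 <= A -> 0 <= c -> 0 < p1 -> 0 < p2 -> 0 < q -> 0 < q3 ->
  0 < x -> A <= D * c -> c ^+ 2 + s ^+ 2 = 1 -> x * p2 <= s * q3 ->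
  (D ^+ 2 - A ^+ 2) * (q * q3) ^+ 2 < (D * p1 * p2) ^+ 2 -> x * q <= p1.
Proof.
move=> D0 A0 c0 p10 p20 q0 q30 x0 cl s2 s1 k2; rewrite leNgt; apply/negP => h.
have s0 : 0 < s by rewrite -(pmulr_lgt0 _ q30); apply: lt_le_trans s1; rewrite mulr_gt0.
have h1 : p1 * p2 <= s * (q * q3).
  apply: (@le_trans _ _ (x * q * p2)); first by rewrite ler_pM2r // ltW.
  by rewrite mulrAC [leRHS]mulrCA mulrC ler_pM2l.
have h2 : (D * p1 * p2) ^+ 2 <= (D * s) ^+ 2 * (q * q3) ^+ 2.
  rewrite -exprMn ler_sqr ?nnegrE; last 2 first.
  - by rewrite !mulr_ge0 // ltW.
  - by rewrite !mulr_ge0 // ltW.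
  by rewrite -[leLHS]mulrA -[leRHS]mulrA ler_pM2l.
have h3 : (D * s) ^+ 2 <= D ^+ 2 - A ^+ 2.
  have w : A ^+ 2 <= (D * c) ^+ 2 by rewrite ler_sqr // ?nnegrE // mulr_ge0 // ltW.
  have -> : (D * s) ^+ 2 = D ^+ 2 * (c ^+ 2 + s ^+ 2) - (D * c) ^+ 2 by ring.
  by rewrite s2 mulr1 lerB.
have h4 : (D * s) ^+ 2 * (q * q3) ^+ 2 <= (D ^+ 2 - A ^+ 2) * (q * q3) ^+ 2.
  by rewrite ler_wpM2r // exprn_ge0 // mulr_ge0 // ltW.
by have := lt_le_trans k2 (le_trans h2 h4); rewrite ltxx.
Qed.

Lemma pi1024 : let x := (pi / 1024 : R) in [/\ 0 < x, 0 <= cos x & x * 1020 <= sin x * 1024].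
Proof.
have [x0 x1 c0] : [/\ 0 < (pi / 1024 : R), (pi / 1024 : R) < 4 / 1024 & 0 <= cos (pi / 1024 : R)].
  have := @pi_gt0 R; have := @pi_lt4 R; move: (@cos_ge0_pihalf R (pi / 1024)).
  by move: (pi : R) => w h w4 w0; split; try apply: h; try (apply/andP; split); lra.
move=> x; rewrite -/x in x0 x1 c0; clearbody x.
have hs : `|x| <= 1 by rewrite (gtr0_norm x0); lra.
have := sin_near_id hs; rewrite ler_norml => /andP[sl _]; split; [exact: x0|exact: c0|].
have h : x ^+ 2 <= x * (4 / 1024) by rewrite expr2; apply: ler_wpM2l; apply: ltW.
by move: (x ^+ 2) sl h => w; lra.
Qed.

(** Nine half-angle steps from cos(pi/2) = 0 enclose cos(pi/1024). The lower bound for pi then comes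
    from 1 - cos x <= x^2/2, the upper one from sin x >= (1020/1024) x, valid since x < 4/1024. *)
Lemma pi_bounds : 7853 / 2500 <= (pi : R) <= 3155 / 1000.
Proof.
have q1 : 0 < (3155 : R) by rewrite ltr0n.
have q2 : 0 < (1020 : R) by rewrite ltr0n.
have q3 : 0 < (1000 : R) by rewrite ltr0n.
have q4 : 0 < (1024 : R) by rewrite ltr0n.
have base : cosb (pi / 2) (0, 0).
  have p0 := @pi_gt0 R; clear -p0.
  by split; rewrite //= ?cos_pihalf ?mulr0 ?rmorph0 ?lexx //; apply/andP; split; lra.
have it n : cosb (pi / 2 / 2 ^+ n) (iter n halfZ (0, 0)).
  elim: n => [|n IH]; first by rewrite expr0 divr1.
  by rewrite iterS exprSr invfM mulrA; apply: halfZ_cosb.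
have := it 9; have -> : pi / 2 / 2 ^+ 9 = pi / 1024 :> R by field.
have chk : let ab := iter 9 halfZ (0, 0) in
  (7853%:R ^+ 2 * scaleZ <= 2%:R * (scaleZ - ab.2) * (2500%:R * 1024%:R) ^+ 2) &&
  ((scaleZ ^+ 2 - ab.1 ^+ 2) * (1000%:R * 1024%:R * 1024%:R) ^+ 2 < (scaleZ * 3155%:R * 1020%:R) ^+ 2).
  by vm_compute.
move: chk; case: (iter _ _ _) => a b; cbv zeta; rewrite [(a, b).1]/= [(a, b).2]/= => /andP[chk1 chk2].
case=> _ /= a0 b0 /andP[cl cu].
have D0 : 0 < iz R scaleZ by rewrite -(rmorph0 (iz R)) ltr_iz scaleZ_gt0.
have A0 : 0 <= iz R a by rewrite iz_ge0.
have [x0 c0 s1] := pi1024.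
have lo := lo_gen D0 (ltW x0) (ler0n R _) (mulr_ge0 (ler0n R _) (ler0n R _)) cu _ (izk1 chk1).
have {lo} lo := lo (cos_ge_sqr (pi / 1024)).
have hi := hi_gen D0 A0 c0 q1 q2 (mulr_gt0 q3 q4) q4 x0 cl (cos2Dsin2 _) s1 (izk2 chk2).
move: lo hi; clear; move: (pi : R) => w lo hi; apply/andP; split; lra.
Qed.

Lemma expR_ge_taylor x n : 0 <= x -> \sum_(0 <= k < n) x ^+ k / k`!%:R <= expR x.
Proof.
move=> x0; rewrite /expR; apply: (nondecreasing_cvgn_le _ _ n); last exact: is_cvg_series_exp_coeff.
apply: nondecreasing_series => k _ _; exact: exp_coeff_ge0.
Qed.

Lemma expR1_ge : 2718 / 1000 <= expR (1 : R).
Proof.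
apply: le_trans (expR_ge_taylor 8 ler01).
rewrite !big_nat_recr //= big_geq // !expr1n !factS fact0; lra.
Qed.

Lemma expR_ge3 x : 0 <= x -> 1 + x + x ^+ 2 / 2 + x ^+ 3 / 6 + x ^+ 4 / 24 <= expR x.
Proof.
move=> x0; apply: le_trans (expR_ge_taylor 5 x0).
rewrite !big_nat_recr //= big_geq // !factS fact0 expr0 expr1.
by rewrite le_eqVlt; apply/orP; left; apply/eqP; field.
Qed.

Lemma mul_lbound (a b x y c : R) : 0 <= a -> 0 <= b -> a <= x -> b <= y -> c <= a * b -> c <= x * y.
Proof. by move=> a0 b0 ax byy h; apply: le_trans h _; apply: ler_pM. Qed.

Lemma expRN_le x (a : R) : 0 < a -> a <= expR x -> expR (- x) <= a^-1.
Proof. by move=> a0 h; rewrite expRN lef_pV2 // posrE // expR_gt0. Qed.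

Lemma expR_powers : [/\ 1483 / 10 <= expR (5 : R) & 1314 * 1000 * 1000 <= expR (21 : R)].
Proof.
have e1 := expR1_ge.
have e2 : 7387 / 1000 <= expR (2 : R).
  by rewrite -[2]/(1 + 1) expRD; apply: (@mul_lbound _ _ _ _ _ _ _ e1 e1); clear; lra.
have e4 : (54 + 567 / 1000) <= expR (4 : R).
  by rewrite (_ : 4 = 2 + 2); [rewrite expRD; apply: (@mul_lbound _ _ _ _ _ _ _ e2 e2); clear; lra|ring].
have e5 : 1483 / 10 <= expR (5 : R).
  by rewrite (_ : 5 = 4 + 1); [rewrite expRD; apply: (@mul_lbound _ _ _ _ _ _ _ e4 e1); clear; lra|ring].
have e10 : 2199 * 10 <= expR (10 : R).
  by rewrite (_ : 10 = 5 + 5); [rewrite expRD; apply: (@mul_lbound _ _ _ _ _ _ _ e5 e5); clear; lra|ring].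
have e20 : 4835 * 1000 * 100 <= expR (20 : R).
  by rewrite (_ : 20 = 10 + 10); [rewrite expRD; apply: (@mul_lbound _ _ _ _ _ _ _ e10 e10); clear; lra|ring].
split; first exact: e5.
by rewrite (_ : 21 = 20 + 1); [rewrite expRD; apply: (@mul_lbound _ _ _ _ _ _ _ e20 e1); clear; lra|ring].
Qed.

(** The thresholds of this lemma and of the next three are lower bounds, on the arc, for the
    exponents of |e(t)|, of |e(-1/(t+1))|, of |e(t)|^3 |e(-1/(t+1))|, and of the ratio estimate in
    [alpha_le]. *)
Lemma expRN_544 x : 544 / 100 <= x -> expR (- x) <= 44 / (100 * 100).
Proof.
move=> h; rewrite -[44 / (100 * 100)]invrK; apply: expRN_le; first by rewrite invr_gt0; lra.
apply: (@le_trans _ _ (expR (5 + 44 / 100))); last by rewrite ler_expR; lra.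
rewrite expRD invf_div; have [e5 _] := expR_powers.
apply: (@mul_lbound _ (154 / 100) _ _ _ _ _ e5); [lra|lra| |lra].
by apply: le_trans (expR_ge3 _); lra.
Qed.

Lemma expRN_314 x : 7853 / 2500 <= x -> expR (- x) <= 435 / (100 * 100).
Proof.
move=> h; rewrite -[435 / (100 * 100)]invrK; apply: expRN_le; first by rewrite invr_gt0; lra.
apply: (@le_trans _ _ (expR (1 + 1 + 1 + 14 / 100))); last by rewrite ler_expR; lra.
rewrite !expRD invf_div; have e1 := expR1_ge.
apply: (@mul_lbound 20 (115 / 100)); [(clear; lra)|(clear; lra)| | |(clear; lra)].
  apply: (@mul_lbound (7387 / 1000) (2718 / 1000)); [(clear; lra)|(clear; lra)| |exact: e1|(clear; lra)].
  by apply: (@mul_lbound (2718 / 1000) (2718 / 1000)); [(clear; lra)|(clear; lra)|exact: e1|exact: e1|(clear; lra)].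
by apply: le_trans (expR_ge3 _); (clear; lra).
Qed.

Lemma expRN_2176 x : 2176 / 100 <= x -> expR (- x) <= 36 / (1000 * 1000 * 1000 * 100).
Proof.
move=> h; rewrite -[36 / _]invrK; apply: expRN_le; first by rewrite invr_gt0; lra.
apply: (@le_trans _ _ (expR (21 + 76 / 100))); last by rewrite ler_expR; lra.
rewrite expRD invf_div; have [_ e21] := expR_powers.
apply: (@mul_lbound _ (2130 / 1000) _ _ _ _ _ e21); [lra|lra| |lra].
by apply: le_trans (expR_ge3 _); lra.
Qed.

Lemma expRN_19 x : 19 / 10 <= x -> expR (- x) <= 151 / 1000.
Proof.
move=> h; rewrite -[151 / _]invrK; apply: expRN_le; first by rewrite invr_gt0; lra.
apply: (@le_trans _ _ (expR (1 + 9 / 10))); last by rewrite ler_expR; lra.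
rewrite expRD invf_div; have e1 := expR1_ge.
apply: (@mul_lbound _ (2453 / 1000) _ _ _ _ _ e1); [lra|lra| |lra].
by apply: le_trans (expR_ge3 _); lra.
Qed.

Lemma sqr_ubound (a b c : R) : 0 <= a -> a <= b -> b * b <= c -> a ^+ 2 <= c.
Proof. by move=> a0 ab h; apply: le_trans h; rewrite expr2; apply: ler_pM. Qed.

Lemma expRN_ge x (a : R) : expR x <= a -> a^-1 <= expR (- x).
Proof.
move=> h; have a0 : 0 < a by apply: lt_le_trans h; apply: expR_gt0.
by rewrite expRN lef_pV2 // posrE // expR_gt0.
Qed.

(** The exponent is halved nine times, to where the quadratic bound on e^x is sharp, and the result
    is squared back. The limit 6.31 is twice the upper bound 3.155 for pi. *)
Lemma expRN_lower x : 0 <= x <= 631 / 100 -> 1 / 670 <= expR (- x).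
Proof.
move=> /andP[x0 x1]; rewrite div1r; apply: expRN_ge.
apply: (@le_trans _ _ (expR (631 / 100))); first by rewrite ler_expR.
have y1 : `|(631 / (512 * 100) : R)| <= 1 / 2 by rewrite ger0_norm; clear; lra.
have /andP[_ h] := expR_near1D y1.
have E : expR (631 / 100 : R) = expR (631 / (512 * 100)) ^+ 2 ^+ 2 ^+ 2 ^+ 2 ^+ 2 ^+ 2 ^+ 2 ^+ 2 ^+ 2.
  have d (z : R) : expR z ^+ 2 = expR (2 * z) by rewrite mulr2n mulrDl mul1r expRD.
  by rewrite !d; congr expR; clear; lra.
rewrite E; have h0 : expR (631 / (512 * 100) : R) <= (101 * 1000 + 263) / (1000 * 100) by clear -h; lra.
have h1 := sqr_ubound (c := ((102 * 1000 + 542) / (1000 * 100))) (expR_ge0 _) h0 ltac:(clear; lra).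
have h2 := sqr_ubound (c := ((105 * 1000 + 149) / (1000 * 100))) (sqr_ge0 _) h1 ltac:(clear; lra).
have h3 := sqr_ubound (c := ((110 * 1000 + 564) / (1000 * 100))) (sqr_ge0 _) h2 ltac:(clear; lra).
have h4 := sqr_ubound (c := ((122 * 1000 + 244) / (1000 * 100))) (sqr_ge0 _) h3 ltac:(clear; lra).
have h5 := sqr_ubound (c := ((149 * 1000 + 436) / (1000 * 100))) (sqr_ge0 _) h4 ltac:(clear; lra).
have h6 := sqr_ubound (c := (2234 / 1000)) (sqr_ge0 _) h5 ltac:(clear; lra).
have h7 := sqr_ubound (c := (4991 / 1000)) (sqr_ge0 _) h6 ltac:(clear; lra).
have h8 := sqr_ubound (c := ((24 * 1000 + 911) / 1000)) (sqr_ge0 _) h7 ltac:(clear; lra).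
have h9 := sqr_ubound (c := (6206 / 10)) (sqr_ge0 _) h8 ltac:(clear; lra).
by apply: le_trans h9 _; clear; lra.
Qed.

End NumericalBounds.

(** * Bounds for E4, E6, Delta and E4^3 - x Delta *)

Section SeriesBounds.
Variable R : realType.
Local Notation C := R[i].
Local Notation cst := (@fps_cst C).

Lemma pow_le_geom p (M : R) n0 : (forall n, (n <= n0)%N -> n%:R ^+ p <= M * (5 / 2) ^+ n) ->
  (0 < n0)%N -> (n0.+1%:R / n0%:R) ^+ p <= 5 / 2 :> R ->
  forall n, n%:R ^+ p <= M * (5 / 2) ^+ n.
Proof.
move=> base n00 ratio; have M0 : 0 <= M.
  by have := base 0%N (leq0n _); rewrite expr0 mulr1; apply: le_trans; rewrite exprn_ge0.
suff H k : (n0 + k)%:R ^+ p <= M * (5 / 2) ^+ (n0 + k).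
  move=> n; case: (leqP n n0) => [/base//|h]; by rewrite -(subnKC (ltnW h)); apply: H.
elim: k => [|k IH]; first by rewrite addn0; apply: base.
have p0 : 0 < (n0 + k)%:R :> R by rewrite ltr0n addn_gt0 n00.
rewrite addnS exprSr [leRHS]mulrA.
have -> : (n0 + k).+1%:R ^+ p = (n0 + k)%:R ^+ p * ((n0 + k).+1%:R / (n0 + k)%:R) ^+ p :> R.
  by rewrite -exprMn mulrC divfK ?gt_eqF.
apply: ler_pM => //; rewrite ?exprn_ge0 ?divr_ge0 //.
apply: le_trans ratio; apply: lerXn2r; rewrite ?nnegrE ?divr_ge0 //.
have n0p : 0 < n0%:R :> R by rewrite ltr0n.
rewrite ler_pdivrMr // mulrAC ler_pdivlMr // -!natrM ler_nat; nia.
Qed.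

Lemma n4_le n : n%:R ^+ 4 <= (66 / 10) * (5 / 2) ^+ n :> R.
Proof.
apply: (@pow_le_geom 4 _ 5); [|by []|by lra].
by do 6 (case=> [_|]; first by lra).
Qed.

Lemma n6_le n : n%:R ^+ 6 <= 193 * (5 / 2) ^+ n :> R.
Proof.
apply: (@pow_le_geom 6 _ 7); [|by []|by lra].
by do 8 (case=> [_|]; first by lra).
Qed.

Lemma absb_1geom (f : fps C) (A : R) : cf f 0 = 1 -> 0 <= A ->
  (forall k, (0 < k)%N -> nm (cf f k) <= A * (5 / 2) ^+ k) -> absb f 5^-1 (1 + A * 2).
Proof.
move=> f0 A0 h; have -> : f = cst 1 + (f - 1) by rewrite addrC subrK.
apply: absbD; [by lra|by rewrite -{2}(nm1 R); apply: absb_cst|].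
have -> : A * 2 = A / (1 - 5^-1 * (5 / 2)).
  by have -> : 1 - 5^-1 * (5 / 2) = (2^-1 : R); [lra|rewrite invrK].
have g1 : 0 <= (5 / 2 : R) by lra.
have g2 : 0 <= (5^-1 : R) by lra.
have g3 : 5^-1 * (5 / 2) < (1 : R) by lra.
apply: (absb_geom A0 g1 g2 g3) => -[|k].
  by rewrite cfB f0 subrr nm0 mulr_ge0 // exprn_ge0 //; lra.
by rewrite cfB subr0 h.
Qed.

Lemma absb_E4 : absb (E4f R) 5^-1 3200.
Proof.
have A0 : 0 <= 240 * (66 / 10) :> R by lra.
have le : 1 + 240 * (66 / 10) * 2 <= 3200 :> R by lra.
apply: absbW (absb_1geom (cf_E4_0 R) A0 _) le => -[//|k] _.
rewrite /= nmM !nm_nat -mulrA; apply: ler_wpM2l; first by rewrite ler0n.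
by apply: le_trans (n4_le _); rewrite -natrX ler_nat sigma_le.
Qed.

Lemma absb_E6 : absb (E6f R) 5^-1 (1946 * 100).
Proof.
have A0 : 0 <= 504 * 193 :> R by lra.
have le : 1 + 504 * 193 * 2 <= 1946 * 100 :> R by lra.
apply: absbW (absb_1geom (cf_E6_0 R) A0 _) le => -[//|k] _.
rewrite /= nmN nmM !nm_nat -mulrA; apply: ler_wpM2l; first by rewrite ler0n.
by apply: le_trans (n6_le _); rewrite -natrX ler_nat sigma_le.
Qed.

Definition KD : R := 1728^-1 * (3200 ^+ 3 + (1946 * 100) ^+ 2).

Lemma DfE : Df R = cst 1728^-1 * (E4f R ^+ 3 - E6f R ^+ 2).
Proof. by apply: fpsP => n; rewrite cf_cstM mulrC. Qed.

Lemma absb_Df : absb (Df R) 5^-1 KD.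
Proof.
have p5 : 0 <= (5^-1 : R) by rewrite invr_ge0.
rewrite DfE /KD; apply: absbM => //.
  by have := absb_cst (1728^-1 : C) 5^-1; rewrite nmV nm_nat.
by apply: absbB => //; apply: absbX => //; [apply: absb_E4|apply: absb_E6].
Qed.

Lemma absb_divX (f g : fps C) (s K : R) : 0 < s -> absb f s K -> f = fX C * g -> absb g s (K / s).
Proof.
move=> s0 h fg N; rewrite ler_pdivlMr // mulr_suml; apply: le_trans (h N.+1).
rewrite [leRHS]big_nat_recl // fg cf_XM nm0 mul0r add0r.
by apply: ler_sum => k _; rewrite cf_XM exprSr mulrA.
Qed.

Lemma absb_d1 : absb (d1f R) 5^-1 (KD * 5).
Proof.
have p5 : 0 < (5^-1 : R) by rewrite invr_gt0.
by have := absb_divX p5 absb_Df (Df_X R); rewrite invrK.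
Qed.

(** The denominator E4^3 - x Delta, which vanishes at q = e(t) when j(t) = x. *)
Definition Bx (x : C) : fps C := E4f R ^+ 3 - cst x * (fX C * d1f R).

Lemma cf_Bx0 x : cf (Bx x) 0 = 1.
Proof. by rewrite cfB cf_cstM cf_XM mulr0 subr0 cfX0 cf_E4_0 expr1n. Qed.

(** Degrees below 20 are checked by computation. From 20 on, the norm at radius 1/5 gives a constant
    times 5^j, and (12/5)^20 absorbs the constant. The range 7500 is the bound for |j| on the arc in
    [jinv_arc_bound]. *)
Lemma Bx_coef (x : C) j : nm x <= 7500 -> (3 < j)%N -> nm (cf (Bx x) j) <= 19700 * 12 ^+ j.
Proof.
move=> x7 j3; case: (ltnP j 20) => j20; first by apply: B_coef_small => //; rewrite j3.
have p5 : 0 <= (5^-1 : R) by rewrite invr_ge0.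
have h : absb (Bx x) 5^-1 (3200 ^+ 3 + 7500 * KD).
  rewrite /Bx -Df_X; apply: absbB => //; first by apply: absbX => //; apply: absb_E4.
  apply: absbW (absbM p5 (absb_cst x 5^-1) absb_Df) _.
  by rewrite ler_wpM2r //; apply: absb_ge0 absb_Df.
have := absb_coef j p5 h; rewrite exprVn ler_pdivrMr ?exprn_gt0 // => {}h.
apply: le_trans h _; have -> : 12 ^+ j = (12 / 5) ^+ j * 5 ^+ j :> R by rewrite -exprMn divfK.
rewrite [leRHS]mulrA; apply: ler_wpM2r; first by rewrite exprn_ge0.
apply: (@le_trans _ _ (19700 * (12 / 5) ^+ 20)); last first.
  apply: ler_wpM2l; first by rewrite ler0n.
  by apply: ler_weXn2l; [lra|exact: j20].
have e4 : 33 <= (12 / 5) ^+ 4 :> R by lra.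
have e16 : 1100 * 1000 <= (12 / 5) ^+ 16 :> R.
  rewrite (_ : 16 = 4 * 4)%N // exprM; move: (_ ^+ 4) e4 => w w33; clear -w33.
  have : 33 ^+ 4 <= w ^+ 4 by apply: lerXn2r; rewrite ?nnegrE; lra.
  by lra.
rewrite (_ : 20 = 16 + 4)%N // exprD.
have : 1100 * 1000 * 33 <= (12 / 5) ^+ 16 * (12 / 5) ^+ 4 :> R by apply: (mul_lbound _ _ e16 e4 (lexx _)); clear; lra.
by move: (_ * _ ^+ 4) => w; rewrite /KD; clear; lra.
Qed.

Lemma Delta_val (t : C) : 0 < complex.Im t -> nm (e2pi t) < 5^-1 -> fval (Df R) (e2pi t) (Delta t).
Proof.
move=> t0 ts; have v4 : fval (E4f R) (e2pi t) (E4 t) := E4_e4c t0.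
have v6 : fval (E6f R) (e2pi t) (E6 t) := E6_e6c t0.
have p5 : 0 <= (5^-1 : R) by rewrite invr_ge0.
have X (f : fps C) K l n : absb f 5^-1 K -> fval f (e2pi t) l -> fval (f ^+ n) (e2pi t) (l ^+ n).
  move=> af vf; elim: n => [|n IH]; first by rewrite !expr0; apply: fval_cst.
  by rewrite !exprS; apply: (fvalM af (absbX n p5 af) ts vf IH).
have a3 := absbX 3 p5 absb_E4; have a2 := absbX 2 p5 absb_E6.
have vs := fvalD (X _ _ _ 3 absb_E4 v4) (fvalN (X _ _ _ 2 absb_E6 v6)).
have := fvalM (absb_cst 1728^-1 5^-1) (absbB p5 a3 a2) ts (fval_cst _ _) vs.
by rewrite -DfE /Delta [1728^-1 * _]mulrC.
Qed.

Lemma d1_val (t : C) : 0 < complex.Im t -> nm (e2pi t) < 5^-1 ->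
  fval (d1f R) (e2pi t) (Delta t / e2pi t).
Proof.
move=> t0 ts; have vD := Delta_val t0 ts.
have [l vl] := fval_ex absb_d1 (ltW ts).
have p5 : 0 <= (5^-1 : R) by rewrite invr_ge0.
have := fvalM (absb_X p5) absb_d1 ts (fval_X _) vl; rewrite -Df_X => h.
by rewrite (fval_uniq vD h) mulrAC divff ?e2pi_neq0 // mul1r.
Qed.

Lemma Bx_val (t x : C) : 0 < complex.Im t -> nm (e2pi t) < 5^-1 -> E4 t ^+ 3 = x * Delta t ->
  fval (Bx x) (e2pi t) 0.
Proof.
move=> t0 ts hx; have v4 : fval (E4f R) (e2pi t) (E4 t) := E4_e4c t0.
have p5 : 0 <= (5^-1 : R) by rewrite invr_ge0.
have v3 : fval (E4f R ^+ 3) (e2pi t) (E4 t ^+ 3).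
  rewrite !exprS !expr0 !mulr1; apply: (fvalM absb_E4 (absbM p5 absb_E4 absb_E4) ts v4).
  exact: (fvalM absb_E4 absb_E4 ts v4 v4).
have vx := fvalM (absb_cst x 5^-1) absb_Df ts (fval_cst _ _) (Delta_val t0 ts).
by have := fvalD v3 (fvalN vx); rewrite hx subrr /Bx -Df_X.
Qed.

(** The linear coefficient has modulus 24; the next six coefficients and a tail estimated at radius
    1/5 raise this to at most 26 for s <= 0.0066, which is 3/2 times the bound 0.0044 for |e(t)|. *)
Lemma absb_d1_small (s : R) : 0 <= s <= 66 / (100 * 100) -> absb (d1f R - 1) s (s * 26).
Proof.
move=> /andP[s0 s1].
pose h : fps C := Fps (fun k => cf (d1f R) k.+1).
have E : d1f R - 1 = fX C * h.
  by apply: fpsP => -[|k]; rewrite cf_XM cfB ?d1f_0 ?subrr // subr0.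
rewrite E; apply: absbM => //; first exact: absb_X.
have p5 : 0 < (5^-1 : R) by rewrite invr_gt0.
have ah : absb h 5^-1 ((KD * 5 + 1) / 5^-1).
  apply: (absb_divX p5 _ E); apply: (absbB (ltW p5) absb_d1).
  by rewrite -{2}(nm1 R); apply: absb_cst.
have s5 : 0 <= s <= 5^-1 by apply/andP; split; lra.
move=> N; pose M := maxn 7 N.
apply: (@le_trans _ _ (\sum_(0 <= k < M) nm (cf h k) * s ^+ k)).
  rewrite [leRHS](big_cat_nat (n := N)) ?leq_maxr // lerDl.
  by apply: sumr_ge0 => k _; apply: absb_term.
rewrite (big_cat_nat (n := 7)) ?leq_maxl //.
have t := absb_tail 7 M s5 p5 ah.
apply: le_trans (lerD (lexx _) t) _.
have tb k (a b : nat) : (k.+1 < 8)%N -> (nth 0 tau8 k.+1 <= a * b)%N -> nm (cf h k) <= a%:R * b%:R.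
  by move=> k8 le; rewrite (nm_d1_small R k8) -natrM ler_nat.
have t1 := tb 0%N 24 1 isT ltac:(by vm_compute); have t2 := tb 1%N 252 1 isT ltac:(by vm_compute).
have t3 := tb 2%N 1472 1 isT ltac:(by vm_compute); have t4 := tb 3%N 49 100 isT ltac:(by vm_compute).
have t5 := tb 4%N 61 100 isT ltac:(by vm_compute); have t6 := tb 5%N 168 100 isT ltac:(by vm_compute).
have t7 := tb 6%N 850 100 isT ltac:(by vm_compute).
clear tb; clearbody h; rewrite !big_nat_recr //= big_geq //.
rewrite add0r expr0 expr1 mulr1.
have z0 : 0 <= s / 5^-1 by apply: divr_ge0; lra.
have z1 : s / 5^-1 <= 33 / 1000 by rewrite invrK; lra.
have q1 : (s / 5^-1) ^+ 7 <= (33 / 1000) ^+ 7.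
  by apply: lerXn2r; rewrite ?nnegrE; [exact: z0|clear; lra|exact: z1].
have K0 : 0 <= (KD * 5 + 1) / 5^-1 by apply: absb_ge0 ah.
have q2 := ler_wpM2r K0 q1; apply: le_trans (lerD (lexx _) q2) _.
have w n : s ^+ n <= (66 / (100 * 100)) ^+ n by apply: lerXn2r; rewrite ?nnegrE; [exact: s0|clear; lra|exact: s1].
have w2 := w 2; have w3 := w 3; have w4 := w 4; have w5 := w 5; have w6 := w 6.
have v n : 0 <= s ^+ n by apply: exprn_ge0.
have m1 := ler_pM (nm_ge0 _) s0 t2 s1.
have m2 := ler_pM (nm_ge0 _) (v 2) t3 w2; have m3 := ler_pM (nm_ge0 _) (v 3) t4 w3.
have m4 := ler_pM (nm_ge0 _) (v 4) t5 w4; have m5 := ler_pM (nm_ge0 _) (v 5) t6 w5.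
have m6 := ler_pM (nm_ge0 _) (v 6) t7 w6.
rewrite /KD invrK; move: m1 m2 m3 m4 m5 m6 t1; move: (nm (cf h 0)) (nm (cf h 1) * s) (_ * s ^+ 2) (_ * s ^+ 3) (_ * s ^+ 4) (_ * s ^+ 5) (_ * s ^+ 6).
by clear => *; lra.
Qed.

End SeriesBounds.

(** * Zeros of the denominator along the arc *)

Section ArcRoots.
Variable R : realType.
Local Notation C := R[i].
Local Notation cst := (@fps_cst C).
Implicit Types u v : R.

Definition arcy u : R := Num.sqrt (1 - u ^+ 2).
(** Three zeros of E4^3 - j(t) Delta: [rt2] is the conjugate of [rt1], a zero because j is real on
    the arc, and [rt3] comes from t -> t + 1 followed by inversion. By [arc_t3] the last point has
    real part -1/2, so [rt3] is a negative real number. *)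
Definition rt1 u : C := e2pi (unit_arc u).
Definition rt2 u : C := e2pi (- (unit_arc u)^*%C).
Definition rt3 u : C := e2pi (- (unit_arc u + 1)^-1).

Lemma arcy_facts u : - (1 / 2) <= u <= 0 ->
  [/\ arcy u ^+ 2 = 1 - u ^+ 2, 866 / 1000 <= arcy u & arcy u <= 1].
Proof.
move=> /andP[u1 u2]; have h : 3 / 4 <= 1 - u ^+ 2 by clear -u1 u2; nra.
have y0 : 0 <= arcy u by apply: sqrtr_ge0.
have y2 : arcy u ^+ 2 = 1 - u ^+ 2 by rewrite sqr_sqrtr //; clear -h; lra.
have y1 : (0 : R) <= 1 by apply: ler01.
have y8 : (0 : R) <= 866 / 1000 by clear; lra.
split; first exact: y2.
  by rewrite -(ler_sqr y8 y0) y2; clear -h; lra.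
rewrite -(ler_sqr y0 y1) y2; have := sqr_ge0 u; clear; lra.
Qed.

Lemma arc_open u : - (1 / 2) <= u <= 0 -> -1 < u < 1.
Proof. by move=> /andP[? ?]; apply/andP; split; lra. Qed.

Lemma arc_t3 u : - (1 / 2) <= u <= 0 ->
  - (unit_arc u + 1)^-1 = (- (1 / 2)) +i* (arcy u / (1 + u) / 2).
Proof.
move=> hu; have [y2 _ _] := arcy_facts hu; case/andP: hu => u1 u2.
have v0 : 1 + u != 0 by rewrite gt_eqF //; lra.
have n0 : unit_arc u + 1 != 0.
  by rewrite eq_complex /= addrC (negbTE v0).
apply: (mulIf n0); rewrite mulNr mulVf //; apply/eqP; rewrite eq_complex /= -/(arcy u).
apply/andP; split; apply/eqP; rewrite ?oppr0; last by field.
have -> : (arcy u / (1 + u) / 2) * (arcy u + 0) = arcy u ^+ 2 / (1 + u) / 2 by rewrite addr0 expr2; ring.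
by rewrite y2; field.
Qed.

Lemma nm_rt1 u : nm (rt1 u) = expR (- (2 * pi * arcy u)).
Proof. by rewrite /rt1 nm_e2pi. Qed.

Lemma rt2_conj u : rt2 u = ((rt1 u)^*)%C.
Proof. by rewrite /rt2 /rt1 e2pi_conj. Qed.

Lemma nm_rt2 u : nm (rt2 u) = nm (rt1 u).
Proof. by rewrite rt2_conj nm_conj. Qed.

Lemma nm_rt3 u : - (1 / 2) <= u <= 0 -> nm (rt3 u) = expR (- (pi * (arcy u / (1 + u)))).
Proof. by move=> hu; rewrite /rt3 (arc_t3 hu) nm_e2pi; congr (expR (- _)) => /=; field; rewrite gt_eqF //; case/andP: hu => ? ?; lra. Qed.

(** Here e^(- pi T) is the modulus of [rt3]. The constant 6.928 lies just below 4 sqrt 3, the value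
    of 6 y + T at rho. *)
Lemma arc_T u : - (1 / 2) <= u <= 0 -> let y := arcy u in let T := y / (1 + u) in
  [/\ 1 <= T, T <= 2 * y & 6928 / 1000 <= 6 * y + T].
Proof.
move=> hu y T; have [y2 yl yu] := arcy_facts hu; rewrite -/y in y2 yl yu; case/andP: hu => u1 u2.
have v0 : 0 < 1 + u by clear -u1; lra.
split.
- rewrite (ler_pdivlMr _ _ v0) mul1r -ler_sqr ?nnegrE ?y2; [|clear -v0; lra|clear -yl; lra].
  clear -u1 u2; nra.
- rewrite (ler_pdivrMr _ _ v0); clear -u1 yl; nra.
have -> : 6 * y + T = y * (7 + 6 * u) / (1 + u) by rewrite /T; field; rewrite gt_eqF.
rewrite (ler_pdivlMr _ _ v0) -ler_sqr ?nnegrE; last 2 first.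
- by clear -v0; lra.
- by apply: mulr_ge0; clear -yl u1; lra.
rewrite !exprMn y2; apply: (@le_trans _ _ (48 * (1 + u) ^+ 2)).
  by have := sqr_ge0 (1 + u); move: (_ ^+ 2) => w; clear; lra.
(* With v = 1 + u this is v (2 - v) (1 + 6 v)^2 - 48 v^2, factored by its root v = 1/2, which
   corresponds to rho. *)
have h : 0 <= (1 + u) * ((1 + u - 1 / 2) * (- 36 * (1 + u) ^+ 2 + 42 * (1 + u) - 4)).
  apply: mulr_ge0; first exact: ltW.
  apply: mulr_ge0; clear -u1 u2; nra.
rewrite -subr_ge0; apply: le_trans h _; rewrite le_eqVlt; apply/orP; left; apply/eqP; clear; by field.
Qed.

(** The last bound is about ten times better than what the separate ones give, since [rt1] is
    largest at rho and [rt3] at i. The estimate in [kappa_num] depends on this gain. *)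
Lemma arc_bounds u : - (1 / 2) <= u <= 0 ->
  [/\ 1 / 670 <= nm (rt1 u), nm (rt1 u) <= 44 / (100 * 100), nm (rt1 u) <= nm (rt3 u),
      nm (rt3 u) <= 435 / (100 * 100) &
      nm (rt1 u) ^+ 3 * nm (rt3 u) <= 36 / (1000 * 1000 * 1000 * 100)].
Proof.
move=> hu; have [_ yl yu] := arcy_facts hu; have [T1 T2 T3] := arc_T hu.
rewrite nm_rt1 (nm_rt3 hu); have /andP[p1 p2] := pi_bounds R.
move: (arcy u) (arcy u / (1 + u)) yl yu T1 T2 T3 => y T yl yu T1 T2 T3.
have py : 7853 / 2500 * (866 / 1000) <= pi * y by apply: (mul_lbound _ _ p1 yl (lexx _)); clear; lra.
have py2 : pi * y <= 3155 / 1000 * 1 by apply: (ler_pM _ _ p2 yu); clear -p1 yl; lra.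
have pT : 7853 / 2500 * 1 <= pi * T by apply: (mul_lbound _ _ p1 T1 (lexx _)); clear; lra.
have pT2 : pi * T <= pi * (2 * y) by apply: (ler_wpM2l _ T2); clear -p1; lra.
have p3 : 7853 / 2500 * (6928 / 1000) <= pi * (6 * y + T) by apply: (mul_lbound _ _ p1 T3 (lexx _)); clear; lra.
split.
- by apply: expRN_lower; rewrite -mulrA; apply/andP; split; clear -py py2; lra.
- by apply: expRN_544; rewrite -mulrA; clear -py; lra.
- by rewrite ler_expR lerN2 -mulrA; clear -pT2; lra.
- by apply: expRN_314; clear -pT; lra.
rewrite !exprS expr0 mulr1 -!expRD; apply: le_trans (expRN_2176 (x := pi * (6 * y + T)) _).
  by rewrite le_eqVlt; apply/orP; left; apply/eqP; congr expR; ring.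
clear -p3; lra.
Qed.

Lemma rt1_lt5 u : - (1 / 2) <= u <= 0 -> nm (rt1 u) < 5^-1.
Proof. by move=> /arc_bounds[_ h _ _ _]; apply: le_lt_trans h _; clear; lra. Qed.

Lemma rt3_lt5 u : - (1 / 2) <= u <= 0 -> nm (rt3 u) < 5^-1.
Proof. by move=> /arc_bounds[_ _ _ h _]; apply: le_lt_trans h _; clear; lra. Qed.

Lemma Delta_arc u : - (1 / 2) <= u <= 0 -> nm (Delta (unit_arc u) / rt1 u - 1) <= 1144 / (100 * 100).
Proof.
move=> hu; have [l1 h _ _ _] := arc_bounds hu.
have r0 : 0 < nm (rt1 u) by rewrite nm_gt0 e2pi_neq0.
have hs : 0 <= nm (rt1 u) <= 66 / (100 * 100) by apply/andP; split; clear -r0 h; lra.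
have v := d1_val (arc_Im (arc_open hu)) (rt1_lt5 hu).
have := fval_bound (absb_d1_small hs) r0 (lexx _) (fvalD v (fvalN (fval_cst 1 _))).
by move=> b; apply: le_trans b _; clear -h; lra.
Qed.

Lemma Delta_arc_lower u : - (1 / 2) <= u <= 0 -> 8856 / (100 * 100) * nm (rt1 u) <= nm (Delta (unit_arc u)).
Proof.
move=> hu; have b := Delta_arc hu; have r0 : 0 < nm (rt1 u) by rewrite nm_gt0 e2pi_neq0.
rewrite -(ler_pdivlMr _ _ r0) -nmV -nmM; move: (Delta _ / _) b => z b.
have := nm_ge_sub 1 (1 - z); rewrite nm1 (_ : 1 - (1 - z) = z); [rewrite (nm_sub 1 z) => h|ring].
clear -h b; lra.
Qed.

Lemma Delta_arc_neq0 u : - (1 / 2) <= u <= 0 -> Delta (unit_arc u) != 0.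
Proof.
move=> hu; rewrite -nm_gt0; apply: lt_le_trans (Delta_arc_lower hu).
by apply: mulr_gt0; [clear; lra|rewrite nm_gt0 e2pi_neq0].
Qed.

Lemma sum3 (f : fps C) (r : C) :
  \sum_(0 <= k < 3) cf f k * r ^+ k = cf f 0 + cf f 1 * r + cf f 2 * r ^+ 2.
Proof. by rewrite big_mkord !big_ord_recl big_ord0 addr0 expr0 mulr1 addrA. Qed.

Lemma nm_quad (a b r : C) : nm (1 + a * r + b * r ^+ 2) <= 1 + nm a * nm r + nm b * nm r ^+ 2.
Proof.
apply: le_trans (nmD _ _) _; rewrite [nm (b * _)]nmM nmX lerD2r.
by apply: le_trans (nmD _ _) _; rewrite nm1 nmM.
Qed.

Lemma E4_arc_bound u : - (1 / 2) <= u <= 0 -> nm (E4 (unit_arc u)) <= 2132 / 1000.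
Proof.
move=> hu; have [_ h _ _ _] := arc_bounds hu.
have v : fval (E4f R) (rt1 u) (E4 (unit_arc u)) := E4_e4c (arc_Im (arc_open hu)).
have p5 : 0 < (5^-1 : R) by rewrite invr_gt0.
have := fval_near 3 (absb_E4 R) p5 (ltW (rt1_lt5 hu)) v.
have r0 := nm_ge0 (rt1 u); move: (E4 _) (rt1 u) r0 h {v hu} => e r r0 h.
have s1 : (sigma 3 1 = 1)%N by apply: sigma1.
have s2 : (sigma 3 2 = 9)%N by rewrite /sigma; have -> : divisors 2 = [:: 1; 2]%N by []; rewrite !big_cons big_nil.
have c1 : cf (E4f R) 1 = 240 by rewrite /= s1 mulr1.
have c2 : cf (E4f R) 2 = 240 * 9 by rewrite /= s2.
rewrite sum3 (cf_E4_0 R) c1 c2 => b.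
have b2 : nm (1 + 240 * r + 240 * 9 * r ^+ 2) <= 1 + 240 * nm r + 240 * 9 * nm r ^+ 2.
  by apply: le_trans (nm_quad _ _ _) _; rewrite nmM !nm_nat.
have k1 : nm r ^+ 2 <= (44 / (100 * 100)) ^+ 2 by apply: lerXn2r; rewrite ?nnegrE; [exact: r0|clear; lra|exact: h].
have k2 : (nm r / 5^-1) ^+ 3 <= (22 / 1000) ^+ 3.
  rewrite invrK; apply: lerXn2r; rewrite ?nnegrE; [clear -r0; lra|clear; lra|clear -h; lra].
have := nm_ge_sub e (1 + 240 * r + 240 * 9 * r ^+ 2).
move: (nm e) (nm _) (nm (_ - _)) (nm r) (nm r ^+ 2) ((nm r / _) ^+ 3) h b b2 k1 k2.
clear => *; lra.
Qed.

Lemma jinv_arc_bound u : - (1 / 2) <= u <= 0 -> nm (jinv (unit_arc u)) <= 7500.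
Proof.
move=> hu; have e := E4_arc_bound hu; have d := Delta_arc_lower hu.
have [l _ _ _ _] := arc_bounds hu.
have D0 : 0 < nm (Delta (unit_arc u)) by rewrite nm_gt0 Delta_arc_neq0.
rewrite /jinv nmM nmV nmX (ler_pdivrMr _ _ D0).
have k : nm (E4 (unit_arc u)) ^+ 3 <= (2132 / 1000) ^+ 3.
  by apply: lerXn2r; rewrite ?nnegrE; [exact: nm_ge0|clear; lra|exact: e].
clear -k d l; lra.
Qed.

Lemma jinv_DeltaE u : - (1 / 2) <= u <= 0 ->
  E4 (unit_arc u) ^+ 3 = jinv (unit_arc u) * Delta (unit_arc u).
Proof. by move=> hu; rewrite /jinv divfK // Delta_arc_neq0. Qed.

Lemma Bx_rt1 u : - (1 / 2) <= u <= 0 -> fval (Bx (jinv (unit_arc u))) (rt1 u) 0.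
Proof. by move=> hu; apply: (Bx_val (arc_Im (arc_open hu)) (rt1_lt5 hu) (jinv_DeltaE hu)). Qed.

Lemma Im_mconj (t : C) : 0 < complex.Im t -> 0 < complex.Im (- t^*%C).
Proof. by case: t => a b /=; rewrite opprK. Qed.

Lemma Delta_conj (t : C) : 0 < complex.Im t -> (Delta t)^*%C = Delta (- t^*%C).
Proof.
move=> t0; rewrite /Delta cjM cjD cjN !cjX (E4_conj t0) (E6_conj t0) cjV.
by congr (_ / _); rewrite cj_nat.
Qed.

Lemma Bx_rt2 u : - (1 / 2) <= u <= 0 -> fval (Bx (jinv (unit_arc u))) (rt2 u) 0.
Proof.
move=> hu; have t0 := arc_Im (arc_open hu); apply: (Bx_val (Im_mconj t0)).
  by rewrite -/(rt2 u) nm_rt2; apply: rt1_lt5.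
rewrite -(E4_conj t0) -(Delta_conj t0) -cjX (jinv_DeltaE hu) cjM.
by rewrite (jinv_arc_conj (arc_open hu)).
Qed.

Lemma Im_shift (t : C) : complex.Im (t + 1) = complex.Im t.
Proof. by case: t => a b /=; rewrite addr0. Qed.

Lemma Bx_rt3 u : - (1 / 2) <= u <= 0 -> fval (Bx (jinv (unit_arc u))) (rt3 u) 0.
Proof.
move=> hu; have t0 := arc_Im (arc_open hu).
have t1 : 0 < complex.Im (unit_arc u + 1) by rewrite Im_shift.
apply: (Bx_val (Im_inv_gt0 t1) (rt3_lt5 hu)).
have e4 : E4 (- (unit_arc u + 1)^-1) = (unit_arc u + 1) ^+ 4 * E4 (unit_arc u) by rewrite (E4_inv t1) E4_shift.
have e6 : E6 (- (unit_arc u + 1)^-1) = (unit_arc u + 1) ^+ 6 * E6 (unit_arc u) by rewrite (E6_inv t1) E6_shift.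
have eD : Delta (- (unit_arc u + 1)^-1) = (unit_arc u + 1) ^+ 12 * Delta (unit_arc u).
  rewrite /Delta e4 e6; move: (1728^-1 : C) => w; ring.
have := jinv_DeltaE hu; rewrite e4 eD exprMn -exprM => ->; ring.
Qed.

Lemma e2piE (a b : R) : e2pi (a +i* b) = (expR (- (2 * pi * b)) * cos (2 * pi * a)) +i*
  (expR (- (2 * pi * b)) * sin (2 * pi * a)).
Proof.
rewrite /e2pi; have -> : (0 +i* (2 * pi)) * (a +i* b) = (- (2 * pi * b)) +i* (2 * pi * a).
  by apply/eqP; rewrite eq_complex /= !mul0r sub0r add0r !eqxx.
by apply/eqP; rewrite /cexp eq_complex /= !mul0r subr0 addr0 !eqxx.
Qed.

Lemma Im_rt1 u : complex.Im (rt1 u) = nm (rt1 u) * sin (2 * pi * u).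
Proof. by rewrite nm_rt1 /rt1 /unit_arc e2piE. Qed.

Lemma sin_arc_lt0 u : - (1 / 2) < u < 0 -> sin (2 * pi * u) < 0.
Proof.
move=> /andP[u1 u2]; have p0 := @pi_gt0 R.
have -> : 2 * pi * u = - (2 * pi * (- u)) by rewrite mulrN opprK.
rewrite sinN oppr_lt0; apply: sin_gt0_pi; apply/andP; split.
  by apply: mulr_gt0; [apply: mulr_gt0|]; clear -u2 p0; lra.
have : pi * (- (2 * u)) < pi * 1 by rewrite ltr_pM2l //; clear -u1; lra.
move: (pi : R) => w; clear; lra.
Qed.

Lemma Im_rt1_lt0 u : - (1 / 2) < u < 0 -> complex.Im (rt1 u) < 0.
Proof.
move=> hu; rewrite Im_rt1; have a0 : 0 < nm (rt1 u) by rewrite nm_gt0 e2pi_neq0.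
by rewrite (pmulr_rlt0 _ a0); apply: sin_arc_lt0.
Qed.

Lemma Im_rt3 u : - (1 / 2) <= u <= 0 -> complex.Im (rt3 u) = 0.
Proof.
move=> hu; rewrite /rt3 (arc_t3 hu) e2piE.
have -> : 2 * pi * - (1 / 2) = - pi :> R by field.
by rewrite sinN sinpi oppr0 mulr0.
Qed.

Lemma rt_neq0 u : [/\ rt1 u != 0, rt2 u != 0 & rt3 u != 0].
Proof. by split; apply: e2pi_neq0. Qed.

Lemma nm_rt1_gt0 u : 0 < nm (rt1 u).
Proof. by rewrite nm_gt0 e2pi_neq0. Qed.

Lemma nm_rt3_gt0 u : 0 < nm (rt3 u).
Proof. by rewrite nm_gt0 e2pi_neq0. Qed.

Opaque rt1 rt2 rt3.

Lemma rt_neq u : - (1 / 2) < u < 0 -> [/\ rt2 u != rt1 u, rt3 u != rt1 u & rt3 u != rt2 u].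
Proof.
move=> hu; have i1 := Im_rt1_lt0 hu.
have hu' : - (1 / 2) <= u <= 0 by case/andP: hu => ? ?; apply/andP; split; apply: ltW.
have i3 := Im_rt3 hu'.
have i2 : complex.Im (rt2 u) = - complex.Im (rt1 u) by rewrite rt2_conj; case: (rt1 u).
by split; apply/eqP => e; move: i3 i2 i1; rewrite -?e; clear => *; lra.
Qed.

(** Here a and b are |rt1| and |rt3|. Collecting factors, the left side is 19700 times 12^4 times
    3/2 times a^3 b, over denominators whose product is at least 0.394. A value below 1 is what
    keeps the cofactor G away from 0. *)
Lemma kappa_num (a b : R) : 0 < a -> 0 < b -> a <= 44 / (100 * 100) -> b <= 435 / (100 * 100) ->
  a ^+ 3 * b <= 36 / (1000 * 1000 * 1000 * 100) ->
  19700 * (a * 12) / (1 - a * 12) * (a * 12) / (1 - a * 12) * (b * 12) / (1 - b * 12) * 12 /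
    (1 - (3 / 2 * a) * 12) * (3 / 2 * a) <= 56 / 100.
Proof.
move=> a0 b0 a1 b1 ab.
have d1 : 9472 / (100 * 100) <= 1 - a * 12 by clear -a1; lra.
have d2 : 478 / 1000 <= 1 - b * 12 by clear -b1; lra.
have d3 : 9208 / (100 * 100) <= 1 - 3 / 2 * a * 12 by clear -a1; lra.
have p1 : 0 < 1 - a * 12 by clear -d1; lra.
have p2 : 0 < 1 - b * 12 by clear -d2; lra.
have p3 : 0 < 1 - 3 / 2 * a * 12 by clear -d3; lra.
have m1 : (9472 / (100 * 100)) * (9472 / (100 * 100)) <= (1 - a * 12) * (1 - a * 12) by apply: (mul_lbound _ _ d1 d1 (lexx _)); clear; lra.
have m2 : (478 / 1000) * (9208 / (100 * 100)) <= (1 - b * 12) * (1 - 3 / 2 * a * 12) by apply: (mul_lbound _ _ d2 d3 (lexx _)); clear; lra.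
have m3 : 394 / 1000 <= (1 - a * 12) * (1 - a * 12) * ((1 - b * 12) * (1 - 3 / 2 * a * 12)).
  by apply: (mul_lbound _ _ m1 m2); clear; lra.
have E (k w h x y z : R) : x != 0 -> y != 0 -> z != 0 ->
    k * (a * w) / x * (a * w) / x * (b * w) / y * w / z * (h * a) =
    (k * (w * w * w * w) * h * (a ^+ 3 * b)) / (x * x * (y * z)).
  by clear => x0 y0 z0; field; rewrite x0 y0 z0.
rewrite (E _ _ _ _ _ _ (lt0r_neq0 p1) (lt0r_neq0 p2) (lt0r_neq0 p3)) {E}.
rewrite ler_pdivrMr; last by apply: mulr_gt0; apply: mulr_gt0.
by move: (a ^+ 3 * b) (_ * _ * (_ * _)) ab m3; clear => x y ab m3; lra.
Qed.

(** The radius exceeds |rt1| by the fixed factor 3/2, the source of the later error (2/3)^n. The arc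
    is open because the zeros must be distinct: [rt1] and [rt2] meet at i, and all three meet at
    rho. *)
Lemma arc_factor u : - (1 / 2) < u < 0 -> exists G : fps C,
  (1 - cst (rt1 u)^-1 * fX C) * ((1 - cst (rt2 u)^-1 * fX C) * ((1 - cst (rt3 u)^-1 * fX C) * G))
    = Bx (jinv (unit_arc u)) /\ absb (G - 1) (3 / 2 * nm (rt1 u)) (56 / 100).
Proof.
move=> hu; have hu' : - (1 / 2) <= u <= 0 by case/andP: hu => ? ?; apply/andP; split; apply: ltW.
have [_ a1 _ b1 ab] := arc_bounds hu'.
have a0 := nm_rt1_gt0 u.
have b0 := nm_rt3_gt0 u.
have p12 : 0 < (12 : R) by rewrite ltr0n.
have A0 : 0 <= 19700 :> R by rewrite ler0n.
have Y0 : 0 <= 12 :> R by rewrite ler0n.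
have y1 : nm (rt1 u) * 12 < 1 by clear -a1; lra.
have y3 : nm (rt3 u) * 12 < 1 by clear -b1; lra.
have y2 : nm (rt2 u) * 12 < 1 by rewrite nm_rt2.
have [|G [GE G0 bG]] := @cube_roots_div _ (Bx (jinv (unit_arc u))) (rt1 u) (rt2 u) (rt3 u) 19700 12
  (cf_Bx0 _) (rt_neq0 u) (rt_neq hu) (And3 (Bx_rt1 hu') (Bx_rt2 hu') (Bx_rt3 hu')) A0 Y0 (And3 y1 y2 y3) _.
- by move=> j; apply: Bx_coef; apply: jinv_arc_bound.
exists G; split; first exact: GE.
rewrite nm_rt2 in bG; have := kappa_num a0 b0 a1 b1 ab.
set kap := _ * (nm (rt3 u) * 12) / (1 - nm (rt3 u) * 12) in bG *.
have kap0 : 0 <= kap.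
  have := bG 1%N isT; rewrite expr1 => h; have := le_trans (nm_ge0 _) h.
  by rewrite (pmulr_lge0 _ p12).
move=> kn; apply: absbW _ kn.
pose h : fps C := Fps (fun k => cf (G - 1) k.+1).
have s0 : 0 <= 3 / 2 * nm (rt1 u) by clear -a0; lra.
have -> : G - 1 = fX C * h by apply: fpsP => -[|k]; rewrite cf_XM cfB ?G0 ?subrr.
rewrite mulrC; apply: absbM; [exact: s0| |exact: absb_X].
apply: absb_geom; [exact: (mulr_ge0 kap0 Y0)|exact: Y0|exact: s0|by clear -a1; lra|] => k.
by rewrite -mulrA -exprS; have := bG k.+1 isT; rewrite /h /= subr0.
Qed.

Lemma arc_factor_val u (G : fps C) (r : C) : - (1 / 2) < u < 0 ->
  absb (G - 1) (3 / 2 * nm (rt1 u)) (56 / 100) -> nm r <= 3 / 2 * nm (rt1 u) ->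
  exists l, fval G r l /\ nm (l - 1) <= 56 / 100.
Proof.
move=> hu aG rs; have s0 : 0 < 3 / 2 * nm (rt1 u).
  by have := nm_rt1_gt0 u; clear; lra.
have [l vl] := fval_ex aG rs; exists (l + 1).
split; first by have := fvalD vl (fval_cst 1 r); rewrite subrK.
by rewrite addrK; apply: (fval_bound aG s0 rs vl).
Qed.

Lemma nm_rt1_lt u v : - (1 / 2) <= u -> u < v -> v <= 0 -> nm (rt1 v) < nm (rt1 u).
Proof.
move=> u1 uv v0; have hu : - (1 / 2) <= u <= 0 by apply/andP; split; clear -u1 uv v0; lra.
have hv : - (1 / 2) <= v <= 0 by apply/andP; split; clear -u1 uv v0; lra.
have [yu lu _] := arcy_facts hu; have [yv lv _] := arcy_facts hv.
rewrite !nm_rt1 ltr_expR ltrN2 ltr_pM2l ?mulr_gt0 ?pi_gt0 //.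
rewrite -ltr_sqr ?nnegrE ?sqrtr_ge0 // yu yv; clear -uv v0; nra.
Qed.

(** If j takes equal values at u < v, then [rt1 v] is a zero of the series attached to u, inside the
    disc because its modulus is smaller. It differs from [rt1 u] and [rt2 u] in modulus, and from
    [rt3 u] because that one is real. So G would vanish there, against |G - 1| <= 0.56. *)
Lemma jinv_arc_inj u v : - (1 / 2) < u -> u < v -> v < 0 -> jinv (unit_arc u) != jinv (unit_arc v).
Proof.
move=> u1 uv v0; apply/eqP => e.
have hu : - (1 / 2) < u < 0 by apply/andP; split; clear -u1 uv v0; lra.
have hu' : - (1 / 2) <= u <= 0 by apply/andP; split; clear -u1 uv v0; lra.
have hv : - (1 / 2) < v < 0 by apply/andP; split; clear -u1 uv v0; lra.
have hv' : - (1 / 2) <= v <= 0 by apply/andP; split; clear -u1 uv v0; lra.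
have [G [GE aG]] := arc_factor hu.
have lt := nm_rt1_lt (ltW u1) uv (ltW v0).
have a0 := nm_rt1_gt0 u.
have s0 : 0 <= 3 / 2 * nm (rt1 u) by clear -a0; lra.
have rs : nm (rt1 v) < 3 / 2 * nm (rt1 u) by clear -a0 lt; lra.
have [l [vl l1]] := arc_factor_val hu aG (ltW rs).
have aG' : absb G (3 / 2 * nm (rt1 u)) (56 / 100 + nm 1).
  by have := absbD s0 aG (absb_cst 1 _); rewrite subrK.
have vb := Bx_rt1 hv'; rewrite -e -GE in vb.
have al r := absb_lin r s0; have vll r := fval_lin r (rt1 v).
have v3 := fvalM (al _) aG' rs (vll (rt3 u)) vl.
have a3 := absbM s0 (al (rt3 u)) aG'.
have v2 := fvalM (al _) a3 rs (vll (rt2 u)) v3.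
have a2 := absbM s0 (al (rt2 u)) a3.
have v1 := fvalM (al _) a2 rs (vll (rt1 u)) v2.
have /eqP := fval_uniq v1 vb; rewrite !mulf_eq0.
have nz (r : C) : r != 0 -> rt1 v != r -> (1 - rt1 v / r == 0) = false.
  move=> r0 h; apply/negbTE; rewrite subr_eq0; apply: contra h => /eqP h.
  by rewrite -[r]mul1r h divfK.
have [z1 z2 z3] := rt_neq0 u.
have n1 : rt1 v != rt1 u by apply/eqP => e1; move: lt; rewrite e1 ltxx.
have n2 : rt1 v != rt2 u by apply/eqP => e2; move: lt; rewrite e2 nm_rt2 ltxx.
have n3 : rt1 v != rt3 u by apply/eqP => e3; have := Im_rt1_lt0 hv; rewrite e3 (Im_rt3 hu') ltxx.
rewrite (nz _ z1 n1) (nz _ z2 n2) (nz _ z3 n3) !orFb => /eqP l0.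
by move: l1; rewrite l0 sub0r nmN nm1; clear; lra.
Qed.

End ArcRoots.

Transparent rt1 rt2 rt3.

(** * Monotonicity from injectivity and intermediate values *)

Section MonotoneOnInterval.
Variable R : realType.
Implicit Types a b c w : R.
Variables (f : R -> R) (l r : R).
Hypothesis fl_fr : f l < f r.
Hypothesis ivt : forall a b w, l <= a -> a <= b -> b <= r ->
  Num.min (f a) (f b) <= w <= Num.max (f a) (f b) -> exists2 c, a <= c <= b & f c = w.
Hypothesis inj : forall a b, l < a -> a < b -> b < r -> f a != f b.

(* A value taken on both sides of [b] contradicts injectivity on the open interval. *)
Lemma no_fold a b c w : l <= a -> a < b -> b < c -> c <= r ->
  f a < w < f b \/ f b < w < f a -> f b < w < f c \/ f c < w < f b -> False.
Proof.
move=> la ab bc cr h1 h2.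
have le x y : x < w < y \/ y < w < x -> Num.min x y <= w <= Num.max x y.
  by case=> /andP[p q]; rewrite ge_min le_max (ltW p) (ltW q) ?orbT.
have ne x y : x < w < y \/ y < w < x -> (w != x) && (w != y).
  by case=> /andP[p q]; rewrite ?(gt_eqF p) ?(lt_eqF q).
have [x /andP[ax xb] fx] := ivt la (ltW ab) (ltW (lt_le_trans bc cr)) (le _ _ h1).
have [y /andP[yb yc] fy] := ivt (le_trans la (ltW ab)) (ltW bc) cr (le _ _ h2).
have /andP[na nb] := ne _ _ h1; have /andP[_ nc] := ne _ _ h2.
have ax' : a < x by rewrite lt_def ax andbT; apply: contra na => /eqP <-; rewrite fx.
have xb' : x < b by rewrite lt_def xb andbT; apply: contra nb => /eqP ->; rewrite fx.
have yb' : b < y by rewrite lt_def yb andbT; apply: contra nb => /eqP <-; rewrite fy.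
have yc' : y < c by rewrite lt_def yc andbT; apply: contra nc => /eqP ->; rewrite fy.
have := inj (le_lt_trans la ax') (lt_trans xb' yb') (lt_le_trans yc' cr).
by rewrite fx fy eqxx.
Qed.

(** A descent from a to b extends to a fold: if f b < f r, the function turns up again after b;
    otherwise f l < f r <= f b < f a, and it has gone up before a. *)
Lemma incr_open a b : l < a -> a < b -> b < r -> f a < f b.
Proof.
move=> la ab br; rewrite lt_def eq_sym (inj la ab br) /= leNgt; apply/negP => lt.
have [hb|hb] := ltP (f b) (f r).
  pose m := Num.min (f a) (f r).
  have m1 : m <= f a by rewrite ge_min lexx.
  have m2 : m <= f r by rewrite ge_min lexx orbT.
  have m3 : f b < m by rewrite lt_min lt.
  apply: (@no_fold a b r ((f b + m) / 2) (ltW la) ab br (lexx _)).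
    by right; apply/andP; split; lra.
  by left; apply/andP; split; lra.
apply: (@no_fold l a b ((f a + f b) / 2) (lexx _) la ab (ltW br)).
  by have q := lt_le_trans fl_fr hb; left; apply/andP; split; lra.
by right; apply/andP; split; lra.
Qed.

Lemma incr_left b : l < b -> b < r -> f l < f b.
Proof.
move=> lb br; rewrite ltNge; apply/negP => h.
have [a1 ab] : l < (l + b) / 2 /\ (l + b) / 2 < b by split; lra.
move: ((l + b) / 2) a1 ab => a a1 ab; have lt := incr_open a1 ab br.
apply: (@no_fold l a b ((f a + f b) / 2) (lexx _) a1 ab (ltW br)).
  by right; apply/andP; split; lra.
by left; apply/andP; split; lra.
Qed.

Lemma incr_right a : l < a -> a < r -> f a < f r.
Proof.
move=> la ar; rewrite ltNge; apply/negP => h.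
have [a1 ab] : a < (a + r) / 2 /\ (a + r) / 2 < r by split; lra.
move: ((a + r) / 2) a1 ab => b ab br; have lt := incr_open la ab br.
apply: (@no_fold a b r ((f a + f b) / 2) (ltW la) ab br (lexx _)).
  by left; apply/andP; split; lra.
by right; apply/andP; split; lra.
Qed.

Lemma incr_closed a b : l <= a -> a < b -> b <= r -> f a < f b.
Proof.
move=> la ab br; have [e1|n1] := eqVneq a l; have [e2|n2] := eqVneq b r; rewrite ?e1 ?e2 //.
- by rewrite e1 in ab; apply: incr_left => //; rewrite lt_def eq_sym n2.
- by rewrite e2 in ab; apply: incr_right => //; rewrite lt_def n1.
by apply: incr_open => //; rewrite lt_def ?n1 // eq_sym n2.
Qed.

Lemma max_lip a x y : `|Num.max a x - Num.max a y| <= `|x - y|.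
Proof.
wlog xy : x y / x <= y => [H|].
  by have [/H //|/ltW /H] := leP x y; rewrite distrC [leRHS]distrC.
rewrite distrC [leRHS]distrC [leRHS]ger0_norm ?subr_ge0 //.
by case: (leP a x) => ax; case: (leP a y) => ay; rewrite ger0_norm; lra.
Qed.

Lemma min_lip b x y : `|Num.min x b - Num.min y b| <= `|x - y|.
Proof.
wlog xy : x y / x <= y => [H|].
  by have [/H //|/ltW /H] := leP x y; rewrite distrC [leRHS]distrC.
rewrite distrC [leRHS]distrC [leRHS]ger0_norm ?subr_ge0 //.
by case: (leP x b) => ax; case: (leP y b) => ay; rewrite ger0_norm; lra.
Qed.

End MonotoneOnInterval.

(** * Lipschitz estimates on the closed arc and monotonicity of j *)

Section LipschitzOnArc.
Variable R : realType.
Local Notation C := R[i].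
Implicit Types (a b u v : R) (f g : R -> C).

Definition inI a := - (1 / 2) <= a <= 0.
(** Continuity on the closed arc in a quantitative form that passes through products, inverses and
    power series in e(t). *)
Definition lipI f := exists2 L : R, 0 <= L & forall a b, inI a -> inI b -> nm (f a - f b) <= L * `|a - b|.

Lemma lip_bnd f : lipI f -> exists2 M : R, 0 <= M & forall a, inI a -> nm (f a) <= M.
Proof.
move=> [L L0 H]; exists (nm (f 0) + L); first by rewrite addr_ge0 ?nm_ge0.
move=> a ha; have h0 : inI 0 by apply/andP; split; clear; lra.
have := H a 0 ha h0; rewrite subr0 => h.
have a1 : `|a| <= 1 by case/andP: ha => ? ?; rewrite ler_norml; apply/andP; split; lra.
have := ler_wpM2l L0 a1; have := nm_ge_sub (f a) (f 0); clear -h; lra.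
Qed.

Lemma lip_cst (c : C) : lipI (fun=> c).
Proof. by exists 0 => // a b _ _; rewrite subrr nm0 mul0r. Qed.

Lemma lipM f g : lipI f -> lipI g -> lipI (fun a => f a * g a).
Proof.
move=> lf lg; have [A A0 hA] := lip_bnd lf; have [B B0 hB] := lip_bnd lg.
case: lf lg => L L0 H [M M0 G]; exists (L * B + A * M); first by rewrite addr_ge0 // mulr_ge0.
move=> a b ha hb.
have -> : f a * g a - f b * g b = (f a - f b) * g a + f b * (g a - g b) by ring.
apply: le_trans (nmD _ _) _; rewrite !nmM mulrDl; apply: lerD.
  by rewrite mulrAC; apply: ler_pM; rewrite ?nm_ge0 ?H ?hB.
by rewrite -mulrA; apply: ler_pM; rewrite ?nm_ge0 ?G ?hA.
Qed.

Lemma lipX f n : lipI f -> lipI (fun a => f a ^+ n).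
Proof.
move=> lf; elim: n => [|n IH]; first exact: lip_cst.
have [L L0 H] := lipM lf IH; exists L => // a b ha hb; rewrite !exprS; exact: H.
Qed.

Lemma lipV f (c : R) : 0 < c -> (forall a, inI a -> c <= nm (f a)) -> lipI f -> lipI (fun a => (f a)^-1).
Proof.
move=> c0 hc [L L0 H]; exists (L / c / c); first by rewrite !divr_ge0 // ltW.
move=> a b ha hb; have na := lt_le_trans c0 (hc a ha); have nb := lt_le_trans c0 (hc b hb).
have a0 : f a != 0 by rewrite -nm_gt0.
have b0 : f b != 0 by rewrite -nm_gt0.
have -> : (f a)^-1 - (f b)^-1 = (f b - f a) / f a / f b by field; rewrite a0 b0.
rewrite !nmM !nmV nm_sub mulrAC [leRHS]mulrAC ler_pM ?invr_ge0 ?nm_ge0 //.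
- by rewrite mulr_ge0 ?invr_ge0 ?nm_ge0.
- by rewrite mulrAC ler_pM ?invr_ge0 ?nm_ge0 ?H // lef_pV2 ?posrE // hc.
by rewrite lef_pV2 ?posrE // hc.
Qed.

Lemma lip_unit_arc : lipI (@unit_arc R).
Proof.
exists 2; first by rewrite ler0n.
move=> a b ha hb; have [ya la _] := arcy_facts ha; have [yb lb _] := arcy_facts hb.
apply: le_trans (nm_le_ReIm _) _; rewrite /= -!/(arcy _).
suff h : `|arcy a - arcy b| <= `|a - b| by rewrite mulr2n mulrDl !mul1r lerD2l.
have s0 : 0 < arcy a + arcy b by clear -la lb; lra.
rewrite -(ler_pM2r s0) -{1}[arcy a + arcy b]gtr0_norm // -normrM.
have -> : (arcy a - arcy b) * (arcy a + arcy b) = (a - b) * - (a + b).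
  have -> : (arcy a - arcy b) * (arcy a + arcy b) = arcy a ^+ 2 - arcy b ^+ 2 by ring.
  by rewrite ya yb; ring.
rewrite normrM ler_wpM2l // normrN; case/andP: ha => a1 a2; case/andP: hb => b1 b2.
by rewrite ler0_norm; clear -a1 a2 b1 b2 la lb; lra.
Qed.

Lemma e2pi_lip (z w : C) : 0 <= complex.Im z -> 0 <= complex.Im w ->
  nm (e2pi z - e2pi w) <= 56 * nm (z - w).
Proof.
move=> z0 w0; have le1 (x : C) : 0 <= complex.Im x -> nm (e2pi x) <= 1.
  by move=> x0; rewrite nm_e2pi expR_le1 oppr_le0 !mulr_ge0 ?pi_ge0.
have [h|h] := leP (nm (z - w)) (1 / 16); last first.
  apply: le_trans (nmB _ _) _; have := le1 _ z0; have := le1 _ w0; clear -h; lra.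
have -> : e2pi z - e2pi w = e2pi w * (e2pi (z - w) - 1) by rewrite mulrBr mulr1 -e2piD [w + _]addrC subrK.
rewrite nmM; have := le1 _ w0; have := e2pi_near h; set d := z - w in h *.
have E : nm ((0 +i* (2 * pi)) * d) = 2 * pi * nm d.
  by rewrite nmM [nm (0 +i* _)]nmE /= expr0n add0r sqrtr_sqr ger0_norm // mulr_ge0 // pi_ge0.
have := nm_ge_sub (e2pi d - 1) ((0 +i* (2 * pi)) * d); rewrite E => h1 h2 h3.
have p0 := @pi_gt0 R; have p4 := @pi_lt4 R; have d0 := nm_ge0 d.
have h4 : (2 * pi) ^+ 2 <= 64 :> R by clear -p0 p4; nra.
have h5 : (2 * pi) ^+ 2 * nm d ^+ 2 <= 64 * (1 / 16 * nm d).
  apply: ler_pM; [exact: sqr_ge0|exact: sqr_ge0|exact: h4|].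
  by rewrite expr2; apply: ler_wpM2r.
have h6 : 2 * pi * nm d <= 8 * nm d by apply: ler_wpM2r => //; clear -p4; lra.
(* The linear term accounts for 8, as 2 pi < 8, and the quadratic error for 48, that is 12 times 64
   / 16. *)
have h7 : nm (e2pi d - 1) <= 56 * nm d by rewrite -mulrA in h2; clear -h1 h2 h5 h6; lra.
by rewrite -[leRHS]mul1r; apply: ler_pM; rewrite ?nm_ge0.
Qed.

Lemma lip_rt1 : lipI (@rt1 R).
Proof.
have [L L0 H] := lip_unit_arc; exists (56 * L); first by apply: mulr_ge0; rewrite ?ler0n.
move=> a b ha hb; rewrite -mulrA.
apply: (@le_trans _ _ (56 * nm (unit_arc a - unit_arc b))).
  by apply: e2pi_lip; apply: ltW; apply: arc_Im; apply: arc_open.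
by apply: ler_wpM2l; [rewrite ler0n|apply: H].
Qed.

(** For x = s'/s < 1, each of the k summands of 1 + x + ... + x^(k-1) is at least x^k, so k x^k <= 1
    / (1 - x). *)
Lemma absb_fD (f : fps C) (s s' K : R) : absb f s K -> 0 <= s' -> s' < s ->
  absb (fD f) s' (K / (1 - s' / s)).
Proof.
move=> h s'0 s's N; have s0 : 0 < s by apply: le_lt_trans s'0 s's.
have x0 : 0 <= s' / s < 1 by rewrite divr_ge0 ?(ltW s0) //= ltr_pdivrMr // mul1r.
apply: (@le_trans _ _ (\sum_(0 <= k < N) (nm (cf f k) * s ^+ k) / (1 - s' / s))).
  apply: ler_sum => k _; rewrite cf_fD nmM nm_nat.
  have -> : s' ^+ k = (s' / s) ^+ k * s ^+ k by rewrite -exprMn divfK ?gt_eqF.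
  move: (s' / s) x0 => x /andP[x0 x1].
  have -> : k%:R * nm (cf f k) * (x ^+ k * s ^+ k) = nm (cf f k) * s ^+ k * (k%:R * x ^+ k) by ring.
  apply: ler_wpM2l; first by rewrite mulr_ge0 ?nm_ge0 ?exprn_ge0 // ltW.
  apply: le_trans (geom_sum_le k (_ : 0 <= x < 1)); last by rewrite x0.
  apply: (@le_trans _ _ (\sum_(0 <= i < k) x ^+ k)).
    by rewrite big_const_nat subn0 iter_addr addr0 mulr_natl.
  by apply: ler_sum_nat => i /andP[_ ik]; exact: (ler_wiXn2l x0 (ltW x1) (ltnW ik)).
rewrite -mulr_suml ler_wpM2r // invr_ge0 subr_ge0 ltW //; by case/andP: x0.
Qed.

Lemma nm_subX (r r' : C) (s : R) k : 0 < s -> nm r <= s -> nm r' <= s ->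
  nm (r ^+ k - r' ^+ k) <= nm (r - r') * (k%:R * s ^+ k / s).
Proof.
move=> s0 hr hr'; rewrite subrXX nmM ler_wpM2l ?nm_ge0 //.
apply: le_trans (nm_sum _ _ _) _.
apply: (@le_trans _ _ (\sum_(i < k) s ^+ k.-1)).
  apply: ler_sum => i _; rewrite nmM !nmX.
  have -> : s ^+ k.-1 = s ^+ (k.-1 - i) * s ^+ i.
    by rewrite -exprD subnK // -ltnS prednK //; apply: leq_ltn_trans (ltn_ord i).
  by apply: ler_pM; rewrite ?exprn_ge0 ?nm_ge0 //; apply: lerXn2r; rewrite ?nnegrE ?nm_ge0 ?(ltW s0).
rewrite sumr_const card_ord; case: k => [|k]; first by rewrite mulr0n !mul0r.
by rewrite -[leLHS]mulr_natl [k.+1.-1]/= exprSr mulrA mulfK ?gt_eqF.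
Qed.

(** Termwise |r^k - r'^k| <= k s^(k-1) |r - r'|, so the norm of [fD f] and the Lipschitz constant of
    [rt1] together give the constant for the sum. *)
Lemma lip_series_gen (f : fps C) (F : R -> C) (s s5 K : R) : absb f s5 K -> 0 < s -> s < s5 ->
  (forall a, inI a -> nm (rt1 a) <= s) ->
  (forall a, inI a -> fval f (rt1 a) (F a)) -> lipI F.
Proof.
move=> af s0 ss hs vf; have [L L0 H] := lip_rt1.
have := absb_fD af (ltW s0) ss; set K' := _ / _ => aD; have K'0 := absb_ge0 aD.
exists (L * (K' / s)); first by rewrite mulr_ge0 // divr_ge0 // ltW.
move=> a b ha hb; rewrite mulrAC.
apply: (@le_trans _ _ (nm (rt1 a - rt1 b) * (K' / s))); last first.
  by apply: ler_wpM2r; [rewrite divr_ge0 // ltW|exact: H].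
apply: (cto_nm_le (ctoB (vf a ha) (vf b hb))) => N; rewrite -sumrB.
apply: le_trans (nm_sum _ _ _) _.
apply: (@le_trans _ _ (\sum_(0 <= k < N) nm (rt1 a - rt1 b) * (nm (cf (fD f) k) * s ^+ k / s))).
  apply: ler_sum => k _; rewrite -mulrBr nmM cf_fD nmM nm_nat.
  apply: le_trans (ler_wpM2l (nm_ge0 _) (nm_subX k s0 (hs a ha) (hs b hb))) _.
  by rewrite le_eqVlt; apply/orP; left; apply/eqP; ring.
rewrite -mulr_sumr ler_wpM2l ?nm_ge0 // -mulr_suml ler_wpM2r ?invr_ge0 ?(ltW s0) //.
Qed.

Lemma lip_series (f : fps C) (F : R -> C) K : absb f 5^-1 K ->
  (forall a, inI a -> fval f (rt1 a) (F a)) -> lipI F.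
Proof.
move=> af; apply: (lip_series_gen (s := 1 / 10) af); try (clear; lra).
by move=> a /arc_bounds[_ h _ _ _]; apply: le_trans h _; clear; lra.
Qed.

Lemma lip_E4 : lipI (fun a => E4 (unit_arc a : C)).
Proof. by apply: (lip_series (absb_E4 R)) => a ha; apply: E4_e4c; apply: arc_Im; apply: arc_open. Qed.

Lemma lip_E6 : lipI (fun a => E6 (unit_arc a : C)).
Proof. by apply: (lip_series (absb_E6 R)) => a ha; apply: E6_e6c; apply: arc_Im; apply: arc_open. Qed.

Lemma lip_Delta : lipI (fun a => Delta (unit_arc a : C)).
Proof.
apply: (lip_series (absb_Df R)) => a ha; apply: Delta_val; last exact: rt1_lt5.
by apply: arc_Im; apply: arc_open.
Qed.

Lemma lip_jinv : lipI (fun a => jinv (unit_arc a : C)).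
Proof.
apply: lipM; first by apply: lipX; apply: lip_E4.
apply: (lipV (c := 8856 / (100 * 100) * (1 / 670)) _ _ lip_Delta); first by clear; lra.
move=> a ha; apply: le_trans (Delta_arc_lower ha); have [h _ _ _ _] := arc_bounds ha.
by apply: ler_wpM2l; [clear; lra|exact: h].
Qed.

Lemma lip_E14 : lipI (fun a => E4 (unit_arc a : C) ^+ 2 * E6 (unit_arc a) * unit_arc a ^+ 7).
Proof.
apply: lipM; last by apply: lipX; apply: lip_unit_arc.
by apply: lipM; [apply: lipX; apply: lip_E4|apply: lip_E6].
Qed.

Lemma lip_IVT f (h : R -> R) a b (w : R) : lipI f -> (forall x, inI x -> f x = (h x)%:C) ->
  - (1 / 2) <= a -> a <= b -> b <= 0 ->
  Num.min (h a) (h b) <= w <= Num.max (h a) (h b) -> exists2 c, a <= c <= b & h c = w.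
Proof.
move=> [L L0 H] fh a1 ab b0 hw.
(* Clamping the argument to [a, b] extends h to a continuous function on the whole line. *)
pose k x := h (Num.max a (Num.min x b)).
have inIk x : inI (Num.max a (Num.min x b)).
  apply/andP; split; first by rewrite le_max a1.
  by rewrite ge_max ge_min b0 orbT andbT (le_trans ab).
have cl x y : `|Num.max a (Num.min x b) - Num.max a (Num.min y b)| <= `|x - y|.
  exact: le_trans (max_lip _ _ _) (min_lip _ _ _).
have kl x y : `|k x - k y| <= L * `|x - y|.
  have -> : `|k x - k y| = nm (f (Num.max a (Num.min x b)) - f (Num.max a (Num.min y b))).
    by rewrite !fh // -rmorphB nm_real.
  by apply: le_trans (H _ _ (inIk x) (inIk y)) _; rewrite ler_wpM2l.
have ck : continuous k.
  move=> x; apply/cvgrPdist_lt => e e0.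
  have d0 : 0 < e / (L + 1) by rewrite divr_gt0 // ltr_wpDl.
  apply/nbhs_ballP; exists (e / (L + 1)) => //= y; rewrite /ball /= => xy.
  apply: le_lt_trans (kl x y) _.
  apply: (@le_lt_trans _ _ ((L + 1) * `|x - y|)); first by rewrite ler_wpM2r // lerDl.
  by rewrite mulrC -ltr_pdivlMr ?ltr_wpDl.
have ka : k a = h a by rewrite /k; congr h; rewrite (min_l ab) maxxx.
have kb : k b = h b by rewrite /k; congr h; rewrite minxx (max_r ab).
have [||c] := @IVT R k a b w ab; first exact: continuous_subspaceT.
  by rewrite ka kb.
rewrite in_itv /= => /andP[ac cb] kc; exists c; first by rewrite ac.
by rewrite -kc /k (min_l cb) (max_r ac).
Qed.

(** The value of j on the arc, real by [jinv_arc_real], with Re t as parameter. *)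
Definition J a : R := complex.Re (jinv (unit_arc a : C)).

Lemma JE a : inI a -> jinv (unit_arc a) = (J a)%:C.
Proof. by move=> ha; apply: jinv_arc_real; apply: arc_open. Qed.

Lemma J_left : J (- (1 / 2)) = 0.
Proof. by rewrite /J -/(rho R) jinv_rho. Qed.

Lemma J_right : J 0 = 1728.
Proof. by rewrite /J jinv_i; move: 1728%N => n; have := rmorph_nat (@real_complex R) n; move: (n%:R : R) => r h; rewrite -[n%:R]h. Qed.

Lemma J_IVT a b w : - (1 / 2) <= a -> a <= b -> b <= 0 ->
  Num.min (J a) (J b) <= w <= Num.max (J a) (J b) -> exists2 c, a <= c <= b & J c = w.
Proof. by move=> a1 ab b0; apply: (lip_IVT lip_jinv JE a1 ab b0). Qed.

Lemma J_inj a b : - (1 / 2) < a -> a < b -> b < 0 -> J a != J b.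
Proof.
move=> a1 ab b0; have ha : inI a by apply/andP; split; apply: ltW; [|apply: lt_trans ab b0].
have hb : inI b by apply/andP; split; apply: ltW; [apply: lt_trans a1 ab|].
by have := jinv_arc_inj a1 ab b0; rewrite (JE ha) (JE hb); apply: contra => /eqP ->.
Qed.

Lemma J_incr a b : - (1 / 2) <= a -> a < b -> b <= 0 -> J a < J b.
Proof.
apply: incr_closed; [|exact: J_IVT|exact: J_inj].
by rewrite J_left J_right ltr0n.
Qed.

Lemma J_surj w : 0 <= w <= 1728 -> exists2 c, inI c & J c = w.
Proof.
move=> hw; have le : - (1 / 2) <= (0 : R) by clear; lra.
apply: (J_IVT (lexx _) le (lexx _)); rewrite J_left J_right.
by have le2 : 0 <= (1728 : R) by [rewrite ler0n]; rewrite (min_l le2) (max_r le2).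
Qed.

End LipschitzOnArc.

(** * Residues and sign alternation *)

Section Residues.
Variable R : realType.
Local Notation C := R[i].
Local Notation cst := (@fps_cst C).
Local Notation X := (fX C).
Local Notation lin r := (1 - cst r^-1 * X).
Implicit Types (f g h : fps C) (r z : C).

Lemma fD_cstM c f : fD (cst c * f) = cst c * fD f.
Proof. by apply: fpsP => n; rewrite cf_fD !cf_cstM cf_fD mulrCA. Qed.

Lemma fDB f g : fD (f - g) = fD f - fD g.
Proof. by apply: fpsP => n; rewrite cf_fD !cfB !cf_fD mulrBr. Qed.

Lemma fD_X : fD X = X.
Proof. by apply: fpsP => n; rewrite cf_fD /=; case: n => [|[|n]] /=; rewrite ?mulr0 ?mulr1. Qed.

Lemma fD_lin c : fD (1 - cst c * X) = - (cst c * X).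
Proof.
rewrite fDB fD_cstM fD_X; have -> : fD 1 = 0 :> fps C; last by rewrite sub0r.
by apply: fpsP => -[|n]; rewrite cf_fD /= ?mul0r ?mulr0.
Qed.

Lemma ramanujan_Bx (di : fps C) x : d1f R * di = 1 ->
  E4f R ^+ 2 * E6f R = d1f R * (E4f R ^+ 3 * di - fD (E4f R ^+ 3 * di)) ->
  d1f R * (E4f R ^+ 2 * E6f R) = (d1f R + fD (d1f R)) * Bx x - d1f R * fD (Bx x).
Proof.
move=> ddi ->; rewrite /Bx; set U := E4f R ^+ 3 * di.
have -> : E4f R ^+ 3 = U * d1f R by rewrite /U -mulrA [di * _]mulrC ddi mulr1.
clearbody U; rewrite fDB fDM fD_cstM fDM fD_X; move: U (d1f R) (fD _) (fD _) (cst x) X => U d d' U' c x'.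
ring.
Qed.

(** A value together with absolute convergence at radius s, the pair that is stable under
    products. *)
Definition gv (s : R) r f l := (exists K, absb f s K) /\ fval f r l.

Lemma gvM s r f g a b : nm r < s -> gv s r f a -> gv s r g b -> gv s r (f * g) (a * b).
Proof.
move=> rs [[K hK] vf] [[L hL] vg]; have s0 : 0 <= s by apply: le_trans (nm_ge0 r) (ltW rs).
split; first by exists (K * L); apply: absbM.
exact: (fvalM hK hL rs vf vg).
Qed.

Lemma gvD s r f g a b : nm r < s -> gv s r f a -> gv s r g b -> gv s r (f + g) (a + b).
Proof.
move=> rs [[K hK] vf] [[L hL] vg]; have s0 : 0 <= s by apply: le_trans (nm_ge0 r) (ltW rs).
by split; [exists (K + L); apply: absbD|apply: fvalD].
Qed.

Lemma gvN s r f a : gv s r f a -> gv s r (- f) (- a).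
Proof. by move=> [[K hK] vf]; split; [exists K; apply: absbN|apply: fvalN]. Qed.

Lemma gv_cst s r c : gv s r (cst c) c.
Proof. by split; [exists (nm c); apply: absb_cst|apply: fval_cst]. Qed.

Lemma gv_X s r : nm r < s -> gv s r X r.
Proof.
move=> rs; have s0 : 0 <= s by apply: le_trans (nm_ge0 r) (ltW rs).
by split; [exists s; apply: absb_X|apply: fval_X].
Qed.

Lemma gv_lin s r r' : nm r < s -> gv s r (lin r') (1 - r / r').
Proof.
move=> rs; have s0 : 0 <= s by apply: le_trans (nm_ge0 r) (ltW rs).
by split; [eexists; apply: absb_lin|apply: fval_lin].
Qed.

Hypothesis ram : forall x : C,
  d1f R * (E4f R ^+ 2 * E6f R) = (d1f R + fD (d1f R)) * Bx x - d1f R * fD (Bx x).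

(* With B = (1 - X/r) H, differentiation gives H(r) = - r B'(r), and Ramanujan's identity
   evaluates the right-hand side at a zero r of B. *)
Lemma residue_val (t x : C) (H : fps C) (s K : R) : 0 < complex.Im t -> nm (e2pi t) < 5^-1 ->
  Delta t != 0 -> lin (e2pi t) * H = Bx x -> absb H s K -> nm (e2pi t) < s ->
  fval H (e2pi t) (E4 t ^+ 2 * E6 t).
Proof.
move=> t0 t5 D0 HB aH ts; set r := e2pi t in t5 HB ts *.
have v4 : fval (E4f R) r (E4 t) := E4_e4c t0.
have v6 : fval (E6f R) r (E6 t) := E6_e6c t0.
have vd : fval (d1f R) r (Delta t / r) := d1_val t0 t5.
have a4 := absb_E4 R; have a6 := absb_E6 R; have ad := absb_d1 R.
move: (5^-1 : R) t5 a4 a6 ad => s5 t5 a4 a6 ad.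
have r0 : 0 <= nm r by apply: nm_ge0.
have [s2 [h1 [h2 h3]]] : exists s2, nm r < s2 /\ s2 < s /\ s2 < s5.
  exists ((nm r + Num.min s s5) / 2); have : nm r < Num.min s s5 by rewrite lt_min ts.
  have : Num.min s s5 <= s by rewrite ge_min lexx.
  have : Num.min s s5 <= s5 by rewrite ge_min lexx orbT.
  by move: (Num.min s s5) => w; clear => ? ? ?; split; [|split]; lra.
have s20 : 0 <= s2 by apply: le_trans (ltW h1).
have sp : 0 < s by apply: le_lt_trans ts.
have s5p : 0 < s5 by apply: le_lt_trans t5.
have hs : 0 <= s2 <= s by rewrite s20 ltW.
have hs5 : 0 <= s2 <= s5 by rewrite s20 ltW.
have [l vl] := fval_ex aH (ltW ts).
have gH : gv s2 r H l by split=> //; exists K; apply: absb_le hs sp aH.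
have aDH := absb_fD aH s20 h2; have [l' vl'] := fval_ex aDH (ltW h1).
have gDH : gv s2 r (fD H) l' by split=> //; eexists; exact: aDH.
have aDd := absb_fD ad s20 h3; have [d' vd'] := fval_ex aDd (ltW h1).
have gDd : gv s2 r (fD (d1f R)) d' by split=> //; eexists; exact: aDd.
have gd : gv s2 r (d1f R) (Delta t / r) by split=> //; eexists; exact: (absb_le hs5 s5p ad).
have g4 : gv s2 r (E4f R) (E4 t) by split=> //; eexists; exact: (absb_le hs5 s5p a4).
have g6 : gv s2 r (E6f R) (E6 t) by split=> //; eexists; exact: (absb_le hs5 s5p a6).
have gl := gv_lin r h1.
have := ram x; rewrite -HB fDM fD_lin expr2 => e.
have lhs := gvM h1 gd (gvM h1 (gvM h1 g4 g4) g6).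
have rhs := gvD h1 (gvM h1 (gvD h1 gd gDd) (gvM h1 gl gH))
  (gvN (gvM h1 gd (gvD h1 (gvM h1 (gvN (gvM h1 (gv_cst s2 r r^-1) (gv_X h1))) gH) (gvM h1 gl gDH)))).
have [_ vlhs] := lhs; have [_ vrhs] := rhs; rewrite -e in vrhs.
have eq := fval_uniq vlhs vrhs; have rn : r != 0 by apply: e2pi_neq0.
have dn : Delta t / r != 0 by rewrite mulf_neq0 // invr_eq0.
have el : E4 t ^+ 2 * E6 t = l.
  apply: (mulfI dn); rewrite expr2 eq mulVf // divff // subrr.
  by move: (Delta t / r) => w; ring.
by rewrite el.
Qed.

Definition geo z : fps C := Fps (fun k => z ^+ k).

Lemma geoE z : (1 - cst z * X) * geo z = 1.
Proof.
apply: fpsP => n; rewrite mulrBl mul1r -mulrA cfB cf_cstM cf_XM.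
by case: n => [|n] /=; rewrite ?mulr0 ?subr0 ?expr0 // exprS subrr.
Qed.

(** After multiplication by the common denominator the claim reduces to [e0], [e1], [e2], one
    Lagrange interpolation identity for each power of X. *)
Lemma pf3 (z1 z2 z3 : C) : z1 != z2 -> z1 != z3 -> z2 != z3 ->
  geo z1 * (geo z2 * geo z3) =
  cst (z1 ^+ 2 / ((z1 - z2) * (z1 - z3))) * geo z1 + cst (z2 ^+ 2 / ((z2 - z1) * (z2 - z3))) * geo z2
  + cst (z3 ^+ 2 / ((z3 - z1) * (z3 - z2))) * geo z3.
Proof.
move=> n12 n13 n23.
have d12 : z1 - z2 != 0 by rewrite subr_eq0.
have d13 : z1 - z3 != 0 by rewrite subr_eq0.
have d23 : z2 - z3 != 0 by rewrite subr_eq0.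
have d21 : z2 - z1 != 0 by rewrite subr_eq0 eq_sym.
have d31 : z3 - z1 != 0 by rewrite subr_eq0 eq_sym.
have d32 : z3 - z2 != 0 by rewrite subr_eq0 eq_sym.
set l1 := z1 ^+ 2 / _; set l2 := z2 ^+ 2 / _; set l3 := z3 ^+ 2 / _.
have e0 : l1 + l2 + l3 = 1 by rewrite /l1 /l2 /l3; field; rewrite d12 d13 d23 d21 d31 d32.
have e1 : l1 * (z2 + z3) + l2 * (z1 + z3) + l3 * (z1 + z2) = 0.
  by rewrite /l1 /l2 /l3; field; rewrite d12 d13 d23 d21 d31 d32.
have e2 : l1 * (z2 * z3) + l2 * (z1 * z3) + l3 * (z1 * z2) = 0.
  by rewrite /l1 /l2 /l3; field; rewrite d12 d13 d23 d21 d31 d32.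
clearbody l1 l2 l3; have g1 := geoE z1; have g2 := geoE z2; have g3 := geoE z3.
apply: (@fps_unitI _ ((1 - cst z1 * X) * ((1 - cst z2 * X) * (1 - cst z3 * X)))).
  by rewrite !cfM0 !cfB !cf_cstM /= !mulr0 !subr0 !mulr1.
transitivity (1 : fps C).
  rewrite mulrACA g1 mul1r mulrACA g2 mul1r; exact: g3.
have x0 := congr1 cst e0; have x1 := congr1 cst e1; have x2 := congr1 cst e2.
rewrite !cstD ?cstM cst1 in x0; rewrite !cstD !cstM !cstD in x1; rewrite !cstD !cstM in x2.
have c0 : cst 0 = 0 by apply: fpsP => -[].
rewrite c0 in x1 x2.
move: (geo z1) (geo z2) (geo z3) (cst l1) (cst l2) (cst l3) (cst z1) (cst z2) (cst z3) X g1 g2 g3 x0 x1 x2.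
move=> G1 G2 G3 L1 L2 L3 w1 w2 w3 x g1 g2 g3 x0 x1 x2.
transitivity (((1 - w1 * x) * G1) * (L1 * ((1 - w2 * x) * (1 - w3 * x))) +
  ((1 - w2 * x) * G2) * (L2 * ((1 - w1 * x) * (1 - w3 * x))) +
  ((1 - w3 * x) * G3) * (L3 * ((1 - w1 * x) * (1 - w2 * x)))); last by ring.
rewrite g1 g2 g3 !mul1r.
transitivity ((L1 + L2 + L3) - x * (L1 * (w2 + w3) + L2 * (w1 + w3) + L3 * (w1 + w2))
  + x ^+ 2 * (L1 * (w2 * w3) + L2 * (w1 * w3) + L3 * (w1 * w2))); last by ring.
by rewrite x0 x1 x2 !mulr0 subr0 addr0.
Qed.

(** The pole at r contributes r^(-n) times a partial sum of g(r), that is g(r) r^(-n) up to a tail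
    of g. *)
Lemma cf_geo g l r n : r != 0 ->
  cf (g * (cst l * geo r^-1)) n = l / r ^+ n * \sum_(0 <= k < n.+1) cf g k * r ^+ k.
Proof.
move=> r0; rewrite cfM big_mkord mulr_sumr; apply: eq_bigr => k _.
have kn : (k <= n)%N by rewrite -ltnS.
rewrite cf_cstM /= exprVn; have rk : r ^+ k != 0 by rewrite expf_neq0.
have rnk : r ^+ (n - k) != 0 by rewrite expf_neq0.
have -> : r ^+ n = r ^+ (n - k) * r ^+ k by rewrite -exprD subnK.
by move: (r ^+ k) (r ^+ (n - k)) rk rnk => x y x0 y0; field; rewrite x0 y0.
Qed.

(** From g = h - (G - 1) g the truncated norm S of g satisfies S <= L + k S. Truncation makes S
    finite before anything is known about the convergence of g. *)
Lemma absb_quot (G g h : fps C) (s k L : R) : 0 <= s -> k < 1 -> absb (G - 1) s k ->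
  absb h s L -> G * g = h -> absb g s (L / (1 - k)).
Proof.
move=> s0 k1 aG ah e N; have k1' : 0 < 1 - k by rewrite subr_gt0.
rewrite ler_pdivlMr // mulrBr mulr1 lerBlDr.
set S := \sum_(0 <= j < N) _.
pose g' : fps C := Fps (fun i => if (i < N)%N then cf g i else 0).
have ag' : absb g' s S.
  move=> M; apply: (@le_trans _ _ (\sum_(0 <= j < maxn N M) nm (cf g' j) * s ^+ j)).
    rewrite [leRHS](big_cat_nat (n := M)) ?leq_maxr //= lerDl.
    by apply: sumr_ge0 => i _; rewrite mulr_ge0 ?nm_ge0 ?exprn_ge0.
  rewrite (big_cat_nat (n := N)) ?leq_maxl //= [X in _ + X]big_nat_cond [X in _ + X]big1 ?addr0; last first.
    by move=> i /andP[/andP[Ni _] _]; rewrite ltnNge Ni nm0 mul0r.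
  by rewrite /S le_eqVlt; apply/orP; left; apply/eqP; apply: eq_big_nat => i /andP[_ ->].
have ap := absbM s0 aG ag' N.
apply: (@le_trans _ _ (\sum_(0 <= j < N) nm (cf h j) * s ^+ j + \sum_(0 <= j < N) nm (cf ((G - 1) * g') j) * s ^+ j)); last first.
  by apply: lerD; [apply: ah|rewrite [S * k]mulrC; exact: ap].
rewrite -big_split /=; apply: ler_sum_nat => j /andP[_ jN]; rewrite -mulrDl ler_wpM2r ?exprn_ge0 //.
have -> : cf g j = cf h j - cf ((G - 1) * g') j.
  have -> : cf ((G - 1) * g') j = cf ((G - 1) * g) j.
    by apply: (cfM_ext (N := N)) => // i iN /=; rewrite iN.
  by rewrite -cfB -e -mulrBl opprB addrC subrK mul1r.
exact: nmB.
Qed.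

End Residues.

(** * Asymptotics of the coefficients with relative error *)

Section Asymptotics.
Variable R : realType.
Local Notation C := R[i].
Local Notation cst := (@fps_cst C).
Local Notation X := (fX C).
Local Notation lin r := (1 - cst r^-1 * X).

Hypothesis ram : forall x : C,
  d1f R * (E4f R ^+ 2 * E6f R) = (d1f R + fD (d1f R)) * Bx x - d1f R * fD (Bx x).

(** The Eisenstein series of weight 14. *)
Definition E14 (t : C) : C := E4 t ^+ 2 * E6 t.

(** By [residue_val] the cofactor (1 - q/r') (1 - q/r'') G takes the value E4^2 E6 at q = e(t); none
    of its factors vanishes there, so E4^2 E6 does not either. The lower bound for g comes from
    0.8856^2 / 1.56 > 1/2. *)
Lemma root_term (t r' r'' x : C) (G g : fps C) (s K : R) :
  0 < complex.Im t -> nm (e2pi t) < 5^-1 -> 8856 / (100 * 100) <= nm (Delta t / e2pi t) ->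
  lin (e2pi t) * (lin r' * (lin r'' * G)) = Bx x -> absb (G - 1) s (56 / 100) ->
  nm (e2pi t) < s -> absb g s K -> G * g = d1f R ^+ 2 ->
  r' != 0 -> r'' != 0 -> e2pi t != r' -> e2pi t != r'' ->
  exists gi, [/\ fval g (e2pi t) gi, 1 / 2 <= nm gi, E14 t != 0 &
    gi = (1 - e2pi t / r') * (1 - e2pi t / r'') * ((Delta t / e2pi t) ^+ 2 / E14 t)].
Proof.
move=> t0 t5 hD HB aG ts ag Gg r'0 r''0 n' n''.
have s0 : 0 < s by apply: le_lt_trans (nm_ge0 _) ts.
have D0 : Delta t != 0.
  have h : 0 < nm (Delta t / e2pi t) by apply: lt_le_trans hD; clear; lra.
  by move: h; rewrite nm_gt0; apply: contra => /eqP ->; rewrite mul0r.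
have [l1 vl1] := fval_ex aG (ltW ts); have b1 := fval_bound aG s0 (ltW ts) vl1.
have vl : fval G (e2pi t) (l1 + 1) by have := fvalD vl1 (fval_cst 1 _); rewrite subrK.
have aG' : absb G s (56 / 100 + nm 1) by have := absbD (ltW s0) aG (absb_cst 1 s); rewrite subrK.
have l0 : l1 + 1 != 0.
  apply/eqP => e; have e' : l1 = -1 by rewrite -[l1]subr0 -e opprD addrA subrr sub0r.
  by move: b1; rewrite e' nmN nm1; clear; lra.
have gG : gv s (e2pi t) G (l1 + 1) by split=> //; eexists; exact: aG'.
have gH := gvM ts (gv_lin r' ts) (gvM ts (gv_lin r'' ts) gG).
have [[KH aH] vH] := gH.
have := fval_uniq vH (residue_val ram t0 t5 D0 HB aH ts).
rewrite -/(E14 t) => eH.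
have nz (r : C) : r != 0 -> e2pi t != r -> 1 - e2pi t / r != 0.
  move=> r0 h; rewrite subr_eq0; apply: contra h => /eqP h.
  by rewrite -[r]mul1r h divfK.
have q1 := nz _ r'0 n'; have q2 := nz _ r''0 n''.
have E0 : E14 t != 0 by rewrite -eH !mulf_neq0.
have [gi vg] := fval_ex ag (ltW ts).
have vd : fval (d1f R) (e2pi t) (Delta t / e2pi t) := d1_val t0 t5.
have t5' : nm (e2pi t) <= 5^-1 by apply: ltW.
have vd2 : fval (d1f R ^+ 2) (e2pi t) ((Delta t / e2pi t) ^+ 2).
  by rewrite !expr2; apply: (fvalM (absb_d1 R) (absb_d1 R) t5 vd vd).
have := fvalM aG' ag ts vl vg; rewrite Gg => vGg.
have e2 := fval_uniq vGg vd2.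
exists gi; split=> //.
  have e3 : nm (l1 + 1) * nm gi = nm (Delta t / e2pi t) ^+ 2 by rewrite -nmM e2 nmX.
  have h1 : nm (l1 + 1) <= 156 / 100.
    by apply: le_trans (nmD _ _) _; rewrite nm1; clear -b1; lra.
  have h2 : (8856 / (100 * 100)) ^+ 2 <= nm (Delta t / e2pi t) ^+ 2.
    by apply: lerXn2r; rewrite ?nnegrE; [clear; lra|exact: nm_ge0|exact: hD].
  rewrite leNgt; apply/negP => h3.
  have := ler_pM (nm_ge0 _) (nm_ge0 _) h1 (ltW h3); rewrite e3; clear -h2.
  by move: (nm _ ^+ 2) h2 => w; lra.
rewrite -e2 -eH; move: (1 - _ / r') (1 - _ / r'') (l1 + 1) q1 q2 l0 => a b l a0 b0 l0.
by field; rewrite a0 b0 l0.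
Qed.

Lemma lam_eq (r1 r2 r3 : C) : r1 != 0 -> r2 != 0 -> r3 != 0 -> r1 != r2 -> r1 != r3 ->
  r1^-1 ^+ 2 / ((r1^-1 - r2^-1) * (r1^-1 - r3^-1)) = ((1 - r1 / r2) * (1 - r1 / r3))^-1.
Proof.
move=> h1 h2 h3 n2 n3; have d2 : r2 - r1 != 0 by rewrite subr_eq0 eq_sym.
have d3 : r3 - r1 != 0 by rewrite subr_eq0 eq_sym.
by field; rewrite h1 h2 h3 d2 d3.
Qed.

(** Since r3 is real and r2 is conjugate to r1, |r2 - r1| = 2 |Im r1| <= 2 |r2 - r3|. This keeps the
    third residue comparable with the first even where r1 and r2 come close. *)
Lemma lam3_le (r1 r2 r3 : C) : r1 != 0 -> r2 != 0 -> r3 != 0 -> r3 != r1 -> r3 != r2 -> r2 != r1 ->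
  r2 = (r1^*)%C -> complex.Im r3 = 0 ->
  nm ((1 - r3 / r1) * (1 - r3 / r2))^-1 <=
  2 * (nm r1 / nm r3) * nm ((1 - r1 / r2) * (1 - r1 / r3))^-1.
Proof.
move=> h1 h2 h3 n31 n32 n21 cj i3.
have e (a b : C) : b != 0 -> nm (1 - a / b) = nm (b - a) / nm b.
  by move=> b0; rewrite -nmV -nmM mulrBl divff.
rewrite !nmV !nmM !e // (nm_sub r1 r3).
have p1 : 0 < nm r1 by rewrite nm_gt0.
have p2 : nm r2 = nm r1 by rewrite cj nm_conj.
have p3 : 0 < nm r3 by rewrite nm_gt0.
have q31 : 0 < nm (r3 - r1) by rewrite nm_gt0 subr_eq0.
have q32 : 0 < nm (r2 - r3) by rewrite nm_gt0 subr_eq0 eq_sym.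
have q21 : 0 < nm (r2 - r1) by rewrite nm_gt0 subr_eq0.
have key : nm (r2 - r1) <= 2 * nm (r2 - r3).
  apply: (@le_trans _ _ (2 * `|complex.Im (r2 - r3)|)); last by rewrite ler_pM2l // nm_ge_Im.
  apply: le_trans (nm_le_ReIm _) _; rewrite cj; case: r1 r3 i3 {h1 h2 h3 n31 n32 n21 cj p1 p2 p3 q31 q32 q21 e} => a b [c d] /= ->.
  by rewrite subrr normr0 add0r subr0 -opprD normrN -mulr2n normrMn normrN mulr_natl.
rewrite p2 !invfM !invrK; move: (nm r1) (nm r3) (nm (r3 - r1)) (nm (r2 - r3)) (nm (r2 - r1)) p1 p3 q31 q32 q21 key.
move=> a c x y z a0 c0 x0 y0 z0 key.
have -> : x^-1 * a * (y^-1 * a) = (a * a / (x * y * z)) * z by field; rewrite !gt_eqF.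
have -> : 2 * (a / c) * (z^-1 * a * (x^-1 * c)) = (a * a / (x * y * z)) * (2 * y).
  by field; rewrite !gt_eqF.
by rewrite ler_pM2l // divr_gt0 // !mulr_gt0.
Qed.

(** The contribution of the pole at [rt1], equal to Delta^2 / (E14 q^(n+2)) at q = e(t); the pole at
    [rt2] contributes the conjugate. *)
Definition Mterm u n : C := (Delta (unit_arc u) / rt1 u) ^+ 2 / E14 (unit_arc u) / rt1 u ^+ n.

(** The point r may lie outside the disc of radius s, where g need not have a value, so its partial
    sum is only bounded: degree by degree, a^n |r|^(k-n) <= mu^n s^k. *)
Lemma S3_bound (g : fps C) (r : C) (a s K : R) n : 0 < a -> s = 3 / 2 * a -> a <= nm r -> absb g s K ->
  nm (r ^+ n)^-1 * nm (\sum_(0 <= k < n.+1) cf g k * r ^+ k) <=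
  (a ^+ n)^-1 * (K * Num.max (a / nm r) (2 / 3) ^+ n).
Proof.
move=> a0 sE ar ag; have p0 : 0 < nm r by apply: lt_le_trans ar.
have s0 : 0 < s by rewrite sE; clear -a0; lra.
set mu := Num.max _ _.
have mu1 : a / nm r <= mu by rewrite le_max lexx.
have mu2 : 2 / 3 <= mu by rewrite le_max lexx orbT.
have mu0 : 0 < mu by apply: lt_le_trans mu2; clear; lra.
have K0 := absb_ge0 ag.
have an : 0 < a ^+ n by apply: exprn_gt0.
have rn : 0 < nm r ^+ n by apply: exprn_gt0.
rewrite nmV nmX [leLHS]mulrC [leRHS]mulrC (ler_pdivrMr _ _ rn) mulrAC (ler_pdivlMr _ _ an).
apply: (@le_trans _ _ ((\sum_(0 <= k < n.+1) nm (cf g k) * nm r ^+ k) * a ^+ n)).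
  apply: ler_wpM2r; first exact: ltW.
  by apply: le_trans (nm_sum _ _ _) _; apply: ler_sum => k _; rewrite nmM nmX.
apply: (@le_trans _ _ ((\sum_(0 <= k < n.+1) nm (cf g k) * s ^+ k) * (mu ^+ n * nm r ^+ n))); last first.
  by rewrite -[leRHS]mulrA; apply: ler_wpM2r; [apply: mulr_ge0; apply: ltW => //; apply: exprn_gt0|apply: ag].
rewrite !mulr_suml; apply: ler_sum_nat => k /andP[_ kn]; rewrite -!mulrA.
apply: ler_wpM2l; first exact: nm_ge0.
rewrite ltnS in kn.
have -> : nm r ^+ n = nm r ^+ k * nm r ^+ (n - k) by rewrite -exprD subnKC.
have -> : a ^+ n = a ^+ k * a ^+ (n - k) by rewrite -exprD subnKC.
have -> : mu ^+ n = mu ^+ k * mu ^+ (n - k) by rewrite -exprD subnKC.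
have b1 : a ^+ k <= s ^+ k * mu ^+ k.
  rewrite -exprMn; apply: lerXn2r; rewrite ?nnegrE; [exact: ltW|by apply: mulr_ge0; apply: ltW|].
  have := ler_wpM2l (ltW s0) mu2; rewrite sE; move: (_ * mu) => w; clear; lra.
have b2 : a ^+ (n - k) <= mu ^+ (n - k) * nm r ^+ (n - k).
  rewrite -exprMn; apply: lerXn2r; rewrite ?nnegrE; [exact: ltW|by apply: mulr_ge0; apply: ltW|].
  by rewrite -ler_pdivrMr.
have k0 : 0 <= nm r ^+ k by apply: exprn_ge0; apply: nm_ge0.
have := ler_pM (exprn_ge0 k (ltW a0)) (exprn_ge0 (n - k) (ltW a0)) b1 b2.
move=> b3; apply: le_trans (ler_wpM2l k0 b3) _.
by rewrite le_eqVlt; apply/orP; left; apply/eqP; ring.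
Qed.

Lemma near_term (l gi S M : C) (rn K q : R) : 0 <= rn -> 1 / 2 <= nm gi -> nm M = nm l * rn * nm gi ->
  nm (gi - S) <= q * K -> K <= 312 / 100 -> 0 <= q ->
  nm l * rn * nm (S - gi) <= nm M * (624 / 100 * q).
Proof.
move=> rn0 hg -> h hK q0; have p0 : 0 <= nm l * rn by rewrite mulr_ge0 ?nm_ge0.
rewrite -[leRHS]mulrA; apply: (ler_wpM2l p0); rewrite nm_sub; apply: le_trans h _.
have h1 : q * K <= q * (312 / 100) by apply: (ler_wpM2l q0 hK).
have h2 : 1 / 2 * (624 / 100 * q) <= nm gi * (624 / 100 * q).
  by apply: (ler_wpM2r _ hg); clear -q0; lra.
clear -h1 h2; lra.
Qed.

(** Partial fractions at r1, r2, r3. At the first two poles the partial sums of g are within 3.12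
    (2/3)^(n+1) of the values, and |g_i| >= 1/2 makes this an error relative to |M|; the two
    together give 12.48, four times 3.12. The third pole is handled by [S3_bound] and [lam3_le]. *)
Lemma asym_core (r1 r2 r3 g1 g2 M : C) (g a : fps C) (s : R) n :
  r1 != 0 -> r2 != 0 -> r3 != 0 -> r2 != r1 -> r3 != r1 -> r3 != r2 ->
  r2 = (r1^*)%C -> complex.Im r3 = 0 -> nm r1 <= nm r3 -> s = 3 / 2 * nm r1 ->
  absb g s (312 / 100) -> fval g r1 g1 -> fval g r2 g2 -> 1 / 2 <= nm g1 -> 1 / 2 <= nm g2 ->
  g = a * (lin r1 * (lin r2 * lin r3)) ->
  M = ((1 - r1 / r2) * (1 - r1 / r3))^-1 / r1 ^+ n * g1 ->
  (M^*)%C = ((1 - r2 / r1) * (1 - r2 / r3))^-1 / r2 ^+ n * g2 ->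
  nm (cf a n - (M + (M^*)%C)) <= nm M * (1248 / 100 * ((2 / 3) ^+ n.+1 +
      nm r1 / nm r3 * Num.max (nm r1 / nm r3) (2 / 3) ^+ n)).
Proof.
move=> z1 z2 z3 n21 n31 n32 cj i3 le13 sE ag v1 v2 b1 b2 gE ME MjE.
have a0 : 0 < nm r1 by rewrite nm_gt0.
have c0 : 0 < nm r3 by rewrite nm_gt0.
have s0 : 0 < s by rewrite sE; clear -a0; lra.
have rs1 : nm r1 <= s by rewrite sE; clear -a0; lra.
have p2 : nm r2 = nm r1 by rewrite cj nm_conj.
have rs2 : nm r2 <= s by rewrite p2.
have q23 : nm r1 / s = 2 / 3 by rewrite sE; field; rewrite gt_eqF.
have near1 := fval_near n.+1 ag s0 rs1 v1; have near2 := fval_near n.+1 ag s0 rs2 v2.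
rewrite p2 in near2; rewrite q23 in near1 near2.
have l3 := lam3_le z1 z2 z3 n31 n32 n21 cj i3.
have n12 : r1 != r2 by rewrite eq_sym.
have n13 : r1 != r3 by rewrite eq_sym.
have n23 : r2 != r3 by rewrite eq_sym.
have aE : a = g * (geo r1^-1 * (geo r2^-1 * geo r3^-1)).
  have := geoE r1^-1; have := geoE r2^-1; have := geoE r3^-1; rewrite gE.
  move: (lin r1) (lin r2) (lin r3) (geo _) (geo _) (geo _) => A B D x y z e3 e2 e1.
  transitivity (a * ((A * x) * ((B * y) * (D * z)))); last by ring.
  by rewrite e1 e2 e3 !mulr1.
have iz (x y : C) : x != y -> x^-1 != y^-1 by rewrite (inj_eq invr_inj).
have pf := pf3 (iz _ _ n12) (iz _ _ n13) (iz _ _ n23).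
rewrite (lam_eq z1 z2 z3 n12 n13) (lam_eq z2 z1 z3 n21 n23) (lam_eq z3 z1 z2 n31 n32) in pf.
have D3 (f x y z : fps C) : f * (x + y + z) = f * x + f * y + f * z by ring.
rewrite aE pf D3 2!cfD (cf_geo _ _ _ z1) (cf_geo _ _ _ z2) (cf_geo _ _ _ z3).
have S3 := S3_bound n a0 sE le13 ag.
have r1n : r1 ^+ n != 0 by rewrite expf_neq0.
have r2n : r2 ^+ n != 0 by rewrite expf_neq0.
have nr2 : nm (r2 ^+ n)^-1 = (nm r1 ^+ n)^-1 by rewrite nmV nmX p2.
have nr1 : nm (r1 ^+ n)^-1 = (nm r1 ^+ n)^-1 by rewrite nmV nmX.
have an : 0 < (nm r1 ^+ n)^-1 by rewrite invr_gt0 exprn_gt0.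
have nM1 : nm M = nm ((1 - r1 / r2) * (1 - r1 / r3))^-1 * (nm r1 ^+ n)^-1 * nm g1 by rewrite ME 2!nmM nr1.
have nM2 : nm M = nm ((1 - r2 / r1) * (1 - r2 / r3))^-1 * (nm r1 ^+ n)^-1 * nm g2 by rewrite -nm_conj MjE 2!nmM nr2.
rewrite MjE {1}ME.
move: (\sum_(0 <= k < n.+1) cf g k * r1 ^+ k) (\sum_(0 <= k < n.+1) cf g k * r2 ^+ k)
  (\sum_(0 <= k < n.+1) cf g k * r3 ^+ k) near1 near2 S3 => T1 T2 T3 near1 near2 S3.
have q0 : 0 <= (2 / 3) ^+ n.+1 :> R by apply: exprn_ge0; clear; lra.
have t1 := near_term (ltW an) b1 nM1 near1 (lexx _) q0.
have t2 := near_term (ltW an) b2 nM2 near2 (lexx _) q0.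
set al := nm r1 / nm r3 in S3 l3 *; set mu := Num.max _ _ in S3 *.
have al0 : 0 <= al by apply: divr_ge0; apply: ltW.
have mu0 : 0 <= mu ^+ n by apply: exprn_ge0; rewrite le_max al0.
move: (((1 - r1 / r2) * (1 - r1 / r3))^-1) (((1 - r2 / r1) * (1 - r2 / r3))^-1)
  (((1 - r3 / r1) * (1 - r3 / r2))^-1) l3 t1 t2 nM1 nM2 => L1 L2 L3 l3 t1 t2 nM1 nM2.
have -> : L1 / r1 ^+ n * T1 + L2 / r2 ^+ n * T2 + L3 / r3 ^+ n * T3 -
  (L1 / r1 ^+ n * g1 + L2 / r2 ^+ n * g2) =
  L1 / r1 ^+ n * (T1 - g1) + L2 / r2 ^+ n * (T2 - g2) + L3 / r3 ^+ n * T3 by ring.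
have t3 : nm (L3 / r3 ^+ n * T3) <= nm M * (1248 / 100 * (al * mu ^+ n)).
  rewrite 2!nmM -mulrA.
  apply: (@le_trans _ _ (2 * al * nm L1 * ((nm r1 ^+ n)^-1 * (312 / 100 * mu ^+ n)))).
    by apply: ler_pM => //; rewrite ?nm_ge0 // mulr_ge0 ?nm_ge0.
  have h : nm L1 * (nm r1 ^+ n)^-1 * (1 / 2) <= nm M.
    by rewrite nM1; apply: (ler_wpM2l _ b1); apply: mulr_ge0; [apply: nm_ge0|apply: ltW].
  have am0 : 0 <= al * mu ^+ n by apply: mulr_ge0.
  have := ler_wpM2r am0 h; move: (nm L1) ((nm r1 ^+ n)^-1) (nm M) (mu ^+ n) => x y z w; clear => h; lra.
apply: le_trans (nmD _ _) _; apply: le_trans (lerD (nmD _ _) (lexx _)) _.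
rewrite [nm (L1 / _ * _)]nmM [nm (L1 / _)]nmM nr1 [nm (L2 / _ * _)]nmM [nm (L2 / _)]nmM nr2.
move: (nm (L3 / r3 ^+ n * T3)) t3 (_ * _ * nm (T1 - g1)) t1 (_ * _ * nm (T2 - g2)) t2.
move: (nm M) ((2 / 3) ^+ n.+1) (al * mu ^+ n); clear => x y z p h3 p1 h1 p2 h2; lra.
Qed.

Lemma asym u n (Bi : fps C) : - (1 / 2) < u < 0 -> Bx (jinv (unit_arc u)) * Bi = 1 ->
  E14 (unit_arc u) != 0 /\
  nm (cf (d1f R ^+ 2 * Bi) n - (Mterm u n + (Mterm u n)^*%C)) <=
    nm (Mterm u n) * (1248 / 100 * ((2 / 3) ^+ n.+1 +
      nm (rt1 u) / nm (rt3 u) * Num.max (nm (rt1 u) / nm (rt3 u)) (2 / 3) ^+ n)).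
Proof.
move=> hu BB; have hu' : - (1 / 2) <= u <= 0 by case/andP: hu => ? ?; apply/andP; split; apply: ltW.
have [_ a1 ab _ _] := arc_bounds hu'; have a0 := nm_rt1_gt0 u.
have [z1 z2 z3] := rt_neq0 u; have [n21 n31 n32] := rt_neq hu.
have [G [GE aG]] := arc_factor hu.
have cj := rt2_conj u; have i3 := Im_rt3 hu'.
have t0 := arc_Im (arc_open hu'); have t5 : nm (e2pi (unit_arc u)) < 5^-1 := rt1_lt5 hu'.
have hD : 8856 / (100 * 100) <= nm (Delta (unit_arc u) / e2pi (unit_arc u)).
  by rewrite nmM nmV (ler_pdivlMr _ _ a0); apply: Delta_arc_lower.
have t0' := Im_mconj t0.
have E14j : E14 (- (unit_arc u)^*%C) = ((E14 (unit_arc u))^*)%C.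
  by rewrite /E14 cjM cjX (E4_conj t0) (E6_conj t0).
have t5' : nm (e2pi (- (unit_arc u)^*%C)) < 5^-1 by rewrite -e2pi_conj nm_conj.
have hD' : 8856 / (100 * 100) <= nm (Delta (- (unit_arc u)^*%C) / e2pi (- (unit_arc u)^*%C)).
  by rewrite -e2pi_conj -(Delta_conj t0) -cjV -cjM nm_conj.
have Dj := Delta_conj t0; rewrite /Mterm.
change (e2pi (unit_arc u)) with (rt1 u) in *; change (e2pi (- (unit_arc u)^*%C)) with (rt2 u) in *.
have RT1 := @root_term (unit_arc u); have RT2 := @root_term (- (unit_arc u)^*%C).
change (e2pi (unit_arc u)) with (rt1 u) in RT1; change (e2pi (- (unit_arc u)^*%C)) with (rt2 u) in RT2.
move: (rt1 u) (rt2 u) (rt3 u) (jinv (unit_arc u)) a1 ab a0 z1 z2 z3 n21 n31 n32 GE aG cj i3 t5 hD t5' hD' RT1 RT2 BB.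
move=> r1 r2 r3 x a1 ab a0 z1 z2 z3 n21 n31 n32 GE aG cj i3 t5 hD t5' hD' RT1 RT2 BB.
have [s sE] : exists s, s = 3 / 2 * nm r1 by exists (3 / 2 * nm r1).
rewrite -sE in aG.
have s0 : 0 < s by rewrite sE; clear -a0; lra.
have rs : nm r1 < s by rewrite sE; clear -a0; lra.
have rs2 : nm r2 < s by rewrite cj nm_conj.
have s66 : 0 <= s <= 66 / (100 * 100) by rewrite sE; apply/andP; split; clear -a0 a1; lra.
(* This is d^2 / G, with norm at most 1.1716^2 / (1 - 0.56) < 3.12. *)
pose g := d1f R ^+ 2 * Bi * (lin r1 * (lin r2 * lin r3)).
have Gg : G * g = d1f R ^+ 2.
  rewrite -[RHS]mulr1 -BB -GE /g.
  move: (lin r1) (lin r2) (lin r3) => A B D; ring.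
have ad : absb (d1f R) s (s * 26 + nm 1).
  by have := absbD (ltW s0) (absb_d1_small s66) (absb_cst 1 s); rewrite subrK.
have ad2 : absb (d1f R ^+ 2) s ((11716 / (100 * 100)) ^+ 2).
  apply: absbX; first exact: ltW.
  apply: (absbW ad); rewrite nm1; case/andP: s66 => _; clear; lra.
have k56 : 56 / 100 < (1 : R) by clear; lra.
have ag : absb g s (312 / 100).
  apply: (absbW (absb_quot (ltW s0) k56 aG ad2 Gg)).
  by rewrite ler_pdivrMr; clear; lra.
clear ad ad2 k56.
have n12 : r1 != r2 by rewrite eq_sym.
have n13 : r1 != r3 by rewrite eq_sym.
have n23 : r2 != r3 by rewrite eq_sym.
have [g1 [v1 b1 E0 e1]] := RT1 r2 r3 x G g s (312 / 100) t0 t5 hD GE aG rs ag Gg z2 z3 n12 n13.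
have GE2 : lin r2 * (lin r1 * (lin r3 * G)) = Bx x.
  by rewrite -GE; move: (lin r1) (lin r2) (lin r3) => A B D; ring.
have [g2 [v2 b2 E02 e2]] := RT2 r1 r3 x G g s (312 / 100) t0' t5' hD' GE2 aG rs2 ag Gg z1 z3 n21 n23.
split; first exact: E0.
have nz (a b : C) : b != 0 -> a != b -> 1 - a / b != 0.
  move=> b0 h; rewrite subr_eq0; apply: contra h => /eqP h.
  by rewrite -[b]mul1r h divfK.
apply: (asym_core z1 z2 z3 n21 n31 n32 cj i3 ab sE ag v1 v2 b1 b2 (erefl g)).
  rewrite e1; have := nz _ _ z2 n12; have := nz _ _ z3 n13; have rn : r1 ^+ n != 0 by rewrite expf_neq0.
  move: (1 - r1 / r2) (1 - r1 / r3) (Delta _ / _) (E14 _) E0 (r1 ^+ n) rn => A B D E E0 w w0 B0 A0.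
  by field; rewrite w0 E0 A0 B0.
rewrite e2 E14j -Dj; have -> : ((Delta (unit_arc u) / r1) ^+ 2 / E14 (unit_arc u) / r1 ^+ n)^*%C =
  ((Delta (unit_arc u))^*%C / r2) ^+ 2 / (E14 (unit_arc u))^*%C / r2 ^+ n.
  by rewrite 2!cjM 2!cjV cjX cjM cjV cjX -cj.
have E0' : (E14 (unit_arc u))^*%C != 0 by rewrite -E14j.
have := nz _ _ z1 n21; have := nz _ _ z3 n23; have rn : r2 ^+ n != 0 by rewrite expf_neq0.
move: (1 - r2 / r1) (1 - r2 / r3) ((Delta _)^*%C / _) ((E14 _)^*%C) E0' (r2 ^+ n) rn => A B D E E00 w w0 B0 A0.
by field; rewrite w0 E00 A0 B0.
Qed.

End Asymptotics.

(** * Points where the phase is a multiple of pi *)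

Section SamplePoints.
Variable R : realType.
Implicit Types (b c x : R) (m n k : nat).

Lemma cos_pi3 : cos (pi / 3) = 1 / 2 :> R.
Proof.
have e : cos (pi / 3 + pi / 3 + pi / 3) = -1 :> R by rewrite -cospi; congr cos; field.
have p0 := @pi_gt0 R.
have c0 : 0 < cos (pi / 3 : R) by apply: cos_gt0_pihalf; apply/andP; split; clear -p0; lra.
move: e; rewrite !cosD !sinD; have := cos2Dsin2 (pi / 3 : R).
move: (cos _) (sin _) c0 => a s c0 h1 h2; clear p0.
have s2 : s * s = 1 - a * a by rewrite -h1 !expr2 addrAC subrr add0r.
have h3 : (a * a - s * s) * a - (s * a + a * s) * s = a * (a * a) - 3 * a * (s * s) by ring.
rewrite h3 s2 in h2.
have : (a + 1) * (2 * a - 1) ^+ 2 = 0.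
  have -> : (a + 1) * (2 * a - 1) ^+ 2 = a * (a * a) - 3 * a * (1 - a * a) + 1 by ring.
  by rewrite h2 addrC subrr.
move/eqP; rewrite mulf_eq0 gt_eqF ?addr_gt0 //= sqrf_eq0 subr_eq0 => /eqP e.
clear -e; lra.
Qed.

Lemma cos_2pi3 : cos (2 / 3 * pi) = - (1 / 2) :> R.
Proof.
have -> : 2 / 3 * pi = pi / 3 + pi / 3 :> R by field.
rewrite cosD -!expr2; have := cos2Dsin2 (pi / 3 : R); rewrite cos_pi3.
by move: (sin _ ^+ 2) => w; clear; lra.
Qed.

(** For t = e^(i x) on the arc this is the argument 5 x + 2 pi m cos x of t^5 e(m t), divided by
    pi. *)
Definition psi m x : R := 5 / pi * x + 2 * m%:R * cos x.

Lemma psi_cont m : continuous (psi m).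
Proof.
move=> x; apply: cvgD; apply: cvgM; [exact: cvg_cst|exact: cvg_id|exact: cvg_cst|exact: continuous_cos].
Qed.

Lemma psi_half m : psi m (pi / 2) = 5 / 2.
Proof. rewrite /psi cos_pihalf mulr0 addr0; have := @pi_gt0 R; move: (pi : R) => w w0.
by field; exact: lt0r_neq0. Qed.

Lemma psi_step m b c : pi / 2 <= b -> psi m b < c -> c <= 5 / 2 ->
  exists2 x, pi / 2 <= x < b & psi m x = c.
Proof.
move=> hb bc c5; have [||x] := @IVT R (psi m) (pi / 2) b c hb.
- by apply: continuous_subspaceT; apply: psi_cont.
- by rewrite psi_half ge_min le_max c5 (ltW bc) orbT.
rewrite in_itv /= => /andP[x1 x2] e; exists x => //; rewrite x1 lt_def x2 andbT.
by apply/eqP => eb; move: bc; rewrite eb e ltxx.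
Qed.

(** At rho [psi] is 10/3 - m and at i it is 5/2, so the m - 1 integers from 4 - m to 2 are attained.
    Each point is found by the intermediate value theorem between pi/2 and the previous one, which
    makes the sequence decreasing. *)
Lemma theta_seq m : (2 <= m)%N -> forall K, (K <= m.-2)%N -> exists th : nat -> R,
  forall k, (k <= K)%N -> [/\ pi / 2 <= th k, th k <= 2 / 3 * pi, psi m (th k) = k%:R + 4 - m%:R &
    (k < K)%N -> th k.+1 < th k].
Proof.
move=> m2; have p0 := @pi_gt0 R.
have top k : (k <= m.-2)%N -> k%:R + 4 - m%:R <= 5 / 2 :> R.
  move=> h; have : k.+2%:R <= m%:R :> R by rewrite ler_nat; lia.
  by rewrite -[k.+2]addn2 natrD; clear; lra.
elim=> [_|K IH hK].
  have [|||x /andP[x1 x2] e] := @psi_step m (2 / 3 * pi) (0%:R + 4 - m%:R).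
  - by clear -p0; lra.
  - rewrite /psi cos_2pi3 (_ : 5 / pi * (2 / 3 * pi) = 10 / 3); first by clear; lra.
    by move: (pi : R) p0 => w w0; field; exact: lt0r_neq0.
  - exact: top.
  exists (fun=> x) => k; rewrite leqn0 => /eqP ->; split=> //; exact: ltW.
have [th H] := IH (ltnW hK); have [h1 h2 h3 _] := H K (leqnn K).
have [||x /andP[x1 x2] e] := @psi_step m (th K) (K.+1%:R + 4 - m%:R) h1.
- by rewrite h3 -natr1; clear; lra.
- exact: top.
exists (fun k => if (k <= K)%N then th k else x) => k; rewrite leq_eqVlt => /orP[/eqP ->|].
  rewrite ltnn; split=> //; last by rewrite ltnn.
  by apply: le_trans (ltW x2) h2.
rewrite ltnS => kK; have [q1 q2 q3 q4] := H k kK; rewrite kK; split=> // _.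
by case: ltnP => [/q4 //|Kk]; have -> : k = K by apply/eqP; rewrite eqn_leq kK.
Qed.

End SamplePoints.

(** * Sign alternation at the sample points *)

Section Alternation.
Variable R : realType.
Local Notation C := R[i].
Hypothesis ram : forall x : C,
  d1f R * (E4f R ^+ 2 * E6f R) = (d1f R + fD (d1f R)) * Bx x - d1f R * fD (Bx x).

Lemma arc_conj u : - (1 / 2) <= u <= 0 -> ((unit_arc u : C)^*)%C = (unit_arc u)^-1.
Proof.
move=> hu; have h : -1 <= u <= 1 by case/andP: hu => ? ?; apply/andP; split; lra.
by apply: oppr_inj; rewrite (arc_inv h).
Qed.

(** On the arc a form of weight k becomes real after multiplication by t^(k/2), which gives the
    exponents 7 here and 6 for Delta. *)
Definition Wr u : R := complex.Re (E14 (unit_arc u : C) * unit_arc u ^+ 7).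
Definition Dr u : R := complex.Re (Delta (unit_arc u : C) * unit_arc u ^+ 6).

Lemma unit_arc_neq0 u : - (1 / 2) <= u <= 0 -> (unit_arc u : C) != 0.
Proof.
move=> hu; rewrite -nm_gt0 arc_nm ?ltr01 //.
by case/andP: hu => ? ?; apply/andP; split; lra.
Qed.

Lemma WrE u : - (1 / 2) <= u <= 0 -> E14 (unit_arc u) * unit_arc u ^+ 7 = (Wr u)%:C.
Proof.
move=> hu; apply: conj_real; have t0 := unit_arc_neq0 hu; have o := arc_open hu.
rewrite /E14 cjM cjM cjX (E4_arc_conj o) (E6_arc_conj o) cjX (arc_conj hu).
by move: (unit_arc u) (E4 _) (E6 _) t0 => t a b t0; field.
Qed.

Lemma DrE u : - (1 / 2) <= u <= 0 -> Delta (unit_arc u) * unit_arc u ^+ 6 = (Dr u)%:C.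
Proof.
move=> hu; apply: conj_real; have t0 := unit_arc_neq0 hu; have o := arc_open hu.
rewrite cjM (Delta_arc_conj o) cjX (arc_conj hu).
by move: (unit_arc u) (Delta _) t0 => t a t0; field.
Qed.

Lemma Bx_inv (x : C) : exists Bi, Bx x * Bi = 1.
Proof. by have [g ? _] := fps_inv (cf_Bx0 x); exists g. Qed.

Lemma Wr_neq0 u : - (1 / 2) < u < 0 -> Wr u != 0.
Proof.
move=> hu; have hu' : - (1 / 2) <= u <= 0 by case/andP: hu => ? ?; apply/andP; split; apply: ltW.
have [Bi BB] := Bx_inv (jinv (unit_arc u)); have [E0 _] := asym ram 0 hu BB.
have : E14 (unit_arc u) * unit_arc u ^+ 7 != 0 by rewrite mulf_neq0 // expf_neq0 // unit_arc_neq0.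
by rewrite (WrE hu'); apply: contra => /eqP ->.
Qed.

(** A change of sign would produce, by [lip_IVT], a zero inside the arc, against [Wr_neq0]. *)
Lemma Wr_sign (u v : R) : - (1 / 2) < u < 0 -> - (1 / 2) < v < 0 -> 0 < Wr u * Wr v.
Proof.
wlog uv : u v / u <= v => [H|].
  by move=> hu hv; case: (leP u v) => [|/ltW] uv; [exact: H|rewrite mulrC; exact: H].
move=> hu hv; rewrite lt_def mulf_neq0 ?Wr_neq0 //= leNgt; apply/negP => neg.
case/andP: (hu) => u1 u2; case/andP: (hv) => v1 v2.
have [c /andP[uc cv] Wc] : exists2 c, u <= c <= v & Wr c = 0.
  apply: (lip_IVT (lip_E14 R) _ (ltW u1) uv (ltW v2)); first by move=> x hx; apply: WrE.
  rewrite ge_min le_max; case: (lerP (Wr u) 0) => h1 /=.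
    by apply/orP; right; rewrite leNgt; apply/negP => h2; have := mulr_le0 h1 (ltW h2); rewrite leNgt neg.
  by rewrite (ltW h1) orTb andbT leNgt; apply/negP => h2; have := mulr_gt0 h1 h2; rewrite ltNge (ltW neg).
have hc : - (1 / 2) < c < 0 by rewrite (lt_le_trans u1 uc) (le_lt_trans cv v2).
by have := Wr_neq0 hc; rewrite Wc eqxx.
Qed.

(** When [psi] is an integer, t^5 e(m t) is real and its sign is the parity of that integer; k + 4 -
    m and k + m have the same parity. *)
Lemma sample_phase (u th : R) m k : - (1 / 2) <= u <= 0 -> pi / 2 <= th <= 2 / 3 * pi -> u = cos th ->
  psi m th = k%:R + 4 - m%:R ->
  unit_arc u ^+ 5 * rt1 u ^+ m = (-1) ^+ (k + m) * (nm (rt1 u) ^+ m)%:C.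
Proof.
move=> hu /andP[th1 th2] uE hp; have p0 := @pi_gt0 R.
have tE : unit_arc u = e2pi ((th / (2 * pi)) +i* 0).
  rewrite e2piE mulr0 oppr0 expR0 !mul1r (_ : 2 * pi * (th / (2 * pi)) = th); last first.
    by move: (pi : R) p0 => w w0; field; exact: lt0r_neq0.
  rewrite /unit_arc uE; congr (_ +i* _); have -> : 1 - cos th ^+ 2 = sin th ^+ 2.
    by rewrite -(cos2Dsin2 th) addrAC subrr add0r.
  rewrite sqrtr_sqr ger0_norm //; apply: sin_ge0_pi; apply/andP; split; clear -th1 th2 p0; lra.
have sE : rt1 u = e2pi (u +i* 0) * (nm (rt1 u))%:C.
  rewrite nm_rt1 /rt1 /unit_arc !e2piE mulr0 oppr0 expR0 !mul1r -/(arcy u).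
  move: (expR _) (cos _) (sin _) => E c s; apply/eqP.
  by rewrite eq_complex /= !mulr0 subr0 add0r [c * E]mulrC [s * E]mulrC !eqxx.
rewrite {1}sE exprMn mulrA tE !e2piX -e2piD -rmorphXn; congr (_ * _).
have -> : 5%:R * ((th / (2 * pi)) +i* 0) + m%:R * (u +i* 0) = (k + 4 + m)%:R * 2^-1 - m%:R :> C.
  have rr (x : R) : x +i* 0 = x%:C by [].
  rewrite !rr -!(rmorph_nat (@real_complex R)) -(fmorphV (@real_complex R)) -!rmorphM -rmorphD -rmorphB.
  congr (_%:C); move: hp; rewrite /psi -uE !natrD.
  rewrite (_ : 5 / pi * th = 10 * (th / (2 * pi))); last first.
    by move: (pi : R) p0 => w w0; field; exact: lt0r_neq0.
  by move: (th / (2 * pi)) => w; clear; lra.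
rewrite e2piBnat -e2piX e2pi_half -addnA exprD [(4 + m)%N]addnC exprD exprD.
by have -> : (-1) ^+ 4 = 1 :> C; [rewrite -signr_odd|rewrite mulr1].
Qed.

(** The ratio |rt1| / |rt3| is exp(- 2 pi T (u + 1/2)) with T >= 1, and the sample points satisfy 2
    (n + 2) (u + 1/2) >= 2/3. For n >= 12 its power n + 1 therefore has exponent beyond (2/3)
    (13/14) pi > 1.9, and the total is at most 12.48 (0.0052 + 0.151) < 2. The threshold is 2
    because the main term is twice the real number M. *)
Lemma alpha_le (u : R) n : - (1 / 2) < u < 0 -> (12 <= n)%N -> 2 / 3 <= 2 * n.+2%:R * (u + 1 / 2) ->
  1248 / 100 * ((2 / 3) ^+ n.+1 + nm (rt1 u) / nm (rt3 u) * Num.max (nm (rt1 u) / nm (rt3 u)) (2 / 3) ^+ n) < 2.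
Proof.
move=> hu n12 hs; have hu' : - (1 / 2) <= u <= 0 by case/andP: hu => ? ?; apply/andP; split; apply: ltW.
have [T1 _ _] := arc_T hu'; case/andP: (hu) => u1 u2.
have v0 : 1 + u != 0 by rewrite gt_eqF //; clear -u1; lra.
have aE : nm (rt1 u) / nm (rt3 u) = expR (- (2 * pi * (arcy u / (1 + u)) * (u + 1 / 2))).
  by rewrite nm_rt1 (nm_rt3 hu') -expRN opprK -expRD; congr expR; field.
have an1 : (nm (rt1 u) / nm (rt3 u)) ^+ n.+1 <= 151 / 1000.
  rewrite aE -expRM_natl mulrN; apply: expRN_19.
  have /andP[p1 _] := pi_bounds R.
  have nn : 13 * n.+2%:R <= 14 * n.+1%:R :> R.
    have h12 : 12%:R <= n%:R :> R by rewrite ler_nat.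
    by rewrite -[n.+2]addn2 -[n.+1]addn1 !natrD; clear -h12; lra.
  have w0 : 0 < u + 1 / 2 by clear -u1; lra.
  have k1 : 13 * n.+2%:R * (u + 1 / 2) <= 14 * n.+1%:R * (u + 1 / 2) by apply: ler_wpM2r nn; apply: ltW.
  have k2 : 2 / 3 * 13 / 14 <= 2 * n.+1%:R * (u + 1 / 2) by clear -k1 hs; lra.
  have k3 : 7853 / 2500 * 1 <= pi * (arcy u / (1 + u)) by apply: (mul_lbound _ _ p1 T1 (lexx _)); clear; lra.
  have k4 : 19 / 10 <= pi * (arcy u / (1 + u)) * (2 * n.+1%:R * (u + 1 / 2)).
    by apply: (mul_lbound _ _ k3 k2); clear; lra.
  by move: k4; move: (arcy u / (1 + u)) (n.+1%:R) (pi : R) => a b c k4; apply: le_trans k4 _; rewrite le_eqVlt; apply/orP; left; apply/eqP; ring.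
have q : (2 / 3) ^+ n.+1 <= (2 / 3) ^+ 13 :> R by apply: ler_wiXn2l; [clear; lra|clear; lra|].
have q13 : (2 / 3) ^+ 13 <= 52 / (100 * 100) :> R.
  have h4 : (2 / 3) ^+ 4 <= 1976 / (100 * 100) :> R by clear; lra.
  have h40 : 0 <= (2 / 3) ^+ 4 :> R by clear; lra.
  have h8 := sqr_ubound (c := 391 / (100 * 100)) h40 h4 ltac:(clear; lra).
  have h12 := ler_pM (sqr_ge0 _) h40 h8 h4.
  rewrite (_ : (2 / 3) ^+ 13 = ((2 / 3) ^+ 4) ^+ 2 * (2 / 3) ^+ 4 * (2 / 3) :> R); last by rewrite -exprM -exprD -exprSr.
  move: (_ ^+ 2 * _) h12 => w; clear; lra.
have mx : nm (rt1 u) / nm (rt3 u) * Num.max (nm (rt1 u) / nm (rt3 u)) (2 / 3) ^+ n <= 151 / 1000.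
  have al0 : 0 <= nm (rt1 u) / nm (rt3 u) by rewrite aE expR_ge0.
  move: (nm (rt1 u) / nm (rt3 u)) al0 an1 {aE} => al al0 an1.
  have [h|h] := leP al (2 / 3); last by rewrite -exprS.
  apply: (@le_trans _ _ ((2 / 3) ^+ n.+1)).
    by rewrite exprS; apply: (ler_wpM2r _ h); apply: exprn_ge0; clear; lra.
  by apply: le_trans q _; apply: le_trans q13 _; clear; lra.
move: (_ * Num.max _ _ ^+ n) ((2 / 3) ^+ n.+1) q mx => a b q mx; clear -q mx q13; lra.
Qed.

Lemma real_sign (z : C) (c e : R) : e < 2 -> c != 0 -> nm (z - (c%:C + (c%:C)^*%C)) <= nm (c%:C : C) * e ->
  0 < complex.Re z * c.
Proof.
move=> e2 c0 h; have h1 : `|complex.Re z - 2 * c| <= `|c| * e.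
  apply: le_trans _ (le_trans (nm_ge_Re _) (le_trans h _)); last by rewrite nm_real.
  by case: z {h} => a b /=; rewrite mulr2n mulrDl mul1r.
have c1 : 0 < `|c| by rewrite normr_gt0.
have h2 : `|complex.Re z - 2 * c| < 2 * `|c| by apply: le_lt_trans h1 _; rewrite mulrC ltr_pM2r.
move: (complex.Re z) h2 => x; rewrite ltr_norml => /andP[a b].
have [cp|cn|ce] := ltgtP 0 c; last by rewrite -ce eqxx in c0.
  by rewrite gtr0_norm // in a b; apply: mulr_gt0 => //; lra.
by rewrite ltr0_norm // in a b; rewrite -mulrNN; apply: mulr_gt0; lra.
Qed.

Lemma sample_sign (u th : R) n k (Bi : fps C) : - (1 / 2) < u < 0 -> (12 <= n)%N ->
  pi / 2 <= th <= 2 / 3 * pi -> u = cos th -> psi n.+2 th = k%:R + 4 - n.+2%:R ->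
  2 / 3 <= 2 * n.+2%:R * (u + 1 / 2) -> Bx (jinv (unit_arc u)) * Bi = 1 ->
  0 < complex.Re (cf (d1f R ^+ 2 * Bi) n) * ((-1) ^+ (k + n) * Wr u).
Proof.
move=> hu n12 hth uE hp hs BB.
have hu' : - (1 / 2) <= u <= 0 by case/andP: hu => ? ?; apply/andP; split; apply: ltW.
have [E0 est] := asym ram n hu BB; have al := alpha_le hu n12 hs.
have ph := sample_phase hu' hth uE hp; have t0 := unit_arc_neq0 hu'.
have r0 := nm_rt1_gt0 u; have W0 := Wr_neq0 hu; have D0 := Delta_arc_neq0 hu'.
have Dr0 : Dr u != 0.
  have : Delta (unit_arc u) * unit_arc u ^+ 6 != 0 by rewrite mulf_neq0 // expf_neq0.
  by rewrite (DrE hu'); apply: contra => /eqP ->.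
have [z1 _ _] := rt_neq0 u.
set c := (-1) ^+ (k + n) * (Dr u ^+ 2 / Wr u / nm (rt1 u) ^+ n.+2).
have Mc : Mterm u n = c%:C.
  (* The powers of t balance, 12 = 7 + 5, so the main term is a quotient of three quantities that
     are real at the sample points. *)
  have -> : Mterm u n = (Delta (unit_arc u) * unit_arc u ^+ 6) ^+ 2 / (E14 (unit_arc u) * unit_arc u ^+ 7) / (unit_arc u ^+ 5 * rt1 u ^+ n.+2).
    rewrite /Mterm (_ : rt1 u ^+ n.+2 = rt1 u ^+ n * rt1 u ^+ 2); last by rewrite -exprD addn2.
    have rn : rt1 u ^+ n != 0 by rewrite expf_neq0.
    move: (rt1 u) z1 (unit_arc u) t0 (Delta _) (E14 _) E0 (rt1 u ^+ n) rn => r r00 t t00 D E E00 w w0.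
    by field; rewrite w0 r00 t00 E00.
  have sg : (-1) ^+ (k + n.+2) = ((-1) ^+ (k + n) : R)%:C :> C.
    by rewrite addnS addnS -signr_odd /= negbK signr_odd rmorphXn rmorphN1.
  rewrite ph (DrE hu') (WrE hu') sg /c -rmorphXn -rmorphM -!fmorph_div; congr (_%:C).
  have -> : ((-1) ^+ (k + n) * nm (rt1 u) ^+ n.+2)^-1 = (-1) ^+ (k + n) * (nm (rt1 u) ^+ n.+2)^-1.
    by rewrite invfM -exprVn invrN1.
  by rewrite mulrCA.
have c0 : c != 0.
  have rn : nm (rt1 u) ^+ n.+2 != 0 := lt0r_neq0 (exprn_gt0 n.+2 r0).
  apply: mulf_neq0; first by rewrite signr_eq0.
  apply: mulf_neq0; last by rewrite invr_eq0.
  by apply: mulf_neq0; [exact: expf_neq0|rewrite invr_eq0].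
rewrite Mc in est; have sg := real_sign al c0 est.
have pos : 0 < Dr u ^+ 2 / Wr u ^+ 2 / nm (rt1 u) ^+ n.+2.
  by apply: divr_gt0; [apply: divr_gt0; rewrite lt_def sqr_ge0 sqrf_eq0 ?Dr0 ?W0|apply: exprn_gt0].
rewrite -(pmulr_lgt0 _ pos); apply: lt_le_trans sg _; rewrite le_eqVlt; apply/orP; left; apply/eqP.
rewrite /c; have rn : nm (rt1 u) ^+ n.+2 != 0 by rewrite expf_neq0 // gt_eqF.
by move: (nm _ ^+ _) rn (Wr u) W0 (Dr u) ((-1) ^+ _) (complex.Re _) => w w0 W W00 D s x; field; rewrite w0 W00.
Qed.

Lemma large_alternation n : (12 <= n)%N -> exists (U : nat -> R) (e : bool),
  (forall k, (k <= n)%N -> [/\ - (1 / 2) < U k, U k < 0,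
     k%:R - n%:R - 4 / 3 <= 2 * n.+2%:R * U k <= k%:R - n%:R - 1 / 2,
     (k < n)%N -> U k < U k.+1 &
     forall Bi, Bx (jinv (unit_arc (U k) : C)) * Bi = 1 ->
       0 < (-1) ^+ (e + k) * complex.Re (cf (d1f R ^+ 2 * Bi) n)]).
Proof.
move=> n12; have p0 := @pi_gt0 R.
have [th H] := @theta_seq R n.+2 isT n (leqnn n).
pose U k := cos (th k).
have HU k : (k <= n)%N -> [/\ - (1 / 2) < U k, U k < 0,
     k%:R - n%:R - 4 / 3 <= 2 * n.+2%:R * U k <= k%:R - n%:R - 1 / 2 & 2 / 3 <= 2 * n.+2%:R * (U k + 1 / 2)].
  move=> kn; have [h1 h2 h3 _] := H k kn.
  have q1 : 5 / 2 <= 5 / pi * th k.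
    by rewrite mulrAC ler_pdivlMr //; clear -h1; lra.
  have q2 : 5 / pi * th k <= 10 / 3.
    by rewrite mulrAC ler_pdivrMr //; clear -h2; lra.
  have kn' : k%:R <= n%:R :> R by rewrite ler_nat.
  have k0 : 0 <= k%:R :> R by rewrite ler0n.
  have nn : n.+2%:R = n%:R + 2 :> R by rewrite -!natr1; clear; lra.
  have n0 : 0 <= n%:R :> R by rewrite ler0n.
  move: h3; rewrite /psi -/(U k) => h3.
  have b : k%:R - n%:R - 4 / 3 <= 2 * n.+2%:R * U k <= k%:R - n%:R - 1 / 2.
    by rewrite nn in h3 *; apply/andP; split; clear -h3 q1 q2; lra.
  have m0 : 0 < 2 * n.+2%:R :> R by rewrite nn; clear -n0; lra.
  case/andP: (b) => b1 b2; split.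
  - by rewrite -(ltr_pM2l m0); apply: lt_le_trans b1; rewrite nn; clear -k0; lra.
  - by rewrite -(ltr_pM2l m0) mulr0; apply: le_lt_trans b2 _; clear -kn'; lra.
  - exact: b.
  by rewrite mulrDr; move: b1; rewrite nn; clear -k0; lra.
have [u1 u2 _ _] := HU 0%N (leq0n n).
have h0 : - (1 / 2) < U 0%N < 0 by rewrite u1.
exists U, (odd n (+) (Wr (U 0%N) < 0)) => k kn; have [a1 a2 a3 a4] := HU k kn.
have [h1 h2 h3 h4] := H k kn.
split=> //.
  move=> kn'; have [h1' h2' _ _] := H k.+1 kn'.
  rewrite /U ltr_cos ?h4 // in_itv /=; apply/andP; split; clear -h1 h2 h1' h2' p0; lra.
move=> Bi BB; have hk : - (1 / 2) < U k < 0 by rewrite a1.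
have hth : pi / 2 <= th k <= 2 / 3 * pi by rewrite h1.
have sg := sample_sign hk n12 hth erefl h3 a4 BB.
have ws := Wr_sign h0 hk.
have -> : (-1) ^+ ((odd n (+) (Wr (U 0%N) < 0)) + k) = (-1) ^+ (k + n) * (-1) ^+ (Wr (U 0%N) < 0)%R :> R.
  by rewrite exprD signr_addb signr_odd [(-1) ^+ (k + n)]exprD mulrC mulrA.
move: (complex.Re _) ((-1) ^+ (k + n)) sg => x y sg.
have [W0|W0] := ltP (Wr (U 0%N)) 0.
  rewrite nmulr_rgt0 // in ws; rewrite expr1 mulrN1 mulNr oppr_gt0 mulrC.
  by move: sg; rewrite mulrA nmulr_lgt0.
have W0' : 0 < Wr (U 0%N) by rewrite lt_def Wr_neq0.
rewrite pmulr_rgt0 // in ws; rewrite expr0 mulr1 mulrC.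
by move: sg; rewrite mulrA pmulr_lgt0.
Qed.

End Alternation.

(** * Counting the zeros *)

Section Counting.
Variable R : realType.
Implicit Types (a b : R) (P : pred nat) (n k : nat).

Lemma count_upper P n a b : a <= b -> (forall k, (k < n)%N -> P k -> a < k%:R /\ k%:R < b) ->
  (count P (iota 0 n))%:R <= b - a + 1.
Proof.
move=> ab H; set s := [seq k <- iota 0 n | P k]; rewrite -size_filter -/s.
have mem k : k \in s -> [/\ P k, (k < n)%N, a < k%:R & k%:R < b].
  by rewrite mem_filter mem_iota add0n => /and3P[Pk _ kn]; have [h1 h2] := H k kn Pk.
have [s0|[k0 k0s]] : s = [::] \/ exists k, k \in s by case: (s) => [|x l]; [left|right; exists x; rewrite mem_head].
  by rewrite s0 /=; move: ab; clear; lra.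
have ex : exists k, k \in s by exists k0.
have bd k : k \in s -> (k <= n)%N by case/mem => _ /ltnW.
pose lo := ex_minn ex; pose hi := ex_maxn ex bd.
have [los lom] : lo \in s /\ forall k, k \in s -> (lo <= k)%N by rewrite /lo; case: ex_minnP.
have [his him] : hi \in s /\ forall k, k \in s -> (k <= hi)%N by rewrite /hi; case: ex_maxnP.
have le : (size s <= size (iota lo (hi.+1 - lo)))%N.
  apply: uniq_leq_size; first by rewrite filter_uniq // iota_uniq.
  by move=> k ks; rewrite mem_iota (lom k ks) subnKC ?ltnS ?him // leqW // lom.
have [_ _ h1 _] := mem _ los; have [_ _ _ h2] := mem _ his.
rewrite size_iota in le; have le' : (size s + lo <= hi.+1)%N by have := lom _ his; lia.
have : (size s + lo)%:R <= hi.+1%:R :> R by rewrite ler_nat.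
by rewrite natrD -natr1; move: h1 h2; clear; lra.
Qed.

Lemma count_lower P n a b : -1 < a -> b < n%:R -> (forall k, (k < n)%N -> a <= k%:R -> k%:R <= b -> P k) ->
  b - a - 1 <= (count P (iota 0 n))%:R.
Proof.
move=> a1 bn H; have [b0|b0] := ltP b 0.
  by apply: le_trans (ler0n _ _); move: a1 b0; clear; lra.
have exa : exists k, a <= k%:R.
  exists (Num.Def.archi_bound `|a|); apply: le_trans (ler_norm a) _; exact: ltW (archi_boundP (normr_ge0 a)).
have exb : exists k, (k%:R <= b) by exists 0%N.
have bdb k : k%:R <= b -> (k <= n)%N.
  by move=> h; rewrite -(ler_nat R); apply: le_trans h (ltW bn).
pose lo := ex_minn exa; pose hi := ex_maxn exb bdb.
have [loa lom] : a <= lo%:R /\ forall k, a <= k%:R -> (lo <= k)%N by rewrite /lo; case: ex_minnP.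
have [hib him] : hi%:R <= b /\ forall k, k%:R <= b -> (k <= hi)%N by rewrite /hi; case: ex_maxnP.
have lo1 : lo%:R < a + 1.
  case E : lo => [|l]; first by move: a1; clear; lra.
  rewrite ltNge; apply/negP => h; have : a <= l%:R by move: h; rewrite -natr1; clear; lra.
  by move/lom; rewrite E ltnn.
have hi1 : b < hi.+1%:R by rewrite ltNge; apply/negP => /him; rewrite ltnn.
have [|hl] := leqP hi.+1 lo.
  rewrite -(ler_nat R) => hl; apply: le_trans (ler0n _ _); move: lo1 hi1 hl; clear; lra.
have le : (size (iota lo (hi.+1 - lo)) <= size [seq k <- iota 0 n | P k])%N.
  apply: uniq_leq_size; first exact: iota_uniq.
  move=> k; rewrite mem_iota (subnKC (ltnW hl)) ltnS => /andP[lk kh].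
  have kb : k%:R <= b by apply: le_trans hib; rewrite ler_nat.
  have kn : (k < n)%N by rewrite -(ltr_nat R); apply: le_lt_trans bn.
  rewrite mem_filter mem_iota add0n kn andbT H //; apply: le_trans loa _; by rewrite ler_nat.
rewrite size_iota size_filter in le.
have le' : (hi.+1 <= count P (iota 0 n) + lo)%N by rewrite addnC -leq_subLR.
have : hi.+1%:R <= (count P (iota 0 n) + lo)%:R :> R by rewrite ler_nat.
by rewrite natrD; move: lo1 hi1; clear; lra.
Qed.

End Counting.

(** * All zeros of F_m and their distribution *)

Section Main.
Variables (R : realType) (F : nat -> {poly int}).
Hypothesis hF : forall m : nat, (2 <= m)%N -> is_F R m (F m).
Local Notation C := R[i].
Local Notation FR m := (map_poly intr (F m) : {poly R}).
Local Notation FC m := (map_poly intr (F m) : {poly C}).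

Lemma FC_FR m : FC m = map_poly (real_complex R) (FR m).
Proof. by rewrite -map_poly_comp; apply: eq_map_poly => x /=; rewrite rmorph_int. Qed.

Lemma root_FR m (x : R) : root (FC m) x%:C = root (FR m) x.
Proof. by rewrite FC_FR rootE horner_map rootE fmorph_eq0. Qed.

(** The cofactors P_n are chosen for all n simultaneously, because Ramanujan's identity draws on
    every relation at once. *)
Lemma faber_data : (forall x : C,
    d1f R * (E4f R ^+ 2 * E6f R) = (d1f R + fD (d1f R)) * Bx x - d1f R * fD (Bx x)) /\
  forall n (x : R) (Bi : fps C), Bx (x%:C) * Bi = 1 ->
    (FR n.+2).[x] = complex.Re (cf (d1f R ^+ 2 * Bi) n) * (x * (x - 1728)).
Proof.
have H n := FC_factor (isT : (1 < n.+2)%N) (hF (isT : (1 < n.+2)%N)).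
have [P HP] := choice H.
have G n := is_F_good (isT : (1 < n.+2)%N) (hF (isT : (1 < n.+2)%N)).
have HP' n i : (i < n.+2)%N -> cf (hom (E4f R) (d1f R) (P n) n * (E4f R ^+ 2 * E6f R)) i =
   cf (d1f R ^+ n.+2 * (1 - fps_cst (cf (d1f R) n.+1) * fX R[i] ^+ n.+1)) i.
  by have [h1 h2] := HP n; have [g Hg] := G n; apply: (HP_of_good Hg h1 h2).
have [di ddi _] := fps_inv (d1f_0 R).
have rj := fps_ramanujan (cf_E4_0 R) (cf_E6_0 R) (d1f_0 R) HP' ddi.
split=> [x|n x Bi BB]; first exact: (ramanujan_Bx x ddi rj).
have [h1 h2] := HP n.
have e := faber_eval (cf_E4_0 R) (cf_E6_0 R) (d1f_0 R) HP' h2 BB.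
have : ((FR n.+2).[x])%:C = (P n).[x%:C] * (x * (x - 1728))%:C.
  rewrite -(horner_map (real_complex R)) -FC_FR h1 !hornerM hornerX hornerXsubC -mulrA; congr (_ * _).
  by rewrite rmorphM rmorphB rmorph_nat.
rewrite e; move: (cf _ n) (x * _) => [a b] y /(congr1 (@complex.Re R)) /=.
by rewrite mulr0 subr0.
Qed.

(** The signs are those of F itself. Its factor x (x - 1728) is negative on (0, 1728), which is why
    [e] is negated when passing from P_n to F. *)
Definition alternates n (X : nat -> R) (e : bool) := forall k, (k <= n)%N ->
  [/\ 0 < X k, X k < 1728, (k < n)%N -> X k < X k.+1 & 0 < (-1) ^+ (e + k) * (FR n.+2).[X k]].

Lemma sign_flip (s x y : R) : 0 < s * x -> y < 0 -> 0 < - s * (x * y).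
Proof. by move=> h y0; rewrite mulNr mulrA -mulrN pmulr_rgt0 // oppr_gt0. Qed.

Lemma vanish_neg (x : R) : 0 < x -> x < 1728 -> x * (x - 1728) < 0.
Proof. by move=> x0 x1; rewrite (pmulr_rlt0 _ x0) subr_lt0; exact: x1. Qed.

Lemma alternates_small n : (n < 12)%N -> exists X e, alternates n X e.
Proof.
move=> n12; have [g [sg pg lg H]] := small_alternation R n12.
exists (fun k => (nth 0%N g k)%:R), (~~ odd n) => k kn.
have kg : (k < size g)%N by rewrite sg.
have srt : sorted ltn (0%N :: g) by [].
have pos : (0 < nth 0%N g k)%N.
  have := sorted_ltn_nth ltn_trans 0%N srt 0%N k.+1.
  by rewrite !inE /= sg ltnS => /(_ isT kn isT).
have top : (nth 0%N g k < 1728)%N by exact: (allP lg _ (mem_nth 0%N kg)).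
have p0 : 0 < (nth 0%N g k)%:R :> R by rewrite ltr0n.
have p1 : (nth 0%N g k)%:R < 1728%:R :> R by rewrite ltr_nat.
split; [exact: p0|exact: p1| |].
  move=> kn'; rewrite ltr_nat.
  have := sorted_ltn_nth ltn_trans 0%N srt k.+1 k.+2.
  by rewrite !inE /= sg !ltnS => /(_ kn kn' (leqnn _)).
have [Bi BB] := Bx_inv ((nth 0%N g k)%:R%:C : C).
have [_ fe] := faber_data; rewrite (fe _ _ _ BB).
have BB' := BB; rewrite rmorph_nat in BB'.
have [z ze zs] := H k kn Bi BB'; rewrite ze /=.
have -> : (-1) ^+ (~~ odd n + k) = - (-1) ^+ (odd n (+) odd k) :> R.
  by rewrite exprD signr_addb signrN !signr_odd mulNr.
by apply: (sign_flip zs); apply: (vanish_neg p0 p1).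
Qed.

Lemma alternates_large n : (12 <= n)%N -> exists (U : nat -> R) e,
  (forall k, (k <= n)%N -> [/\ - (1 / 2) <= U k, U k <= 0 &
     k%:R - n%:R - 4 / 3 <= 2 * n.+2%:R * U k <= k%:R - n%:R - 1 / 2]) /\
  alternates n (fun k => J (U k)) e.
Proof.
move=> n12; have [ram fe] := faber_data; have [U [e H]] := large_alternation ram n12.
exists U, (~~ e); split=> k kn; have [a1 a2 a3 a4 a5] := H k kn.
  by split; [exact: ltW|exact: ltW|].
have J0 : 0 < J (U k) by rewrite -(J_left R); exact: (J_incr (lexx _) a1 (ltW a2)).
have J1 : J (U k) < 1728 by rewrite -(J_right R); exact: (J_incr (ltW a1) a2 (lexx _)).
split; [exact: J0|exact: J1| |].
  move=> kn'; have [b1 b2 _ _ _] := H k.+1 kn'.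
  by apply: J_incr; [exact: ltW|exact: a4|exact: ltW].
have [Bi BB] := Bx_inv (jinv (unit_arc (U k)) : C).
have hu : inI (U k) by apply/andP; split; apply: ltW.
have s := a5 Bi BB; rewrite (JE hu) in BB; rewrite (fe _ _ _ BB).
have -> : (-1) ^+ (~~ e + k) = - (-1) ^+ (e + k) :> R by rewrite !exprD signrN mulNr.
by apply: (sign_flip s); apply: (vanish_neg J0 J1).
Qed.

Definition root_list n (Z : nat -> R) : seq R := [:: 0, 1728 & mkseq Z n].

(** The n sign changes give n roots strictly inside the interval; with 0 and 1728 they number n + 2,
    the degree of F, so they exhaust the roots and each is simple. *)
Lemma roots_of_alternates n X e : alternates n X e -> exists Z,
  (forall k, (k < n)%N -> X k < Z k < X k.+1) /\ uniq (root_list n Z) /\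
  (forall z : C, root (FC n.+2) z = (z \in [seq x%:C | x <- root_list n Z])) /\
  FC n.+2 = \prod_(z <- [seq x%:C | x <- root_list n Z]) ('X - z%:P).
Proof.
move=> alt.
have step k : exists z, (k < n)%N -> X k < z < X k.+1 /\ root (FR n.+2) z.
  have [kn|] := ltnP k n; last by exists 0.
  have [a1 a2 a3 a4] := alt k (ltnW kn); have [b1 b2 b3 b4] := alt k.+1 kn.
  have neg : (FR n.+2).[X k] * (FR n.+2).[X k.+1] < 0.
    rewrite addnS exprS mulN1r mulNr oppr_gt0 in b4.
    have ss : (-1) ^+ (e + k) * (-1) ^+ (e + k) = 1 :> R by rewrite -expr2 sqrr_sign.
    move: ((-1) ^+ (e + k)) ss a4 b4 => w ss a4 b4.
    have -> : (FR n.+2).[X k] * (FR n.+2).[X k.+1] = w * (FR n.+2).[X k] * (w * (FR n.+2).[X k.+1]).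
      by rewrite mulrACA ss mul1r.
    by rewrite (pmulr_rlt0 _ a4).
  have [z] := poly_ivtoo (ltW (a3 kn)) neg.
  by rewrite in_itv /= => zz rz; exists z.
have [Z HZ] := choice step; exists Z.
have mono i j : (i < j)%N -> (j < n)%N -> Z i < Z j.
  elim: j => // j IH; rewrite ltnS leq_eqVlt => /orP[/eqP ->|ij] jn.
    have [/andP[_ h1] _] := HZ j (ltnW jn); have [/andP[h2 _] _] := HZ j.+1 jn.
    exact: lt_trans h1 h2.
  apply: lt_trans (IH ij (ltnW jn)) _.
  have [/andP[_ h1] _] := HZ j (ltnW jn); have [/andP[h2 _] _] := HZ j.+1 jn.
  exact: lt_trans h1 h2.
have Zin k : (k < n)%N -> 0 < Z k /\ Z k < 1728.
  move=> kn; have [/andP[h1 h2] _] := HZ k kn.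
  have [a1 _ _ _] := alt k (ltnW kn); have [_ b2 _ _] := alt k.+1 kn.
  by split; [exact: lt_trans a1 h1|exact: lt_trans h2 b2].
have mk z : z \in mkseq Z n -> 0 < z /\ z < 1728 by case/mapP => k; rewrite mem_iota add0n => /andP[_ kn] ->; apply: Zin.
have un : uniq (root_list n Z).
  rewrite /root_list !cons_uniq; apply/and3P; split; last apply/mkseq_uniqP.
  - rewrite inE negb_or eq_sym pnatr_eq0 /=; apply/negP => /mk[]; by rewrite ltxx.
  - by apply/negP => /mk[_]; rewrite ltxx.
  move=> i j; rewrite !inE => i_n j_n e0; have [ij|ij|//] := ltngtP i j.
    by have := mono _ _ ij j_n; rewrite e0 ltxx.
  by have := mono _ _ ij i_n; rewrite e0 ltxx.
split; first by move=> k kn; case: (HZ k kn).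
split; first exact: un.
set L := [seq x%:C | x <- root_list n Z].
have m2 : (1 < n.+2)%N by [].
have prod : FC n.+2 = \prod_(z <- L) ('X - z%:P).
  have lc : lead_coef (FC n.+2) = 1.
    have [mo _ _] := hF m2; rewrite lead_coef_map_inj; [|exact: intr_inj|by rewrite rmorph0].
    by rewrite (monicP mo) rmorph1.
  have := @all_roots_prod_XsubC _ (FC n.+2) L; rewrite lc scale1r; apply.
  - by rewrite (size_FC (hF m2)) size_map /= size_mkseq.
  - have [r0 r1] := (FC_0 m2 (hF m2), FC_1728 m2 (hF m2)).
    apply/allP => z /mapP[x xL ->]; rewrite root_FR; move: xL; rewrite !inE => /or3P[/eqP ->|/eqP ->|].
    + by rewrite -root_FR; apply/rootP; rewrite rmorph0.
    + by rewrite -root_FR; apply/rootP; rewrite rmorph_nat.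
    by case/mapP => k; rewrite mem_iota add0n => /andP[_ kn] ->; case: (HZ k kn).
  by rewrite uniq_rootsE map_inj_uniq //; apply: complexI.
by split=> [z|]; [rewrite prod root_prod_XsubC|exact: prod].
Qed.

(** [zeros] enumerates the roots in an unspecified order. A factorization into distinct linear
    factors fixes the set, and equality of lengths excludes repetitions. *)
Lemma zeros_perm n (L : seq C) : uniq L -> FC n.+2 = \prod_(z <- L) ('X - z%:P) ->
  perm_eq (zeros R (F n.+2)) L.
Proof.
move=> uL prod; rewrite /zeros; case: closed_field_poly_normal => s /=.
have lc : lead_coef (FC n.+2) = 1 by apply/eqP; rewrite prod -[_ == _]/(_ \is monic) monic_prod_XsubC.
rewrite lc scale1r => e.
have ms z : (z \in s) = (z \in L) by rewrite -!root_prod_XsubC -e prod.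
have sz : size s = size L.
  have := congr1 (fun p : {poly C} => size p) e; rewrite prod !size_prod_XsubC => -[] //.
have us : uniq s by apply: (leq_size_uniq uL) => [z|]; rewrite ?ms ?sz.
exact: uniq_perm.
Qed.

Lemma alternates_ex n : exists X e, alternates n X e.
Proof.
have [/alternates_small //|/alternates_large[U [e [_ h]]]] := ltnP n 12.
by exists (fun k => J (U k)), e.
Qed.

Lemma mup_prod_uniq (L : seq C) z : uniq L -> z \in L -> mup z (\prod_(w <- L) ('X - w%:P)) = 1%N.
Proof.
move=> uL zL; rewrite (big_rem z zL) /= mupMl; first by rewrite -['X - _]expr1 mup_XsubCX eqxx.
by rewrite root_prod_XsubC mem_rem_uniq // inE eqxx.
Qed.

Lemma simple_real_zeros m (z : C) : (2 <= m)%N -> root (FC m) z ->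
  mup z (FC m) = 1%N /\ in_itv_cc 0 1728 z.
Proof.
case: m => [|[|n]] // _; have [X [e alt]] := alternates_ex n.
have [Z [HZ [uL [rt prod]]]] := roots_of_alternates alt.
set L := [seq x%:C | x <- root_list n Z] in rt prod; rewrite rt => zL.
have uL' : uniq L by rewrite map_inj_uniq //; apply: complexI.
split.
  by rewrite prod; apply: mup_prod_uniq.
case/mapP: zL => x xL ->; rewrite /in_itv_cc /= eqxx /=.
move: xL; rewrite !inE => /or3P[/eqP ->|/eqP ->|]; rewrite ?lexx ?ler0n //.
case/mapP => k; rewrite mem_iota add0n => /andP[_ kn] ->.
have /andP[h1 h2] := HZ k kn; have [a1 _ _ _] := alt k (ltnW kn); have [_ b2 _ _] := alt k.+1 kn.
by rewrite (ltW (lt_trans a1 h1)) (ltW (lt_trans h2 b2)).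
Qed.

(** The number j accounts for the two roots 0 and 1728. *)
Lemma count_root_list n Z (c d : R) : exists2 j : nat, (j <= 2)%N &
  count (in_itv_cc c d) [seq x%:C | x <- root_list n Z] =
  (j + count (fun k => (c <= Z k <= d)%R) (iota 0 n))%N.
Proof.
rewrite count_map; set p := preim _ _; exists (p 0%R + p 1728%R)%N; first by case: (p 0); case: (p 1728).
change (p 0%R + (p 1728%R + count p (mkseq Z n)) =
  p 0%R + p 1728%R + count (fun k => (c <= Z k <= d)%R) (iota 0 n))%N.
rewrite addnA count_map; congr (_ + _)%N; apply: eq_count => k.
by rewrite /p /= /in_itv_cc /= eqxx.
Qed.

Lemma J_lt_inv a b : inI a -> inI b -> J a < J b -> a < b :> R.
Proof.
move=> /andP[a1 a2] /andP[b1 b2] h; rewrite ltNge; apply/negP => ba.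
have [e|ne] := eqVneq b a; first by move: h; rewrite e ltxx.
have lt : b < a by rewrite lt_def eq_sym ne.
by have := lt_trans h (J_incr b1 lt a2); rewrite ltxx.
Qed.

Lemma J_mono a b : inI a -> inI b -> a <= b -> J a <= J b :> R.
Proof. by move=> ha hb ab; rewrite leNgt; apply/negP => /(J_lt_inv hb ha); rewrite ltNge ab. Qed.

(** Zero k lies between J(U_k) and J(U_(k+1)), so by monotonicity of J its membership is decided by
    comparing k with 2 m uc + n and 2 m ud + n, up to bounded shifts. The shifts 4/3 and 1/2, one
    for rounding and two for the roots 0 and 1728, add up to less than 5. *)
Lemma zeros_count n (uc ud : R) : (12 <= n)%N -> inI uc -> inI ud -> uc <= ud ->
  size (zeros R (F n.+2)) = n.+2 /\
  `|(count (in_itv_cc (J uc) (J ud)) (zeros R (F n.+2)))%:R - 2 * n.+2%:R * (ud - uc)| <= 5.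
Proof.
move=> n12 ic id ucd; have [U [e [HU alt]]] := alternates_large n12.
have [Z [HZ [uL [_ prod]]]] := roots_of_alternates alt.
set L := [seq x%:C | x <- root_list n Z] in prod.
have uL' : uniq L by rewrite map_inj_uniq //; apply: complexI.
have pe := zeros_perm uL' prod.
split; first by rewrite (perm_size pe) size_map /= size_mkseq.
rewrite (permP pe (in_itv_cc (J uc) (J ud))).
have [j j2 ->] := count_root_list n Z (J uc) (J ud).
have m0 : 0 < 2 * n.+2%:R :> R by rewrite mulr_gt0 ?ltr0n.
have mE : n.+2%:R = n%:R + 2 :> R by rewrite -[n.+2]addn2 natrD.
have kE (k : nat) : k.+1%:R = k%:R + 1 :> R by rewrite natr1.
have inU k : (k <= n)%N -> inI (U k) by move=> /HU[h1 h2 _]; rewrite /inI h1 h2.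
case/andP: (ic) => c1 c2; case/andP: (id) => d1 d2.
have c1' : - n.+2%:R <= 2 * n.+2%:R * uc.
  by have := ler_wpM2l (ltW m0) c1; clear; lra.
have d2' : 2 * n.+2%:R * ud <= 0 by rewrite pmulr_rle0.
have ab' : 2 * n.+2%:R * uc <= 2 * n.+2%:R * ud by rewrite ler_pM2l.
set N := count _ _.
have up : N%:R <= 2 * n.+2%:R * ud + n%:R + 4 / 3 - (2 * n.+2%:R * uc + n%:R - 1 / 2) + 1.
  apply: count_upper; first by clear -ab'; lra.
  move=> k kn /andP[h1 h2]; have /andP[z1 z2] := HZ k kn.
  have [_ _ /andP[b1 _]] := HU k (ltnW kn); have [_ _ /andP[_ b2]] := HU k.+1 kn.
  have q1 : U k < ud by apply: (J_lt_inv (inU k (ltnW kn)) id); apply: lt_le_trans z1 h2.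
  have q2 : uc < U k.+1 by apply: (J_lt_inv ic (inU k.+1 kn)); apply: le_lt_trans h1 z2.
  rewrite -(ltr_pM2l m0) in q1; rewrite -(ltr_pM2l m0) in q2; rewrite (kE k) in b2.
  by split; clear -q1 q2 b1 b2; lra.
have lo : 2 * n.+2%:R * ud + n%:R - 1 / 2 - (2 * n.+2%:R * uc + n%:R + 4 / 3) - 1 <= N%:R.
  apply: count_lower; [by rewrite mE in c1' *; clear -c1'; lra|by clear -d2'; lra|].
  move=> k kn h1 h2; have /andP[z1 z2] := HZ k kn.
  have [_ _ /andP[b1 _]] := HU k (ltnW kn); have [_ _ /andP[_ b2]] := HU k.+1 kn.
  rewrite (kE k) in b2.
  have q1 : uc <= U k by rewrite -(ler_pM2l m0); clear -h1 b1; lra.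
  have q2 : U k.+1 <= ud by rewrite -(ler_pM2l m0); clear -h2 b2; lra.
  have r1 := J_mono ic (inU k (ltnW kn)) q1; have r2 := J_mono (inU k.+1 kn) id q2.
  by rewrite (le_trans r1 (ltW z1)) (le_trans (ltW z2) r2).
have j0 : 0 <= j%:R :> R by rewrite ler0n.
have j2' : j%:R <= 2%:R :> R by rewrite ler_nat.
rewrite natrD ler_norml; clear -up lo j0 j2'; apply/andP; split; lra.
Qed.

Lemma arc_measure_itv (uc ud : R) : inI uc -> inI ud -> uc <= ud ->
  arc_measure `[J uc, J ud]%classic = (2 * (ud - uc))%:E.
Proof.
move=> ic id ucd; rewrite /arc_measure.
have -> : (`[- (1 / 2), 0] `&` [set u : R | `[J uc, J ud] (complex.Re (jinv (unit_arc u)))] = `[uc, ud])%classic.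
  case/andP: (ic) => c1 c2; case/andP: (id) => d1 d2.
  apply/seteqP; split=> u /=; rewrite !in_itv /= -/(J u).
    move=> [hu /andP[h1 h2]]; apply/andP; split; rewrite leNgt; apply/negP => h.
      by have := lt_le_trans (J_incr (proj1 (andP hu)) h c2) h1; rewrite ltxx.
    by have := le_lt_trans h2 (J_incr d1 h (proj2 (andP hu))); rewrite ltxx.
  move=> /andP[h1 h2]; have hu : inI u by rewrite /inI (le_trans c1 h1) (le_trans h2 d2).
  by split; [exact: hu|apply/andP; split; [exact: (J_mono ic hu h1)|exact: (J_mono hu id h2)]].
rewrite lebesgue_measure_itv /= lte_fin; case: ltP => h; first by rewrite -EFinB -EFinM.
by have -> : ud = uc by [apply/eqP; rewrite eq_le h ucd]; rewrite subrr mulr0 mule0.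
Qed.

(** Writing c = J(uc) and d = J(ud) turns an interval of values into an interval of parameters,
    whose target measure is 2 (ud - uc); [zeros_count] divided by m differs from it by at most
    5/m. *)
Lemma zeros_equidistributed : equidistributed 0 1728 (@arc_measure R) (fun m => zeros R (F m)).
Proof.
move=> c d c0 cd d1.
have [uc ic Jc] : exists2 u, inI u & J u = c by apply: J_surj; rewrite c0 (le_trans cd d1).
have [ud id Jd] : exists2 u, inI u & J u = d by apply: J_surj; rewrite (le_trans c0 cd) d1.
have ucd : uc <= ud.
  rewrite leNgt; apply/negP => h; case/andP: ic => _ c2; case/andP: id => d1' _.
  by have := J_incr d1' h c2; rewrite Jc Jd ltNge cd.
rewrite -Jc -Jd (arc_measure_itv ic id ucd); apply: cvg_EFin; first exact: nearW.
apply/subr_cvg0; apply/small_cvg.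
pose a m : R := (count (in_itv_cc (J uc) (J ud)) (zeros R (F m)))%:R / (size (zeros R (F m)))%:R - 2 * (ud - uc).
(* The error 5/m is at most 10/(m + 1), the sequence that [small_inv] covers; the start m >= 14 is n
   >= 12. *)
have sm : small (fun n => 10 * n.+1%:R^-1 : R) := smallZ 10 (@small_inv R).
suff : small a by [].
apply: (small_le (a := a) (n0 := 14) sm) => -[|[|n]] // n14.
have n12 : (12 <= n)%N by [].
have [sz h] := zeros_count n12 ic id ucd; rewrite /a sz.
have m0 : 0 < n.+2%:R :> R by rewrite ltr0n.
have m1 : 0 < n.+3%:R :> R by rewrite ltr0n.
move: (count _ _)%:R h => N h.
have -> : N / n.+2%:R - 2 * (ud - uc) = (N - 2 * n.+2%:R * (ud - uc)) / n.+2%:R.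
  by move: (n.+2%:R) m0 => w w0; field; rewrite gt_eqF.
rewrite normrM normfV (gtr0_norm m0) [leRHS]ger0_norm; last by rewrite mulr_ge0 ?invr_ge0 ?ler0n.
rewrite (ler_pdivrMr _ _ m0) [leRHS]mulrAC (ler_pdivlMr _ _ m1).
have m2 : n.+3%:R <= 2 * n.+2%:R :> R by rewrite -[n.+3]addn1 natrD mulr_natl mulr2n lerD2l ler1n.
apply: (@le_trans _ _ (5 * n.+3%:R)); first by apply: (ler_wpM2r (ltW m1) h).
clear -m2; lra.
Qed.

End Main.

Theorem theorem1p3 (R : realType) (F : nat -> {poly int})
    (hF : forall m : nat, (2 <= m)%N -> is_F R m (F m)) :
  [/\ forall m : nat, (2 <= m)%N -> (F m).[0] = 0 /\ (F m).[1728] = 0,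
      forall m : nat, (2 <= m)%N ->
        forall z : R[i], root (map_poly intr (F m)) z ->
          mup z (map_poly intr (F m)) = 1%N /\ in_itv_cc 0 1728 z
    & equidistributed 0 1728 (@arc_measure R) (fun m => zeros R (F m))].
Proof.
split=> [m m2|m m2 z|]; first exact: F_root m2 (hF m m2).
  by have h := simple_real_zeros hF m2; apply: h.
exact: zeros_equidistributed hF.
Qed.
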